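(* Let $(V_1,V_2,V_3)$ be an orthogonal splitting of $\mathrm{H}=\mathrm{H}_1(\Sigma_3,\mathbb{Z})$. Then this splitting is symmetric if and only if $$\mathrm{Arf}(\omega_0|_{V_1})=\mathrm{Arf}(\omega_0|_{V_3})=1,\qquad \mathrm{Arf}(\omega_0|_{V_2})=0.$$
   Context: Surface, involution and basis. Let $\Sigma_3\subset\mathbb{R}^3$ be the standard closed oriented genus 3 surface: the boundary of a thickening (symmetric under rotation by $\pi$ about the $x$-axis) of a planar domain in the $xy$-plane that is a disc with three round holes centred at points $x_1<x_2<x_3$ of the $x$-axis, the domain being symmetric about the $x$-axis. The hyperelliptic involution $s$ is the rotation by $\pi$ about the $x$-axis. For $i=1,2,3$ let $\beta_i$ be the curve on $\Sigma_3$ going once around the $i$-th hole in the plane $z=0$ (the inner boundary circle of the hole), and let $\alpha_i$ be the component of $\Sigma_3\cap\{x=x_i\}$ lying in $\{y>0\}$. Orient them so that $a_i\cdot b_i=1$ where $a_i=[\alpha_i]$, $b_i=[\beta_i]$; then $\{a_1,b_1,a_2,b_2,a_3,b_3\}$ is a symplectic basis of $\mathrm{H}$ for the algebraic intersection form. Sp-quadratic forms. For a free abelian group $W\cong\mathbb{Z}^{2n}$ with a unimodular symplectic form $x\cdot y$, an Sp-quadratic form is a map $\omega:W\to\mathbb{Z}/2\mathbb{Z}$ with $\omega(x\pm y)=\omega(x)+\omega(y)+(x\cdot y \bmod 2)$; its Arf invariant is $\mathrm{Arf}(\omega)=\sum_{i=1}^n\omega(x_i)\omega(y_i)$ for any symplectic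 basis $\{x_1,y_1,\dots,x_n,y_n\}$ of $W$ (independent of the basis). $\omega_0$ is the Sp-quadratic form on $\mathrm{H}$ with $\omega_0(a_1)=\omega_0(a_3)=\omega_0(b_1)=\omega_0(b_2)=\omega_0(b_3)=1$, $\omega_0(a_2)=0$. Splittings. An orthogonal splitting of $\mathrm{H}$ is an ordered triple $(V_1,V_2,V_3)$ of rank 2 subgroups, pairwise orthogonal for the intersection form, with $\mathrm{H}=V_1\oplus V_2\oplus V_3$. A separating pair is an ordered pair $(\gamma,\delta)$ of disjoint nonisotopic (essential) separating simple closed curves on $\Sigma_3$; it is symmetric if $\gamma$ and $\delta$ are both $s$-invariant. Let $X_1$ (a one-holed torus bounded by $\gamma$), $X_2$ (a two-holed torus bounded by $\gamma$ and $\delta$), $X_3$ (a one-holed torus bounded by $\delta$) be the components of $\Sigma_3\setminus(\gamma\cup\delta)$. The splitting corresponding to $(\gamma,\delta)$ is $(\mathrm{H}_{X_1},\mathrm{H}_{X_2},\mathrm{H}_{X_3})$, where $\mathrm{H}_{X_i}$ is the image of $\mathrm{H}_1(X_i,\mathbb{Z})$ in $\mathrm{H}$. An orthogonal splitting is called symmetric if it corresponds to some symmetric separating pair. *)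

(* Defs.v *)
From HB Require Import structures.
From mathcomp Require Import all_boot all_order all_algebra.
From mathcomp Require Import ring_quotient.
From mathcomp Require Import all_classical all_reals all_analysis.
From mathcomp.multinomials Require Import freeg.

Set Implicit Arguments.
Unset Strict Implicit.
Unset Printing Implicit Defensive.

Import Order.TTheory GRing.Theory Num.Theory.
Import numFieldNormedType.Exports.

Local Open Scope classical_set_scope.
Local Open Scope ring_scope.

HB.instance Definition _ (K : choiceType) (M : lmodType int) (f : K -> M) :=
  GRing.isZmodMorphism.Build _ _ (fglift f) (lift_is_additive f).

Section SingularHomology.
Variable R : realType.

Definition std_simplex (n : nat) : set 'rV[R]_n.+1 :=
  [set p : 'rV[R]_n.+1 | (forall i, 0 <= p 0 i) /\ \sum_i p 0 i = 1].
Arguments std_simplex : clear implicits.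

Definition face_pt (n : nat) (i : 'I_n.+2) (p : 'rV[R]_n.+1) : 'rV[R]_n.+2 :=
  \row_j (if unlift i j is Some k then p 0 k else 0).

Lemma face_pt_simplex n (i : 'I_n.+2) (p : std_simplex n) :
  face_pt i (set_val p) \in std_simplex n.+1.
Proof.
have [p0 p1] := set_mem (valP p).
apply/mem_set; split => [j|].
  by rewrite mxE; case: unliftP => // k _; exact: p0.
rewrite -p1 (bigD1_ord i) //= mxE unlift_none add0r.
by apply: eq_bigr => j _; rewrite mxE liftK.
Qed.

Definition face_map n (i : 'I_n.+2) (p : std_simplex n) : std_simplex n.+1 :=
  exist _ (face_pt i (set_val p)) (face_pt_simplex i p).

Lemma face_map_continuous n (i : 'I_n.+2) : continuous (@face_map n i).
Proof.
apply: continuous_comp_initial => p U [P /= Pp sPU].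
have FF : Filter (nbhs (p : std_simplex n)) := nbhs_filter p.
have nP j : nbhs (p : std_simplex n)
    [set q : std_simplex n | P 0 j (face_pt i (set_val q) 0 j)].
  have := Pp 0 j; rewrite /= mxE.
  case E : (unlift i j) => [k|] Pj; last first.
    apply: (@filterE _ _ FF) => q /=; rewrite mxE E.
    exact: (nbhs_singleton Pj).
  have cv : continuous (fun q : std_simplex n => set_val q 0 k).
    move=> q; apply: (@continuous_comp _ _ _ (@set_val _ (std_simplex n))
      (fun M : 'rV[R]_n.+1 => M 0 k)).
      exact: initial_continuous.
    exact: coord_continuous.
  by apply: (@filterS _ _ FF _ _ _ (cv p _ Pj)) => q /=; rewrite mxE E.
apply: (@filterS _ _ FF _ _ _ (@filter_forall _ _ _ _ FF nP)) => q H.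
by apply: sPU => a j; rewrite ord1; exact: H.
Qed.

HB.instance Definition _ n (i : 'I_n.+2) :=
  @isContinuous.Build (std_simplex n) (std_simplex n.+1) (face_map i)
    (@face_map_continuous n i).

Section Chains.
Variable T : topologicalType.

Definition simplex (n : nat) := continuousType (std_simplex n) T.

Definition chain (n : nat) := {freeg (simplex n) / int}.

Definition simplex_boundary n (s : simplex n.+1) : chain n :=
  \sum_(i < n.+2) << (-1) ^+ i *g (s \o face_map i : simplex n) >>.

Definition boundary n (c : chain n.+1) : chain n :=
  fglift (@simplex_boundary n) c.

HB.instance Definition _ n := GRing.Additive.copy (@boundary n)
  (fglift (@simplex_boundary n)).

Definition cycle1 : {pred chain 1} := fun c => boundary c == 0.

Lemma cycle1_zmod_closed : zmod_closed cycle1.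
Proof.
split=> [|x y]; rewrite !unfold_in ?raddf0 // => /eqP x0 /eqP y0.
by rewrite raddfB /= x0 y0 subrr.
Qed.

HB.instance Definition _ := GRing.isZmodClosed.Build _ cycle1 cycle1_zmod_closed.

Definition Z1 := {c : chain 1 | c \in cycle1}.
HB.instance Definition _ := SubChoice.on Z1.
HB.instance Definition _ := [SubChoice_isSubZmodule of Z1 by <:].

Definition B1 : {pred Z1} := fun z => `[< exists c : chain 2, boundary c = val z >].

Lemma B1_zmod_closed : zmod_closed B1.
Proof.
split=> [|x y]; rewrite !unfold_in.
  by apply/asboolP; exists 0; rewrite raddf0.
move=> /asboolP[c cx] /asboolP[d dy]; apply/asboolP; exists (c - d).
by rewrite (_ : boundary (c - d) = boundary c - boundary d) ?raddfB // cx dy.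
Qed.

HB.instance Definition _ := GRing.isZmodClosed.Build _ B1 B1_zmod_closed.

Definition H1 := Quotient.quot B1.
HB.instance Definition _ := GRing.Zmodule.on H1.
Definition hclass (z : Z1) : H1 := (\pi_(Quotient.quot B1) z)%qT.

End Chains.

Section Functoriality.
Variables (S T : topologicalType) (f : continuousType S T).

Definition chain_map n (c : chain S n) : chain T n :=
  fglift (fun s : simplex S n => << (f \o s : simplex T n) >>) c.

HB.instance Definition _ n := GRing.Additive.copy (@chain_map n)
  (fglift (fun s : simplex S n => << (f \o s : simplex T n) >>)).

Lemma boundary_chain_map n (c : chain S n.+1) :
  boundary (chain_map c) = chain_map (boundary c).
Proof.
rewrite -[c]freeg_sumE; elim/big_ind: _ => [|x y Hx Hy|s _].
- by rewrite !raddf0.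
- by rewrite !raddfD /= Hx Hy.
rewrite /chain_map /boundary !liftU !raddf_int_scalable /= liftU scale1r.
congr (_ *: _); rewrite /simplex_boundary raddf_sum; apply: eq_bigr => i _ /=.
rewrite liftU; apply/eqP; apply/freeg_eqP => t; rewrite coeffZ !coeffU mul1r.
by congr (_ * (_ == _)%:R); apply/continuousEP.
Qed.

Lemma chain_map_cycle1 (z : Z1 S) : chain_map (val z) \in @cycle1 T.
Proof.
rewrite unfold_in boundary_chain_map.
by have /eqP -> := valP z; rewrite raddf0.
Qed.

Definition Z1_map (z : Z1 S) : Z1 T := Sub (chain_map (val z)) (chain_map_cycle1 z).

Definition H1_map (h : H1 S) : H1 T := hclass (Z1_map (repr h)).

End Functoriality.

Section Loops.
Variable T : topologicalType.

(* A closed curve is a map from the circle R/Z. *)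
Record loop := Loop {
  loop_fun :> R -> T;
  loop_continuous : continuous loop_fun;
  loop_periodic : forall t, loop_fun (t + 1) = loop_fun t }.

Definition param (p : std_simplex 1) : R := set_val p 0 1.

Lemma param_continuous : continuous param.
Proof.
move=> p; apply: (@continuous_comp _ _ _ (@set_val _ (std_simplex 1))
  (fun M : 'rV[R]_2 => M 0 1)).
  exact: initial_continuous.
exact: coord_continuous.
Qed.

Lemma loop_simplex_continuous (c : loop) : continuous (c \o param).
Proof.
move=> p; apply: continuous_comp; first exact: param_continuous.
exact: loop_continuous.
Qed.

Definition loop_simplex (c : loop) : simplex T 1 :=
  mkcts (@loop_simplex_continuous c).

Lemma loop_cycle1 (c : loop) : << loop_simplex c >> \in @cycle1 T.
Proof.
rewrite unfold_in /boundary liftU scale1r /simplex_boundary.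
rewrite big_ord_recl big_ord1 /= expr0 expr1.
have E : (loop_simplex c \o face_map ord0 : simplex T 0) =
    (loop_simplex c \o face_map (fintype.lift ord0 ord0) : simplex T 0).
  apply/continuousEP => p; rewrite /= /mkcts /= /param !set_valE /= !mxE.
  have -> : (1 : 'I_2) = fintype.lift ord0 ord0 by apply/val_inj.
  rewrite liftK unlift_none -[0 in RHS]/(0 : R).
  have [_] := set_mem (valP p); rewrite big_ord1 set_valE => ->.
  by rewrite -[1]add0r loop_periodic.
by apply/freeg_eqP => t; rewrite coeffD coeff0 !coeffU E mul1r mulN1r subrr.
Qed.

Definition loop_class (c : loop) : H1 T := hclass (Sub << loop_simplex c >> (loop_cycle1 c)).

Definition simple (c : loop) := {in `[0, 1[ &, injective c}.

Definition null_homotopic (c : loop) :=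
  exists F : R * R -> T,
  [/\ {within `[0, 1] `*` setT, continuous F},
      (forall t u, t \in `[0, 1] -> F (t, u + 1) = F (t, u)),
      (forall u, F (0, u) = c u)
    & exists p, forall u, F (1, u) = p].

End Loops.
End SingularHomology.

Section Curves.
Variables (R : realType) (T : topologicalType).
Implicit Types (A X : set T) (c d : loop R T).

Definition component A X := exists2 p, A p & X = connected_component A p.

Definition frontier X := closure X `\` X°.

Definition essential c := ~ null_homotopic c.

Definition separating c := ~ connected (~` range c).

Definition ess_sep_scc c := [/\ simple c, essential c & separating c].

(* Ambient isotopy, through homeomorphisms F(t, _) with inverses G(t, _). *)
Definition isotopic A B :=
  exists F G : R * T -> T,
  [/\ {within `[0, 1] `*` setT, continuous F} /\
        {within `[0, 1] `*` setT, continuous G},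
      (forall t p, t \in `[0, 1] ->
         F (t, G (t, p)) = p /\ G (t, F (t, p)) = p),
      (forall p, F (0, p) = p)
    & (fun p => F (1, p)) @` A = B].

Definition separating_pair c d :=
  [/\ ess_sep_scc c, ess_sep_scc d, range c `&` range d = set0
    & ~ isotopic (range c) (range d)].

Definition H1_incl X : H1 R X -> H1 R T :=
  @H1_map R X T (mkcts (@initial_continuous X T set_val)).
End Curves.

Section Symplectic.
Variables (H : zmodType) (dot : H -> H -> int).
Implicit Types (V : set H) (w : H -> 'F_2).

Definition biadditive :=
  (forall x y z, dot (x + y) z = dot x z + dot y z) /\
  (forall x y z, dot x (y + z) = dot x y + dot x z).

Definition Zbasis (I : finType) V (e : I -> H) :=
  (forall k : I -> int, \sum_i e i *~ k i = 0 -> forall i, k i = 0) /\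
  V = range (fun k : I -> int => \sum_i e i *~ k i).

Definition symplectic_basis n V (e : {ffun 'I_n -> H * H}) :=
  Zbasis V (fun k : 'I_n * bool => if k.2 then (e k.1).2 else (e k.1).1) /\
  forall i j, [/\ dot (e i).1 (e j).2 = (i == j)%:R,
                  dot (e i).2 (e j).1 = - (i == j)%:R,
                  dot (e i).1 (e j).1 = 0
                & dot (e i).2 (e j).2 = 0].

Definition Sp_quadratic w := forall x y,
  w (x + y) = w x + w y + (dot x y)%:~R /\
  w (x - y) = w x + w y + (dot x y)%:~R.

(* V is assumed unimodular of rank 2n; the value does not depend on the chosen
   symplectic basis. *)
Definition Arf n w V : 'F_2 :=
  let e := xget [ffun=> (0, 0)] [set e | @symplectic_basis n V e] in
  \sum_i w (e i).1 * w (e i).2.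

Definition orthogonal_splitting (V : 'I_3 -> set H) :=
  [/\ (forall i, exists e : 'I_2 -> H, Zbasis (V i) e),
      (forall i j x y, i != j -> V i x -> V j y -> dot x y = 0)
    & forall h, exists! v : {ffun 'I_3 -> H},
        (forall i, V i (v i)) /\ h = \sum_i v i].

End Symplectic.

Section Surface.
Variable R : realType.

Definition hole_center (i : 'I_3) : R := 3 * ((i : nat)%:R - 1).

(* The planar domain with holes is the disc of radius 5 minus the three discs
   of radius 1 centred at (-3, 0), (0, 0), (3, 0), i.e. the set
   [domain_eq >= 0]; the solid [z ^+ 2 <= domain_eq x y] is a thickening of it
   and the surface is the boundary [z ^+ 2 = domain_eq x y] of that solid. *)
Definition domain_eq (x y : R) : R :=
  (5 ^+ 2 - (x ^+ 2 + y ^+ 2)) *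
  \prod_(i < 3) ((x - hole_center i) ^+ 2 + y ^+ 2 - 1).

Definition surface_eq (p : 'rV[R]_3) : R :=
  (p 0 2) ^+ 2 - domain_eq (p 0 0) (p 0 1).

Definition Sigma3 : set 'rV[R]_3 := [set p : 'rV[R]_3 | surface_eq p = 0].

Definition rotation (p : 'rV[R]_3) : 'rV[R]_3 :=
  \row_j (if j == 0 then p 0 j else - p 0 j).

Lemma rotation_Sigma3 (p : Sigma3) : rotation (set_val p) \in Sigma3.
Proof.
apply/mem_set; apply: etrans (set_mem (valP p)).
by rewrite /surface_eq /domain_eq !mxE /= !sqrrN.
Qed.

Definition hyperelliptic (p : Sigma3) : Sigma3 :=
  exist _ (rotation (set_val p)) (rotation_Sigma3 p).

Local Notation H_Sigma3 := (H1 R Sigma3).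

(* Outward for the solid [surface_eq <= 0]. *)
Definition normal (p : 'rV[R]_3) : 'rV[R]_3 :=
  \row_j 'D_(delta_mx 0 j) surface_eq p.

Definition velocity (c : loop R Sigma3) : R -> 'rV[R]_3 :=
  derive1 (fun t => set_val (c t) : 'rV[R]_3).

Definition C1_loop (c : loop R Sigma3) :=
  (forall t, derivable (fun t => set_val (c t) : 'rV[R]_3) t 1) /\ continuous (velocity c).

Definition orientation_det (c d : loop R Sigma3) (t u : R) : R :=
  \det (\matrix_(i < 3)
    [:: normal (set_val (c t)); velocity c t; velocity d u]`_i).

Definition transverse (c d : loop R Sigma3) :=
  forall t u, c t = d u -> orientation_det c d t u != 0.

Definition intersection_number (c d : loop R Sigma3) : int :=
  \sum_(p \in [set p : R * R |
        [/\ p.1 \in `[0, 1[, p.2 \in `[0, 1[ & c p.1 = d p.2]])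
    sgz (orientation_det c d p.1 p.2).

(* The algebraic intersection form: the biadditive form on H_1 counting with
   sign the intersections of transverse curves. Transverse C^1 representatives
   always exist, so this determines [dot]. *)
Definition intersection_form (dot : H_Sigma3 -> H_Sigma3 -> int) :=
  biadditive dot /\
  forall c d, C1_loop c -> C1_loop d -> transverse c d ->
    dot (loop_class c) (loop_class d) = intersection_number c d.

Definition is_alpha (i : 'I_3) (c : loop R Sigma3) :=
  [/\ simple c,
      component [set p : Sigma3 | set_val p 0 0 = hole_center i] (range c)
    & range c `<=` [set p : Sigma3 | 0 < set_val p 0 1]].

Definition is_beta (i : 'I_3) (c : loop R Sigma3) :=
  simple c /\
  range c = [set p : Sigma3 | set_val p 0 2 = 0 /\
    (set_val p 0 0 - hole_center i) ^+ 2 + (set_val p 0 1) ^+ 2 = 1].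

Definition s_invariant (c : loop R Sigma3) :=
  hyperelliptic @` range c = range c.

(* The components X_1, X_2, X_3 (here X 0, X 1, X 2) are told apart by the curves
   that bound them; for a separating pair on a genus 3 surface, X 0 and X 2 are
   then one-holed tori and X 1 is a two-holed torus. *)
Definition corresponds (c d : loop R Sigma3) (V : 'I_3 -> set H_Sigma3) :=
  exists X : 'I_3 -> set Sigma3,
  [/\ forall i, component (~` (range c `|` range d)) (X i),
      [/\ frontier (X 0) = range c,
          frontier (X 1) = range c `|` range d
        & frontier (X 2) = range d]
    & forall i, V i = range (@H1_incl R Sigma3 (X i))].

Definition symmetric_splitting (V : 'I_3 -> set H_Sigma3) :=
  exists c d : loop R Sigma3,
  [/\ separating_pair c d, s_invariant c, s_invariant d & corresponds c d V].

End Surface.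

Arguments Sigma3 R : clear implicits.
Arguments Arf {H} dot n w V.

(* Main.v *)
(** An orthogonal splitting forces H_1 of the surface to be free of rank 6. Hence six
    angle functions (continuous modulo 1), each supported near one curve of the chain
    [c_0, ..., c_6] of curves through the eight fixed points of the involution, detect all
    of H_1 through their degrees, as these degrees form a unimodular matrix on the
    chain; they are the intersection numbers with the chain curves.

    The Dehn twists along the chain curves commute with the involution and act on H_1 by
    transvections in vectors on which [omega0] is 1. Such transvections act transitively
    on the symplectic pairs of planes of Arf invariant 1, and the splitting cut out by the
    ovals [x = -3/2] and [x = 3/2] is symmetric. This gives the "if" part.

    Conversely, let [X] be a component of the complement of a symmetric pair and let
    two fixed points lie in a connected set [K] disjoint from [X] and its image under the
    involution. Seen on the quotient sphere, the function with a simple zero at [q] and a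
    simple pole at a fixed point has a degree on each class of [X] which does not
    change as [q] moves in [K]; modulo 2 this says that a class carried by [X] meets the
    lift of an arc between the two fixed points evenly. If classes modulo 2 are
    encoded as even subsets of the set of fixed points, up to complement, the classes of
    an end piece are thus carried by its fixed points, and counting these points shows
    that both end planes have Arf invariant 1. *)

From HB Require Import structures.
From mathcomp Require Import all_boot all_order all_algebra.
From mathcomp Require Import ring_quotient.
From mathcomp Require Import all_classical all_reals all_analysis.
From mathcomp.multinomials Require Import freeg.
From mathcomp Require Import ring lra zify.
Require Import Defs.

Set Implicit Arguments.
Unset Strict Implicit.
Unset Printing Implicit Defensive.

Import Order.TTheory GRing.Theory Num.Theory.
Import numFieldNormedType.Exports.

Local Open Scope classical_set_scope.
Local Open Scope ring_scope.

(** * Angles in turns *)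

Section Turns.
Variable R : realType.
Implicit Types x y : R.

(** Nothing is known beforehand about $H_1$ of the surface, and [dot] is prescribed only on
    transverse $C^1$ loops; so homology is read off from maps to the circle, which can be written
    down. Injectivity of six degrees comes from rank alone: classes dual to them exist, and a
    one-sided inverse of a square integer matrix is two-sided. [intersection_form] does not state
    antisymmetry. The self-intersections of the chain curves vanish because the outer circle is
    homologous to the sum of the odd ones and disjoint from each, and because the even ones sum to
    zero. The Arf invariant of the middle plane is transported from the model splitting by the same
    transitivity that gives symmetry. In the other direction parity enters through a square root:
    [half_arg] halves the argument on the quotient sphere once the three odd dual functions are
    added. For even subsets of the eight fixed points the pairing is $|S\cap T|$ and the form is
    $|S|/2$ modulo 2; this is why an end piece with three or four fixed points has Arf invariant
    1. *)

Definition cost x : R := cos (pi *+ 2 * x).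
Definition sint x : R := sin (pi *+ 2 * x).

Lemma continuous_cost : continuous cost.
Proof.
move=> x; apply: (@continuous_comp _ _ _ (fun y : R => pi *+ 2 * y) cos).
  exact: mulrl_continuous.
exact: continuous_cos.
Qed.

Lemma continuous_sint : continuous sint.
Proof.
move=> x; apply: (@continuous_comp _ _ _ (fun y : R => pi *+ 2 * y) sin).
  exact: mulrl_continuous.
exact: continuous_sin.
Qed.

Lemma cost2Dsint2 x : cost x ^+ 2 + sint x ^+ 2 = 1.
Proof. exact: cos2Dsin2. Qed.

Lemma costD x y : cost (x + y) = cost x * cost y - sint x * sint y.
Proof. by rewrite /cost mulrDr cosD. Qed.

Lemma sintD x y : sint (x + y) = sint x * cost y + cost x * sint y.
Proof. by rewrite /sint mulrDr sinD. Qed.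

Lemma costN x : cost (- x) = cost x.
Proof. by rewrite /cost mulrN cosN. Qed.

Lemma sintN x : sint (- x) = - sint x.
Proof. by rewrite /sint mulrN sinN. Qed.

Lemma cost0 : cost 0 = 1. Proof. by rewrite /cost mulr0 cos0. Qed.
Lemma sint0 : sint 0 = 0. Proof. by rewrite /sint mulr0 sin0. Qed.

Lemma cost1 : cost 1 = 1. Proof. by rewrite /cost mulr1 cos2pi. Qed.
Lemma sint1 : sint 1 = 0. Proof. by rewrite /sint mulr1 sin2pi. Qed.

Lemma cost_half : cost 2^-1 = -1.
Proof. by rewrite /cost (_ : pi *+ 2 * _ = pi) ?cospi // mulr2n; field. Qed.

Lemma sint_half : sint 2^-1 = 0.
Proof. by rewrite /sint (_ : pi *+ 2 * _ = pi) ?sinpi // mulr2n; field. Qed.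

Lemma cost_quarter : cost 4^-1 = 0.
Proof.
by rewrite /cost (_ : pi *+ 2 * _ = pi / 2) ?cos_pihalf // mulr2n; field.
Qed.

Lemma sint_quarter : sint 4^-1 = 1.
Proof.
by rewrite /sint (_ : pi *+ 2 * _ = pi / 2) ?sin_pihalf // mulr2n; field.
Qed.

Lemma cost_int x : x \is a Num.int -> cost x = 1 /\ sint x = 0.
Proof.
suff H (n : nat) : cost n%:R = 1 /\ sint n%:R = 0.
  case/intrP => -[] n ->; first exact: H.
  by rewrite NegzE mulrNz costN sintN; have [-> ->] := H n.+1; rewrite oppr0.
elim: n => [|n [c s]]; first by rewrite cost0 sint0.
by rewrite -natr1 costD sintD c s cost1 sint1; split; lra.
Qed.

Lemma cost_eqm x y : x - y \is a Num.int -> cost x = cost y /\ sint x = sint y.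
Proof.
move=> /cost_int[c s]; have -> : x = (x - y) + y by ring.
rewrite !(costD (x - y)) !(sintD (x - y)) c s; split; lra.
Qed.

Lemma costDz x (n : int) : cost (x + n%:~R) = cost x.
Proof. by apply: (cost_eqm _).1; rewrite addrAC subrr add0r intr_int. Qed.

Lemma sintDz x (n : int) : sint (x + n%:~R) = sint x.
Proof. by apply: (cost_eqm _).2; rewrite addrAC subrr add0r intr_int. Qed.

(* The representative of x mod 1 in [-1/2, 1/2[. *)
Definition res x : R := x - (Num.floor (x + 2^-1))%:~R.

Lemma res_int x : x - res x \is a Num.int.
Proof. by rewrite /res opprB addrCA subrr addr0 intr_int. Qed.

Lemma res_itv x : - 2^-1 <= res x < 2^-1.
Proof.
have /andP[] := floor_itv (x + 2^-1); rewrite intrD /= /res => h1 h2.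
by apply/andP; split; lra.
Qed.

Lemma res_small x y : `|x| < 2^-1 -> y - x \is a Num.int -> res y = x.
Proof.
move=> x2 /intrP[n e]; rewrite /res (_ : Num.floor _ = n); first by rewrite -e; ring.
have -> : y = x + n%:~R by rewrite -e; ring.
apply: floor_def; move: x2; rewrite ltr_norml intrD /= => /andP[h1 h2].
by apply/andP; split; lra.
Qed.

Lemma cost_gt x y : 0 <= x < y -> y <= 2^-1 -> cost y < cost x.
Proof.
move=> /andP[x0 xy] y2; have p0 := pi_gt0 R.
rewrite /cost; have H (z : R) : 0 <= z <= 2^-1 -> pi *+ 2 * z \in `[0, pi].
  move=> /andP[z0 z2]; rewrite in_itv /=; apply/andP; split.
    by rewrite mulr_ge0 // mulrn_wge0 // ltW.
  rewrite mulr2n; have := ler_wpM2l (ltW p0) z2; lra.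
have Hx : pi *+ 2 * x \in `[0, pi] by apply: H; apply/andP; split; lra.
have Hy : pi *+ 2 * y \in `[0, pi] by apply: H; apply/andP; split; lra.
by rewrite ltr_cos // ltr_pM2l // mulrn_wgt0.
Qed.

(** The cosine decreases on half a turn, so a value near 1 confines the angle modulo 1. This
    converts continuity of [cost] and [sint] into smallness of [res]. *)
Lemma cost_close (e : R) : 0 < e ->
  exists2 d : R, 0 < d & forall x, 1 - d < cost x -> `|res x| < e.
Proof.
move=> e0; have [e2|e2] := ltP e 2^-1; last first.
  (* The residue can reach the bound only at $-1/2$, where the cosine is $-1 = 1 - 2$. *)
  exists 2; first by lra.
  move=> x h; have := res_itv x => /andP[h1 h2].
  have hr : cost x = cost (res x) by apply: (cost_eqm (res_int _)).1.
  rewrite ltr_norml; apply/andP; split; last by lra.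
  have [E|E] := eqVneq (res x) (- 2^-1); last by rewrite lt_neqAle eq_sym in E *; lra.
  by move: h; rewrite hr E costN cost_half; lra.
exists (1 - cost e).
  by rewrite subr_gt0 -cost0; apply: cost_gt; rewrite ?lexx ?ltW.
move=> x; rewrite (cost_eqm (res_int x)).1 => h.
have E : cost (res x) = cost `|res x| by case: ger0P; rewrite ?costN.
rewrite {}E in h.
rewrite ltNge; apply/negP => le; move: h; apply/negP; rewrite -leNgt.
have /andP[r1 r2] := res_itv x.
have r3 : `|res x| <= 2^-1 by rewrite ler_norml; lra.
move: le; rewrite le_eqVlt => /orP[/eqP <-|lt]; first by lra.
have := @cost_gt e `|res x|; rewrite lt ltW // => /(_ isT r3); lra.
Qed.

Lemma cost_eq1 x : cost x = 1 -> x \is a Num.int.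
Proof.
move=> c; have [E|E] := eqVneq (res x) 0; first by have := res_int x; rewrite E subr0.
have n0 : 0 < `|res x| by rewrite normr_gt0.
have [d d0 /(_ x)] := cost_close n0; rewrite c ltxx => H.
by have /H : 1 - d < 1 by lra.
Qed.

Lemma turn_inj x y : cost x = cost y -> sint x = sint y -> x - y \is a Num.int.
Proof.
by move=> c s; apply: cost_eq1; rewrite costD costN sintN c s mulrN opprK -!expr2 cost2Dsint2.
Qed.

Lemma turn_exists (a b : R) : a ^+ 2 + b ^+ 2 = 1 ->
  exists x, cost x = a /\ sint x = b.
Proof.
move=> ab; have a1 : -1 <= a <= 1.
  by have := sqr_ge0 b; move=> b2; apply/andP; split; nra.
have p0 : (pi : R) *+ 2 != 0 by rewrite mulrn_eq0 /= gt_eqF // pi_gt0.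
have s : Num.sqrt (1 - a ^+ 2) = `|b| by rewrite -sqrtr_sqr; congr Num.sqrt; lra.
have [b0|b0] := leP 0 b.
  exists (acos a / (pi *+ 2)); rewrite /cost /sint mulrCA divff // mulr1.
  by rewrite acosK ?sin_acos // s ger0_norm.
exists (- (acos a / (pi *+ 2))); rewrite costN sintN /cost /sint mulrCA divff // mulr1.
by rewrite acosK ?sin_acos // s ltr0_norm ?opprK.
Qed.

(** Argument of a vector, in turns. At the origin both quotients are 0 and no angle qualifies, so
    the value is the default 0. *)
Definition turn (a b : R) : R :=
  xget 0 [set x | cost x = a / Num.sqrt (a ^+ 2 + b ^+ 2) /\ sint x = b / Num.sqrt (a ^+ 2 + b ^+ 2)].

Lemma turnP (a b : R) : (a, b) != 0 ->
  cost (turn a b) = a / Num.sqrt (a ^+ 2 + b ^+ 2) /\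
  sint (turn a b) = b / Num.sqrt (a ^+ 2 + b ^+ 2).
Proof.
move=> ab; rewrite /turn; case: xgetP => [x _ //|/= H].
have n0 : a ^+ 2 + b ^+ 2 != 0.
  by apply: contra ab; rewrite paddr_eq0 ?sqr_ge0 // !sqrf_eq0 => /andP[/eqP-> /eqP->].
have [|x xP] := @turn_exists (a / Num.sqrt (a ^+ 2 + b ^+ 2)) (b / Num.sqrt (a ^+ 2 + b ^+ 2)).
  by rewrite !expr_div_n sqr_sqrtr ?addr_ge0 ?sqr_ge0 // -mulrDl divff.
by case: (H x).
Qed.

End Turns.

(** * Winding numbers *)

Section Continuity.
Variables (R : realType) (T : topologicalType) (x : T).
Implicit Types f g : T -> R.

Lemma contat_cst (S : topologicalType) (c : S) : continuous_at x (fun=> c).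
Proof. exact: cvg_cst. Qed.

Lemma contat_id : continuous_at x id.
Proof. exact: cvg_id. Qed.

Lemma contat_comp (S U : topologicalType) (f : T -> S) (g : S -> U) :
  continuous g -> continuous_at x f -> continuous_at x (fun y => g (f y)).
Proof. by move=> cg cf; apply: (continuous_comp cf); exact: cg. Qed.

Lemma contatD f g : continuous_at x f -> continuous_at x g ->
  continuous_at x (fun y => f y + g y).
Proof. exact: cvgD. Qed.

Lemma contatN f : continuous_at x f -> continuous_at x (fun y => - f y).
Proof. exact: cvgN. Qed.

Lemma contatM f g : continuous_at x f -> continuous_at x g ->
  continuous_at x (fun y => f y * g y).
Proof. exact: cvgM. Qed.

Lemma contatX f n : continuous_at x f -> continuous_at x (fun y => f y ^+ n).
Proof.
move=> cf; elim: n => [|n IH]; first by under eq_fun do rewrite expr0; exact: contat_cst.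
by under eq_fun do rewrite exprS; exact: contatM.
Qed.

Lemma contatV f : f x != 0 -> continuous_at x f -> continuous_at x (fun y => (f y)^-1).
Proof. by move=> f0 cf; exact: cvgV. Qed.

Lemma contat_norm f : continuous_at x f -> continuous_at x (fun y => `|f y|).
Proof. exact: cvg_norm. Qed.

Lemma contat_max f g : continuous_at x f -> continuous_at x g ->
  continuous_at x (fun y => Num.max (f y) (g y)).
Proof.
move=> cf cg; have -> : (fun y => Num.max (f y) (g y)) =
    (fun y => (f y + g y + `|f y - g y|) / 2) by apply/funext => y; rewrite maxr_absE.
apply: contatM; last exact: contat_cst.
apply: contatD; first exact: contatD.
by apply: contat_norm; apply: contatD => //; exact: contatN.
Qed.

Lemma contat_min f g : continuous_at x f -> continuous_at x g ->
  continuous_at x (fun y => Num.min (f y) (g y)).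
Proof.
move=> cf cg; have -> : (fun y => Num.min (f y) (g y)) =
    (fun y => (f y + g y - `|f y - g y|) / 2) by apply/funext => y; rewrite minr_absE.
apply: contatM; last exact: contat_cst.
apply: contatD; first exact: contatD.
by apply: contatN; apply: contat_norm; apply: contatD => //; exact: contatN.
Qed.

Lemma contat_sqrt f : continuous_at x f -> continuous_at x (fun y => Num.sqrt (f y)).
Proof. by apply: contat_comp; exact: sqrt_continuous. Qed.

Lemma contat_cost f : continuous_at x f -> continuous_at x (fun y => cost (f y)).
Proof. by apply: contat_comp; exact: continuous_cost. Qed.

Lemma contat_sint f : continuous_at x f -> continuous_at x (fun y => sint (f y)).
Proof. by apply: contat_comp; exact: continuous_sint. Qed.

Lemma contat_fst (U V : topologicalType) (f : T -> U * V) :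
  continuous_at x f -> continuous_at x (fun y => (f y).1).
Proof. by apply: contat_comp => ?; exact: cvg_fst. Qed.

Lemma contat_snd (U V : topologicalType) (f : T -> U * V) :
  continuous_at x f -> continuous_at x (fun y => (f y).2).
Proof. by apply: contat_comp => ?; exact: cvg_snd. Qed.

Lemma contat_pair (U V : topologicalType) (f : T -> U) (g : T -> V) :
  continuous_at x f -> continuous_at x g -> continuous_at x (fun y => (f y, g y)).
Proof. by move=> cf cg; apply: cvg_pair. Qed.

End Continuity.

(** Extension hook of [cont], redefined each time new continuity rules become available. *)
Ltac cont_more := fail.
Ltac cont1 := lazymatch goal with
  | |- continuous_at ?x (fun _ => ?c) => exact: contat_cst
  | |- continuous_at ?x (fun y => y) => exact: contat_id
  | |- continuous_at ?x (fun y => (@?f y + @?g y)%R) => apply: (@contatD _ _ x f g)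
  | |- continuous_at ?x (fun y => (- @?f y)%R) => apply: (@contatN _ _ x f)
  | |- continuous_at ?x (fun y => (@?f y * @?g y)%R) => apply: (@contatM _ _ x f g)
  | |- continuous_at ?x (fun y => (@?f y ^+ _)%R) => apply: (@contatX _ _ x f)
  | |- continuous_at ?x (fun y => ((@?f y)^-1)%R) => apply: (@contatV _ _ x f)
  | |- continuous_at ?x (fun y => `|@?f y|%R) => apply: (@contat_norm _ _ x f)
  | |- continuous_at ?x (fun y => Num.max (@?f y) (@?g y)) => apply: (@contat_max _ _ x f g)
  | |- continuous_at ?x (fun y => Num.min (@?f y) (@?g y)) => apply: (@contat_min _ _ x f g)
  | |- continuous_at ?x (fun y => Num.sqrt (@?f y)) => apply: (@contat_sqrt _ _ x f)
  | |- continuous_at ?x (fun y => cost (@?f y)) => apply: (@contat_cost _ _ x f)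
  | |- continuous_at ?x (fun y => sint (@?f y)) => apply: (@contat_sint _ _ x f)
  | |- continuous_at ?x (fun y => (@?f y, @?g y)) => apply: (@contat_pair _ x _ _ f g)
  | |- continuous_at ?x (fun y => (@?f y).1) => apply: (@contat_fst _ x _ _ f)
  | |- continuous_at ?x (fun y => (@?f y).2) => apply: (@contat_snd _ x _ _ f)
  | |- _ => first
    [ assumption
    | match goal with H : continuous ?f |- continuous_at ?x ?f => exact: (H x) end
    | match goal with H : continuous ?g |- continuous_at _ (fun y => ?g (@?h y)) => apply: (@contat_comp _ _ _ _ h g H) end
    | lazymatch goal with |- continuous_at _ fst => exact: cvg_fst | |- continuous_at _ snd => exact: cvg_snd end
    | cont_more ]
  end.
Ltac cont := intros; lazymatch goal with
  | |- continuous _ => let x := fresh "x" in move=> x; repeat (cbv beta; cont1)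
  | |- _ => repeat (cbv beta; cont1) end.

Section Circ.
Variable R : realType.

(** Continuity of the composite with $\mathbb{R}\to\mathbb{R}/\mathbb{Z}$. Such a function stands
    for a class in $H^1$ with integer coefficients; keeping real representatives makes sums and
    integer corrections ordinary arithmetic. *)
Definition circ (T : topologicalType) (f : T -> R) :=
  continuous (@cost R \o f) /\ continuous (@sint R \o f).

Lemma circ_comp (S T : topologicalType) (h : S -> T) (f : T -> R) :
  continuous h -> circ f -> circ (f \o h).
Proof. move=> ch [cf sf]; split => x.
  by apply: (@continuous_comp _ _ _ h (@cost R \o f)); [exact: ch|exact: cf].
by apply: (@continuous_comp _ _ _ h (@sint R \o f)); [exact: ch|exact: sf]. Qed.

Lemma circ_continuous (T : topologicalType) (f : T -> R) : continuous f -> circ f.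
Proof.
move=> cf; split => x.
  by apply: (continuous_comp (cf x)); exact: continuous_cost.
by apply: (continuous_comp (cf x)); exact: continuous_sint.
Qed.

Lemma circ_eqm (T : topologicalType) (f g : T -> R) :
  (forall x, f x - g x \is a Num.int) -> circ f -> circ g.
Proof.
move=> fg [cf sf].
have E1 : @cost R \o g = @cost R \o f by apply/funext => x /=; rewrite (cost_eqm (fg x)).1.
have E2 : @sint R \o g = @sint R \o f by apply/funext => x /=; rewrite (cost_eqm (fg x)).2.
by split; rewrite ?E1 ?E2.
Qed.

Lemma res_lt (x y e : R) : `|x| < e -> e <= 2^-1 -> y - x \is a Num.int -> `|res y| < e.
Proof. by move=> xe e2 yx; rewrite (@res_small _ x) // (lt_le_trans xe). Qed.

Lemma circ_near (T : topologicalType) (f : T -> R) (p : T) (e : R) :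
  circ f -> 0 < e -> \forall q \near p, `|res (f q - f p)| < e.
Proof.
move=> [cf sf] e0; have [d d0 H] := cost_close e0.
have C : cost (f q - f p) @[q --> p] --> (1 : R).
  rewrite -(cost2Dsint2 (f p)) !expr2.
  have -> : (fun q => cost (f q - f p)) = (fun q => cost (f q) * cost (f p) + sint (f q) * sint (f p)).
    by apply/funext => q; rewrite costD costN sintN mulrN opprK.
  by apply: cvgD; apply: cvgMl; [exact: cf|exact: sf].
have K : 1 - d < 1 by lra.
near=> q; apply: H; near: q; exact: (cvgr_gt _ C _ K).
Unshelve. all: by end_near. Qed.

(** Converse of [circ_near]: any small real representative of the increment will do, which suits
    functions defined by cases that jump by integers. *)
Lemma circ_of_near (T : topologicalType) (f : T -> R) :
  (forall (p : T) (e : R), 0 < e -> \forall q \near p, exists2 a : R, `|a| < e & f q - f p - a \is a Num.int) ->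
  circ f.
Proof.
move=> H.
suff K (h : R -> R) : continuous h -> (forall x y, x - y \is a Num.int -> h x = h y) ->
    continuous (h \o f).
  split; apply: K.
  - exact: continuous_cost.
  - by move=> x y /cost_eqm[].
  - exact: continuous_sint.
  - by move=> x y /cost_eqm[].
move=> ch hi p; apply/cvgrPdist_lt => e e0 /=.
have /cvgrPdist_lt /(_ e e0) := ch (f p); rewrite -nbhs_nearE => /nbhs_ballP[d /= d0 sub].
near=> q.
have [a ad fa] : exists2 a : R, `|a| < d & f q - f p - a \is a Num.int by near: q; exact: H.
have -> : h (f q) = h (f p + a) by apply: hi; rewrite opprD addrA.
by apply: sub; rewrite /ball /= opprD addrA subrr add0r normrN.
Unshelve. all: by end_near. Qed.

Definition clamp (M : R) (t : R) : R := Num.max (- M) (Num.min M t).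

Lemma clamp_continuous M : continuous (clamp M).
Proof. by rewrite /clamp; cont. Qed.

Lemma clamp_le M t : 0 <= M -> `|clamp M t| <= M.
Proof. by move=> M0; rewrite ler_norml /clamp le_max lexx /= ge_max ge_min lexx andbT /=; lra. Qed.

Lemma clamp_id M t : `|t| <= M -> clamp M t = t.
Proof.
rewrite ler_norml => /andP[h1 h2]; rewrite /clamp min_r // max_r //.
Qed.

(** Unwrap [f] along the rays from the origin. Uniform continuity on the compact square cuts each
    ray into steps whose increments have small residue; these residues sum to a continuous function
    congruent to [f]. Clamping the argument makes it continuous on the whole plane. *)
Lemma lift_square (f : R * R -> R) (M : R) : circ f -> 0 < M ->
  exists2 g : R * R -> R, continuous g &
    forall x, `|x| <= M -> g x - f x \is a Num.int.
Proof.
move=> cf M0.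
have [d d0 unif] : exists2 d : R, 0 < d &
    forall x y, `|x| <= M -> `|y - x| < d -> `|res (f y - f x)| < 8^-1.
  have /compact_near_coveringP cov : compact (`[- M, M] `*` `[- M, M] : set (R * R)).
    by apply: compact_setX; exact: segment_compact.
  have H := cov _ (0:R)^'+ (fun d x => forall y : R * R, `|y - x| < d -> `|res (f y - f x)| < 8^-1) _ _.
  have {}H : \forall d \near (0:R)^'+, `[- M, M] `*` `[- M, M] `<=`
     (fun x : R * R => forall y : R * R, `|y - x| < d -> `|res (f y - f x)| < 8^-1).
    apply: H => x _. have e0 : (0 : R) < 16^-1 by [].
    have /nbhs_ballP[r /= r0 sub] := circ_near x cf e0.
    have r2 : 0 < r / 2 by rewrite divr_gt0.
    exists (ball x (r / 2), [set d | d < r / 2]) => /=.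
      split; first exact: nbhsx_ballx.
      by near=> d => //=; near: d; exact: nbhs_right_lt.
    move=> [x' d] /= [xx' dr] y yx'.
    have h1 : `|res (f x' - f x)| < 16^-1.
      by apply: sub; apply: le_ball xx'; lra.
    have h2 : `|res (f y - f x)| < 16^-1.
      apply: sub; rewrite -ball_normE /=; move: xx'; rewrite -ball_normE /= => xx'.
      have -> : x - y = (x - x') - (y - x') by rewrite opprB addrA subrK.
      by apply: (le_lt_trans (ler_normB _ _)); lra.
    apply: (@res_lt (res (f y - f x) - res (f x' - f x))); last 2 first.
    + lra.
    + have i1 := res_int (f y - f x); have i2 := res_int (f x' - f x).
      have -> : f y - f x' - (res (f y - f x) - res (f x' - f x)) =
        (f y - f x - res (f y - f x)) - (f x' - f x - res (f x' - f x)) by ring.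
      exact: rpredB.
    + by apply: (le_lt_trans (ler_normB _ _)); lra.
  have : \forall d \near (0 : R)^'+, 0 < d /\ `[- M, M] `*` `[- M, M] `<=` (fun x : R * R => forall y : R * R, `|y - x| < d -> `|res (f y - f x)| < 8^-1).
    near=> d; split; last by near: d; exact: H.
    by near: d; exact: nbhs_right_gt.
  move=> /filter_ex[d [d0 Hd]]; exists d => // x y xM; apply: Hd.
  move: xM; rewrite prod_normE ge_max => /andP[h1 h2].
  by split => /=; rewrite in_itv /= -ler_norml.
have [N MN] : exists N : nat, M / N.+1%:R < d.
  exists (Num.truncn (M / d)); rewrite ltr_pdivrMr // mulrC -ltr_pdivrMr //.
  by rewrite truncnS_gt.
pose sc (k : nat) (x : R * R) := (k%:R / N.+1%:R) *: x.
have step k x : `|x| <= M -> (k <= N)%N -> `|res (f (sc k.+1 x) - f (sc k x))| < 8^-1.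
  move=> xM kN; apply: unif.
    rewrite normrZ ger0_norm ?divr_ge0 // (le_trans _ xM) // ler_piMl //.
    by rewrite ler_pdivrMr // mul1r ler_nat ltnW // ltnS.
  rewrite /sc -scalerBl -mulrBl -natr1 addrAC subrr add0r normrZ ger0_norm ?divr_ge0 //.
  by apply: le_lt_trans MN; rewrite mul1r mulrC ler_wpM2r // invr_ge0.
pose g0 x := f 0 + \sum_(k < N.+1) res (f (sc k.+1 x) - f (sc k x)).
have sc0 x : sc 0 x = 0 by rewrite /sc mul0r scale0r.
have scN x : sc N.+1 x = x by rewrite /sc divff ?scale1r // pnatr_eq0.
have g0f x : g0 x - f x \is a Num.int.
  have -> : f x = f 0 + \sum_(k < N.+1) (f (sc k.+1 x) - f (sc k x)).
    rewrite -(big_mkord xpredT (fun k => f (sc k.+1 x) - f (sc k x))) telescope_sumr //.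
    by rewrite sc0 scN addrC subrK.
  rewrite /g0 opprD addrACA subrr add0r -sumrB; apply: rpred_sum => k _.
  by rewrite -rpredN opprB res_int.
have scc k : continuous (sc k).
  by move=> x; exact: scaler_continuous.
have g0c (x : R * R) (e : R) : `|x| <= M -> 0 < e -> \forall y \near x, `|y| <= M -> `|g0 y - g0 x| < e.
  (* Residues under $1/8$ changed by two errors under $1/16$ stay below $1/2$, so they vary without
     wrapping and the errors telescope. *)
  move=> xM e0; pose e' := Num.min e 16^-1.
  have e'0 : 0 < e' by rewrite lt_min e0 invr_gt0 ltr0n.
  near=> y => yM.
  pose E (k : nat) := res (f (sc k y) - f (sc k x)).
  have Es (k : 'I_N.+2) : `|E k| < e'.
    rewrite /E; move: k; clear E yM; near: y; apply: filter_forall => k.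
    by have := scc k x _ (circ_near (sc k x) cf e'0).
  have EE (k : 'I_N.+1) : res (f (sc k.+1 y) - f (sc k y)) = res (f (sc k.+1 x) - f (sc k x)) + (E k.+1 - E k).
    have h1 : `|E k.+1| < e' by exact: (Es (fintype.lift ord0 k)).
    have h2 : `|E k| < e' by exact: (Es (widen_ord (leqnSn _) k)).
    have h3 := @step k x xM (ltn_ord k).
    have e16 : e' <= 16^-1 by rewrite ge_min lexx orbT.
    apply: res_small.
      apply: (le_lt_trans (ler_normD _ _)).
      have := ler_normB (E k.+1) (E k); lra.
    have i1 := res_int (f (sc k.+1 x) - f (sc k x)).
    have i2 := res_int (f (sc k.+1 y) - f (sc k.+1 x)).
    have i3 := res_int (f (sc k y) - f (sc k x)).
    have -> : f (sc k.+1 y) - f (sc k y) - (res (f (sc k.+1 x) - f (sc k x)) + (E k.+1 - E k)) =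
     (f (sc k.+1 x) - f (sc k x) - res (f (sc k.+1 x) - f (sc k x))) +
     (f (sc k.+1 y) - f (sc k.+1 x) - E k.+1) -
     (f (sc k y) - f (sc k x) - E k) by ring.
    by rewrite rpredB // rpredD.
  have -> : g0 y - g0 x = \sum_(k < N.+1) (E k.+1 - E k).
    rewrite /g0 opprD addrACA subrr add0r -sumrB; apply: eq_bigr => k _.
    by rewrite EE addrAC subrr add0r.
  rewrite -(big_mkord xpredT (fun k => E k.+1 - E k)) telescope_sumr //.
  have -> : E 0%N = 0.
    by rewrite /E !sc0 subrr; apply: res_small; rewrite ?normr0 ?subr0 ?rpred0.
  by rewrite subr0; apply: lt_le_trans (Es ord_max) _; rewrite ge_min lexx.
pose cl (x : R * R) := (clamp M x.1, clamp M x.2).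
have clM x : `|cl x| <= M by rewrite prod_normE ge_max !clamp_le // ltW.
exists (g0 \o cl); last first.
  move=> x; rewrite prod_normE ge_max => /andP[h1 h2] /=.
  by rewrite /cl !clamp_id // -surjective_pairing.
move=> x; apply/cvgrPdist_lt => e e0.
have clc : continuous cl by rewrite /cl; have c := @clamp_continuous M; cont.
have := clc x _ (g0c (cl x) e (clM x) e0); rewrite nbhs_nearE => near_x.
near=> y; rewrite /= distrC; have : `|cl y| <= M by [].
by near: y.
Unshelve. all: by end_near. Qed.

End Circ.

Section Winding.
Variable R : realType.

(** Otherwise the intermediate value theorem would produce a half-integral value. *)
Lemma int_continuous_const (h : R -> R) : continuous h ->
  (forall t, 0 <= t <= 1 -> h t \is a Num.int) -> h 1 = h 0.
Proof.
move=> ch hi; apply/eqP; apply/negPn/negP => ne.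
have /hi/intrP[a ha] : 0 <= (0 : R) <= 1 by rewrite lexx ler01.
have /hi/intrP[b hb] : 0 <= (1 : R) <= 1 by rewrite lexx ler01.
have ch' : {within `[0, 1], continuous h} by apply: continuous_subspaceT.
have ab : (a != b) by apply: contraNneq ne => E; rewrite ha hb E.
have [c c01 hc] : exists2 c, c \in `[(0:R), 1] & h c = (Order.min a b)%:~R + 2^-1.
  apply: IVT => //; rewrite ha hb.
  have [le|le] := leP a b; [have lt : a < b by rewrite lt_neqAle ab|have lt := le].
    have : a%:~R + 1 <= b%:~R :> R by rewrite -[1]/(1%:~R) -intrD ler_int lezD1.
    by move=> h1; rewrite min_l ?max_r ?ler_int //; apply/andP; split; lra.
  have : b%:~R + 1 <= a%:~R :> R by rewrite -[1]/(1%:~R) -intrD ler_int lezD1.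
  by move=> h1; rewrite min_r ?max_l ?ler_int ?(ltW lt) //; apply/andP; split; lra.
have /hi/intrP[n hn] : 0 <= c <= 1 by move: c01; rewrite in_itv.
move: hc; rewrite hn => /eqP; set m := Order.min a b => /eqP E.
have h1 : (m%:~R : R) < n%:~R by rewrite E; lra.
have h2 : (n%:~R : R) < (m + 1)%:~R by rewrite E intrD /=; lra.
by move: h1 h2; rewrite !ltr_int; lia.
Qed.

Definition lifts (f g : R -> R) :=
  continuous g /\ forall t, 0 <= t <= 1 -> g t - f t \is a Num.int.

(** Two lifts differ by a constant integer on [[0, 1]], so the choice made by [xget] does not affect
    the increment. *)
Definition wind (f : R -> R) : R :=
  let g := xget (fun=> 0) [set g | lifts f g] in g 1 - g 0.

Lemma windE (f g : R -> R) : lifts f g -> wind f = g 1 - g 0.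
Proof.
move=> fg; rewrite /wind; case: xgetP => [h _ /= [ch hf]|/(_ g)//].
have : h 1 - g 1 = h 0 - g 0.
  apply: (@int_continuous_const (fun t => h t - g t)).
    by have [cg _] := fg; cont.
  move=> t t01; have -> : h t - g t = (h t - f t) - (g t - f t) by ring.
  by rewrite rpredB ?hf ?fg.2.
lra.
Qed.

Lemma lift_path (f : R -> R) : circ f -> exists g, lifts f g.
Proof.
move=> cf; have cf' : circ (f \o fst : R * R -> R) by apply: circ_comp => //; cont.
have [g cg gf] := lift_square cf' (@ltr01 R).
exists (fun t => g (t, 0)); split; first by cont.
move=> t /andP[t0 t1]; apply: (gf (t, 0)).
by rewrite prod_normE /= normr0 ge_max ler01 andbT ger0_norm.
Qed.

Lemma lift_rect (f : R * R -> R) : circ f -> exists2 g : R * R -> R, continuous g &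
  forall s t, 0 <= s <= 1 -> 0 <= t <= 1 -> g (s, t) - f (s, t) \is a Num.int.
Proof.
move=> cf; have [g cg gf] := lift_square cf (@ltr01 R); exists g => // s t s01 t01.
by apply: gf; rewrite prod_normE /= ge_max !ler_norml; lra.
Qed.

(** Lifts of [f1] and [f2] combine with [k] into a lift of [f]. The real function [k] contributes
    only its endpoint difference, a coboundary that disappears on cycles. *)
Lemma wind_comb (f f1 f2 k : R -> R) (m : int) :
  circ f1 -> circ f2 -> continuous k ->
  (forall t, 0 <= t <= 1 -> f t - (f1 t + m%:~R * f2 t + k t) \is a Num.int) ->
  wind f = wind f1 + m%:~R * wind f2 + (k 1 - k 0).
Proof.
move=> /lift_path[g1 [cg1 l1]] /lift_path[g2 [cg2 l2]] ck H.
rewrite (windE (conj cg1 l1)) (windE (conj cg2 l2)).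
rewrite (@windE f (fun t => g1 t + m%:~R * g2 t + k t)); first by ring.
split; first by cont.
move=> t t01; have -> : g1 t + m%:~R * g2 t + k t - f t =
  (g1 t - f1 t) + m%:~R * (g2 t - f2 t) - (f t - (f1 t + m%:~R * f2 t + k t)) by ring.
by rewrite rpredB ?H // rpredD ?l1 // rpredM ?intr_int ?l2.
Qed.

(** Retraction onto the unit interval: precomposing with it makes maps given on intervals, squares
    and simplices continuous everywhere, so that subspace topologies rarely appear. *)
Definition clamp01 (t : R) : R := Num.max 0 (Num.min 1 t).

Lemma clamp01_continuous : continuous clamp01.
Proof. by rewrite /clamp01; cont. Qed.

Lemma clamp01_itv t : 0 <= clamp01 t <= 1.
Proof. by rewrite /clamp01 le_max lexx /= ge_max ler01 ge_min lexx. Qed.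

Lemma clamp01_id t : 0 <= t <= 1 -> clamp01 t = t.
Proof. by move=> /andP[t0 t1]; rewrite /clamp01 min_r ?max_r. Qed.

End Winding.

Section ContinuityMatrix.
Variables (R : realType) (T : topologicalType) (x : T).

Lemma contat_row n (F : T -> 'I_n -> R) :
  (forall j, continuous_at x (F^~ j)) -> continuous_at x (fun y => \row_j F y j : 'rV[R]_n).
Proof.
move=> cF U [P /= Pp sPU].
suff nP : nbhs x (fun y => forall j, P 0 j (F y j)).
  by apply: filterS nP => y Py; apply: sPU => i j; rewrite ord1 mxE; exact: Py.
by apply: filter_forall => j; apply: cF; have := Pp 0 j; rewrite mxE.
Qed.

Lemma contat_coord m n (f : T -> 'M[R]_(m.+1, n.+1)) i j :
  continuous_at x f -> continuous_at x (fun y => f y i j).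
Proof.
move=> cf; apply: (@contat_comp _ _ _ _ f (fun M : 'M[R]_(m.+1, n.+1) => M i j)) cf.
exact: coord_continuous.
Qed.

Lemma contat_val (X : topologicalType) (A : set X) (f : T -> A) :
  continuous_at x f -> continuous_at x (fun y => set_val (f y)).
Proof. by apply: contat_comp; exact: initial_continuous. Qed.

Lemma contat_clamp01 (f : T -> R) : continuous_at x f -> continuous_at x (fun y => clamp01 (f y)).
Proof. by apply: contat_comp; exact: clamp01_continuous. Qed.

Lemma contat_clamp M (f : T -> R) : continuous_at x f -> continuous_at x (fun y => clamp M (f y)).
Proof. by apply: contat_comp; exact: clamp_continuous. Qed.

End ContinuityMatrix.

Lemma continuous_sub (T X : topologicalType) (A : set X) (f : T -> A) :
  continuous (fun y => set_val (f y)) -> continuous f.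
Proof. by move=> cf; apply: continuous_comp_initial. Qed.

Ltac cont_more ::= lazymatch goal with
  | |- continuous_at ?x (fun y => clamp01 (@?f y)) => apply: (@contat_clamp01 _ _ x f)
  | |- continuous_at ?x (fun y => clamp _ (@?f y)) => apply: (@contat_clamp _ _ x _ f)
  | |- continuous_at ?x (fun y => fun_of_matrix (@?f y) _ _) => apply: (@contat_coord _ _ x _ _ f)
  | |- continuous_at ?x (fun y => set_val (@?f y)) => apply: (@contat_val _ x _ _ f)
  | |- continuous_at ?x (fun y => \row_j (@?f y j)) => apply: (@contat_row _ _ x _ f); intro
  end.

Section Degree.
Variable R : realType.

Definition edge_pt (t : R) : 'rV[R]_2 :=
  \row_j (if j == 0 then 1 - clamp01 t else clamp01 t).

Lemma edge_subproof t : edge_pt t \in @std_simplex R 1.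
Proof.
have /andP[t0 t1] := clamp01_itv t; apply/mem_set; split.
  by move=> i; rewrite mxE; case: ifP => _; lra.
by rewrite big_ord_recl big_ord1 !mxE /=; lra.
Qed.

Definition edge (t : R) : @std_simplex R 1 := exist _ (edge_pt t) (edge_subproof t).

Lemma edge_continuous : continuous edge.
Proof.
apply: continuous_sub => t; rewrite /edge set_valE /= /edge_pt.
by apply: contat_row => j; case: (j == 0); cont.
Qed.

(* The square onto the standard 2-simplex; it collapses the side s = 0. *)
Definition triangle_pt (x : R * R) : 'rV[R]_3 :=
  \row_j [:: 1 - clamp01 x.1; clamp01 x.1 * (1 - clamp01 x.2); clamp01 x.1 * clamp01 x.2]`_j.

Lemma triangle_subproof x : triangle_pt x \in @std_simplex R 2.
Proof.
have /andP[s0 s1] := clamp01_itv x.1; have /andP[t0 t1] := clamp01_itv x.2.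
apply/mem_set; split.
  by move=> [[|[|[|//]]] i] //; rewrite mxE /= ?mulr_ge0 //; lra.
by rewrite !big_ord_recl big_ord0 !mxE /=; ring.
Qed.

Definition triangle x : @std_simplex R 2 := exist _ (triangle_pt x) (triangle_subproof x).

Lemma triangle_continuous : continuous triangle.
Proof.
apply: continuous_sub => x; rewrite /triangle set_valE /= /triangle_pt.
by apply: contat_row => -[[|[|[|//]]] i] /=; cont.
Qed.

Lemma simplex_eq n (p q : @std_simplex R n) :
  (forall j, set_val p 0 j = set_val q 0 j) -> p = q.
Proof. by move=> H; apply/val_inj/rowP => j; exact: H. Qed.

Lemma triangle_edges t : 0 <= t <= 1 ->
  [/\ face_map ord0 (edge t) = triangle (1, t),
      face_map (fintype.lift ord0 ord0) (edge t) = triangle (t, 1) &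
      face_map ord_max (edge t) = triangle (t, 0)].
Proof.
move=> t01; have c0 : clamp01 (0 : R) = 0 by rewrite clamp01_id ?lexx ?ler01.
have c1 : clamp01 (1 : R) = 1 by rewrite clamp01_id ?lexx ?ler01.
split; apply: simplex_eq => j; rewrite !set_valE /= !mxE /= ?c0 ?c1 (clamp01_id t01);
  case: unliftP => [k|] ->; rewrite ?mxE; try case: k => -[|[|//]] ?;
  by rewrite /= ?(clamp01_id t01) ?subrr ?subr0 ?mulr0 ?mul0r ?mul1r ?mulr1.
Qed.

Section WindChain.
Variable (T : topologicalType) (f : T -> R).

(** [zmodule R] carries the [int]-module structure that [fglift] expects of its target. *)
Definition wind_simplex (s : simplex R T 1) : zmodule R := wind (f \o s \o edge).

Definition wind_chain (c : chain R T 1) : R := fglift wind_simplex c.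

Lemma wind_chainD : {morph wind_chain : c d / c + d}.
Proof. by move=> c d; rewrite /wind_chain raddfD. Qed.

Lemma wind_chainB : {morph wind_chain : c d / c - d}.
Proof. by move=> c d; rewrite /wind_chain raddfB. Qed.

Lemma wind_chainE c : wind_chain c = \sum_(s <- dom c) (coeff s c)%:~R * wind (f \o s \o edge).
Proof.
rewrite /wind_chain -[in LHS](freeg_sumE c) raddf_sum; apply: eq_bigr => s _.
by rewrite /= liftU /wind_simplex mulrzl.
Qed.

Lemma wind_chainU s : wind_chain << s >> = wind (f \o s \o edge).
Proof. by rewrite /wind_chain liftU scale1r. Qed.

Hypothesis cf : circ f.

Lemma circ_simplex n (s : simplex R T n) : circ (f \o s).
Proof. by apply: circ_comp => //; exact: cts_fun. Qed.

(** A lift over the square that parametrizes the triangle computes all three edges; their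
    contributions cancel because the lift is constant along the collapsed side. *)
Lemma wind_simplex_boundary (s : simplex R T 2) : wind_chain (simplex_boundary s) = 0.
Proof.
have cs : circ (f \o s \o triangle).
  by apply: circ_comp; [exact: triangle_continuous|exact: circ_simplex].
have [g cg gf] := lift_rect cs.
have u0 : 0 <= (0 : R) <= 1 by rewrite lexx ler01.
have u1 : 0 <= (1 : R) <= 1 by rewrite lexx ler01.
have w0 : wind (f \o (s \o face_map ord0) \o edge) = g (1, 1) - g (1, 0).
  apply: (@windE _ _ (fun t => g (1, t))); split; first by cont.
  by move=> t t01; rewrite /=; have [-> _ _] := triangle_edges t01; exact: gf.
have w1 : wind (f \o (s \o face_map (fintype.lift ord0 ord0)) \o edge) = g (1, 1) - g (0, 1).
  apply: (@windE _ _ (fun t => g (t, 1))); split; first by cont.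
  by move=> t t01; rewrite /=; have [_ -> _] := triangle_edges t01; exact: gf.
have w2 : wind (f \o (s \o face_map ord_max) \o edge) = g (1, 0) - g (0, 0).
  apply: (@windE _ _ (fun t => g (t, 0))); split; first by cont.
  by move=> t t01; rewrite /=; have [_ _ ->] := triangle_edges t01; exact: gf.
have w3 : g (0, 1) = g (0, 0).
  have := @int_continuous_const R (fun t => g (0, t) - f (s (triangle (0, 0)))).
  move=> /(_ _ _)/(subIr) -> //; first by cont.
  move=> t t01; have -> : triangle (0, 0) = triangle (0, t) by
    apply: simplex_eq => -[[|[|[|//]]] i]; rewrite !set_valE /= !mxE /= (clamp01_id u0) ?mul0r.
  exact: gf.
rewrite /simplex_boundary !big_ord_recl big_ord0 addr0 /= !wind_chainD.
have sg (k : int) (r : simplex R T 1) : wind_chain << k *g r >> = k%:~R * wind (f \o r \o edge).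
  by rewrite /wind_chain liftU mulrzl.
rewrite !sg expr0 expr1 /bump /= expr2 mulN1r opprK.
have -> : fintype.lift ord0 (fintype.lift ord0 ord0) = ord_max :> 'I_3 by exact/val_inj.
rewrite w2; have := w0; rewrite /= => ->; have := w1; rewrite /= => ->.
by rewrite mulrN1z mulr1z w3; ring.
Qed.

Lemma wind_boundary (c : chain R T 2) : wind_chain (boundary c) = 0.
Proof.
rewrite -[c]freeg_sumE raddf_sum /wind_chain raddf_sum big1 // => s _ /=.
by rewrite /boundary liftU raddf_int_scalable /= [fglift _ _]wind_simplex_boundary scaler0.
Qed.

End WindChain.

End Degree.

Arguments edge {R} t.

(** * Degrees on first homology *)

Section DegreeH1.
Variable R : realType.

Definition vertex_pt : 'rV[R]_1 := \row_j 1.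
Lemma vertex_subproof : vertex_pt \in @std_simplex R 0.
Proof. by apply/mem_set; split=> [i|]; rewrite ?big_ord1 mxE. Qed.
Definition vertex : @std_simplex R 0 := exist _ vertex_pt vertex_subproof.

Lemma face_vertex : face_map ord0 vertex = edge 1 /\ face_map (fintype.lift ord0 ord0) vertex = edge 0.
Proof.
have u0 : 0 <= (0 : R) <= 1 by rewrite lexx ler01.
have u1 : 0 <= (1 : R) <= 1 by rewrite lexx ler01.
split; apply: simplex_eq => j; rewrite !set_valE /= !mxE ?(clamp01_id u0) ?(clamp01_id u1);
  case: unliftP => [k|] ->; rewrite ?mxE; try (case: k => -[|//] ?);
  by rewrite /= ?subrr ?subr0.
Qed.

Section OneSpace.
Variable T : topologicalType.
Implicit Types (f k : T -> R) (c : chain R T 1) (h : H1 R T).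

(** The sum is the 0-cochain [k] evaluated on the boundary. As [k] is arbitrary, an angle function
    itself may be inserted, which yields the integrality of [wind_chain] on cycles. *)
Lemma cycle_endpoints k c : boundary c = 0 ->
  \sum_(s <- dom c) (coeff s c)%:~R * (k (s (edge 1)) - k (s (edge 0))) = 0.
Proof.
move=> c0; pose e (d : chain R T 0) : R := fglift (fun s : simplex R T 0 => k (s vertex) : zmodule R) d.
transitivity (e (boundary c)); last by rewrite c0 /e raddf0.
rewrite /e -[in RHS](freeg_sumE c) !raddf_sum /=; apply: eq_bigr => s _.
rewrite /boundary liftU raddf_int_scalable /= /simplex_boundary big_ord_recl big_ord1 raddfD /=.
by rewrite !liftU expr0 expr1 /= !scalezrE !face_vertex.1 !face_vertex.2 mulr1z mulrN1z mulrzl.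
Qed.

Lemma wind_int f (s : simplex R T 1) : circ f ->
  wind (f \o s \o edge) - (f (s (edge 1)) - f (s (edge 0))) \is a Num.int.
Proof.
move=> cf; have cs : circ (f \o s \o edge).
  by apply: circ_comp; [exact: edge_continuous|exact: circ_simplex].
have [g [cg gf]] := lift_path cs; rewrite (windE (conj cg gf)).
have -> : g 1 - g 0 - (f (s (edge 1)) - f (s (edge 0))) =
  (g 1 - f (s (edge 1))) - (g 0 - f (s (edge 0))) by ring.
by rewrite rpredB // gf // lexx ler01.
Qed.

Lemma wind_cycle_int f c : circ f -> boundary c = 0 -> wind_chain f c \is a Num.int.
Proof.
move=> cf c0; have := cycle_endpoints f c0; set S := \sum_(s <- _) _ => S0.
have -> : wind_chain f c = wind_chain f c - S by rewrite S0 subr0.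
rewrite wind_chainE /S -sumrB.
apply: rpred_sum => s _; rewrite -mulrBr rpredM ?intr_int //; exact: wind_int.
Qed.

(** [wind_chain] is integral on cycles and vanishes on boundaries, so for [circ f] neither the floor
    nor the chosen representative loses anything. *)
Definition deg f h : int := Num.floor (wind_chain f (val (repr h))).

Lemma hclassK h : hclass (repr h) = h.
Proof. exact: reprK. Qed.

Lemma cycle_boundary (z : Z1 R T) : boundary (val z) = 0.
Proof. by have /eqP := valP z. Qed.

Lemma hclass_eqP (z w : Z1 R T) : hclass z = hclass w ->
  exists d : chain R T 2, boundary d = val z - val w.
Proof.
move=> /eqP; rewrite /hclass -Quotient.idealrBE unfold_in => /asboolP[d dE].
by exists d; rewrite dE raddfB.
Qed.

Lemma degE f z : circ f -> (deg f (hclass z))%:~R = wind_chain f (val z).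
Proof.
move=> cf; rewrite floorK ?wind_cycle_int ?cycle_boundary //.
have [d dE] := hclass_eqP (hclassK (hclass z)).
have := wind_boundary cf d; rewrite dE wind_chainB => /eqP.
by rewrite subr_eq0 => /eqP.
Qed.

Lemma hclassD (z w : Z1 R T) : hclass (z + w) = hclass z + hclass w.
Proof. by rewrite /hclass raddfD. Qed.

Lemma degD f h h' : circ f -> deg f (h + h') = deg f h + deg f h'.
Proof.
move=> cf; apply: (@intr_inj R); rewrite intrD /= -(hclassK h) -(hclassK h') -hclassD !degE //.
by rewrite -wind_chainD.
Qed.

Lemma deg0 f : circ f -> deg f 0 = 0.
Proof. by move=> cf; apply: (@addrI _ (deg f 0)); rewrite -degD // !addr0. Qed.

Lemma degN f h : circ f -> deg f (- h) = - deg f h.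
Proof. by move=> cf; apply/eqP; rewrite -addr_eq0 -degD // addNr deg0. Qed.

Lemma degB f h h' : circ f -> deg f (h - h') = deg f h - deg f h'.
Proof. by move=> cf; rewrite degD // degN. Qed.

Lemma deg_mulz f h n : circ f -> deg f (h *~ n) = n * deg f h.
Proof.
move=> cf; suff H (m : nat) : deg f (h *+ m) = m%:Z * deg f h.
  by case: n => m; [exact: H|rewrite NegzE mulrNz degN // H mulNr].
elim: m => [|m IH]; first by rewrite deg0 ?mul0r.
by rewrite mulrSr degD // IH -addn1 PoszD mulrDl mul1r.
Qed.

Lemma deg_sum f (I : finType) (F : I -> H1 R T) : circ f ->
  deg f (\sum_i F i) = \sum_i deg f (F i).
Proof.
by move=> cf; elim/big_rec2: _ => [|i x y _ <-]; rewrite ?deg0 ?degD.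
Qed.

Lemma wind_chain_comb f f1 f2 k (m : int) c : boundary c = 0 ->
  (forall s, s \in dom c -> wind (f \o s \o edge) =
     wind (f1 \o s \o edge) + m%:~R * wind (f2 \o s \o edge) + (k (s (edge 1)) - k (s (edge 0)))) ->
  wind_chain f c = wind_chain f1 c + m%:~R * wind_chain f2 c.
Proof.
move=> c0 H; have := cycle_endpoints k c0; set S := \sum_(s <- _) _ => S0.
transitivity (wind_chain f1 c + m%:~R * wind_chain f2 c + S); last by rewrite S0 addr0.
rewrite !wind_chainE mulr_sumr -!big_split /=.
by apply: eq_big_seq => s sc; rewrite H // ; ring.
Qed.

(** The working tool for degrees: a congruence modulo 1 between angle functions, up to a continuous
    real error [k], becomes a linear relation in cohomology. *)
Lemma deg_comb f f1 f2 k (m : int) h : circ f -> circ f1 -> circ f2 -> continuous k ->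
  (forall x, f x - (f1 x + m%:~R * f2 x + k x) \is a Num.int) ->
  deg f h = deg f1 h + m * deg f2 h.
Proof.
move=> cf cf1 cf2 ck H; apply: (@intr_inj R); rewrite -(hclassK h) intrD intrM /= !degE //.
apply: (@wind_chain_comb _ _ _ k); first exact: cycle_boundary.
have cs (g : T -> R) (s : simplex R T 1) : circ g -> circ (g \o s \o edge).
  by move=> cg; apply: circ_comp; [exact: edge_continuous|exact: circ_simplex].
move=> s _; apply: (@wind_comb _ _ _ _ (k \o s \o edge)).
- exact: cs.
- exact: cs.
- have ce := @edge_continuous R; have cs' : continuous s by exact: cts_fun.
  by rewrite /comp; cont.
- by move=> t t01; exact: H.
Qed.

Lemma circ_cst (a : R) : circ (fun _ : T => a).
Proof. by apply: circ_continuous => x; exact: contat_cst. Qed.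

Lemma deg_eq f f1 h : circ f -> (forall x, f x - f1 x \is a Num.int) -> deg f h = deg f1 h.
Proof.
move=> cf H; have cf1 := circ_eqm H cf.
rewrite (@deg_comb f f1 f1 (fun=> 0) 0 h) ?mul0r ?addr0 //.
  by move=> x; exact: contat_cst.
by move=> x; rewrite mul0r !addr0.
Qed.

Lemma deg_cst f (a : R) h : (forall x, f x - a \is a Num.int) -> deg f h = 0.
Proof.
move=> H; have cf : circ f.
  apply: circ_eqm (circ_cst a) => x; rewrite -rpredN opprB; exact: H.
rewrite (deg_eq _ cf H); have ca := circ_cst a.
(* With $f = f_1 = f_2 = a$ and $k = -a$ the relation reads $\deg a = \deg a + \deg a$. *)
have := @deg_comb (fun=> a) (fun=>a) (fun=> a) (fun=> - a) 1 h ca ca ca.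
rewrite mul1r => /(_ _ _)/esym/eqP; rewrite -subr_eq0 addrK => E; apply/eqP/E.
  by move=> x; exact: contat_cst.
by move=> x; rewrite mul1r addrK subrr rpred0.
Qed.

Lemma deg_loop f (c : loop R T) (g : R -> R) : circ f -> continuous g ->
  (forall t, 0 <= t <= 1 -> g t - f (c t) \is a Num.int) ->
  (deg f (loop_class c))%:~R = g 1 - g 0.
Proof.
move=> cf cg H; rewrite /loop_class degE //= wind_chainU; apply: windE; split=> // t t01 /=.
have -> : loop_simplex c (edge t) = c t; last exact: H.
by congr (c _); rewrite /param set_valE /= mxE /= clamp01_id.
Qed.

(** The increment of a lift around the loop is, at each stage of the homotopy, an integer depending
    continuously on the stage. *)
Lemma deg_homotopic f (c d : loop R T) (F : R * R -> T) : circ f -> continuous F ->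
  (forall s, 0 <= s <= 1 -> F (s, 1) = F (s, 0)) ->
  (forall t, 0 <= t <= 1 -> F (0, t) = c t /\ F (1, t) = d t) ->
  deg f (loop_class c) = deg f (loop_class d).
Proof.
move=> cf cF per ends; have [g cg gf] := lift_rect (circ_comp cF cf).
have u0 : 0 <= (0 : R) <= 1 by rewrite lexx ler01.
have u1 : 0 <= (1 : R) <= 1 by rewrite lexx ler01.
apply: (@intr_inj R).
rewrite (@deg_loop f c (fun t => g (0, t))) ?(@deg_loop f d (fun t => g (1, t))) //.
- apply/esym; apply: (@int_continuous_const R (fun s => g (s, 1) - g (s, 0))); first by cont.
  move=> s s01; have -> : g (s, 1) - g (s, 0) =
    (g (s, 1) - f (F (s, 1))) - (g (s, 0) - f (F (s, 0))) by rewrite per //; ring.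
  by rewrite rpredB // gf.
- by cont.
- by move=> t t01; have [_ <-] := ends t t01; exact: gf.
- by cont.
- by move=> t t01; have [<- _] := ends t t01; exact: gf.
Qed.

End OneSpace.

Section Map.
Variables (S T : topologicalType) (phi : continuousType S T).

Lemma wind_chain_map (f : T -> R) (c : chain R S 1) :
  wind_chain f (chain_map phi c) = wind_chain (f \o phi) c.
Proof.
rewrite -[c]freeg_sumE /wind_chain !raddf_sum; apply: eq_bigr => s _ /=.
by rewrite /chain_map !liftU raddf_int_scalable /= liftU scale1r.
Qed.

Lemma deg_map (f : T -> R) (h : H1 R S) : circ f ->
  deg f (H1_map phi h) = deg (f \o phi) h.
Proof.
move=> cf; apply: (@intr_inj R); rewrite /H1_map degE // -[h in RHS]hclassK degE.
  by rewrite /= wind_chain_map.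
by apply: circ_comp => //; exact: cts_fun.
Qed.

End Map.

End DegreeH1.

(** * Twists along an annulus *)

Section Annulus.
Variables (R : realType) (T : topologicalType).
Hypothesis hT : hausdorff_space T.
Variable E : R * R -> T.
Hypothesis cE : continuous E.
Hypothesis perE : forall x y, E (x + 1, y) = E (x, y).
Hypothesis injE : forall x y x' y', `|y| <= 1 -> `|y'| <= 1 -> E (x, y) = E (x', y') ->
  x - x' \is a Num.int /\ y = y'.
Hypothesis openE : open (E @` [set x | `|x.2| < 1]).

Lemma perEz x y (n : int) : E (x + n%:~R, y) = E (x, y).
Proof.
suff H (k : nat) x' : E (x' + k%:R, y) = E (x', y).
  case: n => k; first exact: H.
  by rewrite NegzE mulrNz -(H k.+1 (x - _)) subrK.
by elim: k x' => [|k IH] x'; rewrite ?addr0 // -natr1 addrA perE.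
Qed.

Lemma perE_eqm x x' y : x - x' \is a Num.int -> E (x, y) = E (x', y).
Proof. by case/intrP => n e; rewrite -(perEz x' y n) -e addrCA subrr addr0. Qed.

Lemma annulus_repr x y : exists2 x', 0 <= x' <= 1 & E (x, y) = E (x', y).
Proof.
exists (x - (Num.floor x)%:~R); last by apply: perE_eqm; rewrite opprB addrCA subrr addr0 intr_int.
by have /andP[] := floor_itv x; rewrite intrD /= => h1 h2; apply/andP; split; lra.
Qed.

(** Pasting lemma. The closed band is the image of a compact rectangle, so closed parts of that
    rectangle have closed image in the Hausdorff space [T]; the complement of the open band is
    closed as well. *)
Lemma annulus_glue (Y : topologicalType) (phi psi : T -> Y) (G : R * R -> Y) :
  continuous G -> continuous psi ->
  (forall x y, 0 <= x <= 1 -> `|y| <= 1 -> phi (E (x, y)) = G (x, y)) ->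
  (forall p, (forall x y, `|y| < 1 -> p <> E (x, y)) -> phi p = psi p) ->
  continuous phi.
Proof.
move=> cG cpsi inG outpsi; apply/continuous_closedP => C clC.
pose K : set (R * R) := `[0, 1] `*` `[-1, 1].
have cK : compact K by apply: compact_setX; exact: segment_compact.
have -> : phi @^-1` C = E @` (K `&` G @^-1` C) `|` (~` (E @` [set x | `|x.2| < 1]) `&` psi @^-1` C).
  apply/seteqP; split => p /=.
    move=> Cp; have [[[x y] /= y1 xyp]|np] := pselect ((E @` [set x | `|x.2| < 1]) p).
      left; have [x' x01 E'] := annulus_repr x y; exists (x', y); last by rewrite -E'.
      have y1' : `|y| <= 1 by rewrite ltW.
      split; last by rewrite /= -inG // -E' xyp.
      by split; rewrite /= in_itv //= -ler_norml.
    right; split => //; rewrite /= -outpsi // => x y y1 pE; apply: np.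
    by exists (x, y).
  case=> [[[x y] /= [[]]]|[np Cp]].
    by rewrite /= !in_itv /= => x01 y1 Cxy <-; rewrite inG // ler_norml.
  by rewrite outpsi // => x y y1 pE; apply: np; exists (x, y).
apply: closedU.
  apply: compact_closed => //; apply: continuous_compact; first exact: continuous_subspaceT.
  by apply: compact_closedI => //; exact: (continuous_closedP _).1 clC.
apply: closedI; first exact: open_closedC.
exact: (continuous_closedP _).1 clC.
Qed.

(** Dehn twist: the shear grows from 0 at [y = -1] to [k] full turns at [y = 1], so it is the
    identity on both boundary circles and agrees there with the default value [p] used outside. *)
Definition twist (k : int) (p : T) : T :=
  xget p [set q | exists x y, [/\ `|y| <= 1, p = E (x, y) & q = E (x + k%:~R * ((y + 1) / 2), y)]].

Lemma twistE k x y : `|y| <= 1 -> twist k (E (x, y)) = E (x + k%:~R * ((y + 1) / 2), y).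
Proof.
move=> y1; rewrite /twist; case: xgetP => [q _ [x' [y' [y1' /injE]]]|/= H].
  move=> /(_ y1 y1')[xx' yy'] ->; subst y'; apply: perE_eqm.
  by rewrite opprD addrACA subrr addr0 -rpredN opprB.
by case: (H (E (x + k%:~R * ((y + 1) / 2), y))); exists x, y.
Qed.

Lemma twist_out k p : (forall x y, `|y| < 1 -> p <> E (x, y)) -> twist k p = p.
Proof.
move=> out; rewrite /twist; case: xgetP => [q _ /= [x [y [y1 pE ->]]]|//].
have : ~~ (`|y| < 1) by apply/negP => /out /(_ pE).
rewrite -leNgt => y1'; have {y1 y1'} : `|y| = 1 by apply/eqP; rewrite eq_le y1.
case: ger0P => _ e; rewrite pE; apply: perE_eqm.
  by rewrite e (_ : _ - _ = k%:~R) ?intr_int //; field.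
have -> : y = -1 by lra.
by rewrite (_ : _ - _ = 0) ?rpred0 //; field.
Qed.

Lemma twist_continuous k : continuous (twist k).
Proof.
apply: (@annulus_glue _ _ id (fun x => E (x.1 + k%:~R * ((x.2 + 1) / 2), x.2))).
- by cont.
- by move=> p; exact: contat_id.
- by move=> x y _ y1; rewrite twistE.
- by move=> p; exact: twist_out.
Qed.

Lemma twistK k : cancel (twist k) (twist (- k)).
Proof.
move=> p; have [[x [y [y1 ->]]]|np] := pselect (exists x y, `|y| < 1 /\ p = E (x, y)).
  by rewrite !twistE ?ltW // mulrNz mulNr addrK.
have out x y : `|y| < 1 -> p <> E (x, y) by move=> y1 pE; apply: np; exists x, y.
by rewrite !twist_out.
Qed.

(** Conjugation by $(x,y)\mapsto(-x,-y)$ changes the shear by exactly [k] full turns, which is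
    invisible modulo 1. *)
Lemma twist_involution k (s : T -> T) : involutive s ->
  (forall x y, s (E (x, y)) = E (- x, - y)) -> forall p, s (twist k p) = twist k (s p).
Proof.
move=> sK sE p; have [[x [y [y1 ->]]]|np] := pselect (exists x y, `|y| < 1 /\ p = E (x, y)).
  rewrite twistE ?ltW // !sE twistE ?normrN ?ltW //; apply: perE_eqm.
  by rewrite (_ : _ - _ = - k%:~R) ?rpredN ?intr_int //; field.
rewrite !twist_out // => x y y1 pE; apply: np.
  by exists (- x), (- y); rewrite normrN -sE -pE sK.
by exists x, y.
Qed.

Variable f : T -> R.
Hypothesis cf : circ f.
Hypothesis fE : forall x y, `|y| <= 1 -> f (E (x, y)) - (y + 1) / 2 \is a Num.int.
Hypothesis fout : forall p, (forall x y, `|y| < 1 -> p <> E (x, y)) -> f p \is a Num.int.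

Variable core : loop R T.
Hypothesis coreE : forall x, core x = E (x, 0).

(** Picard-Lefschetz formula. In the annulus, [g] after the twist differs from [g] by $k\,m\,f$ plus
    a real function [kappa], with [m] the degree of [g] on the core; [kappa] vanishes on both
    boundary circles and so extends by 0. *)
Lemma deg_twist (g : T -> R) (k : int) (h : H1 R T) : circ g -> `|k|%N = 1%N ->
  deg (g \o twist k) h = deg g h + k * deg g (loop_class core) * deg f h.
Proof.
(* The square of half-side 3 contains the product of [[-1, 2]] and [[-1, 1]], where the sheared
   points lie because [k] is a unit. *)
move=> cg k1; have [Phi cPhi PhiE] := lift_square (circ_comp cE cg) (ltr0n R 3).
set m := deg g (loop_class core).
have k1' : `|k%:~R : R| <= 1 by rewrite -intr_norm -abszE k1.
have PhiE' (x y : R) : -1 <= x <= 2 -> `|y| <= 1 -> Phi (x, y) - g (E (x, y)) \is a Num.int.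
  move=> x2; rewrite ler_norml => y1; apply: PhiE.
  by rewrite prod_normE /= ge_max !ler_norml; lra.
have mE : m%:~R = Phi (1, 0) - Phi (0, 0).
  apply: (@deg_loop _ _ _ _ (fun t => Phi (t, 0))) => //; first by cont.
  by move=> t t01; rewrite coreE; apply: PhiE'; rewrite ?normr0 //; lra.
have Phiper (x y : R) : -1 <= x <= 1 -> `|y| <= 1 -> Phi (x + 1, y) - Phi (x, y) = m%:~R.
  move=> x1 y1; rewrite mE.
  pose H t := Phi (t * x + 1, t * y) - Phi (t * x, t * y).
  have -> : Phi (x + 1, y) - Phi (x, y) = H 1 by rewrite /H !mul1r.
  have -> : Phi (1, 0) - Phi (0, 0) = H 0 by rewrite /H !mul0r add0r.
  apply: int_continuous_const; first by rewrite /H; cont.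
  move=> t /andP[t0 t1]; rewrite /H.
  have ty : `|t * y| <= 1 by rewrite normrM ger0_norm // mulr_ile1.
  have tx : -1 <= t * x <= 1 by rewrite -ler_norml normrM ger0_norm // mulr_ile1 // ler_norml.
  have -> : Phi (t * x + 1, t * y) - Phi (t * x, t * y) =
    (Phi (t * x + 1, t * y) - g (E (t * x + 1, t * y))) - (Phi (t * x, t * y) - g (E (t * x, t * y))).
    by rewrite perE; ring.
  by rewrite rpredB // PhiE' //; lra.
pose u (y : R) : R := k%:~R * ((y + 1) / 2).
have u1 (y : R) : `|y| <= 1 -> -1 <= u y <= 1.
  move=> y1; rewrite -ler_norml /u normrM mulr_ile1 //; move: y1; rewrite !ler_norml; lra.
pose G (x : R * R) := Phi (x.1 + u x.2, x.2) - Phi x - m%:~R * u x.2.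
have cG : continuous G by rewrite /G /u; cont.
have G01 (y : R) : `|y| <= 1 -> G (1, y) = G (0, y).
  move=> y1; have := Phiper _ _ (u1 y y1) y1; have z1 : -1 <= (0 : R) <= 1 by lra.
  have := Phiper 0 y z1 y1; rewrite /G /= !add0r (addrC 1); lra.
(* [G] takes equal values at [x = 0] and [x = 1], so it descends to the annulus; [kappa] is the
   descended function, with default 0 elsewhere. *)
pose kappa (p : T) : R :=
  xget 0 [set r | exists x y, [/\ 0 <= x <= 1, `|y| <= 1, p = E (x, y) & r = G (x, y)]].
have kappaE (x y : R) : 0 <= x <= 1 -> `|y| <= 1 -> kappa (E (x, y)) = G (x, y).
  move=> x01 y1; rewrite /kappa; case: xgetP => [r _ /= [x' [y' [x01' y1' /injE]]]|/= H].
    move=> /(_ y1 y1')[/intrP[n xx'] yy'] ->; subst y'.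
    have : n = 0 \/ n = 1 \/ n = -1.
      have h1 : n < 2 by rewrite -(ltr_int R) -xx' (_ : 2%:~R = 2 :> R) //; lra.
      have h2 : - n < 2 by rewrite -(ltr_int R) mulrNz -xx' (_ : 2%:~R = 2 :> R) //; lra.
      by lia.
    move=> [n0|[n0|n0]]; rewrite {}n0 ?mulrN1z in xx'.
    - by have -> : x' = x by lra.
    - rewrite mulr1z in xx'; have [-> ->] : x' = 0 /\ x = 1 by split; lra.
      by rewrite G01.
    - have [-> ->] : x' = 1 /\ x = 0 by split; lra.
      by rewrite G01.
  by case: (H (G (x, y))); exists x, y.
have kappaout p : (forall x y, `|y| < 1 -> p <> E (x, y)) -> kappa p = 0.
  move=> out; rewrite /kappa; case: xgetP => [r _ /= [x [y [x01 y1 pE ->]]]|//].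
  have : ~~ (`|y| < 1) by apply/negP => /out /(_ pE).
  rewrite -leNgt => y1'; have {y1 y1'} y1 : `|y| = 1 by apply/eqP; rewrite eq_le y1.
  have [y0|y0] := leP 0 y; last first.
    have -> : y = -1 by rewrite -y1 ltr0_norm ?opprK.
    by rewrite /G /u /= addNr mul0r mulr0 addr0; ring.
  have yE : y = 1 by rewrite -y1 ger0_norm.
  rewrite /G /u /= {}yE -[(1 + 1)%R]/(2 : R) divff // mulr1.
  have n1 : `|1 : R| <= 1 by rewrite normr1.
  have : k = 1 \/ k = -1 by lia.
  case=> ->.
    by have := Phiper x 1 _ n1; rewrite mulr1z; lra.
  by have := Phiper (x - 1) 1 _ n1; rewrite mulrN1z subrK; lra.
have ckappa : continuous kappa.
  apply: (@annulus_glue _ _ (fun=> 0) G) => //.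
  by move=> p; exact: contat_cst.
rewrite -[k * m]/(k * m); apply: (@deg_comb _ _ _ _ _ kappa) => //.
  by apply: circ_comp => //; exact: twist_continuous.
move=> p /=; have [[x [y [y1 ->]]]|np] := pselect (exists x y, `|y| < 1 /\ p = E (x, y)).
  have [x' x01 ->] := annulus_repr x y; have {}y1 := ltW y1.
  rewrite twistE // kappaE // /G -/(u y) intrM /=.
  have i1 : Phi (x' + u y, y) - g (E (x' + u y, y)) \is a Num.int.
    by apply: PhiE' => //; have := u1 y y1; lra.
  have i2 : Phi (x', y) - g (E (x', y)) \is a Num.int by apply: PhiE' => //; lra.
  have i3 := fE x' y1.
  have -> : g (E (x' + u y, y)) - (g (E (x', y)) + k%:~R * m%:~R * f (E (x', y)) +
      (Phi (x' + u y, y) - Phi (x', y) - m%:~R * u y)) =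
    (Phi (x', y) - g (E (x', y))) - (Phi (x' + u y, y) - g (E (x' + u y, y)))
     - k%:~R * m%:~R * (f (E (x', y)) - (y + 1) / 2) by rewrite /u; ring.
  by rewrite rpredB ?rpredM ?intr_int // rpredB.
have out x y : `|y| < 1 -> p <> E (x, y) by move=> y1 pE; apply: np; exists x, y.
rewrite twist_out // kappaout // addr0 opprD addrA subrr sub0r rpredN rpredM ?intr_int //.
exact: fout.
Qed.

End Annulus.

(** * Coordinates on the surface *)

Lemma hausdorff_inj (S T : topologicalType) (f : S -> T) :
  injective f -> continuous f -> hausdorff_space T -> hausdorff_space S.
Proof.
move=> fI cf hT p q pq; apply: fI; apply: hT => A B nA nB.
by have [x [Ax Bx]] := pq _ _ (cf _ _ nA) (cf _ _ nB); exists (f x).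
Qed.

Section SignRoot.
Variable R : realType.

Lemma contat_sgroot (T : topologicalType) (x : T) (s d : T -> R) :
  continuous_at x s -> continuous_at x d -> (s x = 0 -> d x <= 0) ->
  continuous_at x (fun y => Num.sg (s y) * Num.sqrt (d y)).
Proof.
move=> cs cd sd; have [s0|s0|/esym s0] := ltgtP (s x) 0.
- have : continuous_at x (fun y => - Num.sqrt (d y)) by cont.
  rewrite /continuous_at ltr0_sg // mulN1r; apply: cvg_trans.
  apply: near_eq_cvg; near=> y; have sy : s y < 0 by near: y; exact: (cvgr_lt _ cs _ s0).
  by rewrite ltr0_sg // mulN1r.
- have : continuous_at x (fun y => Num.sqrt (d y)) by cont.
  rewrite /continuous_at gtr0_sg // mul1r; apply: cvg_trans.
  apply: near_eq_cvg; near=> y; have sy : 0 < s y by near: y; exact: (cvgr_gt _ cs _ s0).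
  by rewrite gtr0_sg // mul1r.
have d0 : Num.sqrt (d x) = 0 by apply/eqP; rewrite sqrtr_eq0 sd.
rewrite /continuous_at d0 mulr0; apply/cvgrPdist_lt => e e0.
have : continuous_at x (fun y => Num.sqrt (d y)) by cont.
rewrite /continuous_at d0 => /cvgrPdist_lt /(_ e e0); apply: filterS => y.
rewrite !sub0r !normrN => /(le_lt_trans _); apply.
rewrite normrM ler_piMl //; case: sgrP => _; by rewrite ?normr0 ?normr1 ?normrN1.
Unshelve. all: by end_near. Qed.

End SignRoot.

Section Surface.
Variable R : realType.
Notation Sigma := (Sigma3 R).
Implicit Types (p q : Sigma) (x y z : R).

Definition cx (p : Sigma) : R := set_val p 0 0.
Definition cy (p : Sigma) : R := set_val p 0 1.
Definition cz (p : Sigma) : R := set_val p 0 2%:R.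

Lemma cx_continuous : continuous cx. Proof. by rewrite /cx; cont. Qed.
Lemma cy_continuous : continuous cy. Proof. by rewrite /cy; cont. Qed.
Lemma cz_continuous : continuous cz. Proof. by rewrite /cz; cont. Qed.

Lemma czE p : cz p ^+ 2 = domain_eq (cx p) (cy p).
Proof. by have := set_mem (valP p); rewrite /Sigma3 /= /surface_eq => /eqP; rewrite subr_eq0 => /eqP. Qed.

Lemma Sigma_eq p q : cx p = cx q -> cy p = cy q -> cz p = cz q -> p = q.
Proof.
move=> hx hy hz; apply/val_inj/rowP => -[[|[|[|//]]] i].
- by have -> : Ordinal i = 0 by exact/val_inj.
- by have -> : Ordinal i = 1 by exact/val_inj.
- by have -> : Ordinal i = 2%:R by exact/val_inj.
Qed.

Lemma Sigma_hausdorff : hausdorff_space Sigma.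
Proof.
apply: (@hausdorff_inj _ _ (@set_val _ Sigma)); first exact: val_inj.
  exact: initial_continuous.
exact: norm_hausdorff.
Qed.

Definition triple x y z : 'rV[R]_3 := \row_j [:: x; y; z]`_j.

Lemma domain_eqE x y : domain_eq x y =
  (25 - (x ^+ 2 + y ^+ 2)) * (((x + 3) ^+ 2 + y ^+ 2 - 1) *
  ((x ^+ 2 + y ^+ 2 - 1) * ((x - 3) ^+ 2 + y ^+ 2 - 1))).
Proof. by rewrite /domain_eq !big_ord_recl big_ord0 /hole_center /= /bump /=; ring. Qed.

Lemma triple_sub x y z : z ^+ 2 = domain_eq x y -> triple x y z \in Sigma.
Proof.
move=> zD; apply/mem_set; rewrite /Sigma3 /= /surface_eq !mxE /= zD subrr //.
Qed.

Lemma pt0_sub : triple 5 0 0 \in Sigma.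
Proof. by apply: triple_sub; rewrite domain_eqE; ring. Qed.

Definition pt0 : Sigma := exist _ (triple 5 0 0) pt0_sub.

(** The fallback [pt0] makes the construction total; [surfE] recovers the coordinates when the
    equation of the surface holds. *)
Definition surf x y z : Sigma := insubd pt0 (triple x y z).

Lemma surfE x y z : z ^+ 2 = domain_eq x y ->
  [/\ cx (surf x y z) = x, cy (surf x y z) = y & cz (surf x y z) = z].
Proof.
move=> zD; have E : set_val (surf x y z) = triple x y z.
  by rewrite set_valE /surf val_insubd (triple_sub zD).
by rewrite /cx /cy /cz E !mxE.
Qed.

Lemma surf_continuous (T : topologicalType) (fx fy fz : T -> R) :
  (forall t, fz t ^+ 2 = domain_eq (fx t) (fy t)) ->
  continuous fx -> continuous fy -> continuous fz ->
  continuous (fun t => surf (fx t) (fy t) (fz t)).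
Proof.
move=> H c1 c2 c3; apply: continuous_sub.
have -> : (fun t => set_val (surf (fx t) (fy t) (fz t))) = (fun t => triple (fx t) (fy t) (fz t)).
  by apply/funext => t; rewrite set_valE /surf val_insubd (triple_sub (H t)).
by move=> t; apply: contat_row => -[[|[|[|//]]] i] /=; cont.
Qed.

Lemma domain_eq_continuous (T : topologicalType) (t : T) (f g : T -> R) :
  continuous_at t f -> continuous_at t g -> continuous_at t (fun u => domain_eq (f u) (g u)).
Proof.
move=> cf cg; have -> : (fun u => domain_eq (f u) (g u)) = (fun u =>
  (25 - (f u ^+ 2 + g u ^+ 2)) * (((f u + 3) ^+ 2 + g u ^+ 2 - 1) *
  ((f u ^+ 2 + g u ^+ 2 - 1) * ((f u - 3) ^+ 2 + g u ^+ 2 - 1)))).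
  by apply/funext => u; rewrite domain_eqE.
by cont.
Qed.

Definition in_domain x y := [/\ x ^+ 2 + y ^+ 2 <= 25, 1 <= (x + 3) ^+ 2 + y ^+ 2,
  1 <= x ^+ 2 + y ^+ 2 & 1 <= (x - 3) ^+ 2 + y ^+ 2].

Lemma domain_ge0 x y : in_domain x y -> 0 <= domain_eq x y.
Proof. by case=> *; rewrite domain_eqE !mulr_ge0 //; lra. Qed.

(** The holes are disjoint and inside the disc, so at a point violating one inequality that factor
    is negative and the other three are positive. *)
Lemma domainP x y : 0 <= domain_eq x y -> in_domain x y.
Proof.
rewrite domain_eqE => H; have y2 := sqr_ge0 y.
have aux (a b c : R) : 0 < a -> 0 < b -> 0 < c -> 0 < a * (b * c).
  by move=> *; rewrite !mulr_gt0.
have aux4 (a b c d : R) : a < 0 -> 0 < b -> 0 < c -> 0 < d -> a * (b * (c * d)) < 0.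
  by move=> a0 b0 c0 d0; rewrite nmulr_rlt0 // aux.
have N1 : ~ (25 < x ^+ 2 + y ^+ 2).
  move=> K; have := @aux4 (25 - (x ^+ 2 + y ^+ 2)) ((x + 3) ^+ 2 + y ^+ 2 - 1)
    (x ^+ 2 + y ^+ 2 - 1) ((x - 3) ^+ 2 + y ^+ 2 - 1).
  suff : 0 < (x + 3) ^+ 2 + y ^+ 2 - 1 /\ 0 < (x - 3) ^+ 2 + y ^+ 2 - 1.
    by move=> [h1 h2] /(_ _ h1 _ h2); lra.
  by split; nra.
have N2 : ~ ((x + 3) ^+ 2 + y ^+ 2 < 1).
  move=> K; have [h1 h2] : -4 <= x /\ x <= -2 by split; nra.
  have := @aux4 ((x + 3) ^+ 2 + y ^+ 2 - 1) (25 - (x ^+ 2 + y ^+ 2))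
    (x ^+ 2 + y ^+ 2 - 1) ((x - 3) ^+ 2 + y ^+ 2 - 1).
  have -> : 0 < 25 - (x ^+ 2 + y ^+ 2) by nra.
  have -> : 0 < x ^+ 2 + y ^+ 2 - 1 by nra.
  have -> : 0 < (x - 3) ^+ 2 + y ^+ 2 - 1 by nra.
  by rewrite subr_lt0 => /(_ K isT isT isT); rewrite mulrCA; lra.
have N3 : ~ (x ^+ 2 + y ^+ 2 < 1).
  move=> K; have [h1 h2] : -1 <= x /\ x <= 1 by split; nra.
  have := @aux4 (x ^+ 2 + y ^+ 2 - 1) (25 - (x ^+ 2 + y ^+ 2))
    ((x + 3) ^+ 2 + y ^+ 2 - 1) ((x - 3) ^+ 2 + y ^+ 2 - 1).
  have -> : 0 < 25 - (x ^+ 2 + y ^+ 2) by nra.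
  have -> : 0 < (x + 3) ^+ 2 + y ^+ 2 - 1 by nra.
  have -> : 0 < (x - 3) ^+ 2 + y ^+ 2 - 1 by nra.
  rewrite subr_lt0 => /(_ K isT isT isT); move: H.
  set a := 25 - _; set b := (x + 3) ^+ 2 + _ - _; set c := x ^+ 2 + _ - _; set d := (x - 3) ^+ 2 + _ - _.
  have -> : a * (b * (c * d)) = c * (a * (b * d)) by ring.
  by lra.
have N4 : ~ ((x - 3) ^+ 2 + y ^+ 2 < 1).
  move=> K; have [h1 h2] : 2 <= x /\ x <= 4 by split; nra.
  have := @aux4 ((x - 3) ^+ 2 + y ^+ 2 - 1) (25 - (x ^+ 2 + y ^+ 2))
    ((x + 3) ^+ 2 + y ^+ 2 - 1) (x ^+ 2 + y ^+ 2 - 1).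
  have -> : 0 < 25 - (x ^+ 2 + y ^+ 2) by nra.
  have -> : 0 < (x + 3) ^+ 2 + y ^+ 2 - 1 by nra.
  have -> : 0 < x ^+ 2 + y ^+ 2 - 1 by nra.
  rewrite subr_lt0 => /(_ K isT isT isT); move: H.
  set a := 25 - _; set b := (x + 3) ^+ 2 + _ - _; set c := x ^+ 2 + _ - _; set d := (x - 3) ^+ 2 + _ - _.
  have -> : a * (b * (c * d)) = d * (a * (b * c)) by ring.
  by lra.
by split; rewrite leNgt; apply/negP.
Qed.

Lemma Sigma_domain p : in_domain (cx p) (cy p).
Proof. by apply: domainP; rewrite -czE sqr_ge0. Qed.

Lemma hypE p : [/\ cx (hyperelliptic p) = cx p, cy (hyperelliptic p) = - cy p
  & cz (hyperelliptic p) = - cz p].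
Proof. by rewrite /cx /cy /cz !set_valE /= !mxE. Qed.

Lemma hypK : involutive (@hyperelliptic R).
Proof.
move=> p; have [h1 h2 h3] := hypE p; have [k1 k2 k3] := hypE (hyperelliptic p).
by apply: Sigma_eq; rewrite ?k1 ?k2 ?k3 ?h1 ?h2 ?h3 ?opprK.
Qed.

Lemma hyp_continuous : continuous (@hyperelliptic R).
Proof.
apply: continuous_sub => p.
have -> : (fun q : Sigma => set_val (hyperelliptic q)) = (fun q => \row_j (if j == 0 then set_val q 0 j else - set_val q 0 j)).
  by apply/funext => q; rewrite set_valE.
by apply: contat_row => j; case: (j == 0); cont.
Qed.

End Surface.

Ltac cont_more ::= lazymatch goal with
  | |- continuous_at ?x (fun y => clamp01 (@?f y)) => apply: (@contat_clamp01 _ _ x f)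
  | |- continuous_at ?x (fun y => clamp _ (@?f y)) => apply: (@contat_clamp _ _ x _ f)
  | |- continuous_at ?x (fun y => cx (@?f y)) => apply: (@contat_comp _ x _ _ f (@cx _) (@cx_continuous _))
  | |- continuous_at ?x (fun y => cy (@?f y)) => apply: (@contat_comp _ x _ _ f (@cy _) (@cy_continuous _))
  | |- continuous_at ?x (fun y => cz (@?f y)) => apply: (@contat_comp _ x _ _ f (@cz _) (@cz_continuous _))
  | |- continuous_at ?x (@cx _) => exact: cx_continuous
  | |- continuous_at ?x (@cy _) => exact: cy_continuous
  | |- continuous_at ?x (@cz _) => exact: cz_continuous
  | |- continuous_at ?x (fun y => domain_eq (@?f y) (@?g y)) => apply: (@domain_eq_continuous _ _ x f g)
  | |- continuous_at ?x (fun y => fun_of_matrix (@?f y) _ _) => apply: (@contat_coord _ _ x _ _ f)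
  | |- continuous_at ?x (fun y => set_val (@?f y)) => apply: (@contat_val _ x _ _ f)
  | |- continuous_at ?x (fun y => \row_j (@?f y j)) => apply: (@contat_row _ _ x _ f); intro
  end.

(** * Charts around the chain curves *)

(** A closed annulus [|tau| <= 1] parametrized by [E] inside an open set [U] where [tau] makes
    sense. [chart_far] keeps the open band [|tau| < 1] away from the complement of [U], so that
    functions constant off the band extend continuously. *)
Record chart (R : realType) (T : topologicalType) (U : T -> bool) (tau : T -> R)
    (E : R * R -> T) : Prop := Chart {
  chart_open : open [set p | U p];
  chart_tau : forall p, U p -> continuous_at p tau;
  chart_far : forall p, ~~ U p -> \forall q \near p, U q -> 1 <= `|tau q|;
  chart_cont : continuous E;
  chart_per : forall x y, E (x + 1, y) = E (x, y);
  chart_E : forall x y, `|y| <= 1 -> U (E (x, y)) /\ tau (E (x, y)) = y;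
  chart_surj : forall p, U p -> `|tau p| <= 1 -> exists x, p = E (x, tau p);
  chart_inj : forall x x' y, `|y| <= 1 -> E (x, y) = E (x', y) -> x - x' \is a Num.int }.

Lemma open_lt (R : realType) (T : topologicalType) (f : T -> R) (a : R) :
  continuous f -> open [set p | f p < a].
Proof.
move=> cf; rewrite openE => p /= pa; near=> q => /=; near: q.
exact: (cvgr_lt _ (cf p)).
Unshelve. all: by end_near. Qed.

Lemma open_gt (R : realType) (T : topologicalType) (f : T -> R) (a : R) :
  continuous f -> open [set p | a < f p].
Proof.
move=> cf; rewrite openE => p /= pa; near=> q => /=; near: q.
exact: (cvgr_gt _ (cf p)).
Unshelve. all: by end_near. Qed.

Section Chart.
Variables (R : realType) (T : topologicalType) (U : T -> bool) (tau : T -> R) (E : R * R -> T).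

(* The map to R/Z collapsing the complement of the annulus |tau| < 1 to a point. *)
Definition dualf (p : T) : R := if U p then (clamp 1 (tau p) + 1) / 2 else 0.

Lemma clamp_out (t : R) : 1 <= `|t| -> clamp 1 t = 1 \/ clamp 1 t = -1.
Proof.
rewrite /clamp; case: ger0P => t0 t1; [left|right].
  by rewrite min_l // max_r //; lra.
by rewrite min_r ?max_l //; lra.
Qed.

Lemma clamp_half_int (t : R) : 1 <= `|t| -> (clamp 1 t + 1) / 2 \is a Num.int.
Proof.
case/clamp_out => ->; last by rewrite addNr mul0r rpred0.
by rewrite -[(1 + 1)%R]/(2 : R) divff // rpred1.
Qed.

(** Off the band the clamped coordinate is 1 or -1, so [dualf] is an integer there and leaving [U]
    is continuous modulo 1. *)
Lemma band_circ : open [set p | U p] -> (forall p, U p -> continuous_at p tau) ->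
  (forall p, ~~ U p -> \forall q \near p, U q -> 1 <= `|tau q|) -> circ dualf.
Proof.
move=> oU cU farU; apply: circ_of_near => p e e0; have [Up|Up] := boolP (U p).
  have c : continuous_at p (fun q => (clamp 1 (tau q) + 1) / 2).
    by have ct := cU _ Up; cont.
  move/cvgrPdist_lt : c => /(_ e e0) c.
  near=> q; exists (dualf q - dualf p); last by rewrite subrr rpred0.
  have Uq : U q by near: q; exact: (open_nbhs_nbhs (conj oU Up)).
  by rewrite /dualf Up Uq distrC; near: q.
near=> q; exists 0; first by rewrite normr0.
rewrite subr0 /dualf (negbTE Up) subr0; case: ifP => Uq; rewrite ?rpred0 //.
by apply: clamp_half_int; apply: (near (farU _ Up) q).
Unshelve. all: by end_near. Qed.

Hypothesis H : chart U tau E.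

Lemma dualf_circ : circ dualf.
Proof. exact: (band_circ (chart_open H) (chart_tau H) (chart_far H)). Qed.

Lemma dualf_E x y : `|y| <= 1 -> dualf (E (x, y)) - (y + 1) / 2 \is a Num.int.
Proof. by move=> y1; rewrite /dualf; have [-> ->] := chart_E H x y1; rewrite clamp_id // subrr rpred0. Qed.

Lemma dualf_out p : (forall x y, `|y| < 1 -> p <> E (x, y)) -> dualf p \is a Num.int.
Proof.
move=> out; rewrite /dualf; case: ifP => [Up|]; rewrite ?rpred0 //.
apply: clamp_half_int; rewrite leNgt; apply/negP => t1.
by have [x pE] := chart_surj H Up (ltW t1); exact: out t1 pE.
Qed.

Lemma chart_openE : open (E @` [set x | `|x.2| < 1]).
Proof.
rewrite openE => p [[x y] /= y1 <-{p}]; rewrite /interior.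
have [UE tE] := chart_E H x (ltW y1).
have c := contat_norm (chart_tau H UE).
near=> q; have Uq : U q by near: q; exact: (open_nbhs_nbhs (conj (chart_open H) UE)).
have tq : `|tau q| < 1.
  by near: q; apply: (cvgr_lt _ c); rewrite tE.
by have [x' ->] := chart_surj H Uq (ltW tq); exists (x', tau q).
Unshelve. all: by end_near. Qed.

Lemma chart_inj2 x y x' y' : `|y| <= 1 -> `|y'| <= 1 -> E (x, y) = E (x', y') ->
  x - x' \is a Num.int /\ y = y'.
Proof.
move=> y1 y1' e; have yy : y = y'.
  by have [_ <-] := chart_E H x y1; have [_ <-] := chart_E H x' y1'; rewrite e.
by split=> //; apply: (chart_inj H (y := y)) => //; rewrite e yy.
Qed.

Lemma core_subproof1 : continuous (fun x => E (x, 0)).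
Proof. by have cE := chart_cont H; cont. Qed.

Lemma core_subproof2 x : E (x + 1, 0) = E (x, 0).
Proof. exact: (chart_per H). Qed.

Definition core : loop R T := Loop core_subproof1 core_subproof2.

End Chart.

(** * Annuli around the boundary circles of the holes *)

Section HoleChart.
Variable R : realType.
Notation Sigma := (Sigma3 R).
Variable c : R.
Hypothesis c3 : [\/ c = -3, c = 0 | c = 3].

Definition rad (p : Sigma) : R := Num.sqrt ((cx p - c) ^+ 2 + cy p ^+ 2).

Lemma rad_sqr p : rad p ^+ 2 = (cx p - c) ^+ 2 + cy p ^+ 2.
Proof. by rewrite sqr_sqrtr // addr_ge0 // sqr_ge0. Qed.

Lemma rad_ge1 p : 1 <= rad p.
Proof.
have r0 : 0 <= rad p by exact: sqrtr_ge0.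
have : 1 <= rad p ^+ 2.
  rewrite rad_sqr; have [_ h1 h2 h3] := Sigma_domain p.
  by case: c3 => ->; rewrite ?opprK ?subr0.
by nra.
Qed.

(** Within radius $7/4$ of the centre no other boundary circle is met: the neighbouring holes begin
    at distance 2 and the outer circle is at least as far. The annulus itself only uses radii up to
    $3/2$. *)
Lemma hole_domain (x y : R) : 1 <= (x - c) ^+ 2 + y ^+ 2 < 49 / 16 ->
  0 <= domain_eq x y /\ (domain_eq x y = 0 -> (x - c) ^+ 2 + y ^+ 2 = 1).
Proof.
move=> /andP[r1 r2]; have y2 := sqr_ge0 y.
have [x1 x2] : -(7/4) <= x - c /\ x - c <= 7/4 by split; nra.
rewrite domain_eqE.
have K a b d : 0 < a -> 0 < b -> 0 < d -> 0 <= a * (((x - c) ^+ 2 + y ^+ 2 - 1) * (b * d)) /\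
   (a * (((x - c) ^+ 2 + y ^+ 2 - 1) * (b * d)) = 0 -> (x - c) ^+ 2 + y ^+ 2 = 1).
  move=> a0 b0 d0; split; first by rewrite !mulr_ge0 ?(ltW a0) ?(ltW b0) ?(ltW d0) //; lra.
  move=> /eqP; rewrite !mulf_eq0 (gt_eqF a0) (gt_eqF b0) (gt_eqF d0) /= orbF => /eqP; lra.
case: c3 => cE; rewrite cE ?opprK ?subr0 in r1 r2 x1 x2 K *.
- by apply: K; nra.
- have -> (a b d e : R) : a * (b * (d * e)) = a * (d * (b * e)) by ring.
  by apply: K; nra.
have -> (a b d e : R) : a * (b * (d * e)) = a * (e * (b * d)) by ring.
by apply: K; nra.
Qed.

Definition hole_U (p : Sigma) := (cx p - c) ^+ 2 + cy p ^+ 2 < 49 / 16.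
(** Distance to the hole, signed by the sheet; the factor 2 makes the band end at radius $3/2$. *)
Definition hole_tau (p : Sigma) : R := 2 * (Num.sg (cz p) * (rad p - 1)).
Definition hole_r (y : R) : R := 1 + `|clamp 1 y| / 2.
Definition hole_z (x y : R) : R :=
  Num.sg (clamp 1 y) * Num.sqrt (domain_eq (c + hole_r y * cost x) (hole_r y * sint x)).
Definition hole_E (x : R * R) : Sigma :=
  surf (c + hole_r x.2 * cost x.1) (hole_r x.2 * sint x.1) (hole_z x.1 x.2).

Lemma hole_r_sqr x y : (c + hole_r y * cost x - c) ^+ 2 + (hole_r y * sint x) ^+ 2 = hole_r y ^+ 2.
Proof.
by rewrite addrAC subrr add0r !exprMn -mulrDr cost2Dsint2 mulr1.
Qed.

Lemma hole_r_itv y : 1 <= hole_r y <= 3 / 2.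
Proof.
have : `|clamp 1 y| <= 1 by apply: clamp_le.
have : 0 <= `|clamp 1 y| by []. rewrite /hole_r; lra.
Qed.

Lemma hole_r_domain x y : 1 <= (c + hole_r y * cost x - c) ^+ 2 + (hole_r y * sint x) ^+ 2 < 49 / 16.
Proof. by rewrite hole_r_sqr; have := hole_r_itv y; nra. Qed.

Lemma hole_domain0 x y : clamp 1 y = 0 ->
  domain_eq (c + hole_r y * cost x) (hole_r y * sint x) = 0.
Proof.
move=> y0; have := hole_r_sqr x y; have -> : hole_r y = 1 by rewrite /hole_r y0 normr0 mul0r addr0.
rewrite domain_eqE; set u := 1 * cost x; set v := 1 * sint x.
case: c3 => -> e.
- have -> : (-3 + u + 3) ^+ 2 + v ^+ 2 - 1 = 0 by move: e; rewrite expr1n; lra.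
  by ring.
- have -> : (0 + u) ^+ 2 + v ^+ 2 - 1 = 0 by move: e; rewrite expr1n; lra.
  by ring.
- have -> : (3 + u - 3) ^+ 2 + v ^+ 2 - 1 = 0 by move: e; rewrite expr1n; lra.
  by ring.
Qed.

Lemma hole_zE x y : hole_z x y ^+ 2 = domain_eq (c + hole_r y * cost x) (hole_r y * sint x).
Proof.
have [D0 _] := hole_domain (hole_r_domain x y).
rewrite /hole_z exprMn sqr_sqrtr // sqr_sg; case: eqP => [e|_]; last by rewrite mul1r.
by rewrite hole_domain0 // mulr0.
Qed.

Lemma hole_EE x y : [/\ cx (hole_E (x, y)) = c + hole_r y * cost x,
  cy (hole_E (x, y)) = hole_r y * sint x & cz (hole_E (x, y)) = hole_z x y].
Proof. exact: (surfE (hole_zE x y)). Qed.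

Lemma hole_rad x y : rad (hole_E (x, y)) = hole_r y.
Proof.
have [h1 h2 _] := hole_EE x y; rewrite /rad h1 h2 hole_r_sqr sqrtr_sqr ger0_norm //.
by have := hole_r_itv y; lra.
Qed.

Lemma hole_chart : chart hole_U hole_tau hole_E.
Proof.
have rad_cont : continuous rad by rewrite /rad; cont.
split.
- by apply: open_lt; cont.
(* Written as the root of a square, the distance falls under [contat_sgroot]. *)
- move=> p Up; have -> : hole_tau = fun p => 2 * (Num.sg (cz p) * Num.sqrt ((rad p - 1) ^+ 2)).
    apply/funext => q; rewrite sqrtr_sqr ger0_norm //; have := rad_ge1 q; lra.
  apply: contatM; first exact: contat_cst.
  apply: contat_sgroot; [by cont|by cont|move=> z0].
  have e : (cx p - c) ^+ 2 + cy p ^+ 2 = 1.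
    apply: (hole_domain _).2; last by rewrite -czE z0 expr0n.
    by rewrite -rad_sqr; apply/andP; split; [have := rad_ge1 p; nra|rewrite rad_sqr].
  by rewrite /rad e sqrtr1 subrr expr0n.
- move=> p Up; near=> q; rewrite /hole_U => Uq.
  have r1 := rad_ge1 q.
  have rq : 3 / 2 < rad q.
    near: q; apply: (cvgr_gt _ (rad_cont p)).
    move: Up; rewrite /hole_U -leNgt -rad_sqr; have := rad_ge1 p; nra.
  have z0 : cz q != 0.
    apply/eqP => z0; have := @hole_domain (cx q) (cy q).
    rewrite Uq -rad_sqr -czE z0 expr0n /=; have -> : 1 <= rad q ^+ 2 by nra.
    by move=> /(_ isT)[_ /(_ erefl)]; nra.
  rewrite /hole_tau !normrM normr_sg z0 mul1r ger0_norm // ger0_norm; lra.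
- apply: surf_continuous => /=; [by move=> x; exact: hole_zE|by rewrite /hole_r; cont|by rewrite /hole_r; cont|].
  move=> x; apply: contat_sgroot; [by cont|by rewrite /hole_r; cont|].
  by move=> /hole_domain0 ->.
- by move=> x y; rewrite /hole_E /hole_z /= !costD !sintD cost1 sint1 !mulr1 !mulr0 subr0 addr0.
- move=> x y y1; have [h1 h2 h3] := hole_EE x y; rewrite /hole_U /hole_tau h1 h2 h3 hole_rad.
  have := hole_r_domain x y => /andP[_ ->]; split => //.
  rewrite /hole_r /hole_z clamp_id // addrAC subrr add0r.
  have [->|y0] := eqVneq y 0; first by rewrite normr0 mul0r !mulr0.
  have Dp : 0 < domain_eq (c + hole_r y * cost x) (hole_r y * sint x).
    have [D0 Dn] := hole_domain (hole_r_domain x y).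
    rewrite lt_neqAle D0 andbT eq_sym; apply/eqP => /Dn.
    rewrite hole_r_sqr /hole_r clamp_id //; have : 0 < `|y| by rewrite normr_gt0.
    by nra.
  rewrite sgrM sgr_id (gtr0_sg (x := Num.sqrt _)) ?sqrtr_gt0 // mulr1.
  by rewrite [RHS]numEsg; field.
- move=> p Up t1; have r1 := rad_ge1 p.
  have rp : 0 < rad p by lra.
  have [x [cx1 sx1]] : exists x, cost x = (cx p - c) / rad p /\ sint x = cy p / rad p.
    apply: turn_exists; rewrite !expr_div_n -mulrDl -rad_sqr divff // expf_neq0 // gt_eqF //.
  exists x; have [h1 h2 h3] := hole_EE x (hole_tau p).
  have z0 : cz p = 0 -> rad p = 1.
    have Up' : (cx p - c) ^+ 2 + cy p ^+ 2 < 49 / 16 := Up.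
    move=> z0; have := @hole_domain (cx p) (cy p); rewrite Up' -rad_sqr -czE z0 expr0n /=.
    have -> : 1 <= rad p ^+ 2 by nra.
    by move=> /(_ isT)[_ /(_ erefl)]; nra.
  have rE : hole_r (hole_tau p) = rad p.
    rewrite /hole_r clamp_id // /hole_tau !normrM normr_sg ger0_norm //.
    case: eqP => /= [/z0 ->|_]; first by rewrite subrr normr0 !mulr0 mul0r addr0.
    by rewrite mul1r ger0_norm ?subr_ge0 //; field.
  have hx : c + hole_r (hole_tau p) * cost x = cx p.
    by rewrite rE cx1 mulrC divfK ?gt_eqF //; ring.
  have hy : hole_r (hole_tau p) * sint x = cy p.
    by rewrite rE sx1 mulrC divfK ?gt_eqF.
  apply: Sigma_eq; rewrite ?h1 ?h2 ?h3 // /hole_z hx hy -czE clamp_id // sqrtr_sqr.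
  have [z00|z00] := eqVneq (cz p) 0; first by rewrite z00 normr0 mulr0.
  have rp1 : 0 < rad p - 1.
    rewrite lt_neqAle subr_ge0 r1 andbT eq_sym subr_eq0; apply/eqP => r11.
    have := czE p; have := rad_sqr p; rewrite r11 domain_eqE.
    move: z00; case: c3 => ->; rewrite ?opprK ?subr0 => /eqP z00 e1 e2; apply: z00; apply/eqP.
    - by rewrite -sqrf_eq0 e2 -e1 expr1n subrr !(mul0r, mulr0).
    - by rewrite -sqrf_eq0 e2 -e1 expr1n subrr !(mul0r, mulr0).
    - by rewrite -sqrf_eq0 e2 -e1 expr1n subrr !(mul0r, mulr0).
  rewrite /hole_tau !sgrM sgr_id (gtr0_sg rp1) gtr0_sg // mul1r mulr1.
  by rewrite -numEsg.
move=> x x' y y1 e; have [h1 h2 _] := hole_EE x y; have [h1' h2' _] := hole_EE x' y.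
have r1 : hole_r y != 0 by have := hole_r_itv y; case: eqP => // ->; lra.
apply: turn_inj; apply: (mulfI r1).
  by apply: (@addrI _ c); rewrite -h1 -h1' e.
by rewrite -h2 -h2' e.
Unshelve. all: by end_near. Qed.

End HoleChart.

(** * Annuli around the curves lying over the gaps on the x-axis *)

Section GapChart.
Variable R : realType.
Notation Sigma := (Sigma3 R).
Variable i : nat.
Hypothesis i3 : (i <= 3)%N.

(** Also meant for [i = 3], where it is 6: in all four cases the [i]-th gap lies between [hc - 3]
    and [hc]. *)
Definition hc : R := 3 * (i%:R - 1).

(* The left and right ends, at height y, of the i-th of the four pieces cut out of
   the planar domain by the vertical lines through the centers of the holes. *)
Definition gap_l (y : R) : R :=
  if i == 0 then - Num.sqrt (25 - y ^+ 2) else hc - 3 + Num.sqrt (1 - y ^+ 2).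
Definition gap_r (y : R) : R :=
  if i == 3 then Num.sqrt (25 - y ^+ 2) else hc - Num.sqrt (1 - y ^+ 2).

(** With $s=\sqrt{1-y^2}$ and $t=\sqrt{25-y^2}$ the equation splits into factors linear in $x$;
    those not vanishing at the ends of the gap combine into a positive factor [P]. *)
Lemma gap_ends (y : R) : `|y| <= 1 / 2 ->
  [/\ hc - 3 < gap_l y, gap_l y < gap_r y, gap_r y < hc &
    forall x, hc - 3 < x < hc ->
      (gap_l y <= x <= gap_r y <-> 0 <= domain_eq x y) /\
      (gap_l y <= x <= gap_r y -> domain_eq x y = 0 -> x = gap_l y \/ x = gap_r y) /\
      (x = gap_l y \/ x = gap_r y -> domain_eq x y = 0)].
Proof.
move=> y1; have y2 : 0 <= y ^+ 2 <= 1 / 4.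
  rewrite sqr_ge0 -real_normK ?num_real //=; have : 0 <= `|y| by []. nra.
rewrite /gap_l /gap_r /hc.
have : 0 <= Num.sqrt (1 - y ^+ 2) by exact: sqrtr_ge0.
have : Num.sqrt (1 - y ^+ 2) ^+ 2 = 1 - y ^+ 2 by rewrite sqr_sqrtr //; lra.
have : 0 <= Num.sqrt (25 - y ^+ 2) by exact: sqrtr_ge0.
have : Num.sqrt (25 - y ^+ 2) ^+ 2 = 25 - y ^+ 2 by rewrite sqr_sqrtr //; lra.
set s := Num.sqrt (1 - _); set t := Num.sqrt (25 - _) => tE t0 sE s0.
have [s1 s2] : 3/4 < s /\ s <= 1 by split; nra.
have [t1 t2] : 19/4 < t /\ t <= 5 by split; nra.
have DE x : domain_eq x y = ((t - x) * (t + x)) * ((x + 3 - s) * (x + 3 + s)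
   * (((x - s) * (x + s)) * ((x - 3 - s) * (x - 3 + s)))).
  rewrite domain_eqE; have -> : y ^+ 2 = 1 - s ^+ 2 by lra.
  have -> : 25 - (x ^+ 2 + (1 - s ^+ 2)) = (t - x) * (t + x).
    have -> : (t - x) * (t + x) = t ^+ 2 - x ^+ 2 by ring.
    lra.
  by ring.
have main (P l r x : R) : 0 < P -> l < r -> domain_eq x y = P * ((x - l) * (r - x)) ->
   (l <= x <= r <-> 0 <= domain_eq x y) /\
   (l <= x <= r -> domain_eq x y = 0 -> x = l \/ x = r) /\
   (x = l \/ x = r -> domain_eq x y = 0).
  move=> P0 lr ->; split; last split.
  - rewrite pmulr_rge0 //; split => [/andP[h1 h2]|h]; first by rewrite mulr_ge0 // subr_ge0.
    by apply/andP; split; nra.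
  - move=> _ /eqP; rewrite !mulf_eq0 gt_eqF //= !subr_eq0 => /orP[/eqP ->|/eqP ->]; [by left|by right].
  - by case=> ->; rewrite subrr ?mulr0 ?mul0r ?mulr0.
have P6 (a b c d e f : R) : 0 < a -> 0 < b -> 0 < c -> 0 < d -> 0 < e -> 0 < f ->
  0 < a * b * (c * d) * (e * f) by move=> *; rewrite !mulr_gt0.
case: i i3 => [|[|[|[|//]]]] _ /=; split; try lra; move=> x xi.
- apply: (@main ((t - x) * (s - x - 3) * ((s - x) * (- x - s)) * ((3 + s - x) * (3 - s - x)))).
  + by apply: P6; lra.
  + by lra.
  + by rewrite DE; ring.
- apply: (@main ((t - x) * (t + x) * ((x + 3 + s) * (s - x)) * ((3 + s - x) * (3 - s - x)))).
  + by apply: P6; lra.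
  + by lra.
  + by rewrite DE; ring.
- apply: (@main ((t - x) * (t + x) * ((x + 3 - s) * (x + 3 + s)) * ((x + s) * (3 + s - x)))).
  + by apply: P6; lra.
  + by lra.
  + by rewrite DE; ring.
- apply: (@main ((t + x) * (x + 3 - s) * ((x + 3 + s) * (x - s)) * ((x + s) * (x - 3 + s)))).
  + by apply: P6; lra.
  + by lra.
  + by rewrite DE; ring.
Qed.

Definition gap_U (p : Sigma) := (hc - 3 < cx p < hc).
Definition gap_tau (p : Sigma) : R := 2 * cy p.
Definition gap_y (y : R) : R := clamp 1 y / 2.
(** The segment between the two ends is traversed back and forth by a cosine, once on each sheet,
    which gives a closed curve. *)
Definition gap_x (x y : R) : R :=
  (gap_l (gap_y y) + gap_r (gap_y y)) / 2 + (gap_r (gap_y y) - gap_l (gap_y y)) / 2 * cost x.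
Definition gap_z (x y : R) : R :=
  Num.sg (sint x) * Num.sqrt (domain_eq (gap_x x y) (gap_y y)).
Definition gap_E (x : R * R) : Sigma :=
  surf (gap_x x.1 x.2) (gap_y x.2) (gap_z x.1 x.2).

Lemma gap_y_le y : `|gap_y y| <= 1 / 2.
Proof.
by rewrite /gap_y normrM (ger0_norm (x := 2^-1)) //; have := clamp_le y (@ler01 R); lra.
Qed.

Lemma cost_itv (x : R) : -1 <= cost x <= 1.
Proof. by have := cost2Dsint2 x; have := sqr_ge0 (sint x); nra. Qed.

Lemma gap_x_itv x y : gap_l (gap_y y) <= gap_x x y <= gap_r (gap_y y).
Proof.
have [_ h _ _] := gap_ends (gap_y_le y); have := cost_itv x; rewrite /gap_x.
set l := gap_l _ in h *; set r := gap_r _ in h *; nra.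
Qed.

Lemma gap_x_zone x y : hc - 3 < gap_x x y < hc.
Proof. by have [h1 h2 h3 _] := gap_ends (gap_y_le y); have := gap_x_itv x y; lra. Qed.

Lemma sint0_cost (x : R) : sint x = 0 -> cost x = 1 \/ cost x = -1.
Proof.
move=> s0; have := cost2Dsint2 x; rewrite s0 expr0n addr0 => /eqP.
by rewrite sqrf_eq1 => /orP[/eqP ->|/eqP ->]; [left|right].
Qed.

Lemma gap_z0 x y : sint x = 0 -> domain_eq (gap_x x y) (gap_y y) = 0.
Proof.
move=> s0; have [_ _ _ /(_ _ (gap_x_zone x y))[_ [_ H]]] := gap_ends (gap_y_le y).
by apply: H; rewrite /gap_x; case: (sint0_cost s0) => ->; [right|left]; field.
Qed.

Lemma gap_zE x y : gap_z x y ^+ 2 = domain_eq (gap_x x y) (gap_y y).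
Proof.
have [_ _ _ /(_ _ (gap_x_zone x y))[[H _] _]] := gap_ends (gap_y_le y).
rewrite /gap_z exprMn sqr_sqrtr ?H ?gap_x_itv // sqr_sg.
by case: eqP => [/gap_z0 ->|_]; rewrite ?mul1r ?mulr0.
Qed.

Lemma gap_EE x y : [/\ cx (gap_E (x, y)) = gap_x x y,
  cy (gap_E (x, y)) = gap_y y & cz (gap_E (x, y)) = gap_z x y].
Proof. exact: (surfE (gap_zE x y)). Qed.

Lemma gap_l_cont (T : topologicalType) (f : T -> R) t : continuous_at t f ->
  continuous_at t (fun u => gap_l (f u)).
Proof. by move=> cf; rewrite /gap_l; case: (i == 0); cont. Qed.

Lemma gap_r_cont (T : topologicalType) (f : T -> R) t : continuous_at t f ->
  continuous_at t (fun u => gap_r (f u)).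
Proof. by move=> cf; rewrite /gap_r; case: (i == 3); cont. Qed.

Lemma gap_chart : chart gap_U gap_tau gap_E.
Proof.
have cgy : continuous (fun x : R * R => gap_y x.2) by rewrite /gap_y; cont.
have cgx : continuous (fun x : R * R => gap_x x.1 x.2).
  move=> x; rewrite /gap_x; have c1 := gap_l_cont (cgy x); have c2 := gap_r_cont (cgy x).
  by cont.
split.
- have -> : [set p | gap_U p] = [set p | hc - 3 < cx p] `&` [set p | cx p < hc].
    by apply/seteqP; split => p; rewrite /gap_U /=; [move/andP|move=> h; apply/andP].
  by apply: openI; [apply: open_gt|apply: open_lt]; cont.
- by move=> p _; rewrite /gap_tau; cont.
(* Within $1/2$ of the vertical line through a hole centre the domain has $y^2\ge 3/4$, hence
   $|2y|\ge 1$; at the two extreme ends there are no points at all. *)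
- move=> p; rewrite /gap_U negb_and -!leNgt => Up.
  suff : \forall q \near p, hc - 3 < cx q < hc -> 3 / 4 <= cy q ^+ 2.
    apply: filterS => q H /H {}H.
    rewrite /gap_tau normrM ger0_norm // -(@ler_pXn2r _ 2) ?nnegrE ?mulr_ge0 //.
    by rewrite expr1n exprMn real_normK ?num_real //; lra.
  case/orP: Up => Up; near=> q => /andP[q1 q2].
    have {q2} q2 : cx q < hc - 3 + 1 / 2.
      by near: q; apply: (cvgr_lt _ (@cx_continuous R p)); lra.
    have [x25 d1 d2 d3] := Sigma_domain q; have y2 := sqr_ge0 (cy q).
    by move: q1 q2; rewrite /hc; case: i i3 => [|[|[|[|//]]]] _ /= q1 q2; nra.
  have {q1} q1 : hc - 1 / 2 < cx q.
    by near: q; apply: (cvgr_gt _ (@cx_continuous R p)); lra.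
  have [x25 d1 d2 d3] := Sigma_domain q; have y2 := sqr_ge0 (cy q).
  by move: q1 q2; rewrite /hc; case: i i3 => [|[|[|[|//]]]] _ /= q1 q2; nra.
- apply: surf_continuous => /=; [by move=> x; exact: gap_zE|exact: cgx|exact: cgy|].
  move=> x; apply: contat_sgroot; [by cont|by apply: domain_eq_continuous; [exact: cgx|exact: cgy]|].
  by move=> /gap_z0 ->.
- by move=> x y; rewrite /gap_E /gap_z /gap_x /= !costD !sintD cost1 sint1 !mulr1 !mulr0 subr0 addr0.
- move=> x y y1; have [h1 h2 h3] := gap_EE x y; rewrite /gap_U /gap_tau h1 h2 gap_x_zone.
  by split => //; rewrite /gap_y clamp_id //; field.
- move=> p Up t1; have yE : gap_y (gap_tau p) = cy p by rewrite /gap_y clamp_id // /gap_tau; field.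
  have y1 : `|cy p| <= 1 / 2 by rewrite -yE gap_y_le.
  have [h1 h2 h3 /(_ (cx p) Up)[[_ H1] [H2 H3]]] := gap_ends y1.
  have xlr : gap_l (cy p) <= cx p <= gap_r (cy p) by apply: H1; rewrite -czE sqr_ge0.
  pose w := (gap_r (cy p) - gap_l (cy p)) / 2.
  have w0 : 0 < w by rewrite /w; lra.
  have [a aw] : exists a, a * w = cx p - (gap_l (cy p) + gap_r (cy p)) / 2.
    by exists ((cx p - (gap_l (cy p) + gap_r (cy p)) / 2) / w); rewrite divfK // gt_eqF.
  have a1 : a ^+ 2 <= 1.
    have : (a * w) ^+ 2 <= w ^+ 2 by rewrite aw /w; nra.
    by rewrite exprMn -[X in _ <= X]mul1r ler_pM2r // exprn_gt0.
  have [x [cxa sxa]] : exists x, cost x = a /\ sint x = Num.sg (cz p) * Num.sqrt (1 - a ^+ 2).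
    apply: turn_exists; rewrite exprMn sqr_sqrtr ?subr_ge0 // sqr_sg.
    have [z0|_] := eqVneq (cz p) 0; last by rewrite mul1r addrC subrK.
    rewrite mul0r addr0.
    have [|e|e] := H2 xlr; first by rewrite -czE z0 expr0n.
      have -> : a = -1 by apply: (mulIf (lt0r_neq0 w0)); rewrite aw e /w; field.
      by rewrite sqrrN expr1n.
    have -> : a = 1 by apply: (mulIf (lt0r_neq0 w0)); rewrite aw e /w; field.
    by rewrite expr1n.
  have xE : gap_x x (gap_tau p) = cx p.
    by rewrite /gap_x yE cxa -/w (mulrC w) aw; ring.
  exists x; have [e1 e2 e3] := gap_EE x (gap_tau p).
  apply: Sigma_eq; rewrite ?e1 ?e2 ?e3 // /gap_z xE yE -czE sqrtr_sqr sxa sgrM sgr_id.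
  have [a11|a11] := eqVneq (a ^+ 2) 1; last first.
    have ap : 0 < 1 - a ^+ 2 by rewrite subr_gt0 lt_neqAle a11.
    by rewrite (gtr0_sg (x := Num.sqrt _)) ?sqrtr_gt0 // mulr1 -numEsg.
  rewrite a11 subrr sqrtr0 sgr0 mulr0 mul0r; apply/eqP; rewrite -sqrf_eq0 czE; apply/eqP; apply: H3.
  move/eqP: a11; rewrite sqrf_eq1 => /orP[/eqP a11|/eqP a11]; move: aw; rewrite a11 /w => aw; [right|left]; lra.
move=> x x' y y1 e; have [h1 h2 h3] := gap_EE x y; have [h1' h2' h3'] := gap_EE x' y.
have [e1 e2 e3 _] := gap_ends (gap_y_le y).
have cc : cost x = cost x'.
  have : gap_x x y = gap_x x' y by rewrite -h1 -h1' e.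
  rewrite /gap_x => /addrI/mulfI; apply; rewrite gt_eqF //; lra.
apply: turn_inj => //.
have sg_eq : Num.sg (sint x) = Num.sg (sint x').
  have : gap_z x y = gap_z x' y by rewrite -h3 -h3' e.
  have xx : gap_x x y = gap_x x' y by rewrite /gap_x cc.
  have s0 : sint x = 0 -> sint x' = 0.
    move=> s0; apply/eqP; rewrite -sqrf_eq0; have := cost2Dsint2 x'; have := cost2Dsint2 x.
    by rewrite s0 cc => h h'; apply/eqP; lra.
  have [/[dup] /s0 -> ->//|sn0] := eqVneq (sint x) 0.
  rewrite /gap_z xx => /mulIf; apply; rewrite gt_eqF // sqrtr_gt0 lt_neqAle.
  have [_ _ _ /(_ _ (gap_x_zone x y))[[H1 _] [H2 _]]] := gap_ends (gap_y_le y).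
  rewrite -xx (H1 (gap_x_itv x y)) andbT eq_sym; apply/eqP => D0.
  move/eqP: sn0; apply; apply/eqP; rewrite -sqrf_eq0; apply/eqP.
  suff : cost x = 1 \/ cost x = -1.
    by have := cost2Dsint2 x => + [] E; rewrite E ?sqrrN expr1n; lra.
  have w0 : 0 < (gap_r (gap_y y) - gap_l (gap_y y)) / 2 by lra.
  case: (H2 (gap_x_itv x y) D0); rewrite /gap_x => E; [right|left];
    apply: (mulfI (lt0r_neq0 w0)); lra.
rewrite (numEsg (sint x)) (numEsg (sint x')) sg_eq; congr (_ * _).
rewrite -!sqrtr_sqr; congr Num.sqrt.
by have := cost2Dsint2 x'; have := cost2Dsint2 x; rewrite cc; lra.
Unshelve. all: by end_near. Qed.

End GapChart.

(** * The chain curves and their dual functions *)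

Section Crossing.
Variable R : realType.

Lemma cost_ge0 (t : R) : -(1/4) <= t <= 1/4 -> 0 <= cost t.
Proof.
move=> h; have -> : cost t = cost `|t| by case: ger0P; rewrite ?costN.
have t0 : 0 <= `|t| by []. have : `|t| <= 1/4 by rewrite ler_norml.
rewrite le_eqVlt => /orP[/eqP ->|lt]; first by rewrite div1r cost_quarter.
by have := @cost_gt R `|t| (4^-1); rewrite t0 -div1r lt div1r cost_quarter => /(_ isT) H; apply/ltW/H; lra.
Qed.

Lemma cost_le0 (t : R) : 1/4 <= t <= 3/4 -> cost t <= 0.
Proof.
move=> h; have -> : t = (t - 1/2) + 1/2 by ring.
rewrite costD div1r cost_half sint_half mulr0 subr0 mulrN1 oppr_le0; apply: cost_ge0; lra.
Qed.

Lemma cost_3quarter : cost (3 / 4 : R) = 0.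
Proof.
have -> : (3 / 4 : R) = 4^-1 + 2^-1 by field.
by rewrite costD cost_half sint_half cost_quarter mul0r mulr0 subr0.
Qed.

Lemma sint_3quarter : sint (3 / 4 : R) = -1.
Proof.
have -> : (3 / 4 : R) = 4^-1 + 2^-1 by field.
by rewrite sintD cost_half sint_half cost_quarter sint_quarter mulr0 addr0 mulrN1.
Qed.

Lemma clamp_out1 (t : R) : 1 <= t -> clamp 1 t = 1.
Proof. by move=> t1; rewrite /clamp min_l // max_r //; lra. Qed.

Lemma clamp_outN1 (t : R) : t <= -1 -> clamp 1 t = -1.
Proof. by move=> t1; rewrite /clamp min_r ?max_l //; lra. Qed.

Variables (T : topologicalType) (f : T -> R) (c : loop R T) (a : R -> R).
Hypotheses (cf : circ f) (ca : continuous a).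

Lemma loop_per t : c (t + 1) = c t.
Proof. exact: loop_periodic. Qed.

(** The band is crossed downwards on the middle half of the period and [f] is integral on the rest,
    so the degree counts this single crossing. *)
Lemma deg_cross_left : a (1/4) = 1 -> a (3/4) = -1 ->
  (forall t, 1/4 <= t <= 3/4 -> f (c t) - (a t + 1) / 2 \is a Num.int) ->
  (forall t, -(1/4) <= t <= 1/4 -> f (c t) \is a Num.int) ->
  deg f (loop_class c) = -1.
Proof.
move=> a1 a3 mid out; apply: (@intr_inj R).
rewrite (@deg_loop _ _ f c (fun t => (a (Num.max (1/4) (Num.min (3/4) t)) + 1) / 2)) //.
- rewrite (min_r (y := 0)) ?(max_l (y := 0)) ?(min_l (y := 1)) ?max_r ?a1 ?a3 //; lra.
- have cm : continuous (fun t : R => Num.max (1/4) (Num.min (3/4) t)) by cont.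
  by cont.
move=> t /andP[t0 t1]; have [t4|t4] := leP t (1/4).
  rewrite min_r ?max_l ?a1 //; last by lra.
  rewrite -[(1 + 1)%R]/(2 : R) divff // rpredB ?rpred1 // out //; lra.
have [t34|t34] := leP (3/4) t.
  rewrite max_r ?a3 ?addNr ?mul0r ?sub0r ?rpredN; try lra.
  by have := loop_per (t - 1); rewrite subrK => ->; apply: out; lra.
rewrite max_r ?(ltW t4) // -rpredN opprB mid //; lra.
Qed.

(** Here the crossing straddles [t = 0]. In a lift over [[0, 1]] its second half comes first, and
    its first half comes at the end, shifted by a period. *)
Lemma deg_cross_right : a (1/4) = 1 -> a (-(1/4)) = -1 ->
  (forall t, -(1/4) <= t <= 1/4 -> f (c t) - (a t + 1) / 2 \is a Num.int) ->
  (forall t, 1/4 <= t <= 3/4 -> f (c t) \is a Num.int) ->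
  deg f (loop_class c) = 1.
Proof.
move=> a1 a3 mid out; apply: (@intr_inj R).
rewrite (@deg_loop _ _ f c (fun t => (a (Num.min (1/4) t) + 1) / 2 + (a (Num.max (3/4) t - 1) + 1) / 2)) //.
- rewrite (min_r (y := 0)) ?(max_l (y := 0)) ?(min_l (y := 1)) ?max_r ?a1; try lra.
  rewrite subrr (_ : 3/4 - 1 = -(1/4)) ?a3; last by lra.
  by rewrite mulr1z; field.
- by cont.
move=> t /andP[t0 t1]; have [t4|t4] := leP t (1/4).
  rewrite max_l; last by lra.
  rewrite (_ : 3/4 - 1 = -(1/4)) ?a3 ?addNr ?mul0r ?addr0; last by lra.
  by rewrite -rpredN opprB mid //; lra.
rewrite a1 -[(1 + 1)%R]/(2 : R) divff //.
have [t34|t34] := leP (3/4) t; last first.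
  rewrite (_ : 3/4 - 1 = -(1/4)) ?a3 ?addNr ?mul0r ?addr0; last by lra.
  by rewrite rpredB ?rpred1 // out //; lra.
have := loop_per (t - 1); rewrite subrK => ->.
by rewrite -addrA rpredD ?rpred1 // -rpredN opprB mid //; lra.
Qed.

End Crossing.

Section ChainCurves.
Variable R : realType.
Notation Sigma := (Sigma3 R).
Notation hc := (hc R).

(** Odd indices are hole circles and even indices gap curves; in this left-to-right order
    consecutive curves share one fixed point of the involution. *)
Definition chU (k : nat) : Sigma -> bool := if odd k then hole_U (hc k./2) else gap_U k./2.
Definition chtau (k : nat) : Sigma -> R := if odd k then hole_tau (hc k./2) else @gap_tau R.
Definition chE (k : nat) : R * R -> Sigma := if odd k then hole_E (hc k./2) else gap_E k./2.

Lemma hc3 i : (i < 3)%N -> [\/ hc i = -3, hc i = 0 | hc i = 3].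
Proof.
rewrite /hc; case: i => [|[|[|//]]] _; [apply: Or31|apply: Or32|apply: Or33]; rewrite /=; lra.
Qed.

Lemma chainP k : (k < 7)%N -> chart (chU k) (chtau k) (chE k).
Proof.
move=> k7; rewrite /chU /chtau /chE; case: ifP => kodd.
  by apply: hole_chart; apply: hc3; lia.
by apply: gap_chart; lia.
Qed.

Definition cc (k : 'I_7) : loop R Sigma := core (chainP (ltn_ord k)).
Definition dual (k : nat) : Sigma -> R := dualf (chU k) (chtau k).

Lemma dual_circ k : (k < 7)%N -> circ (dual k).
Proof. by move=> k7; exact: dualf_circ (chainP k7). Qed.

Definition lam (k : nat) (h : H1 R Sigma) : int := deg (dual k) h.

Lemma ccE k t : cc k t = chE k (t, 0).
Proof. by []. Qed.

Lemma clamp0 : clamp 1 (0 : R) = 0.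
Proof. by rewrite clamp_id // normr0 ler01. Qed.

Lemma cc_odd (k : 'I_7) t : odd k ->
  [/\ cx (cc k t) = hc k./2 + cost t, cy (cc k t) = sint t & cz (cc k t) = 0].
Proof.
move=> ko; rewrite ccE /chE ko; have k3 : (k./2 < 3)%N by have := ltn_ord k; lia.
have [-> -> ->] := hole_EE (hc3 k3) t 0.
by rewrite /hole_r /hole_z clamp0 normr0 mul0r addr0 !mul1r sgr0 mul0r.
Qed.

Lemma gap_l0 i : (i <= 3)%N -> gap_l i (0 : R) = hc i - 2 /\ gap_r i (0 : R) = hc i - 1.
Proof.
have s25 : Num.sqrt (25 - 0 ^+ 2 : R) = 5.
  by rewrite (_ : 25 - 0 ^+ 2 = 5 ^+ 2) ?sqrtr_sqr ?ger0_norm //; ring.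
have s1 : Num.sqrt (1 - 0 ^+ 2 : R) = 1 by rewrite expr0n subr0 sqrtr1.
rewrite /gap_l /gap_r /hc s25 s1; case: i => [|[|[|[|//]]]] _ /=; split; lra.
Qed.

Lemma gap_y0 : gap_y (0 : R) = 0.
Proof. by rewrite /gap_y clamp0 mul0r. Qed.

Lemma gap_x0 i t : (i <= 3)%N -> gap_x i t (0 : R) = hc i - 3 / 2 + cost t / 2.
Proof. by move=> i3; rewrite /gap_x gap_y0; have [-> ->] := gap_l0 i3; field. Qed.

Lemma cc_even (k : 'I_7) t : ~~ odd k ->
  [/\ cx (cc k t) = hc k./2 - 3 / 2 + cost t / 2, cy (cc k t) = 0 &
      cz (cc k t) = Num.sg (sint t) * Num.sqrt (domain_eq (hc k./2 - 3 / 2 + cost t / 2) 0)].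
Proof.
move=> ke; rewrite ccE /chE (negbTE ke); have k3 : (k./2 <= 3)%N by have := ltn_ord k; lia.
by have [-> -> ->] := gap_EE k3 t 0; rewrite /gap_z gap_x0 // gap_y0.
Qed.

Lemma gap_domain_gt0 i t : (i <= 3)%N -> sint t != 0 ->
  0 < domain_eq (hc i - 3 / 2 + cost t / 2) (0 : R).
Proof.
move=> i3 s0; have y1 : `|0 : R| <= 1/2 by rewrite normr0.
have [h1 h2 h3 /(_ (gap_x i t 0))] := gap_ends i3 y1.
have xE := gap_x0 t i3; have [e1 e2] := gap_l0 i3; have := gap_x_zone i3 t 0.
rewrite -xE => z /(_ z)[[H _] [H2 _]]; have := gap_x_itv i3 t 0; rewrite gap_y0 => xi.
rewrite lt_neqAle (H xi) andbT eq_sym; apply/eqP => D0.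
move/eqP: s0; apply; apply/eqP; rewrite -sqrf_eq0; apply/eqP.
have := cost2Dsint2 t; have := H2 xi D0; rewrite e1 e2 xE.
case=> e.
  have -> : cost t = -1 by lra.
  lra.
have -> : cost t = 1 by lra.
lra.
Qed.

Lemma dual_int k p : (chU k p -> 1 <= `|chtau k p|) -> dual k p \is a Num.int.
Proof.
move=> H; rewrite /dual /dualf; case: ifP => Up; last by rewrite rpred0.
by apply: clamp_half_int; exact: H.
Qed.

Lemma hc_lt i j : (i < j)%N -> hc i + 3 <= hc j.
Proof.
move=> ij; have : (i.+1%:R : R) <= j%:R by rewrite ler_nat.
rewrite -natr1 /hc; lra.
Qed.

(** The case [j = k] is included: along its own core the dual function is constantly $1/2$.
    Otherwise the curve avoids the open annulus. *)
Lemma lam_far (j k : 'I_7) : j != k.+1 :> nat -> k != j.+1 :> nat -> lam j (loop_class (cc k)) = 0.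
Proof.
move=> jk kj; have cd := dual_circ (ltn_ord j).
suff [a H] : exists a, forall t, dual j (cc k t) - a \is a Num.int.
  apply: (@intr_inj R); rewrite (@deg_loop _ _ _ _ (fun=> a)) //; first by rewrite subrr.
    by move=> t; exact: contat_cst.
  by move=> t _; rewrite -rpredN opprB.
have [e|ne] := eqVneq (j : nat) k.
  exists 2^-1 => t; have n0 : `|0 : R| <= 1 by rewrite normr0.
  have := dualf_E (chainP (ltn_ord k)) t n0; rewrite add0r mul1r -ccE /dual e //.
exists 0 => t; rewrite subr0; apply: dual_int.
rewrite /chU /chtau; have [jo|je] := boolP (odd j); have [ko|ke] := boolP (odd k).
- have [h1 h2 h3] := cc_odd t ko; rewrite /hole_U h1 h2.
  have [ij|ij] : (j./2 < k./2)%N \/ (k./2 < j./2)%N by lia.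
    by have := @hc_lt _ _ ij; have := cost_itv t; nra.
  by have := @hc_lt _ _ ij; have := cost_itv t; nra.
- have [h1 h2 h3] := cc_even t ke; rewrite /hole_U h1 h2.
  have [ij|ij] : (k./2 < j./2)%N \/ (j./2.+1 < k./2)%N by lia.
    by have := @hc_lt _ _ ij; have := cost_itv t; nra.
  have : hc k./2 >= hc j./2 + 6 by have := @hc_lt j./2 j./2.+1 (leqnn _); have := @hc_lt _ _ ij; lra.
  by have := cost_itv t; nra.
- have [h1 h2 h3] := cc_odd t ko; rewrite /gap_U h1.
  have [ij|ij] : (j./2 < k./2)%N \/ (k./2.+1 < j./2)%N by lia.
    by have := @hc_lt _ _ ij; have := cost_itv t; lra.
  have : hc j./2 >= hc k./2 + 6 by have := @hc_lt k./2 k./2.+1 (leqnn _); have := @hc_lt _ _ ij; lra.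
  by have := cost_itv t; lra.
have [h1 h2 h3] := cc_even t ke; rewrite /gap_U h1.
have [ij|ij] : (j./2 < k./2)%N \/ (k./2 < j./2)%N by lia.
  by have := @hc_lt _ _ ij; have := cost_itv t; lra.
by have := @hc_lt _ _ ij; have := cost_itv t; lra.
Qed.

(* The value of the odd transverse coordinate along an even curve of the chain, on the half
   where it is close to the hole. *)
Definition bump_coord (t : R) : R := sint t * `|sint t| / (1 + `|cost t|).

Lemma bump_coord_cont : continuous bump_coord.
Proof.
by rewrite /bump_coord; cont; rewrite gt_eqF // ltr_wpDr.
Qed.

(** $\sin^2 = (1-|\cos|)(1+|\cos|)$ cancels the denominator. The quotient form makes continuity
    evident, this one matches [hole_tau]. *)
Lemma bump_coordE t : bump_coord t = Num.sg (sint t) * (1 - `|cost t|).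
Proof.
have c0 : 0 <= `|cost t| by []. have n0 : 1 + `|cost t| != 0 by rewrite gt_eqF //; lra.
apply: (mulIf n0); rewrite /bump_coord divfK //.
have -> : Num.sg (sint t) * (1 - `|cost t|) * (1 + `|cost t|) = Num.sg (sint t) * (1 - `|cost t| ^+ 2) by ring.
rewrite real_normK ?num_real // -(cost2Dsint2 t) addrAC subrr add0r {1}(numEsg (sint t)) -mulrA -expr2.
by rewrite real_normK ?num_real.
Qed.

Lemma sint_half_le (t : R) : `|cost t| <= 3 / 5 -> 1 <= `|2 * sint t|.
Proof.
rewrite ler_norml => c; rewrite normrM ger0_norm // -(@ler_pXn2r _ 2) ?nnegrE ?mulr_ge0 //.
rewrite expr1n exprMn real_normK ?num_real //; have := cost2Dsint2 t; nra.
Qed.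

Lemma cc_even_sg (k : 'I_7) t : ~~ odd k -> Num.sg (cz (cc k t)) = Num.sg (sint t).
Proof.
move=> ke; have [_ _ ->] := cc_even t ke; have k3 : (k./2 <= 3)%N by have := ltn_ord k; lia.
rewrite sgrM sgr_id; have [->|s0] := eqVneq (sint t) 0; first by rewrite sgr0 mul0r.
by rewrite (gtr0_sg (x := Num.sqrt _)) ?mulr1 // sqrtr_gt0 gap_domain_gt0.
Qed.

(** The curve meets its right neighbour at [t = 0]. Along it the transverse coordinate of the
    neighbour is $2\sin$ for an odd curve and [bump_coord] for an even one, up to clamping. *)
Lemma lam_right (j k : 'I_7) : j = k.+1 :> nat -> lam j (loop_class (cc k)) = 1.
Proof.
move=> jk; have cd := dual_circ (ltn_ord j).
have E4 : (1/4 : R) = 4^-1 by lra.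
have [ko|ke] := boolP (odd k).
  have jo : odd j = false by rewrite jk /= ko.
  have ji : j./2 = k./2.+1 by lia.
  have hj : hc j./2 = hc k./2 + 3 by rewrite ji /hc -natr1; ring.
  apply: (@deg_cross_right _ _ _ _ (fun t => clamp 1 (2 * sint t))) => //.
  - by cont.
  - by rewrite E4 sint_quarter clamp_out1 //; lra.
  - by rewrite E4 sintN sint_quarter clamp_outN1 //; lra.
  - move=> t /cost_ge0 c0; have [h1 h2 h3] := cc_odd t ko.
    rewrite /dual /dualf /chU /chtau jo /gap_U /gap_tau h1 h2 hj; have := cost_itv t => c1.
    case: ifP => [_|/negbT]; first by rewrite subrr rpred0.
    rewrite negb_and -!leNgt sub0r rpredN => h; apply: clamp_half_int; apply: sint_half_le.
    by case/orP: h => h; rewrite ger0_norm //; lra.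
  move=> t /cost_le0 c0; have [h1 h2 h3] := cc_odd t ko; apply: dual_int.
  by rewrite /chU jo /gap_U h1 hj; lra.
have jo : odd j by rewrite jk /= ke.
have ji : j./2 = k./2 by lia.
have k3 : (k./2 <= 3)%N by have := ltn_ord k; lia.
apply: (@deg_cross_right _ _ _ _ bump_coord) => //.
- exact: bump_coord_cont.
- by rewrite bump_coordE E4 sint_quarter cost_quarter normr0 sgr1; lra.
- by rewrite bump_coordE E4 sintN costN sint_quarter cost_quarter normr0 sgrN1; lra.
- move=> t /cost_ge0 c0; have [h1 h2 h3] := cc_even t ke; have c1 := cost_itv t.
  have rE : rad (hc j./2) (cc k t) = 3 / 2 - cost t / 2.
    rewrite /rad h1 h2 ji expr0n addr0 sqrtr_sqr ler0_norm; lra.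
  rewrite /dual /dualf /chU /chtau jo /hole_U /hole_tau rE h1 h2 cc_even_sg // ji.
  have -> : (hc k./2 - 3 / 2 + cost t / 2 - hc k./2) ^+ 2 + 0 ^+ 2 < 49 / 16 by nra.
  rewrite bump_coordE (ger0_norm c0).
  rewrite (_ : 2 * _ = Num.sg (sint t) * (1 - cost t)); last by field.
  rewrite clamp_id ?subrr ?rpred0 // normrM normr_sg ger0_norm; last by lra.
  by case: (sint t != 0); rewrite ?mul1r ?mul0r; lra.
move=> t /cost_le0 c0; have [h1 h2 h3] := cc_even t ke; have c1 := cost_itv t; apply: dual_int.
have rE : rad (hc j./2) (cc k t) = 3 / 2 - cost t / 2.
  rewrite /rad h1 h2 ji expr0n addr0 sqrtr_sqr ler0_norm; lra.
rewrite /chU /chtau jo /hole_U /hole_tau rE h1 h2 cc_even_sg // ji => U.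
have s0 : sint t != 0.
  by apply/eqP => /sint0_cost [E|E]; move: U c0; rewrite E; lra.
rewrite !normrM !normr_sg s0 mul1r ger0_norm // ger0_norm; lra.
Qed.

Lemma lam_left (j k : 'I_7) : k = j.+1 :> nat -> lam j (loop_class (cc k)) = -1.
Proof.
move=> kj; have cd := dual_circ (ltn_ord j).
have E4 : (1/4 : R) = 4^-1 by lra.
have [ko|ke] := boolP (odd k).
  have jo : odd j = false by move: ko; rewrite kj /=; case: odd.
  have ji : j./2 = k./2 by lia.
  apply: (@deg_cross_left _ _ _ _ (fun t => clamp 1 (2 * sint t))) => //.
  - by cont.
  - by rewrite E4 sint_quarter clamp_out1 //; lra.
  - by rewrite sint_3quarter clamp_outN1 //; lra.
  - move=> t /cost_le0 c0; have [h1 h2 h3] := cc_odd t ko.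
    rewrite /dual /dualf /chU /chtau jo /gap_U /gap_tau h1 h2 ji; have := cost_itv t => c1.
    case: ifP => [_|/negbT]; first by rewrite subrr rpred0.
    rewrite negb_and -!leNgt sub0r rpredN => h; apply: clamp_half_int; apply: sint_half_le.
    by case/orP: h => h; rewrite ler0_norm //; lra.
  move=> t /cost_ge0 c0; have [h1 h2 h3] := cc_odd t ko; apply: dual_int.
  by rewrite /chU jo /gap_U h1 ji; lra.
have jo : odd j by move: ke; rewrite kj /= negbK.
have ji : k./2 = j./2.+1 by lia.
have hj : hc k./2 = hc j./2 + 3 by rewrite ji /hc -natr1; ring.
have k3 : (k./2 <= 3)%N by have := ltn_ord k; lia.
have rE t : rad (hc j./2) (cc k t) = 3 / 2 + cost t / 2.
  have [h1 h2 h3] := cc_even t ke; have c1 := cost_itv t.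
  rewrite /rad h1 h2 hj expr0n addr0 sqrtr_sqr ger0_norm; lra.
apply: (@deg_cross_left _ _ _ _ bump_coord) => //.
- exact: bump_coord_cont.
- by rewrite bump_coordE E4 sint_quarter cost_quarter normr0 sgr1; lra.
- by rewrite bump_coordE sint_3quarter cost_3quarter normr0 sgrN1; lra.
- move=> t /cost_le0 c0; have [h1 h2 h3] := cc_even t ke; have c1 := cost_itv t.
  rewrite /dual /dualf /chU /chtau jo /hole_U /hole_tau rE h1 h2 cc_even_sg // hj.
  have -> : (hc j./2 + 3 - 3 / 2 + cost t / 2 - hc j./2) ^+ 2 + 0 ^+ 2 < 49 / 16 by nra.
  rewrite bump_coordE (ler0_norm c0) opprK.
  rewrite (_ : 2 * _ = Num.sg (sint t) * (1 + cost t)); last by field.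
  rewrite clamp_id ?subrr ?rpred0 // normrM normr_sg ger0_norm; last by lra.
  by case: (sint t != 0); rewrite ?mul1r ?mul0r; lra.
move=> t /cost_ge0 c0; have [h1 h2 h3] := cc_even t ke; have c1 := cost_itv t; apply: dual_int.
rewrite /chU /chtau jo /hole_U /hole_tau rE h1 h2 cc_even_sg // hj => U.
have s0 : sint t != 0.
  by apply/eqP => /sint0_cost [E|E]; move: U c0; rewrite E; lra.
rewrite !normrM !normr_sg s0 mul1r ger0_norm // ger0_norm; lra.
Qed.

(** Feeds [twist_involution]: as every chart sees the involution as minus the identity, all chain
    twists commute with it. *)
Lemma chE_hyp k x y : (k < 7)%N -> hyperelliptic (chE k (x, y)) = chE k (- x, - y).
Proof.
move=> k7; have cN (z : R) : clamp 1 (- z) = - clamp 1 z.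
  have [h|h] := leP 1 z; first by rewrite clamp_outN1 ?clamp_out1 //; lra.
  have [h'|h'] := leP z (-1); first by rewrite clamp_out1 ?clamp_outN1 ?opprK //; lra.
  by rewrite !clamp_id ?normrN // ler_norml; lra.
rewrite /chE; case: ifP => ko.
  have k3 : (k./2 < 3)%N by lia.
  have [h1 h2 h3] := hole_EE (hc3 k3) x y; have [h1' h2' h3'] := hole_EE (hc3 k3) (- x) (- y).
  have [e1 e2 e3] := hypE (hole_E (hc k./2) (x, y)).
  have rN : hole_r (- y) = hole_r y by rewrite /hole_r cN normrN.
  apply: Sigma_eq; rewrite ?e1 ?e2 ?e3 ?h1 ?h2 ?h3 ?h1' ?h2' ?h3' ?rN ?costN ?sintN ?mulrN //.
  rewrite /hole_z rN costN sintN cN sgrN mulNr; congr (- (_ * Num.sqrt _)).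
  by rewrite !domain_eqE mulrN sqrrN.
have k3 : (k./2 <= 3)%N by lia.
have [h1 h2 h3] := gap_EE k3 x y; have [h1' h2' h3'] := gap_EE k3 (- x) (- y).
have [e1 e2 e3] := hypE (gap_E k./2 (x, y)).
have yN : gap_y (- y) = - gap_y y by rewrite /gap_y cN mulNr.
have xN : gap_x k./2 (- x) (- y) = gap_x k./2 x y by rewrite /gap_x yN costN /gap_l /gap_r sqrrN.
apply: Sigma_eq; rewrite ?e1 ?e2 ?e3 ?h1 ?h2 ?h3 ?h1' ?h2' ?h3' //.
rewrite /gap_z xN yN sintN sgrN mulNr; congr (- (_ * Num.sqrt _)).
by rewrite !domain_eqE sqrrN.
Qed.

End ChainCurves.

(** * Dehn twists as transvections *)

Section ChainTwist.
Variable R : realType.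
Notation Sigma := (Sigma3 R).

Definition tw (k : 'I_7) (n : int) : Sigma -> Sigma := twist (@chE R k) n.

Lemma tw_continuous k n : continuous (tw k n).
Proof.
have C := @chainP R k (ltn_ord k); apply: twist_continuous.
- exact: Sigma_hausdorff.
- exact: (chart_cont C).
- exact: (chart_per C).
- exact: chart_inj2 C.
- exact: chart_openE C.
Qed.

Lemma twK k n : cancel (tw k n) (tw k (- n)).
Proof.
have C := @chainP R k (ltn_ord k); apply: twistK.
- exact: (chart_per C).
- exact: chart_inj2 C.
Qed.

Lemma tw_hyp k n p : hyperelliptic (tw k n p) = tw k n (hyperelliptic p).
Proof.
have C := @chainP R k (ltn_ord k); apply: twist_involution.
- exact: (chart_per C).
- exact: chart_inj2 C.
- exact: hypK.
- by move=> x y; exact: chE_hyp.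
Qed.

Definition twc (k : 'I_7) (n : int) : continuousType Sigma Sigma := mkcts (@tw_continuous k n).

Lemma lam_tw (j k : 'I_7) (n : int) h : `|n|%N = 1%N ->
  lam j (H1_map (twc k n) h) = lam j h + n * lam j (loop_class (cc R k)) * lam k h.
Proof.
move=> n1; have C := @chainP R k (ltn_ord k); rewrite /lam deg_map; last exact: dual_circ.
apply: (deg_twist (@Sigma_hausdorff R) (chart_cont C) (chart_per C) (chart_inj2 C) (chart_openE C)) => //.
- exact: dual_circ.
- by move=> x y y1; exact: (dualf_E C x y1).
- by move=> p out; exact: (dualf_out C out).
- exact: dual_circ.
Qed.

End ChainTwist.

Section Coordinates.
Variable R : realType.
Notation Sigma := (Sigma3 R).
Notation H := (H1 R Sigma).
Notation cl := (fun k => loop_class (cc R k)).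

Lemma lamD k (h h' : H) : (k < 7)%N -> lam k (h + h') = lam k h + lam k h'.
Proof. by move=> k7; apply: degD; exact: dual_circ. Qed.

Lemma lamB k (h h' : H) : (k < 7)%N -> lam k (h - h') = lam k h - lam k h'.
Proof. by move=> k7; apply: degB; exact: dual_circ. Qed.

Lemma lamN k (h : H) : (k < 7)%N -> lam k (- h) = - lam k h.
Proof. by move=> k7; apply: degN; exact: dual_circ. Qed.

Lemma lam0 k : (k < 7)%N -> lam k (0 : H) = 0.
Proof. by move=> k7; apply: deg0; exact: dual_circ. Qed.

Lemma lamMz k (h : H) n : (k < 7)%N -> lam k (h *~ n) = n * lam k h.
Proof. by move=> k7; apply: deg_mulz; exact: dual_circ. Qed.

Lemma lam_sum k (I : finType) (F : I -> H) : (k < 7)%N ->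
  lam k (\sum_i F i) = \sum_i lam k (F i).
Proof. by move=> k7; apply: deg_sum; exact: dual_circ. Qed.

Definition lamc (j k : nat) : int := if j == k.+1 then 1 else if k == j.+1 then -1 else 0.

Lemma lam_cc (j k : 'I_7) : lam j (loop_class (cc R k)) = lamc j k.
Proof.
rewrite /lamc; case: eqP => [/lam_right//|/eqP jk]; case: eqP => [/lam_left//|/eqP kj].
exact: lam_far.
Qed.

Definition o7 (k : nat) : 'I_7 := inord k.
Definition ch (k : nat) : H := loop_class (cc R (o7 k)).

Lemma lam_ch j k : (j < 7)%N -> (k < 7)%N -> lam j (ch k) = lamc j k.
Proof.
by move=> j7 k7; rewrite /ch -[j in LHS](inordK j7) lam_cc !inordK.
Qed.

(* The basis dual to the first six functionals. *)
Definition dual_class (j : nat) : H :=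
  if odd j then \sum_(k < 6 | ~~ odd k && (k < j)%N) ch k
  else - \sum_(k < 6 | odd k && (j < k)%N) ch k.

Lemma lam_dual (i j : 'I_6) : lam i (dual_class j) = (i == j)%:R.
Proof.
have i7 : (i < 7)%N by exact: ltn_trans (ltn_ord i) _.
have E (P : pred 'I_6) : lam i (\sum_(k < 6 | P k) ch k) = \sum_(k < 6 | P k) lamc i k.
  rewrite big_mkcond lam_sum // [RHS]big_mkcond; apply: eq_bigr => k _.
  by case: (P k); rewrite ?lam0 // lam_ch // (ltn_trans (ltn_ord k)).
rewrite /dual_class; case: ifP => jo; rewrite ?lamN // E;
  rewrite !big_mkcond !big_ord_recl big_ord0 /=.
  case: j jo => -[|[|[|[|[|[|//]]]]]] // ? _; case: i i7 E => -[|[|[|[|[|[|//]]]]]] // ? _ _;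
  by rewrite /lamc.
by case: j jo => -[|[|[|[|[|[|//]]]]]] // ? _; case: i i7 E => -[|[|[|[|[|[|//]]]]]] // ? _ _;
  rewrite /lamc.
Qed.

Hypothesis rank6 : exists e : 'I_6 -> H, Zbasis setT e.

(** The matrix of the six degrees on a basis has a left inverse made of the coordinates of the dual
    classes. Being square, by the rank hypothesis, it is invertible. *)
Lemma lam_eq0 (h : H) : (forall k : 'I_6, lam k h = 0) -> h = 0.
Proof.
move=> h0; have [e [efree eT]] := rank6.
have span g : exists k : 'I_6 -> int, g = \sum_i e i *~ k i.
  by have : [set: H] g by []; rewrite eT => -[k _ <-]; exists k.
have k7 (k : 'I_6) : (k < 7)%N by exact: ltn_trans (ltn_ord k) _.
pose A : 'M[int]_6 := \matrix_(i, j) lam j (e i).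
have lamE (k : 'I_6 -> int) (j : 'I_6) : lam j (\sum_i e i *~ k i) = ((\row_i k i) *m A) 0 j.
  by rewrite lam_sum // mxE; apply: eq_bigr => i _; rewrite lamMz // !mxE.
pose B : 'M[int]_6 := \matrix_(j, i) sval (cid (span (dual_class j))) i.
have BA : B *m A = 1%:M.
  apply/matrixP => j i; rewrite !mxE; have := lam_dual i j.
  rewrite {1}(svalP (cid (span (dual_class j)))) lamE mxE eq_sym => <-.
  by apply: eq_bigr => m _; rewrite !mxE.
have [k hE] := span h.
have : (\row_i k i) *m A = 0 by apply/rowP => j; rewrite -lamE -hE h0 mxE.
move=> /(congr1 (mulmx^~ B)); rewrite mul0mx -mulmxA (mulmx1C BA) mulmx1 => /rowP k0.
by rewrite hE big1 // => i _; have := k0 i; rewrite !mxE => ->.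
Qed.

Lemma lam_inj (h h' : H) : (forall k : 'I_6, lam k h = lam k h') -> h = h'.
Proof.
move=> E; apply/eqP; rewrite -subr_eq0; apply/eqP; apply: lam_eq0 => k.
by rewrite lamB ?E ?subrr //; exact: ltn_trans (ltn_ord k) _.
Qed.

Lemma coordE (h : H) : h = \sum_(j < 6) dual_class j *~ lam j h.
Proof.
apply: lam_inj => k; have k7 : (k < 7)%N by exact: ltn_trans (ltn_ord k) _.
rewrite lam_sum // (bigD1 k) //= lamMz // lam_dual eqxx mulr1 big1 ?addr0 // => i ik.
by rewrite lamMz // lam_dual eq_sym (negbTE ik) mulr0.
Qed.

(** The even curves together bound the half [y > 0] of the surface; here the relation is verified on
    degrees. *)
Lemma ch6 : ch 6 = - (ch 0 + ch 2 + ch 4).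
Proof.
apply: lam_inj => k; have k7 : (k < 7)%N by exact: ltn_trans (ltn_ord k) _.
rewrite lamN // !lamD // !lam_ch //; case: k k7 => -[|[|[|[|[|[|//]]]]]] ? _ //.
Qed.

Lemma tw_transvection (k : 'I_7) (n : int) (h : H) : `|n|%N = 1%N ->
  H1_map (twc R k n) h = h + ch k *~ (n * lam k h).
Proof.
move=> n1; apply: lam_inj => j; have j7 : (j < 7)%N by exact: ltn_trans (ltn_ord j) _.
rewrite -[j : nat]/(Ordinal j7 : nat) lam_tw // lamD // lamMz // lam_cc lam_ch //.
by rewrite mulrAC.
Qed.

End Coordinates.

(** * Intersection numbers with the chain curves *)

Section Derivatives.
Variable R : realType.
Implicit Types (f g : R -> R) (t a b : R).

Lemma is_deriv_cst (c : R) t : is_derive t 1 (fun _ : R => c) 0.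
Proof. exact: is_derive_cst. Qed.

Lemma is_derivD f g t a b : is_derive t 1 f a -> is_derive t 1 g b ->
  is_derive t 1 (fun u => f u + g u) (a + b).
Proof. exact: is_deriveD. Qed.

Lemma is_derivM f g t a b : is_derive t 1 f a -> is_derive t 1 g b ->
  is_derive t 1 (fun u => f u * g u) (f t * b + g t * a).
Proof. exact: is_deriveM. Qed.

Lemma is_deriv_cost t : is_derive t 1 (@cost R) (- (pi *+ 2 * sint t)).
Proof.
have h : is_derive t (1 : R) (fun u : R => pi *+ 2 * u) (pi *+ 2).
  apply: (@is_derive_eq _ _ _ _ _ _ _ _ (@is_derivM _ id t 0 1 (is_deriv_cst _ _) (is_derive_id _ _))).
  by rewrite mulr1 mulr0 addr0.
apply: (is_derive_eq (is_derive1_comp (is_derive_cos _) h)).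
by rewrite /sint mulNr mulrC.
Qed.

Lemma is_deriv_sint t : is_derive t 1 (@sint R) (pi *+ 2 * cost t).
Proof.
have h : is_derive t (1 : R) (fun u : R => pi *+ 2 * u) (pi *+ 2).
  apply: (@is_derive_eq _ _ _ _ _ _ _ _ (@is_derivM _ id t 0 1 (is_deriv_cst _ _) (is_derive_id _ _))).
  by rewrite mulr1 mulr0 addr0.
apply: (is_derive_eq (is_derive1_comp (is_derive_sin _) h)).
by rewrite /cost mulrC.
Qed.

Lemma C1_triple (c : loop R (Sigma3 R)) (X Y Z X' Y' Z' : R -> R) :
  (forall t, [/\ cx (c t) = X t, cy (c t) = Y t & cz (c t) = Z t]) ->
  (forall t, [/\ is_derive t 1 X (X' t), is_derive t 1 Y (Y' t) & is_derive t 1 Z (Z' t)]) ->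
  continuous X' -> continuous Y' -> continuous Z' ->
  C1_loop c /\ forall t, velocity c t = triple (X' t) (Y' t) (Z' t).
Proof.
move=> cE dc X'c Y'c Z'c.
have E : (fun t => set_val (c t) : 'rV[R]_3) = fun t => triple (X t) (Y t) (Z t).
  apply/funext => t; apply/rowP => j; rewrite mxE.
  have [<- <- <-] := cE t.
  by case: j => -[|[|[|//]]] jP /=; congr (_ _ _); apply/val_inj.
have D t : derivable (fun t => triple (X t) (Y t) (Z t)) t 1.
  apply/derivable_mxP => i j; have [h1 h2 h3] := dc t.
  rewrite (_ : (fun x => _) = [:: X; Y; Z]`_j); last first.
    by apply/funext => x; rewrite mxE; case: j => -[|[|[|//]]].
  by case: j => -[|[|[|//]]] jP /=; [case: h1|case: h2|case: h3].
have V t : velocity c t = triple (X' t) (Y' t) (Z' t).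
  rewrite /velocity E derive1E derive_mx //; apply/matrixP => i j; rewrite !mxE.
  have [h1 h2 h3] := dc t.
  rewrite (_ : (fun x => _) = [:: X; Y; Z]`_j); last first.
    by apply/funext => x; rewrite mxE; case: j => -[|[|[|//]]].
  by case: j => -[|[|[|//]]] jP /=; [case: h1|case: h2|case: h3].
split; last exact: V.
split; first by rewrite E; exact: D.
rewrite (_ : velocity c = fun t => triple (X' t) (Y' t) (Z' t)); last exact/funext.
rewrite /triple; cont; by case: j => -[|[|[|//]]] jP /=; cont.
Qed.

Lemma derive_quotient (f : 'rV[R]_3 -> R) (p v : 'rV[R]_3) (g : R -> R) :
  (forall h, f (h *: v + p) - f p = h * g h) -> continuous g -> 'D_v f p = g 0.
Proof.
move=> fg gc; rewrite /derive; apply: cvg_lim => //.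
have : g h @[h --> 0^'] --> g 0 by apply: cvg_within_filter; exact: gc.
apply: cvg_trans; apply: near_eq_cvg; near=> h.
rewrite /= fg /GRing.scale /= mulrA mulVf ?mul1r //.
by near: h; exact: nbhs_dnbhs_neq.
Unshelve. all: by end_near. Qed.

End Derivatives.

Section Intersections.
Variable R : realType.
Notation Sigma := (Sigma3 R).
Implicit Types (c d : loop R Sigma).
Notation hc := (hc R).

Lemma triple_eta (A : 'rV[R]_3) : A = triple (A 0 0) (A 0 1) (A 0 2).
Proof.
by apply/rowP => j; rewrite mxE; case: j => -[|[|[|//]]] jP /=; congr (_ _ _); apply/val_inj.
Qed.

Lemma det_triple (a b c x y z u v w : R) :
  \det (\matrix_(i < 3) [:: triple a b c; triple x y z; triple u v w]`_i) =
    a * (y * w - z * v) - b * (x * w - z * u) + c * (x * v - y * u).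
Proof.
rewrite (expand_det_row _ ord0) !big_ord_recl big_ord0 /cofactor.
rewrite !(expand_det_row _ ord0) !big_ord_recl !big_ord0 /cofactor !det_mx11 !mxE /=.
by rewrite /bump /= !addn0 expr0 expr1; ring.
Qed.

Lemma inter_one c d t0 u0 (s : int) : t0 \in `[0, 1[ -> u0 \in `[0, 1[ -> c t0 = d u0 ->
  (forall t u, t \in `[0, 1[ -> u \in `[0, 1[ -> c t = d u -> t = t0 /\ u = u0) ->
  (forall t u, c t = d u -> sgz (orientation_det c d t u) = s) -> s != 0 ->
  transverse c d /\ intersection_number c d = s.
Proof.
move=> t0I u0I cd uniq sE s0; split=> [t u /sE h|].
  by rewrite -sgz_eq0 h.
rewrite /intersection_number (_ : [set _ | _] = [set (t0, u0)]).
  by rewrite fsbig_set1 sE.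
apply/seteqP; split=> -[t u] /=; last by case=> -> ->.
by case=> tI uI /(uniq _ _ tI uI)[-> ->].
Qed.

Lemma inter_none c d : (forall t u, c t <> d u) ->
  transverse c d /\ intersection_number c d = 0.
Proof.
move=> cd; split=> [t u /cd//|].
rewrite /intersection_number (_ : [set _ | _] = set0) ?fsbig_set0 //.
by apply/seteqP; split=> // -[t u] [_ _ /cd].
Qed.

(** What remains of [domain_eq] on the x-axis once the two factors vanishing at the ends of the
    [i]-th gap are removed. *)
Definition Qpoly (i : nat) : {poly R} := match i with
  | 0 => (5%:P - 'X) * (- ('X + 2%:P)) * (1%:P - 'X) * (- ('X + 1%:P)) * (4%:P - 'X) * (2%:P - 'X)
  | 1 => (5%:P - 'X) * (5%:P + 'X) * ('X + 4%:P) * (1%:P - 'X) * (4%:P - 'X) * (2%:P - 'X)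
  | 2 => (5%:P - 'X) * (5%:P + 'X) * ('X + 2%:P) * ('X + 4%:P) * ('X + 1%:P) * (4%:P - 'X)
  | _ => (5%:P + 'X) * ('X + 2%:P) * ('X + 4%:P) * ('X - 1%:P) * ('X + 1%:P) * ('X - 2%:P)
  end.

Lemma QpolyE i (x : R) : (i <= 3)%N ->
  domain_eq x 0 = (x - (hc i - 2)) * ((hc i - 1) - x) * (Qpoly i).[x].
Proof.
case: i => [|[|[|[|//]]]] _; rewrite domain_eqE /Qpoly /hc !(hornerM, hornerD, hornerN, hornerX, hornerC); ring.
Qed.

Lemma Qpoly_gt0 i (x : R) : (i <= 3)%N -> hc i - 2 <= x <= hc i - 1 -> 0 < (Qpoly i).[x].
Proof.
case: i => [|[|[|[|//]]]] _; rewrite /Qpoly /hc !(hornerM, hornerD, hornerN, hornerX, hornerC) => h;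
  by repeat (apply: mulr_gt0); lra.
Qed.

Lemma normal_axis i (w : R) : (i <= 3)%N -> w = hc i - 2 \/ w = hc i - 1 ->
  normal (triple w 0 0) 0 0 = (2 * w - (2 * hc i - 3)) * (Qpoly i).[w].
Proof.
move=> i3 wE; rewrite mxE.
rewrite (@derive_quotient R _ _ _
  (fun h => ((h + w) + w - (2 * hc i - 3)) * (Qpoly i).[h + w])).
- by rewrite add0r; congr (_ * _); ring.
- move=> h; have E k : (h *: 'e_0 + triple w 0 0 : 'rV[R]_3) 0 k = h * (k == 0)%:R + triple w 0 0 0 k.
    by rewrite !mxE /=.
  rewrite /surface_eq !E /triple !mxE /= !(mulr0, mulr1, add0r).
  rewrite !(QpolyE _ i3).
  by case: wE => ->; ring.
- have hQ := @continuous_horner R (Qpoly i).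
  by cont.
Qed.

(** On the axis the two end factors multiply to $(\sin/2)^2$, so the signed root becomes $\sin/2$
    times a smooth positive function. This removes the apparent singularity of the even curves at
    the fixed points. *)
Definition Zeven i (t : R) : R := sint t / 2 * Num.sqrt (Qpoly i).[hc i - 3 / 2 + cost t / 2].

Lemma hc_itv i (t : R) : hc i - 2 <= hc i - 3 / 2 + cost t / 2 <= hc i - 1.
Proof. by have := cost_itv t; lra. Qed.

Lemma Qpoly_pos i (t : R) : (i <= 3)%N -> 0 < (Qpoly i).[hc i - 3 / 2 + cost t / 2].
Proof. by move=> i3; apply: Qpoly_gt0 => //; exact: hc_itv. Qed.

Lemma ZevenE i (t : R) : (i <= 3)%N ->
  Num.sg (sint t) * Num.sqrt (domain_eq (hc i - 3 / 2 + cost t / 2) 0) = Zeven i t.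
Proof.
move=> i3; rewrite (QpolyE _ i3).
have -> : (hc i - 3 / 2 + cost t / 2 - (hc i - 2)) *
    (hc i - 1 - (hc i - 3 / 2 + cost t / 2)) = (sint t / 2) ^+ 2.
  have h : sint t ^+ 2 = 1 - cost t ^+ 2 by rewrite -[1](cost2Dsint2 t); ring.
  by rewrite exprMn h; field.
rewrite sqrtrM ?sqr_ge0 // sqrtr_sqr normrM (ger0_norm (_ : 0 <= 2^-1)); last by lra.
by rewrite /Zeven !mulrA mulr_sg_norm.
Qed.

(** For even curves the velocity is recorded only where the sine vanishes: these are the fixed
    points, where chain curves cross. *)
Lemma cc_C1 (k : 'I_7) : exists2 v : R -> R * R * R, (C1_loop (cc R k) /\ forall t, velocity (cc R k) t = triple (v t).1.1 (v t).1.2 (v t).2)%type &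
  forall t, if odd k then v t = (- (pi *+ 2 * sint t), pi *+ 2 * cost t, 0)
    else sint t = 0 -> v t = (0, 0, pi * cost t * Num.sqrt (Qpoly k./2).[cx (cc R k t)]).
Proof.
case ko : (odd k).
  exists (fun t => (- (pi *+ 2 * sint t), pi *+ 2 * cost t, 0)) => //=.
  apply: (@C1_triple _ _ (fun t => hc k./2 + cost t) (@sint R) (fun=> 0)).
  - by move=> t; exact: cc_odd.
  - move=> t; split; [|exact: is_deriv_sint|exact: is_deriv_cst].
    by apply: (is_derive_eq (is_derivD (is_deriv_cst _ _) (is_deriv_cost _))); rewrite add0r.
  - by cont.
  - by cont.
  - by cont.
set i := k./2.
have i3 : (i <= 3)%N by rewrite /i; have := ltn_ord k; lia.
pose x (t : R) := hc i - 3 / 2 + cost t / 2.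
pose x' (t : R) := - (pi * sint t).
have dx t : is_derive t (1 : R) x (x' t).
  apply: (is_derive_eq (is_derivD (is_deriv_cst _ _) (is_derivM (is_deriv_cost t) (is_deriv_cst _ _)))).
  by rewrite /x' mulr2n; field.
pose z' (t : R) := sint t / 2 * ((2 * Num.sqrt (Qpoly i).[x t])^-1 * ((Qpoly i)^`().[x t] * x' t)) +
   Num.sqrt (Qpoly i).[x t] * (pi * cost t).
have Qp t : 0 < (Qpoly i).[x t] by exact: Qpoly_pos.
have ccE' t : [/\ cx (cc R k t) = x t, cy (cc R k t) = 0 & cz (cc R k t) = Zeven i t].
  by have [-> -> ->] := @cc_even R k t (negbT ko); rewrite ZevenE.
exists (fun t => (x' t, 0, z' t)) => /=; last first.
  move=> t s0; rewrite /x' /z' s0 mulr0 oppr0 !mul0r add0r; have [-> _ _] := ccE' t.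
  by rewrite mulrC.
have cQ := @continuous_horner R (Qpoly i).
have cQ' := @continuous_horner R (Qpoly i)^`().
apply: (@C1_triple _ _ x (fun=> 0) (Zeven i)); first exact: ccE'.
- move=> t; split; [exact: dx|exact: is_deriv_cst|].
  have d1 : is_derive t (1 : R) (fun t => sint t / 2) (pi * cost t).
    apply: (is_derive_eq (is_derivM (is_deriv_sint t) (is_deriv_cst _ _))).
    by rewrite mulr2n; field.
  have d2 : is_derive t (1 : R) (fun t => (Qpoly i).[x t]) ((Qpoly i)^`().[x t] * x' t).
    exact: (is_derive1_comp (is_derive_poly (Qpoly i) (x t)) (dx t)).
  have d3 := @is_derive1_comp _ Num.sqrt (fun t : R => (Qpoly i).[x t]) t _ _ (is_derive1_sqrt (Qp t)) d2.
  exact: (is_derivM d1 d3).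
- by rewrite /x'; cont.
- by cont.
- rewrite /z' /x' /x; cont.
  by rewrite mulf_neq0 ?pnatr_eq0 // sqrtr_eq0 -ltNge; exact: Qp.
Qed.

Lemma hcS i : hc i.+1 = hc i + 3.
Proof. by rewrite /hc -natr1; ring. Qed.

Lemma adj_meet (k l : 'I_7) (t u : R) : l = k.+1 :> nat -> cc R k t = cc R l u ->
  [/\ cost t = 1, sint t = 0, cost u = -1 & sint u = 0].
Proof.
move=> lk E; have := cost_itv t; have := cost_itv u => ci cj.
have E1 : cx (cc R k t) = cx (cc R l u) by rewrite E.
have E2 : cy (cc R k t) = cy (cc R l u) by rewrite E.
have E3 : cz (cc R k t) = cz (cc R l u) by rewrite E.
case ko : (odd k).
  have lo : ~~ odd l by rewrite lk /= ko.
  have [x1 y1 _] := @cc_odd R k t ko; have [x2 y2 _] := @cc_even R l u lo.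
  move: E1 E2; rewrite x1 x2 y1 y2 (_ : l./2 = (k./2).+1) ?hcS; last by lia.
  clear lk E E3; move=> E1 s0; have [c1|c1] := sint0_cost s0; last by lra.
  have c2 : cost u = -1 by lra.
  by split=> //; have := cost2Dsint2 u; rewrite c2 => h; apply/eqP; rewrite -sqrf_eq0; apply/eqP; lra.
have lo : odd l by rewrite lk /= ko.
have [x1 y1 _] := @cc_even R k t (negbT ko); have [x2 y2 _] := @cc_odd R l u lo.
move: E1 E2; rewrite x1 x2 y1 y2 (_ : l./2 = k./2); last by lia.
clear lk E E3; move=> E1 /esym s0; have [c1|c1] := sint0_cost s0; first by lra.
have c2 : cost t = 1 by lra.
by split=> //; have := cost2Dsint2 t; rewrite c2 => h; apply/eqP; rewrite -sqrf_eq0; apply/eqP; lra.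
Qed.

Lemma normal_meet (k l : 'I_7) (t u : R) : l = k.+1 :> nat -> cc R k t = cc R l u ->
  exists n1 n2, normal (set_val (cc R k t)) =
    triple ((-1) ^+ odd k * (Qpoly (if odd k then l else k)./2).[cx (cc R k t)]) n1 n2.
Proof.
move=> lk E; have [c1 s1 c2 s2] := adj_meet lk E.
exists (normal (set_val (cc R k t)) 0 1), (normal (set_val (cc R k t)) 0 2).
rewrite [LHS]triple_eta; congr (triple _ _ _).
have -> : set_val (cc R k t) = triple (cx (cc R k t)) 0 0.
  rewrite [LHS]triple_eta; congr (triple _ _ _); rewrite -/(cy _) -/(cz _).
    by case ko : (odd k); [have [_ -> _] := @cc_odd R k t ko|have [_ -> _] := @cc_even R k t (negbT ko)].
  by case ko : (odd k); [have [_ _ ->] := @cc_odd R k t ko|have [_ _ ->] := @cc_even R k t (negbT ko); rewrite s1 sgr0 mul0r].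
case ko : (odd k).
  have [-> _ _] := @cc_odd R k t ko; rewrite c1.
  have h : hc k./2 + 1 = hc l./2 - 2 by rewrite (_ : l./2 = (k./2).+1) ?hcS; [lra|lia].
  rewrite (normal_axis (i := l./2)); [|by have := ltn_ord l; lia|by left].
  by rewrite h expr1; congr (_ * _); lra.
have [-> _ _] := @cc_even R k t (negbT ko); rewrite c1.
have h : hc k./2 - 3 / 2 + 1 / 2 = hc k./2 - 1 by lra.
rewrite (normal_axis (i := k./2)); [|by have := ltn_ord k; lia|by right].
by rewrite h expr0; congr (_ * _); lra.
Qed.

(** At the common point both velocities are orthogonal to the x-axis, one along [y] and one along
    [z], so only the first component of the normal enters the determinant. *)
Lemma adj_sign (k l : 'I_7) (t u : R) : l = k.+1 :> nat -> cc R k t = cc R l u ->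
  sgz (orientation_det (cc R k) (cc R l) t u) = 1 /\
  sgz (orientation_det (cc R l) (cc R k) u t) = -1.
Proof.
move=> lk E; have [c1 s1 c2 s2] := adj_meet lk E.
have [n1 [n2 nE]] := normal_meet lk E.
have [v [_ vE] vv] := cc_C1 k; have [w [_ wE] ww] := cc_C1 l.
have := vv t; have := ww u; rewrite /orientation_det -E nE vE wE !det_triple.
have lo : odd l = ~~ odd k by rewrite lk.
have Qx : 0 < (Qpoly (if odd k then l else k)./2).[cx (cc R k t)].
  apply: Qpoly_gt0; first by case: ifP => _; [have := ltn_ord l|have := ltn_ord k]; lia.
  case ko : (odd k).
    have [-> _ _] := @cc_odd R k t ko; rewrite c1 (_ : l./2 = (k./2).+1) ?hcS; last by lia.
    by clear lk; lra.
  by have [-> _ _] := @cc_even R k t (negbT ko); rewrite c1; clear lk; lra.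
have Sx : 0 < Num.sqrt (Qpoly (if odd k then l else k)./2).[cx (cc R k t)] by rewrite sqrtr_gt0.
move: Qx Sx; rewrite lo s1 s2 c1 c2 => {nE}.
clear E; set P := cx (cc R k t); clearbody P.
move=> a0 b0.
have p0 := @pi_gt0 R.
have ab : 0 < (Qpoly (if odd k then l else k)./2).[P] *
    (pi *+ 2 * (pi * Num.sqrt (Qpoly (if odd k then l else k)./2).[P])).
  by rewrite !mulr_gt0 // mulr2n addr_gt0.
clear lk lo vv ww; case ko : (odd k) a0 b0 ab => /= a0 b0 ab.
  move=> /(_ erefl)-> -> /=.
  by split; [apply: gtr0_sgz|apply: ltr0_sgz]; lra.
move=> -> /(_ erefl)-> /=.
by split; [apply: gtr0_sgz|apply: ltr0_sgz]; lra.
Qed.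

Lemma unit_cost1 (t : R) : t \in `[0, 1[ -> cost t = 1 -> t = 0.
Proof.
rewrite in_itv /= => ht /cost_eq1/intrP[n tn].
move: ht; rewrite tn -[0]/(0%:~R : R) -[1]/(1%:~R : R) ler_int ltr_int => h.
by congr (_%:~R); lia.
Qed.

Lemma unit_costN1 (t : R) : t \in `[0, 1[ -> cost t = -1 -> sint t = 0 -> t = 2^-1.
Proof.
move=> ht ct st.
have h : t - 2^-1 \is a Num.int by apply: turn_inj; rewrite ?cost_half ?sint_half.
move: ht; rewrite in_itv /=; have /intrP[n tn] := h; have -> : t = n%:~R + 2^-1 by rewrite -tn; lra.
move=> ht; suff -> : n = 0 by rewrite add0r.
have /andP[] : -1 < (n%:~R : R) < 1 by lra.
by rewrite -[-1]/(-(1%:~R : R)) -mulrNz ltr_int ltrz1; lia.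
Qed.

Lemma adj_number (k l : 'I_7) : l = k.+1 :> nat ->
  [/\ transverse (cc R k) (cc R l), transverse (cc R l) (cc R k),
      intersection_number (cc R k) (cc R l) = 1 & intersection_number (cc R l) (cc R k) = -1].
Proof.
move=> lk.
have I0 : (0 : R) \in `[0, 1[ by rewrite in_itv /=; lra.
have Ih : (2^-1 : R) \in `[0, 1[ by rewrite in_itv /=; lra.
have meet : cc R k 0 = cc R l 2^-1.
  case ko : (odd k).
    have lo : ~~ odd l by rewrite lk /= ko.
    have [x1 y1 z1] := @cc_odd R k 0 ko; have [x2 y2 z2] := @cc_even R l 2^-1 lo.
    apply: Sigma_eq; rewrite ?x1 ?x2 ?y1 ?y2 ?z1 ?z2 ?sint_half ?sint0 ?cost0 ?cost_half ?sgr0 ?mul0r //.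
    by rewrite (_ : l./2 = (k./2).+1) ?hcS; [lra|lia].
  have lo : odd l by rewrite lk /= ko.
  have [x1 y1 z1] := @cc_even R k 0 (negbT ko); have [x2 y2 z2] := @cc_odd R l 2^-1 lo.
  apply: Sigma_eq; rewrite ?x1 ?x2 ?y1 ?y2 ?z1 ?z2 ?sint_half ?sint0 ?cost0 ?cost_half ?sgr0 ?mul0r //.
  by rewrite (_ : l./2 = k./2); [lra|lia].
have [||//|T1 N1] := @inter_one (cc R k) (cc R l) 0 2^-1 1 I0 Ih meet.
- move=> t u tI uI E; have [c1 s1 c2 s2] := adj_meet lk E.
  by split; [exact: unit_cost1|exact: unit_costN1].
- by move=> t u /(adj_sign lk)[].
have [||//|T2 N2] := @inter_one (cc R l) (cc R k) 2^-1 0 (-1) Ih I0 (esym meet).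
- move=> t u tI uI /esym E; have [c1 s1 c2 s2] := adj_meet lk E.
  by split; [exact: unit_costN1|exact: unit_cost1].
- by move=> t u /esym/(adj_sign lk)[].
by [].
Qed.

Lemma far_disjoint (k l : 'I_7) t u : (k.+1 < l)%N -> cc R k t <> cc R l u.
Proof.
move=> kl E.
have E1 : cx (cc R k t) = cx (cc R l u) by rewrite E.
have E2 : cy (cc R k t) = cy (cc R l u) by rewrite E.
have := cost_itv t; have := cost_itv u; have := cost2Dsint2 t; have := cost2Dsint2 u.
case ko : (odd k); case lo : (odd l).
- have [x1 y1 _] := @cc_odd R k t ko; have [x2 y2 _] := @cc_odd R l u lo.
  have := @hc_lt R k./2 l./2; rewrite (_ : (k./2 < l./2)%N = true); last by lia.
  by move/(_ erefl); lra.
- have [x1 y1 _] := @cc_odd R k t ko; have [x2 y2 _] := @cc_even R l u (negbT lo).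
  have := @hc_lt R (k./2).+1 l./2; rewrite (_ : (_ < l./2)%N = true) ?hcS; last by lia.
  by move/(_ erefl); lra.
- have [x1 y1 _] := @cc_even R k t (negbT ko); have [x2 y2 _] := @cc_odd R l u lo.
  have := @hc_lt R k./2 l./2; rewrite (_ : (k./2 < l./2)%N = true); last by lia.
  by move/(_ erefl); lra.
- have [x1 y1 _] := @cc_even R k t (negbT ko); have [x2 y2 _] := @cc_even R l u (negbT lo).
  have := @hc_lt R k./2 l./2; rewrite (_ : (k./2 < l./2)%N = true); last by lia.
  by move/(_ erefl); lra.
Qed.

Lemma outer_subproof1 : continuous (fun t : R => surf (5 * cost t) (5 * sint t) (0 : R)).
Proof.
apply: surf_continuous; [|by cont|by cont|by cont].
move=> t; rewrite domain_eqE.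
have -> : 25 - ((5 * cost t) ^+ 2 + (5 * sint t) ^+ 2) = 0 :> R.
  by rewrite !exprMn -mulrDr cost2Dsint2; ring.
by rewrite mul0r expr0n.
Qed.

Lemma outer_subproof2 (t : R) :
  surf (5 * cost (t + 1)) (5 * sint (t + 1)) (0 : R) = surf (5 * cost t) (5 * sint t) 0.
Proof. by rewrite -[1]/(1%:~R) costDz sintDz. Qed.

(** Outer boundary circle of the planar domain. It is homologous to the sum of the odd chain curves
    and disjoint from each, which gives their self-intersections. *)
Definition outer : loop R Sigma := Loop outer_subproof1 outer_subproof2.

Lemma outerE t : [/\ cx (outer t) = 5 * cost t, cy (outer t) = 5 * sint t & cz (outer t) = 0].
Proof.
apply: surfE; rewrite domain_eqE.
have -> : 25 - ((5 * cost t) ^+ 2 + (5 * sint t) ^+ 2) = 0 :> R.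
  by rewrite !exprMn -mulrDr cost2Dsint2; ring.
by rewrite mul0r expr0n.
Qed.

Lemma outer_C1 : C1_loop outer.
Proof.
have [|||||//] := @C1_triple R outer (fun t => 5 * cost t) (fun t => 5 * sint t) (fun=> 0)
  (fun t => 5 * - (pi *+ 2 * sint t)) (fun t => 5 * (pi *+ 2 * cost t)) (fun=> 0).
- exact: outerE.
- move=> t; split; last exact: is_deriv_cst.
    by apply: (is_derive_eq (is_derivM (is_deriv_cst _ _) (is_deriv_cost _))); rewrite mulr0 addr0.
  by apply: (is_derive_eq (is_derivM (is_deriv_cst _ _) (is_deriv_sint _))); rewrite mulr0 addr0.
- by cont.
- by cont.
- by cont.
Qed.

Lemma lam_outer0 : lam 0 (loop_class outer) = -1.
Proof.
apply: (deg_cross_left (a := fun t => clamp 1 (10 * sint t))); first exact: dual_circ.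
- by cont.
- by rewrite div1r sint_quarter clamp_out1 //; lra.
- by rewrite sint_3quarter clamp_outN1 //; lra.
- move=> t ht; rewrite /dual /dualf /chU /chtau /= /gap_U /gap_tau.
  have [-> -> _] := outerE t.
  case: ifP => hU; first by rewrite (_ : 2 * (5 * sint t) = 10 * sint t); [rewrite subrr|ring].
  rewrite sub0r rpredN; apply: clamp_half_int.
  have h : -3/5 <= cost t.
    by move: hU => /negbT; rewrite negb_and -!leNgt /hc; have := cost_itv t => ? /orP[]; lra.
  have h0 := cost_le0 ht; have := cost2Dsint2 t.
  rewrite -(@ler_pXn2r _ 2) ?nnegrE // expr1n real_normK ?num_real //; nra.
- move=> t ht; rewrite /dual /dualf /chU /chtau /= /gap_U.
  have [-> _ _] := outerE t; have h0 := cost_ge0 ht.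
  by rewrite /hc (_ : (_ && _) = false) ?rpred0 //; apply/negbTE/negP; lra.
Qed.

Lemma lam_outer (k : nat) : (0 < k < 6)%N -> lam k (loop_class outer) = 0.
Proof.
move=> k6; apply/eqP; rewrite -(intr_eq0 R) (@deg_loop _ _ _ _ (fun=> 0)) ?subrr //.
- by apply: dual_circ; lia.
- by cont.
move=> t _; rewrite sub0r rpredN; apply: dual_int; rewrite /chU /chtau.
have [xE yE _] := outerE t; have h1 := cost2Dsint2 t; have h2 := cost_itv t.
case ko : (odd k).
  rewrite /hole_U xE yE.
  have [|->|->|->] := @hc3 R k./2; [lia| | |] => h; exfalso; nra.
rewrite /gap_U /gap_tau xE yE => h.
have h3 : -3/5 <= cost t <= 3/5.
  have : (k == 2 \/ k == 4)%N by lia.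
  by case=> /eqP kE; move: h; rewrite kE /hc /=; lra.
by rewrite -(@ler_pXn2r _ 2) ?nnegrE // expr1n real_normK ?num_real //; nra.
Qed.

End Intersections.

(** * The intersection form on the chain classes, and its duality with the degrees *)

Section IntersectionForm.
Variable R : realType.
Notation Sigma := (Sigma3 R).
Notation H := (H1 R Sigma).
Notation ch := (@ch R).
Variable dot : H -> H -> int.
Hypothesis dotP : intersection_form dot.
Hypothesis rank6 : exists e : 'I_6 -> H, Zbasis setT e.

Lemma dotD h h' k : dot (h + h') k = dot h k + dot h' k.
Proof. by have [[+ _] _] := dotP; apply. Qed.

Lemma dotDr h h' k : dot k (h + h') = dot k h + dot k h'.
Proof. by have [[_ +] _] := dotP; apply. Qed.

Lemma dot0 k : dot 0 k = 0.
Proof. by apply/(@addIr _ (dot 0 k)); rewrite -dotD !add0r. Qed.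

Lemma dotN h k : dot (- h) k = - dot h k.
Proof. by apply/eqP; rewrite -subr_eq0 opprK -dotD addNr dot0. Qed.

Lemma dotMz h k n : dot (h *~ n) k = n * dot h k.
Proof.
have hn m : dot (h *+ m) k = m%:Z * dot h k.
  by elim: m => [|m IH]; rewrite ?mulr0n ?dot0 ?mul0r // mulrS dotD IH intS mulrDl mul1r.
by case: n => n; [exact: hn|rewrite NegzE mulrNz dotN mulNr -pmulrn hn].
Qed.

Lemma dot_sum (I : finType) (P : pred I) (F : I -> H) k :
  dot (\sum_(i | P i) F i) k = \sum_(i | P i) dot (F i) k.
Proof.
by elim/big_rec2: _ => [|i x y _ <-]; rewrite ?dot0 ?dotD.
Qed.

Lemma ccC1 k : C1_loop (cc R k).
Proof. by have [v []] := cc_C1 R k. Qed.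

Lemma o7E k : (k < 7)%N -> o7 k = k :> nat.
Proof. by move=> k7; rewrite /o7 inordK. Qed.

Lemma dot_ch_adj k : (k < 6)%N -> dot (ch k) (ch k.+1) = 1 /\ dot (ch k.+1) (ch k) = -1.
Proof.
move=> k6; have [|T1 T2 N1 N2] := (@adj_number R (o7 k) (o7 k.+1)); first by rewrite !o7E //; lia.
have [_ dN] := dotP.
by rewrite /ch !dN //; exact: ccC1.
Qed.

Lemma dot_ch_far k l : (k.+1 < l < 7)%N -> dot (ch k) (ch l) = 0 /\ dot (ch l) (ch k) = 0.
Proof.
move=> kl; have h : ((o7 k).+1 < o7 l)%N by rewrite !o7E //; lia.
have [|T1 N1] := @inter_none R (cc R (o7 k)) (cc R (o7 l)); first by move=> t u; exact: far_disjoint.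
have [|T2 N2] := @inter_none R (cc R (o7 l)) (cc R (o7 k)).
  by move=> t u /esym; exact: far_disjoint.
by have [_ dN] := dotP; rewrite /ch !dN //; exact: ccC1.
Qed.

Lemma outer_class : loop_class (outer R) = ch 1 + ch 3 + ch 5.
Proof.
apply: (lam_inj rank6) => k; have k7 : (k < 7)%N by exact: ltn_trans (ltn_ord k) _.
rewrite !lamD // !lam_ch //.
case: k k7 => -[|k] /= k6 _; first by rewrite lam_outer0.
by rewrite lam_outer; [case: k k6 => [|[|[|[|[|//]]]]]|lia].
Qed.

Lemma dot_outer k : (k < 7)%N -> odd k -> dot (loop_class (outer R)) (ch k) = 0.
Proof.
move=> k7 ko; have [|T1 N1] := @inter_none R (outer R) (cc R (o7 k)).
  move=> t u E; have ok : odd (o7 k) by rewrite o7E.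
  have [xE yE _] := outerE t; have [x2 y2 _] := @cc_odd R (o7 k) u ok.
  move: xE yE; rewrite E x2 y2 => xE yE.
  have := cost2Dsint2 t; have := cost2Dsint2 u; have := cost_itv t; have := cost_itv u.
  have : [\/ hc R (o7 k)./2 = -3, hc R (o7 k)./2 = 0 | hc R (o7 k)./2 = 3] by apply: hc3; rewrite o7E; lia.
  by move: xE => /[swap] -[] ->  xE ????; clear E ok; nra.
by have [_ dN] := dotP; rewrite /ch dN //; [exact: outer_C1|exact: ccC1].
Qed.

(** Intersection numbers need transverse loops, so a curve is not compared with itself but with a
    homologous combination: the outer circle minus the other odd curves, or the relation [ch6] for
    the even ones. *)
Lemma dot_ch_self k : (k < 7)%N -> dot (ch k) (ch k) = 0.
Proof.
have far j l : (j.+1 < l < 7)%N -> dot (ch j) (ch l) = 0 by case/dot_ch_far.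
have far' j l : (j.+1 < l < 7)%N -> dot (ch l) (ch j) = 0 by case/dot_ch_far.
move=> k7; case ko : (odd k).
  have := dot_outer k7 ko; rewrite outer_class !dotD.
  move: k7 ko; case: k => [|[|[|[|[|[|[|k]]]]]]] // _ _.
  - by rewrite (far' 1%N 3%N) // (far' 1%N 5%N) // !addr0.
  - by rewrite (far 1%N 3%N) // (far' 3%N 5%N) // !addr0 add0r.
  - by rewrite (far 1%N 5%N) // (far 3%N 5%N) // !add0r.
have c6 j : dot (ch 6) (ch j) = - (dot (ch 0) (ch j) + dot (ch 2) (ch j) + dot (ch 4) (ch j)).
  by rewrite (ch6 rank6) dotN !dotD.
move: k7 ko; case: k => [|[|[|[|[|[|[|k]]]]]]] // _ _.
- by have /eqP := c6 0%N; rewrite (far' 0%N 6%N) // (far' 0%N 2%N) // (far' 0%N 4%N) // !addr0 eq_sym oppr_eq0 => /eqP.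
- by have /eqP := c6 2%N; rewrite (far' 2%N 6%N) // (far 0%N 2%N) // (far' 2%N 4%N) // addr0 add0r eq_sym oppr_eq0 => /eqP.
- by have /eqP := c6 4%N; rewrite (far' 4%N 6%N) // (far 0%N 4%N) // (far 2%N 4%N) // !add0r eq_sym oppr_eq0 => /eqP.
- by rewrite c6 (far 0%N 6%N) // (far 2%N 6%N) // (far 4%N 6%N) // !addr0 oppr0.
Qed.

Lemma dot_ch j k : (j < 7)%N -> (k < 7)%N -> dot (ch j) (ch k) = lamc k j.
Proof.
move=> j7 k7; rewrite /lamc.
case: eqP => [kj|kj]; first by rewrite kj; have [|->] := @dot_ch_adj j; first lia.
case: eqP => [jk|jk]; first by rewrite jk; have [|_ ->] := @dot_ch_adj k; first lia.
have [jk'|kj'|->] := ltngtP j k; last exact: dot_ch_self.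
- by have [|->] := @dot_ch_far j k; first lia.
- by have [|_ ->] := @dot_ch_far k j; first lia.
Qed.

(** Poincare duality: both sides are additive and agree on the chain classes, of which the dual
    classes are combinations. *)
Lemma lam_dot k h : (k < 7)%N -> lam k h = dot h (ch k).
Proof.
move=> k7; rewrite {1 2}(coordE rank6 h) lam_sum // dot_sum; apply: eq_bigr => j _.
rewrite lamMz // dotMz; congr (_ * _); rewrite /dual_class.
have lE (F : pred 'I_6) : lam k (\sum_(i < 6 | F i) ch i) = dot (\sum_(i < 6 | F i) ch i) (ch k).
  rewrite big_mkcond lam_sum // dot_sum; apply: eq_bigr => i _.
  case: ifP => _; last by rewrite lam0 // dot0.
  have i7 := ltn_trans (ltn_ord i) (ltnSn 6).
  by rewrite lam_ch // dot_ch.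
by case: ifP => _; rewrite ?lamN ?dotN ?lE.
Qed.

End IntersectionForm.

(** * Orbits of integral vectors under the transvections *)

Section Orbits.

Definition vec6 := (int * int * int * int * int * int)%type.
Implicit Types (v w : vec6) (B : vec6 -> Prop).

(* The action of the transvection along the [k]th chain curve, in the symplectic
   basis [a1, b1, a2, b2, a3, b3]. *)
Definition mv (k : nat) v : vec6 :=
  let: (x1, y1, x2, y2, x3, y3) := v in
  match k with
  | 0 => (x1 - y1, y1, x2, y2, x3, y3)
  | 1 => (x1, y1 + x1, x2, y2, x3, y3)
  | 2 => (x1 - (y1 - y2), y1, x2 + (y1 - y2), y2, x3, y3)
  | 3 => (x1, y1, x2, y2 + x2, x3, y3)
  | 4 => (x1, y1, x2 - (y2 - y3), y2, x3 + (y2 - y3), y3)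
  | 5 => (x1, y1, x2, y2, x3, y3 + x3)
  | _ => (x1, y1, x2, y2, x3 - y3, y3)
  end.

Definition invariant_mv n B := forall k, (k < n)%N -> forall v, B (mv k v) <-> B v.

(** Being in the same orbit, phrased as agreement of all invariant predicates: an equivalence
    relation by construction, and directly applicable to transport a property. Only the first [n]
    moves are allowed. *)
Definition reach n v w := forall B, invariant_mv n B -> (B v <-> B w).

Lemma reach_refl n v : reach n v v. Proof. by []. Qed.

Lemma reach_eq n v w : v = w -> reach n v w. Proof. by move=> ->. Qed.

Lemma reach_trans n v w u : reach n v w -> reach n w u -> reach n v u.
Proof. by move=> h1 h2 B iB; rewrite (h1 B iB) (h2 B iB). Qed.

Lemma reach_sym n v w : reach n v w -> reach n w v.
Proof. by move=> h B iB; rewrite (h B iB). Qed.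

Lemma reach_mv n k v : (k < n)%N -> reach n v (mv k v).
Proof. by move=> kn B iB; split=> /iB; apply. Qed.

Lemma reach_le m n v w : (m <= n)%N -> reach m v w -> reach n v w.
Proof. by move=> mn h B iB; apply: h => k km; apply: iB; exact: leq_trans km mn. Qed.

Lemma reach_iter n (f : int -> vec6) : (forall j, reach n (f j) (f (j + 1))) ->
  forall j, reach n (f 0) (f j).
Proof.
move=> h; elim/int_rect => [|j IH|j IH]; first exact: reach_refl.
  by apply: reach_trans IH _; rewrite -addn1 PoszD; exact: h.
apply: reach_trans IH _; apply: reach_sym; have := h (- (j.+1%:Z)).
by rewrite (_ : - j.+1%:Z + 1 = - j%:Z) //; lia.
Qed.

Variable n : nat.
Hypothesis n4 : (4 <= n)%N.
Notation "v ~> w" := (reach n v w) (at level 70).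

Lemma reach0 x1 y1 x2 y2 x3 y3 j :
  (x1, y1, x2, y2, x3, y3) ~> (x1 + j * y1, y1, x2, y2, x3, y3).
Proof.
have := @reach_iter n (fun j => (x1 + j * y1, y1, x2, y2, x3, y3)).
move=> /(_ _ j); rewrite mul0r addr0; apply=> i; apply: reach_sym.
have := @reach_mv n 0 (x1 + (i + 1) * y1, y1, x2, y2, x3, y3).
by rewrite /= mulrDl mul1r addrA addrK; apply; lia.
Qed.

Lemma reach1 x1 y1 x2 y2 x3 y3 j :
  (x1, y1, x2, y2, x3, y3) ~> (x1, y1 + j * x1, x2, y2, x3, y3).
Proof.
have := @reach_iter n (fun j => (x1, y1 + j * x1, x2, y2, x3, y3)).
move=> /(_ _ j); rewrite mul0r addr0; apply=> i.
have := @reach_mv n 1 (x1, y1 + i * x1, x2, y2, x3, y3).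
by rewrite /= mulrDl mul1r addrA; apply; lia.
Qed.

Lemma reach2 x1 y1 x2 y2 x3 y3 j :
  (x1, y1, x2, y2, x3, y3) ~>
  (x1 - j * (y1 - y2), y1, x2 + j * (y1 - y2), y2, x3, y3).
Proof.
have := @reach_iter n (fun j => (x1 - j * (y1 - y2), y1, x2 + j * (y1 - y2), y2, x3, y3)).
move=> /(_ _ j); rewrite mul0r addr0 subr0; apply=> i.
have := @reach_mv n 2 (x1 - i * (y1 - y2), y1, x2 + i * (y1 - y2), y2, x3, y3).
move=> h; apply: reach_trans (h _) _; first lia.
by apply: reach_eq; rewrite /mv; congr (_, _, _, _, _, _); ring.
Qed.

Lemma reach3 x1 y1 x2 y2 x3 y3 j :
  (x1, y1, x2, y2, x3, y3) ~> (x1, y1, x2, y2 + j * x2, x3, y3).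
Proof.
have := @reach_iter n (fun j => (x1, y1, x2, y2 + j * x2, x3, y3)).
move=> /(_ _ j); rewrite mul0r addr0; apply=> i.
have := @reach_mv n 3 (x1, y1, x2, y2 + i * x2, x3, y3).
by rewrite /= mulrDl mul1r addrA; apply; lia.
Qed.

Local Ltac veq := apply: reach_eq; congr (_, _, _, _, _, _); try by lia.

Definition smaller (y1 : int) v := exists x1 y1' x2 y2 x3 y3,
  0 < y1' < y1 /\ v ~> (x1, y1', x2, y2, x3, y3).

Lemma smaller_trans y1 v w : v ~> w -> smaller y1 w -> smaller y1 v.
Proof.
move=> vw [x [y [z [t [s [r [h1 h2]]]]]]]; exists x, y, z, t, s, r; split=> //.
exact: reach_trans vw h2.
Qed.

(** Euclidean step: reduce [x1] modulo [y1] to a nonzero remainder, then subtract it from [y1]. The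
    lemmas that follow push a coordinate not divisible by [y1] along the chain until the failure
    reaches [x1]. *)
Lemma smaller_x1 x1 y1 x2 y2 x3 y3 : 0 < y1 -> ~~ (y1 %| x1)%Z ->
  smaller y1 (x1, y1, x2, y2, x3, y3).
Proof.
move=> y0 ndiv; apply: smaller_trans (reach0 _ _ _ _ _ _ (- (x1 %/ y1)%Z)) _.
have -> : x1 + - (x1 %/ y1)%Z * y1 = (x1 %% y1)%Z by rewrite {1}(divz_eq x1 y1); lia.
have rlt : 0 < (x1 %% y1)%Z < y1.
  rewrite ltz_pmod // andbT lt_neqAle modz_ge0; last by lia.
  by rewrite andbT eq_sym; apply: contraNneq ndiv => h; apply/dvdz_mod0P.
exists (x1 %% y1)%Z, (y1 - (x1 %% y1)%Z), x2, y2, x3, y3; split; first by lia.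
apply: reach_trans (reach1 _ _ _ _ _ _ (-1)) _; veq.
Qed.

Lemma smaller_y2 x1 y1 x2 y2 x3 y3 : 0 < y1 -> ~~ (y1 %| y2)%Z ->
  smaller y1 (x1, y1, x2, y2, x3, y3).
Proof.
move=> y0 ndiv; have [d1|] := boolP (y1 %| x1)%Z; last exact: smaller_x1.
apply: smaller_trans (reach2 _ _ _ _ _ _ 1) _; rewrite mul1r.
apply: smaller_x1 => //; apply: contraNN ndiv => h.
by rewrite (_ : y2 = (x1 - (y1 - y2)) - x1 + y1); [apply: rpredD; [exact: rpredB|exact: dvdzz]|ring].
Qed.

Lemma smaller_x2 x1 y1 x2 y2 x3 y3 : 0 < y1 -> ~~ (y1 %| x2)%Z ->
  smaller y1 (x1, y1, x2, y2, x3, y3).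
Proof.
move=> y0 ndiv; have [d1|] := boolP (y1 %| y2)%Z; last exact: smaller_y2.
apply: smaller_trans (reach3 _ _ _ _ _ _ 1) _; rewrite mul1r.
apply: smaller_y2 => //; apply: contraNN ndiv => h.
by rewrite (_ : x2 = (y2 + x2) - y2); [exact: rpredB|ring].
Qed.

Lemma smaller_y3 x1 y1 x2 y2 x3 y3 : (7 <= n)%N -> 0 < y1 -> ~~ (y1 %| y3)%Z ->
  smaller y1 (x1, y1, x2, y2, x3, y3).
Proof.
move=> n7 y0 ndiv; have [d2|] := boolP (y1 %| x2)%Z; last exact: smaller_x2.
have [d1|] := boolP (y1 %| y2)%Z; last exact: smaller_y2.
apply: smaller_trans (@reach_mv n 4 _ _) _; first by lia.
apply: smaller_x2 => //; apply: contraNN ndiv => h.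
by rewrite (_ : y3 = (x2 - (y2 - y3)) - x2 + y2); [apply: rpredD; [exact: rpredB|]|ring].
Qed.

Lemma smaller_x3 x1 y1 x2 y2 x3 y3 : (7 <= n)%N -> 0 < y1 -> ~~ (y1 %| x3)%Z ->
  smaller y1 (x1, y1, x2, y2, x3, y3).
Proof.
move=> n7 y0 ndiv; have [d2|] := boolP (y1 %| y3)%Z; last exact: smaller_y3.
apply: smaller_trans (@reach_mv n 5 _ _) _; first by lia.
apply: smaller_y3 => //; apply: contraNN ndiv => h.
by rewrite (_ : x3 = (y3 + x3) - y3); [exact: rpredB|ring].
Qed.

(** A Bezout relation, over the first two planes when the moves are confined to them and over all
    six coordinates otherwise. *)
Definition primitive v := let: (x1, y1, x2, y2, x3, y3) := v in
  if (7 <= n)%N then exists k1 l1 k2 l2 k3 l3, k1 * x1 + l1 * y1 + k2 * x2 + l2 * y2 + k3 * x3 + l3 * y3 = 1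
  else exists k1 l1 k2 l2, k1 * x1 + l1 * y1 + k2 * x2 + l2 * y2 = 1.

Lemma primitive_mv : n = 4 \/ n = 7 -> invariant_mv n primitive.
Proof.
move=> n47 k kn [[[[[x1 y1] x2] y2] x3] y3]; rewrite /primitive.
case: n47 => nE; rewrite nE /= in kn *.
  case: k kn => [|[|[|[|//]]]] _; split=> -[k1 [l1 [k2 [l2 h]]]].
  - by exists k1, (l1 - k1), k2, l2; lia.
  - by exists k1, (l1 + k1), k2, l2; lia.
  - by exists (k1 + l1), l1, k2, l2; lia.
  - by exists (k1 - l1), l1, k2, l2; lia.
  - by exists k1, (l1 - k1 + k2), k2, (l2 + k1 - k2); lia.
  - by exists k1, (l1 + k1 - k2), k2, (l2 - k1 + k2); lia.
  - by exists k1, l1, (k2 + l2), l2; lia.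
  - by exists k1, l1, (k2 - l2), l2; lia.
case: k kn => [|[|[|[|[|[|[|//]]]]]]] _; split=> -[k1 [l1 [k2 [l2 [k3 [l3 h]]]]]].
- by exists k1, (l1 - k1), k2, l2, k3, l3; lia.
- by exists k1, (l1 + k1), k2, l2, k3, l3; lia.
- by exists (k1 + l1), l1, k2, l2, k3, l3; lia.
- by exists (k1 - l1), l1, k2, l2, k3, l3; lia.
- by exists k1, (l1 - k1 + k2), k2, (l2 + k1 - k2), k3, l3; lia.
- by exists k1, (l1 + k1 - k2), k2, (l2 - k1 + k2), k3, l3; lia.
- by exists k1, l1, (k2 + l2), l2, k3, l3; lia.
- by exists k1, l1, (k2 - l2), l2, k3, l3; lia.
- by exists k1, l1, k2, (l2 - k2 + k3), k3, (l3 + k2 - k3); lia.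
- by exists k1, l1, k2, (l2 + k2 - k3), k3, (l3 - k2 + k3); lia.
- by exists k1, l1, k2, l2, (k3 + l3), l3; lia.
- by exists k1, l1, k2, l2, (k3 - l3), l3; lia.
- by exists k1, l1, k2, l2, k3, (l3 - k3); lia.
- by exists k1, l1, k2, l2, k3, (l3 + k3); lia.
Qed.

Definition positive v := exists x1 y1 x2 y2 x3 y3, 0 < y1 /\ v ~> (x1, y1, x2, y2, x3, y3).

Lemma positive_trans v w : v ~> w -> positive w -> positive v.
Proof.
move=> vw [x [y [z [t [s [r [h1 h2]]]]]]]; exists x, y, z, t, s, r; split=> //.
exact: reach_trans vw h2.
Qed.

Lemma positive_y1 (x1 y1 x2 y2 x3 y3 : int) : y1 != 0 -> positive (x1, y1, x2, y2, x3, y3).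
Proof.
move=> ynz; have [yp|yn] := ltP 0 y1; first by exists x1, y1, x2, y2, x3, y3.
pose a := x1 + - (`|x1| + 1) * y1.
have a0 : 0 < a by rewrite /a; nia.
exists a, (y1 + (`|y1| + 1) * a), x2, y2, x3, y3; split; first by nia.
by apply: reach_trans (reach0 _ _ _ _ _ _ (- (`|x1| + 1))) _; exact: reach1.
Qed.

Lemma positive_x1 (x1 y1 x2 y2 x3 y3 : int) : x1 != 0 -> positive (x1, y1, x2, y2, x3, y3).
Proof.
move=> xnz; have [->|] := eqVneq y1 0; last exact: positive_y1.
by apply: positive_trans (reach1 _ _ _ _ _ _ 1) _; apply: positive_y1; lia.
Qed.

Lemma positive_y2 (x1 y1 x2 y2 x3 y3 : int) : y2 != 0 -> positive (x1, y1, x2, y2, x3, y3).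
Proof.
move=> ynz; have [->|] := eqVneq y1 0; last exact: positive_y1.
have [->|] := eqVneq x1 0; last exact: positive_x1.
by apply: positive_trans (reach2 _ _ _ _ _ _ 1) _; apply: positive_x1; lia.
Qed.

Lemma positive_x2 (x1 y1 x2 y2 x3 y3 : int) : x2 != 0 -> positive (x1, y1, x2, y2, x3, y3).
Proof.
move=> xnz; have [->|] := eqVneq y2 0; last exact: positive_y2.
by apply: positive_trans (reach3 _ _ _ _ _ _ 1) _; apply: positive_y2; lia.
Qed.

Lemma positive_y3 (x1 y1 x2 y2 x3 y3 : int) : (7 <= n)%N -> y3 != 0 ->
  positive (x1, y1, x2, y2, x3, y3).
Proof.
move=> n7 ynz; have [->|] := eqVneq x2 0; last exact: positive_x2.
have [->|] := eqVneq y2 0; last exact: positive_y2.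
apply: positive_trans (@reach_mv n 4 _ _) _; first by lia.
by apply: positive_x2; lia.
Qed.

Lemma positive_x3 (x1 y1 x2 y2 x3 y3 : int) : (7 <= n)%N -> x3 != 0 ->
  positive (x1, y1, x2, y2, x3, y3).
Proof.
move=> n7 ynz; have [->|] := eqVneq y3 0; last exact: positive_y3.
apply: positive_trans (@reach_mv n 5 _ _) _; first by lia.
by apply: positive_y3; lia.
Qed.

Lemma primitive_positive v : primitive v -> positive v.
Proof.
case: v => [[[[[x1 y1] x2] y2] x3] y3]; rewrite /primitive => pv.
have [x10|] := eqVneq x1 0; last exact: positive_x1.
have [y10|] := eqVneq y1 0; last exact: positive_y1.
have [x20|] := eqVneq x2 0; last exact: positive_x2.
have [y20|] := eqVneq y2 0; last exact: positive_y2.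
move: pv; case: ifP => n7 pv; last by case: pv => k1 [l1 [k2 [l2]]]; rewrite x10 y10 x20 y20; lia.
have [x30|] := eqVneq x3 0; last exact: positive_x3.
have [y30|] := eqVneq y3 0; last exact: positive_y3.
by case: pv => k1 [l1 [k2 [l2 [k3 [l3]]]]]; rewrite x10 y10 x20 y20 x30 y30; lia.
Qed.

Lemma primitive_smaller (x1 y1 x2 y2 x3 y3 : int) : 1 < y1 -> primitive (x1, y1, x2, y2, x3, y3) ->
  smaller y1 (x1, y1, x2, y2, x3, y3).
Proof.
move=> yp; have y0 : 0 < y1 by lia.
have nd (z : int) : (y1 %| z)%Z -> z = 1 -> False.
  by move=> + z1; rewrite z1 dvdz1 => /eqP; lia.
have [d1|h _] := boolP (y1 %| x1)%Z; last exact: smaller_x1.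
have [d2|h _] := boolP (y1 %| y2)%Z; last exact: smaller_y2.
have [d3|h _] := boolP (y1 %| x2)%Z; last exact: smaller_x2.
rewrite /primitive; case: ifP => n7 pv; last first.
  case: pv => k1 [l1 [k2 [l2]]] /nd; case.
  by do ![apply: rpredD]; apply: dvdz_mull.
have [d4|] := boolP (y1 %| y3)%Z; last exact: smaller_y3.
have [d5|] := boolP (y1 %| x3)%Z; last exact: smaller_x3.
case: pv => k1 [l1 [k2 [l2 [k3 [l3]]]]] /nd; case.
by do ![apply: rpredD]; apply: dvdz_mull.
Qed.

(** Descent on a positive [y1]: if [y1 > 1] divided every relevant coordinate the Bezout relation
    would fail, so the Euclidean steps continue down to 1. *)
Lemma reach_y1 v : n = 4%N \/ n = 7%N -> primitive v ->
  exists x1 x2 y2 x3 y3, v ~> (x1, 1, x2, y2, x3, y3).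
Proof.
move=> n47 pv; have ip := primitive_mv n47.
have [a [m [b [c [d [f [m0 h]]]]]]] := primitive_positive pv.
case: m m0 h => m //; elim/ltn_ind: m a b c d f => m IH a b c d f m0 h.
have [m1|m1] := ltP 1 (m%:Z); last first.
  have m1' : m%:Z = 1 by lia.
  by rewrite m1' in h; exists a, b, c, d, f.
have pw := (h _ ip).1 pv.
have [a' [m' [b' [c' [d' [f' [lt h']]]]]]] := primitive_smaller m1 pw.
case: m' lt h' => m' lt h'; last by lia.
by apply: (IH m' _ a' b' c' d' f'); [lia|lia|exact: reach_trans h h'].
Qed.

(* With [y1 = 1] and, after two moves, [y1 = -1], the move along the second
   chain curve changes [x2] by multiples of [1 - y2] and of [1 + y2]. *)
Lemma reach_x2 (x1 x2 y2 x3 y3 x1' j l : int) :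
  (x1, 1, x2, y2, x3, y3) ~> (x1', 1, x2 + j * (1 - y2) + l * (1 + y2), y2, x3, y3).
Proof.
apply: reach_trans (reach2 _ _ _ _ _ _ j) _.
apply: reach_trans (reach0 _ _ _ _ _ _ (-2 - (x1 - j * (1 - y2)))) _.
apply: reach_trans (reach1 _ _ _ _ _ _ 1) _.
apply: reach_trans (reach2 _ _ _ _ _ _ (- l)) _.
set a := (X in (X, _, _, _, _, _)); set b := (X in (_, X, _, _, _, _)).
have bE : b = -1 by rewrite /b; ring.
rewrite bE.
apply: reach_trans (reach0 _ _ _ _ _ _ (a - 2)) _.
apply: reach_trans (reach1 _ _ _ _ _ _ 1) _.
rewrite [X in (_, X, _, _, _, _)](_ : _ = 1); last by ring.
apply: reach_trans (reach0 _ _ _ _ _ _ (x1' - 2)) _.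
by apply: reach_eq; congr (_, _, _, _, _, _); ring.
Qed.

(** Once [y1 = 1], all that survives of the second plane is the value $y_2 + x_2y_2$ modulo 2 of the
    quadratic form; the boolean is that value. *)
Lemma reach_plane2 (x1 x2 y2 x3 y3 : int) :
  (x1, 1, x2, y2, x3, y3) ~> (0, 1, 0, (~~ (2 %| y2)%Z && (2 %| x2)%Z)%:Z, x3, y3).
Proof.
have ev (x1' x2' y2' x1'' x2'' : int) : (2 %| y2')%Z ->
    (x1', 1, x2', y2', x3, y3) ~> (x1'', 1, x2'', y2', x3, y3).
  move=> /dvdzP[k ->]; apply: reach_trans (reach_x2 _ _ _ _ _ x1'' (- (x2'' - x2') * k) ((x2'' - x2') * (1 - k))) _.
  by apply: reach_eq; congr (_, _, _, _, _, _); ring.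
have even0 (x1' x2' y2' : int) : (2 %| y2')%Z -> (x1', 1, x2', y2', x3, y3) ~> (0, 1, 0, 0, x3, y3).
  move=> d2; apply: reach_trans (ev _ _ _ 0 1 d2) _.
  apply: reach_trans (reach3 _ _ _ _ _ _ (- y2')) _.
  by rewrite mulr1 subrr; apply: ev.
have od (x1' x2' y2' x1'' d : int) :
    (x1', 1, x2', y2', x3, y3) ~> (x1'', 1, x2' + 2 * d, y2', x3, y3).
  apply: reach_trans (reach_x2 _ _ _ _ _ x1'' d d) _.
  by apply: reach_eq; congr (_, _, _, _, _, _); ring.
have [d2|d2] := boolP (2 %| y2)%Z; first exact: even0.
have [d3|d3] := boolP (2 %| x2)%Z; last first.
  apply: reach_trans (reach3 _ _ _ _ _ _ 1) _.
  by apply: even0; lia.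
have [k xE] := dvdzP d3; have [l yE] : exists l, y2 = 2 * l + 1 by exists (y2 %/ 2)%Z; lia.
apply: reach_trans (od _ _ _ 0 (- l - k)) _.
apply: reach_trans (reach3 _ _ _ _ _ _ 1) _.
rewrite [X in (_, _, _, X, _, _)](_ : _ = 1); last by rewrite xE yE; ring.
apply: reach_trans (od _ _ _ 0 l) _.
by apply: reach_eq; congr (_, _, _, _, _, _); rewrite xE; ring.
Qed.

End Orbits.

Lemma intr_F2 (z : int) : (z%:~R : 'F_2) = (~~ (2 %| z)%Z)%:R.
Proof.
have two : (2%:~R : 'F_2) = 0 by apply/val_inj.
have [/dvdzP[k ->]|h] := boolP (2 %| z)%Z; first by rewrite intrM two mulr0.
have -> : z = (z %/ 2)%Z * 2 + 1 by lia.
by rewrite intrD intrM two mulr0 add0r.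
Qed.

(** [omega0] in the coordinates of [mv], expanded from its values on the symplectic basis. *)
Definition qform (v : vec6) : 'F_2 :=
  let: (x1, y1, x2, y2, x3, y3) := v in
  x1%:~R + y1%:~R + x1%:~R * y1%:~R + (y2%:~R + x2%:~R * y2%:~R) +
  (x3%:~R + y3%:~R + x3%:~R * y3%:~R).

Lemma F2_cases (P : 'F_2 -> Prop) : P 0 -> P 1 -> forall a, P a.
Proof.
move=> P0 P1 [[|[|//]] h]; [move: P0|move: P1]; congr P; exact/val_inj.
Qed.

Lemma qform_mv k v : (k < 7)%N -> qform (mv k v) = qform v.
Proof.
move=> k7; case: v => [[[[[x1 y1] x2] y2] x3] y3].
case: k k7 => [|[|[|[|[|[|[|//]]]]]]] _ /=; rewrite ?(intrD, intrN, intrB).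
all: move: (x1%:~R : 'F_2) (y1%:~R : 'F_2) (x2%:~R : 'F_2) (y2%:~R : 'F_2) (x3%:~R : 'F_2) (y3%:~R : 'F_2).
all: by do 6 (apply: F2_cases); apply/val_inj.
Qed.

(** The first four moves leave the third plane alone, so this orbit statement applies while a pair
    in that plane is kept fixed. *)
Lemma orbit4 (x1 y1 x2 y2 : int) :
  (exists k1 l1 k2 l2, k1 * x1 + l1 * y1 + k2 * x2 + l2 * y2 = 1) ->
  qform (x1, y1, x2, y2, 0, 0) = 1 ->
  reach 4 (x1, y1, x2, y2, 0, 0) (0, 1, 0, 0, 0, 0).
Proof.
move=> pv qv; have [a [b [c [d [f h]]]]] := @reach_y1 4 isT (x1, y1, x2, y2, 0, 0) (or_introl erefl) pv.
pose Q v := qform v = 1 /\ let: (x1, y1, x2, y2, x3', y3') := v in x3' = 0 /\ y3' = 0.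
have iQ : invariant_mv 4 Q.
  move=> k k4 v; rewrite /Q qform_mv; last exact: leq_trans k4 _.
  by case: v => [[[[[u1 v1] u2] v2] u3] v3]; case: k k4 => [|[|[|[|//]]]].
have /(h _ iQ)[q [d0 f0]] : Q (x1, y1, x2, y2, 0, 0) by [].
rewrite d0 f0 in h q; apply: reach_trans h _; apply: reach_trans (@reach_plane2 4 isT _ _ _ _ _) _.
apply: reach_eq; congr (_, _, _, _, _, _).
by move: q; rewrite /= !intr_F2; case: (2 %| a)%Z; case: (2 %| b)%Z; case: (2 %| c)%Z.
Qed.

Lemma orbit6 (v : vec6) : primitive 7 v -> qform v = 1 -> reach 7 v (0, 1, 0, 1, 0, 1).
Proof.
move=> pv qv; have [x1 [x2 [y2 [x3 [y3 h]]]]] := @reach_y1 7 isT v (or_intror erefl) pv.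
have red u1 u2 v2 u3 v3 := @reach_le 4 7 _ _ isT (@reach_plane2 4 isT u1 u2 v2 u3 v3).
have x3D u1 v1 u2 v2 u3 v3 j : reach 7 (u1, v1, u2, v2, u3, v3) (u1, v1, u2, v2, u3 + j * v3, v3).
  have := @reach_iter 7 (fun j => (u1, v1, u2, v2, u3 + j * v3, v3)).
  move=> /(_ _ j); rewrite mul0r addr0; apply=> i; apply: reach_sym.
  apply: reach_trans (@reach_mv 7 6 _ isT) _; apply: reach_eq; rewrite /mv.
  by congr (_, _, _, _, _, _); ring.
have y3D u1 v1 u2 v2 u3 v3 j : reach 7 (u1, v1, u2, v2, u3, v3) (u1, v1, u2, v2, u3, v3 + j * u3).
  have := @reach_iter 7 (fun j => (u1, v1, u2, v2, u3, v3 + j * u3)).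
  move=> /(_ _ j); rewrite mul0r addr0; apply=> i.
  apply: reach_trans (@reach_mv 7 5 _ isT) _; apply: reach_eq; rewrite /mv.
  by congr (_, _, _, _, _, _); ring.
have mv4 u1 v1 u2 v2 u3 v3 := @reach_mv 7 4 (u1, v1, u2, v2, u3, v3) isT.
have qinv w : reach 7 v w -> qform w = 1.
  by move=> /(_ (fun w => qform w = 1))[|+ _]; [move=> k k7 u; rewrite qform_mv|apply].
(* From [x3 = 1] the end is near: the third plane becomes [(0, 1)], and [qform] then forces [(0, 1)]
   on the second plane. *)
have fin u1 u2 v2 v3 : reach 7 v (u1, 1, u2, v2, 1, v3) -> reach 7 v (0, 1, 0, 1, 0, 1).
  move=> h1.
  have h2 : reach 7 v (u1, 1, u2, v2, 0, 1).
    apply: reach_trans h1 _.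
    apply: reach_trans (y3D _ _ _ _ _ _ (1 - v3)) _; rewrite mulr1 addrC subrK.
    by apply: reach_trans (x3D _ _ _ _ _ _ (-1)) _; rewrite mulr1 subrr; exact: reach_refl.
  have h3 := reach_trans h2 (red _ _ _ _ _); have := qinv _ h3; move: h3.
  by case: (_ && _).
have := qinv _ h; have h1 := reach_trans h (red _ _ _ _ _).
have [ev|od] := boolP (~~ (2 %| y2)%Z && (2 %| x2)%Z); last first.
  move=> _; rewrite (negbTE od) in h1.
  (* Move 4 adds $y_2-y_3$ to $x_3$, so $y_2 = y_3+1-x_3$ turns $x_3$ into 1. With $x_2 = 1$ odd,
     the second plane reduces to zero whatever $y_2$ is, as required in this case. *)
  have h2 := red 0 1 (y3 + 1 - x3) x3 y3.
  rewrite (_ : (2 %| 1)%Z = false) // andbF in h2.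
  apply: (fin _ _ _ _ (reach_trans h1 (reach_trans (reach_sym h2) _))).
  by apply: reach_trans (mv4 _ _ _ _ _ _) _; apply: reach_eq; congr (_, _, _, _, _, _); ring.
move=> q; rewrite ev in h1.
(* In this case the second plane demands $x_2$ even and $y_2$ odd; [a] and [b] are made odd so that
   $y_2 = b+1-a$ qualifies. *)
have [a [b [h2 [a2 b2]]]] : exists a b, reach 7 v (0, 1, 0, 1, a, b) /\ ~~ (2 %| a)%Z /\ ~~ (2 %| b)%Z.
  have q3 : ~~ ((2 %| x3)%Z && (2 %| y3)%Z).
    by have := qinv _ h1; rewrite /= !intr_F2; case: (2 %| x3)%Z; case: (2 %| y3)%Z.
  have [d|d] := boolP (2 %| y3)%Z.
    exists x3, (y3 + 1 * x3); split; first exact: reach_trans h1 (y3D _ _ _ _ _ _ _).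
    by lia.
  have [d'|d'] := boolP (2 %| x3)%Z; last by exists x3, y3.
  exists (x3 + 1 * y3), y3; split; first exact: reach_trans h1 (x3D _ _ _ _ _ _ _).
  by lia.
have h3 := red 0 0 (b + 1 - a) a b.
rewrite (_ : (2 %| 0)%Z = true) // andbT (_ : ~~ (2 %| b + 1 - a)%Z = true) in h3; last by lia.
apply: (fin _ _ _ _ (reach_trans h2 (reach_trans (reach_sym h3) _))).
by apply: reach_trans (mv4 _ _ _ _ _ _) _; apply: reach_eq; congr (_, _, _, _, _, _); ring.
Qed.

(** * The symplectic basis *)

(** The bases of the three summands are concatenated, indexed by quotient and remainder modulo 2;
    uniqueness of the decomposition gives independence. *)
Lemma splitting_rank6 (H : zmodType) (dot : H -> H -> int) (V : 'I_3 -> set H) :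
  orthogonal_splitting dot V -> exists e : 'I_6 -> H, Zbasis setT e.
Proof.
move=> [bas _ dec].
have [E EP] := choice bas.
have i1 (k : 'I_6) : (k %/ 2 < 3)%N by have := ltn_ord k; lia.
have i2 (k : 'I_6) : (k %% 2 < 2)%N by lia.
pose e (k : 'I_6) := E (Ordinal (i1 k)) (Ordinal (i2 k)).
have sumE (f : 'I_6 -> int) : \sum_k e k *~ f k =
    \sum_(i < 3) \sum_(j < 2) E i j *~ f (inord (i * 2 + j)).
  rewrite !big_ord_recr !big_ord0 /= !add0r !addrA.
  have tm (k : 'I_6) (i : 'I_3) (j : 'I_2) : i = (k %/ 2)%N :> nat -> j = (k %% 2)%N :> nat ->
      e k *~ f k = E i j *~ f (inord (i * 2 + j)).
    move=> ik jk; congr (_ *~ f _); last by apply/val_inj; rewrite /= inordK ik jk -divn_eq.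
    by rewrite /e; congr (E _ _); apply/val_inj.
  by congr (_ + _ + _ + _ + _ + _); apply: tm.
have V0 i : V i 0.
  have [_ ->] := EP i; exists (fun=> 0) => //; rewrite big1 // => j _; exact: mulr0z.
exists e; split.
  move=> f; rewrite sumE => f0.
  have [v [_ uni]] := dec 0.
  have h1 : v = [ffun i => \sum_(j < 2) E i j *~ f (inord (i * 2 + j))].
    apply: uni; split=> [i|]; last by rewrite -[LHS]f0; apply: eq_bigr => i _; rewrite ffunE.
    by rewrite ffunE; have [_ ->] := EP i; exists (fun j : 'I_2 => f (inord (i * 2 + j))).
  have h2 : v = [ffun=> 0].
    by apply: uni; split=> [i|]; [rewrite ffunE|rewrite big1 // => i _; rewrite ffunE].
  move=> k; have [ind _] := EP (Ordinal (i1 k)).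
  have := congr1 (fun g : {ffun 'I_3 -> H} => g (Ordinal (i1 k))) h1; rewrite h2 !ffunE => /esym/ind.
  move=> /(_ (Ordinal (i2 k))); congr (f _ = 0); apply/val_inj; rewrite /= inordK -?divn_eq //.
apply/seteqP; split=> // h _.
have [v [[vV ->] _]] := dec h.
have cf i : exists g : 'I_2 -> int, v i = \sum_j E i j *~ g j.
  by have := vV i; have [_ ->] := EP i; move=> [g _ <-]; exists g.
have [g gP] := choice cf.
exists (fun k => g (Ordinal (i1 k)) (Ordinal (i2 k))) => //.
rewrite sumE; apply: eq_bigr => i _; rewrite gP; apply: eq_bigr => j _.
have k6 : (i * 2 + j < 6)%N by have := ltn_ord i; have := ltn_ord j; lia.
congr (_ *~ g _ _); apply/val_inj; rewrite /= inordK //; have := ltn_ord j; lia.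
Qed.

Section AlphaBeta.
Variable R : realType.
Notation Sigma := (Sigma3 R).
Notation H := (H1 R Sigma).
Notation ch := (@ch R).
Notation hc := (hc R).
Variable dot : H -> H -> int.
Hypothesis dotP : intersection_form dot.
Hypothesis rank6 : exists e : 'I_6 -> H, Zbasis setT e.

Lemma lam_loop0 k (c : loop R Sigma) : (k < 7)%N ->
  (forall t, chU k (c t) -> 1 <= `|chtau k (c t)|) -> lam k (loop_class c) = 0.
Proof.
move=> k7 h; apply/eqP; rewrite -(intr_eq0 R) (@deg_loop _ _ _ _ (fun=> 0)) ?subrr //.
- exact: dual_circ.
- by cont.
by move=> t _; rewrite sub0r rpredN; apply: dual_int; exact: h.
Qed.

(** The classes $a_1,a_2,a_3$ up to sign: the even chain curves left of a hole add up to a class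
    that meets, among the odd curves, only the one around that hole. *)
Definition aa (i : nat) : H :=
  match i with 0 => ch 0 | 1 => ch 0 + ch 2 | _ => ch 0 + ch 2 + ch 4 end.
Definition bb (i : nat) : H := ch i.*2.+1.

Lemma hole_centerE (i : 'I_3) : hole_center R i = hc i.
Proof. by []. Qed.

Lemma lam_alpha (k : nat) (i : 'I_3) (c : loop R Sigma) : (forall t, cx (c t) = hc i) ->
  (k < 6)%N -> k != i.*2.+1 -> lam k (loop_class c) = 0.
Proof.
move=> cE k6 ki; apply: lam_loop0; first exact: leq_trans k6 _.
move=> t; rewrite /chU /chtau; have xt := cE t.
case ko : (odd k).
  rewrite /hole_U xt => h; exfalso.
  have ik : i <> k./2 :> nat by move=> E; move: ki; rewrite E; lia.
  have : (i < k./2 \/ k./2 < i)%N by lia.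
  have y2 := sqr_ge0 (cy (c t)).
  by clear cE; case=> /(@hc_lt R); nra.
rewrite /gap_U xt => h; exfalso.
have : (i < k./2 \/ k./2 <= i)%N by lia.
clear cE; case=> [/(@hc_lt R)|]; first by lra.
rewrite leq_eqVlt => /orP[/eqP E|/(@hc_lt R)]; last by lra.
by rewrite E in h; lra.
Qed.

Lemma lam_beta_odd (k : nat) (i : 'I_3) (c : loop R Sigma) : is_beta i c -> (k < 6)%N -> odd k ->
  lam k (loop_class c) = 0.
Proof.
move=> [_ cE] k6 ko; have k7 : (k < 7)%N by exact: leq_trans k6 _.
have pt t : cz (c t) = 0 /\ (cx (c t) - hc i) ^+ 2 + cy (c t) ^+ 2 = 1.
  have : range c (c t) by exists t.
  by rewrite cE /= hole_centerE.
have [ik|ik] := eqVneq (i : nat) k./2.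
  apply/eqP; rewrite -(intr_eq0 R) (@deg_loop _ _ _ _ (fun=> 1/2)) ?subrr //.
  - exact: dual_circ.
  - by cont.
  move=> t _; have [zt xt] := pt t.
  rewrite /dual /dualf /chU /chtau ko /hole_U /hole_tau -ik xt zt sgr0 mul0r mulr0 clamp0.
  by rewrite ifT ?add0r ?subrr //; lra.
apply: lam_loop0 => // t; have [zt xt] := pt t.
rewrite /chU ko /hole_U => h; exfalso.
have : (i < k./2 \/ k./2 < i)%N by lia.
have X1 : -1 <= cx (c t) - hc i <= 1 by clear cE pt; nra.
by clear cE pt; case=> /(@hc_lt R) h2; nra.
Qed.

Lemma lam_beta_even (j : nat) (i : 'I_3) (c : loop R Sigma) : is_beta i c -> (j < 4)%N -> j != i -> j != i.+1 ->
  lam j.*2 (loop_class c) = 0.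
Proof.
move=> [_ cE] j4 ji ji1; apply: lam_loop0; first by lia.
move=> t; have [zt xt] : cz (c t) = 0 /\ (cx (c t) - hc i) ^+ 2 + cy (c t) ^+ 2 = 1.
  have : range c (c t) by exists t.
  by rewrite cE /= hole_centerE.
rewrite /chU odd_double doubleK /gap_U => h; exfalso.
have : (j < i \/ i.+1 < j)%N by lia.
by clear cE; case=> /(@hc_lt R); rewrite ?hcS => h2; nra.
Qed.

Lemma sum_even_lam (h : H) : lam 0 h + lam 2 h + lam 4 h + lam 6 h = 0.
Proof.
rewrite !(lam_dot dotP rank6) // -!(dotDr dotP) (ch6 rank6) subrr.
by apply/(@addIr _ (dot h 0)); rewrite -(dotDr dotP) !add0r.
Qed.

Lemma lam_aa (k i : nat) : (k < 6)%N -> (i < 3)%N -> lam k (aa i) = (k == i.*2.+1)%:R.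
Proof.
move=> k6 i3; have k7 : (k < 7)%N by exact: leq_trans k6 _.
case: i i3 => [|[|[|//]]] _; rewrite /= ?lamD // !lam_ch //;
by case: k k6 k7 => [|[|[|[|[|[|//]]]]]].
Qed.

Lemma alpha_class (i : 'I_3) (c : loop R Sigma) : (forall t, cx (c t) = hc i) ->
  loop_class c = aa i *~ lam i.*2.+1 (loop_class c).
Proof.
move=> ac; apply: (lam_inj rank6) => k; have k7 : (k < 7)%N by exact: ltn_trans (ltn_ord k) _.
rewrite lamMz // lam_aa //.
by case: eqVneq => [->|ki]; rewrite ?mulr1 // (lam_alpha ac) // mulr0.
Qed.

Lemma beta_class (i : 'I_3) (c : loop R Sigma) : is_beta i c ->
  loop_class c = bb i *~ lam i.*2.+2 (loop_class c).
Proof.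
move=> bc; apply: (lam_inj rank6) => k; have k7 : (k < 7)%N by exact: ltn_trans (ltn_ord k) _.
have i3 := ltn_ord i; rewrite lamMz // /bb lam_ch //; last by lia.
case ko : (odd k); first by rewrite (lam_beta_odd bc) // /lamc ifF ?ifF ?mulr0 //; lia.
rewrite /lamc; case: eqP => [->|k1]; first by rewrite mulr1.
have ev : ~~ odd k by rewrite ko.
rewrite -(even_halfK ev); case: eqP => [[/(congr1 half)]|k2].
  rewrite !doubleK => ik; have := sum_even_lam (loop_class c).
  have z j := @lam_beta_even j i c bc.
  rewrite -[0%N]/(0.*2) -[2%N]/(1.*2) -[4%N]/(2.*2) -[6%N]/(3.*2) -doubleS -ik.
  case: (nat_of_ord i) i3 z => [|[|[|//]]] _ z.
  - by rewrite (z 2%N) // (z 3%N) //; lia.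
  - by rewrite (z 0%N) // (z 3%N) //; lia.
  - by rewrite (z 0%N) // (z 1%N) //; lia.
rewrite (lam_beta_even bc) ?mulr0 //; have := ltn_ord k; lia.
Qed.

Lemma dot_aa_bb i : (i < 3)%N -> dot (aa i) (bb i) = 1.
Proof.
by case: i => [|[|[|//]]] _; rewrite /aa /bb /= ?(dotD dotP) !(dot_ch dotP rank6).
Qed.

Lemma dotMr k n h : dot k (h *~ n) = n * dot k h.
Proof.
have d0 : dot k 0 = 0 by apply/(@addIr _ (dot k 0)); rewrite -(dotDr dotP) !add0r.
have hn m : dot k (h *+ m) = m%:Z * dot k h.
  by elim: m => [|m IH]; rewrite ?mulr0n ?d0 ?mul0r // mulrS (dotDr dotP) IH intS mulrDl mul1r.
have dN x : dot k (- x) = - dot k x.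
  by apply/eqP; rewrite -subr_eq0 opprK -(dotDr dotP) addNr d0.
by case: n => n; [exact: hn|rewrite NegzE mulrNz dN mulNr -pmulrn hn].
Qed.

(** [is_alpha] and [is_beta] leave orientations free. The loops are multiples of [aa i] and [bb i],
    and intersection number 1 forces both multipliers to be the same sign. *)
Lemma alpha_beta_unit (i : 'I_3) (c d : loop R Sigma) : is_alpha i c -> is_beta i d ->
  dot (loop_class c) (loop_class d) = 1 ->
  exists2 n : int, `|n|%N = 1%N & loop_class c = aa i *~ n /\ loop_class d = bb i *~ n.
Proof.
move=> [_ [p _ cE] _] bd; rewrite (@alpha_class i c); last first.
  move=> t; have : range c (c t) by exists t.
  by rewrite cE => /connected_component_sub; rewrite /= -hole_centerE.
rewrite (beta_class bd).
set n := lam _ (loop_class c); set m := lam _ (loop_class d).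
rewrite (dotMz dotP) dotMr dot_aa_bb // mulr1 => nm.
have : (n = 1 /\ m = 1 \/ n = -1 /\ m = -1).
  have /eqP : `|n|%N == 1%N by have := congr1 absz nm; rewrite abszM => /eqP; rewrite muln_eq1 => /andP[].
  move=> n1; have [nE|nE] : n = 1 \/ n = -1 by lia.
    by left; rewrite nE in nm *; lia.
  by right; rewrite nE in nm *; lia.
by case=> -[-> ->]; [exists 1|exists (-1)].
Qed.

Section Omega.
Variable w : H -> 'F_2.
Hypothesis wP : Sp_quadratic dot w.

Lemma omega0E : w 0 = 0.
Proof.
have [+ _] := wP 0 0; rewrite addr0 (dot0 dotP) addr0 => /eqP.
by rewrite -subr_eq subrr eq_sym => /eqP.
Qed.

Lemma omegaN h : w (- h) = w h.
Proof. by have [_ +] := wP 0 h; rewrite sub0r omega0E add0r (dot0 dotP) addr0. Qed.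

Lemma omega_unit h (n : int) : `|n|%N = 1%N -> w (h *~ n) = w h.
Proof.
move=> n1; have [->|->] : n = 1 \/ n = -1 by lia.
  by rewrite mulr1z.
by rewrite mulrN1z omegaN.
Qed.

Hypothesis w_aa : forall i, (i < 3)%N -> w (aa i) = (i != 1%N)%:R.
Hypothesis w_bb : forall i, (i < 3)%N -> w (bb i) = 1.

(** The inner even curves are differences of consecutive [aa], which are mutually orthogonal with
    values 1, 0, 1. Value 1 is what makes the twists preserve [w]. *)
Lemma omega_ch k : (k < 7)%N -> w (ch k) = 1.
Proof.
move=> k7; case ko : (odd k).
  by rewrite (_ : k = k./2.*2.+1); [apply: w_bb|]; lia.
have B h h' : w (h - h') = w h + w h' + (dot h h')%:~R by have [] := wP h h'.
case: k k7 ko => [|[|[|[|[|[|[|//]]]]]]] // _ _.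
- exact: (w_aa (i := 0)).
- rewrite (_ : ch 2 = aa 1 - aa 0); last by rewrite /aa addrC addKr.
  by rewrite B !w_aa // /aa (dotD dotP) !(dot_ch dotP rank6) //; exact/val_inj.
- rewrite (_ : ch 4 = aa 2 - aa 1); last by rewrite /aa [_ + ch 4]addrC addrK.
  by rewrite B !w_aa // /aa !(dotD dotP) !(dotDr dotP) !(dot_ch dotP rank6) //; exact/val_inj.
- by rewrite (ch6 rank6) omegaN -/(aa 2) w_aa.
Qed.

End Omega.
End AlphaBeta.

(** * Transitivity on pairs of planes *)

Section Transitivity.
Variable R : realType.
Notation Sigma := (Sigma3 R).
Notation H := (H1 R Sigma).
Notation ch := (@ch R).
Notation aa := (@aa R).
Variable dot : H -> H -> int.
Hypothesis dotP : intersection_form dot.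
Hypothesis rank6 : exists e : 'I_6 -> H, Zbasis setT e.

Lemma gen_ind (P : H -> Prop) : P 0 -> (forall x y, P x -> P y -> P (x + y)) ->
  (forall x, P x -> P (- x)) -> (forall k, (k < 6)%N -> P (ch k)) -> forall h, P h.
Proof.
move=> P0 PD PN Pc h; rewrite (coordE rank6 h); apply: big_ind => // j _.
have PM x n : P x -> P (x *~ n).
  move=> Px; have Pn m : P (x *+ m) by elim: m => [|m IH]; rewrite ?mulr0n // mulrS; exact: PD.
  by case: n => n; [exact: Pn|rewrite NegzE mulrNz; apply: PN; exact: Pn].
apply: PM; rewrite /dual_class; case: ifP => _; [|apply: PN]; apply: big_ind => // i _; exact: Pc.
Qed.

Lemma dot0r k : dot k 0 = 0.
Proof. by apply/(@addIr _ (dot k 0)); rewrite -(dotDr dotP) !add0r. Qed.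

Lemma dotNr k h : dot k (- h) = - dot k h.
Proof. by apply/eqP; rewrite -subr_eq0 opprK -(dotDr dotP) addNr dot0r. Qed.

Lemma dotC h k : dot h k = - dot k h.
Proof.
elim/gen_ind: h => [|x y IHx IHy|x IH|i i6].
- by rewrite (dot0 dotP) dot0r oppr0.
- by rewrite (dotD dotP) (dotDr dotP) IHx IHy opprD.
- by rewrite (dotN dotP) dotNr IH.
elim/gen_ind: k => [|x y IHx IHy|x IH|j j6].
- by rewrite (dot0 dotP) dot0r oppr0.
- by rewrite (dotD dotP) (dotDr dotP) IHx IHy opprD.
- by rewrite (dotN dotP) dotNr IH.
rewrite !(dot_ch dotP rank6) /lamc; [|lia..].
by case: eqP => ij; case: eqP => ji //; lia.
Qed.

Lemma dotxx h : dot h h = 0.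
Proof. by have := dotC h h; lia. Qed.

Definition vec (v : vec6) : H := let: (x1, y1, x2, y2, x3, y3) := v in
  ch 0 *~ x1 + ch 1 *~ y1 + (aa 1 *~ x2 + ch 3 *~ y2) + (aa 2 *~ x3 + ch 5 *~ y3).

Definition lamv (k : nat) (v : vec6) : int := let: (x1, y1, x2, y2, x3, y3) := v in
  match k with 0 => - y1 | 1 => x1 | 2 => y1 - y2 | 3 => x2 | 4 => y2 - y3 | 5 => x3 | _ => y3 end.

Lemma lam_vec k v : (k < 7)%N -> lam k (vec v) = lamv k v.
Proof.
case: v => [[[[[x1 y1] x2] y2] x3] y3] k7.
rewrite /vec /aa !lamD // !lamMz // !lamD // !lam_ch //.
by case: k k7 => [|[|[|[|[|[|[|//]]]]]]] _ /=; rewrite /lamc /=; lia.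
Qed.

Definition coords (h : H) : vec6 :=
  (lam 1 h, - lam 0 h, lam 3 h, - lam 0 h - lam 2 h, lam 5 h, - lam 0 h - lam 2 h - lam 4 h).

Lemma coordsK h : vec (coords h) = h.
Proof.
apply: (lam_inj rank6) => k; rewrite lam_vec; last by exact: ltn_trans (ltn_ord k) _.
by case: k => -[|[|[|[|[|[|//]]]]]] kP /=; lia.
Qed.

Definition tv (u h : H) : H := h + u *~ dot h u.

Lemma tv_mv k v : (k < 7)%N -> tv (ch k) (vec v) = vec (mv k v).
Proof.
move=> k7; apply: (lam_inj rank6) => j; have j7 : (j < 7)%N by exact: ltn_trans (ltn_ord j) _.
rewrite /tv -(lam_dot dotP rank6) // lamD // lamMz // !lam_vec // lam_ch //.
case: v => [[[[[x1 y1] x2] y2] x3] y3].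
by case: j j7 => -[|[|[|[|[|[|//]]]]]] /= _ _; case: k k7 => [|[|[|[|[|[|[|//]]]]]]] _ /=; rewrite /lamc /=; lia.
Qed.

Lemma tv_dot u h k : dot (tv u h) (tv u k) = dot h k.
Proof.
rewrite /tv !(dotD dotP) !(dotDr dotP) !(dotMz dotP) !(dotMr dotP) dotxx.
by rewrite (dotC u k); ring.
Qed.

Lemma tv_inv u h : tv u (h - u *~ dot h u) = h.
Proof. by rewrite /tv (dotD dotP) (dotN dotP) (dotMz dotP) dotxx mulr0 subr0 subrK. Qed.

Lemma tvD u h k : tv u (h + k) = tv u h + tv u k.
Proof. by rewrite /tv (dotD dotP) mulrzDr addrACA. Qed.

Lemma tvMz u h n : tv u (h *~ n) = tv u h *~ n.
Proof. by rewrite /tv (dotMz dotP) mulrzDl mulrC mulrzA. Qed.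

(** Conjugation formula: the transvection along $T_u v$ is $T_uT_vT_u^{-1}$. *)
Lemma tv_tv u v h : tv (tv u v) (tv u h) = tv u (tv v h).
Proof. by rewrite {1}/tv tv_dot [in RHS]/(tv v h) tvD tvMz. Qed.

Lemma tv_fix u h : dot h u = 0 -> tv u h = h.
Proof. by rewrite /tv => ->; rewrite mulr0z addr0. Qed.

Variable w : H -> 'F_2.
Hypothesis wP : Sp_quadratic dot w.
Hypothesis w_aa : forall i, (i < 3)%N -> w (aa i) = (i != 1%N)%:R.
Hypothesis w_ch : forall k, (k < 7)%N -> w (ch k) = 1.

Lemma wD x y : w (x + y) = w x + w y + (dot x y)%:~R. Proof. by have [] := wP x y. Qed.

Lemma wMz x n : w (x *~ n) = n%:~R * w x.
Proof.
have hn m : w (x *+ m) = m%:R * w x.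
  elim: m => [|m IH]; first by rewrite mulr0n mul0r (omega0E dotP wP).
  have d0 : dot (x *+ m) x = 0 by rewrite pmulrn (dotMz dotP) dotxx mulr0.
  by rewrite mulrSr wD IH -natr1 mulrDl mul1r d0 addr0.
case: n => n; first by rewrite -pmulrn hn.
rewrite NegzE mulrNz (omegaN dotP wP) -pmulrn hn mulrNz mulNr.
by move: (n.+1%:R * w x); apply: F2_cases; apply/val_inj.
Qed.

Lemma w_vec v : w (vec v) = qform v.
Proof.
case: v => [[[[[x1 y1] x2] y2] x3] y3]; rewrite /vec /qform.
have wa1 : w (aa 1) = 0 by rewrite w_aa.
have wa2 : w (aa 2) = 1 by rewrite w_aa.
rewrite !wD !wMz !w_ch // wa1 wa2 !(dotD dotP) !(dotDr dotP) !(dotMz dotP) !(dotMr dotP) /aa.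
rewrite !(dotD dotP) !(dotDr dotP) !(dot_ch dotP rank6) // /lamc /= !(intrD, intrM).
move: (x1%:~R : 'F_2) (y1%:~R : 'F_2) (x2%:~R : 'F_2) (y2%:~R : 'F_2) (x3%:~R : 'F_2) (y3%:~R : 'F_2) => *.
by rewrite ?mulr0z ?mulr1z ?mulrN1z; ring.
Qed.

Lemma w_tv u h : w u = 1 -> w (tv u h) = w h.
Proof.
move=> u1; rewrite /tv wD wMz u1 (dotMr dotP) intrM mulr1.
by move: (w h) ((dot h u)%:~R : 'F_2); do 2 apply: F2_cases; apply/val_inj.
Qed.

Definition good u := w u = 1 /\ exists z, dot u z = 1.

Lemma good_primitive v : (exists z, dot (vec v) z = 1) -> primitive 7 v.
Proof.
case=> z; rewrite -(coordsK z); case: v => [[[[[x1 y1] x2] y2] x3] y3].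
case: (coords z) => [[[[[x1' y1'] x2'] y2'] x3'] y3'].
rewrite /vec !(dotD dotP) !(dotDr dotP) !(dotMz dotP) !(dotMr dotP) /aa.
rewrite !(dotD dotP) !(dotDr dotP) !(dot_ch dotP rank6) // /lamc /= => h.
by exists y1', (- x1'), y2', (- x2'), y3', (- x3'); rewrite -h; ring.
Qed.

(* The transvection moving [e] to [x] along [f] and the orthogonal part [g]. *)
Lemma good_adjust (A C : H -> Prop) e f x :
  dot e f = 1 -> w e = 1 -> w f = 1 -> dot x f = 1 -> w x = 1 ->
  C f -> C (x - e) -> (forall y z, C y -> C z -> C (y + z)) -> (forall y n, C y -> C (y *~ n)) ->
  (forall u h, good u -> dot u f = 0 -> C u -> (A (tv u h) <-> A h)) ->
  A e -> A x.
Proof.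
move=> ef we wf xf wx Cf Cxe CD CM inv Ae.
pose n := dot e x; pose g := x - e + f *~ (- n).
have xE : x = e + g + f *~ n by rewrite /g mulrNz addrA [e + (x - e)]addrC !subrK.
have eg : dot e g = 0.
  by rewrite /g !(dotDr dotP) dotNr dotxx (dotMr dotP) ef /n; lia.
have fg : dot f g = 0.
  by rewrite /g !(dotDr dotP) dotNr (dotMr dotP) dotxx (dotC f x) (dotC f e) xf ef; lia.
have Cg : C g by apply: CD => //; exact: CM.
(* Expanding [w x] along [x = e + g + f *~ n] gives $1 + w(g) + 2n$, so [w g] vanishes and [f + g]
   again has value 1. *)
clearbody g; have wg : w g = 0.
  have h : dot (e + g) (f *~ n) = n by rewrite (dotMr dotP) (dotD dotP) ef (dotC g f) fg oppr0 addr0 mulr1.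
  have := wx; rewrite xE !wD wMz we wf eg h mulr0z mulr1 addr0.
  by move: (w g) (n%:~R : 'F_2); do 2 apply: F2_cases.
have gf : good f by split=> //; exists (- e); rewrite dotNr (dotC f e) ef opprK.
have gfg : good (f + g).
  split; first by rewrite wD wf wg fg mulr0z !addr0.
  by exists (- e); rewrite dotNr (dotD dotP) (dotC f e) (dotC g e) ef eg; lia.
have ff := dotxx f.
(* $T_f$ takes $e-f$ to $e$ and $T_{f+g}$ takes it to $e+g$; powers of $T_f$ then add the remaining
   multiple of $f$. *)
have A1 : A (e - f).
  apply/(inv f) => //; rewrite /tv (dotD dotP) (dotN dotP) ef ff subr0 subrK //.
have A2 : A (e + g).
  have df : dot (f + g) f = 0 by rewrite (dotD dotP) ff (dotC g f) fg.
  have := (inv (f + g) (e - f) gfg df (CD _ _ Cf Cg)).2 A1.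
  suff -> : tv (f + g) (e - f) = e + g by [].
  have d1 : dot (e - f) (f + g) = 1 by rewrite (dotD dotP) (dotN dotP) !(dotDr dotP) ef eg ff fg.
  by rewrite /tv d1 mulr1z addrA subrK.
have AS j : A (e + g + f *~ (j + 1)) <-> A (e + g + f *~ j).
  have d : dot (e + g + f *~ j) f = 1.
    by rewrite !(dotD dotP) (dotMz dotP) ef ff (dotC g f) fg mulr0 oppr0 !addr0.
  have <- : tv f (e + g + f *~ j) = e + g + f *~ (j + 1) by rewrite /tv d mulrzDr mulr1z addrA.
  exact: inv.
rewrite xE; clearbody n; elim/int_rect: n {xE} => [|m IH|m IH].
- by rewrite mulr0z addr0.
- by rewrite (_ : m.+1%:Z = m%:Z + 1); [apply/AS; exact: IH|lia].
- by apply/AS; rewrite (_ : - m.+1%:Z + 1 = - m%:Z); [exact: IH|lia].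
Qed.

Definition valid x1 y1 x3 y3 :=
  [/\ dot x1 y1 = 1, dot x3 y3 = 1,
      [/\ dot x1 x3 = 0, dot x1 y3 = 0, dot y1 x3 = 0 & dot y1 y3 = 0] &
      [/\ w x1 = 1, w y1 = 1, w x3 = 1 & w y3 = 1]].

Lemma valid_tv u x1 y1 x3 y3 : w u = 1 ->
  valid (tv u x1) (tv u y1) (tv u x3) (tv u y3) <-> valid x1 y1 x3 y3.
Proof. by move=> wu; rewrite /valid !tv_dot !w_tv. Qed.

Variable P : H -> H -> H -> H -> Prop.
Hypothesis P_ch : forall k x1 y1 x3 y3, (k < 7)%N ->
  P (tv (ch k) x1) (tv (ch k) y1) (tv (ch k) x3) (tv (ch k) y3) <-> P x1 y1 x3 y3.

Definition P_inv u := forall x1 y1 x3 y3, P (tv u x1) (tv u y1) (tv u x3) (tv u y3) <-> P x1 y1 x3 y3.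

Lemma P_inv_tv u v : P_inv u -> (P_inv (tv u v) <-> P_inv v).
Proof.
move=> Pu; split=> Pv x1 y1 x3 y3.
  by rewrite -(Pu x1) -(Pv (tv u x1)) !tv_tv Pu.
rewrite -(tv_inv u x1) -(tv_inv u y1) -(tv_inv u x3) -(tv_inv u y3) !tv_tv.
by rewrite Pu Pv Pu.
Qed.

(** By the conjugation formula, the vectors whose transvection preserves [P] are stable under the
    moves; all good vectors lie in the orbit of [ch 1]. *)
Lemma P_inv_good u : good u -> P_inv u.
Proof.
case; rewrite -(coordsK u); set v := coords u; clearbody v => wv /good_primitive pv.
have iB : invariant_mv 7 (fun v => P_inv (vec v)).
  by move=> k k7 v'; rewrite -tv_mv //; apply: P_inv_tv => x1 y1 x3 y3; exact: P_ch.
rewrite w_vec in wv; apply/(orbit6 pv wv iB).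
have pv1 : primitive 7 (0, 1, 0, 0, 0, 0) by exists 0, 1, 0, 0, 0, 0.
have wv1 : qform (0, 1, 0, 0, 0, 0) = 1 by exact/val_inj.
apply/(orbit6 pv1 wv1 iB); rewrite /vec !mulr0z mulr1z !addr0 add0r => x1 y1 x3 y3; exact: P_ch.
Qed.

Hypothesis P0 : P (ch 0) (ch 1) (aa 2) (ch 5).

Lemma dot_aa2 k : (k < 4)%N -> dot (aa 2) (ch k) = 0.
Proof.
move=> k4; have k7 : (k < 7)%N by lia.
rewrite /aa !(dotD dotP) !(dot_ch dotP rank6) //.
by case: k k4 {k7} => [|[|[|[|//]]]].
Qed.

(** The vectors of the model quadruple are released one at a time. Here it is [x1], by transvections
    along vectors orthogonal to the other three, which therefore stay fixed. *)
Lemma P_valid1 x1 : valid x1 (ch 1) (aa 2) (ch 5) -> P x1 (ch 1) (aa 2) (ch 5).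
Proof.
move=> vx; have [d1 d2 [d3 d4 d5 d6] [w1 w2 w3 w4]] := vx.
pose C h := dot h (aa 2) = 0 /\ dot h (ch 5) = 0.
pose A x := valid x (ch 1) (aa 2) (ch 5) -> P x (ch 1) (aa 2) (ch 5).
have d01 : dot (ch 0) (ch 1) = 1 by rewrite (dot_ch dotP rank6).
have Cd : C (x1 - ch 0).
  have d0a : dot (ch 0) (aa 2) = 0 by rewrite dotC dot_aa2.
  by split; rewrite (dotD dotP) (dotN dotP) ?d3 ?d4 ?d0a ?(dot_ch dotP rank6).
apply: (@good_adjust A C (ch 0) (ch 1) x1) => //.
- by rewrite w_ch.
- by move=> y z [? ?] [? ?]; split; rewrite (dotD dotP); lia.
- by move=> y n [y1 y2]; split; rewrite (dotMz dotP) ?y1 ?y2 mulr0.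
move=> u h gu uf [ua uc]; rewrite /A.
have fix1 : tv u (ch 1) = ch 1 by apply: tv_fix; rewrite dotC uf oppr0.
have fix2 : tv u (aa 2) = aa 2 by apply: tv_fix; rewrite dotC ua oppr0.
have fix3 : tv u (ch 5) = ch 5 by apply: tv_fix; rewrite dotC uc oppr0.
have [wu _] := gu.
have := valid_tv h (ch 1) (aa 2) (ch 5) wu; have := P_inv_good gu h (ch 1) (aa 2) (ch 5).
by rewrite fix1 fix2 fix3 => -> ->.
Qed.

(** Next [y1]: orthogonal to the third plane, it has only four coordinates, and the first four
    transvections, which fix [aa 2] and [ch 5], relate it to [ch 1]. *)
Lemma P_valid2 x1 y1 : valid x1 y1 (aa 2) (ch 5) -> P x1 y1 (aa 2) (ch 5).
Proof.
move=> vx; have [d1 d2 [d3 d4 d5 d6] [w1 w2 w3 w4]] := vx.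
pose A y := forall x, valid x y (aa 2) (ch 5) -> P x y (aa 2) (ch 5).
suff : A y1 by apply.
have iA : invariant_mv 4 (fun v => A (vec v)).
  move=> k k4 v; have k7 : (k < 7)%N by lia.
  rewrite -tv_mv //.
  have fix2 : tv (ch k) (aa 2) = aa 2 by apply: tv_fix; exact: dot_aa2.
  have fix3 : tv (ch k) (ch 5) = ch 5.
    by apply: tv_fix; rewrite (dot_ch dotP rank6) //; case: k k4 {k7 fix2} => [|[|[|[|]]]].
  split=> Av x; last first.
    rewrite -(tv_inv (ch k) x) -{1 2}fix2 -{1 2}fix3 => /(valid_tv _ _ _ _ (w_ch k7))/Av.
    by rewrite P_ch.
  by rewrite -(valid_tv _ _ _ _ (w_ch k7)) fix2 fix3 => /Av; rewrite -{1}fix2 -{1}fix3 P_ch.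
rewrite -(coordsK y1); case E : (coords y1) => [[[[[a b] c] d] e] f].
have y1E : y1 = vec (a, b, c, d, e, f) by rewrite -E coordsK.
have e0 : e = 0 by rewrite -[e]/(lamv 5 (a, b, c, d, e, f)) -lam_vec // -y1E (lam_dot dotP rank6).
have f0 : f = 0.
  rewrite -[f]/(lamv 6 (a, b, c, d, e, f)) -lam_vec // -y1E (lam_dot dotP rank6) // (ch6 rank6).
  by rewrite dotNr d5 oppr0.
rewrite e0 f0 in y1E *.
have pv : exists k1 l1 k2 l2, k1 * a + l1 * b + k2 * c + l2 * d = 1.
  have := d1; rewrite -(coordsK x1); case: (coords x1) => [[[[[x1' y1'] x2'] y2'] x3'] y3'].
  rewrite y1E /vec !(dotD dotP) !(dotDr dotP) !(dotMz dotP) !(dotMr dotP) /aa.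
  rewrite !(dotD dotP) !(dotDr dotP) !(dot_ch dotP rank6) // /lamc /= => h.
  by exists (- y1'), x1', (- y2'), x2'; rewrite -h; ring.
have qv : qform (a, b, c, d, 0, 0) = 1 by rewrite -w_vec -y1E.
apply/(orbit4 pv qv iA); rewrite /vec !mulr0z mulr1z !addr0 add0r => x; exact: P_valid1.
Qed.

Lemma P_valid3 x1 y1 x3 : valid x1 y1 x3 (ch 5) -> P x1 y1 x3 (ch 5).
Proof.
move=> vx; have [d1 d2 [d3 d4 d5 d6] [w1 w2 w3 w4]] := vx.
pose A x := forall x1 y1, valid x1 y1 x (ch 5) -> P x1 y1 x (ch 5).
suff : A x3 by apply.
have d01 : dot (aa 2) (ch 5) = 1.
  by rewrite /aa !(dotD dotP) !(dot_ch dotP rank6).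
apply: (@good_adjust A (fun=> True) (aa 2) (ch 5) x3) => //.
- by rewrite w_aa.
- move=> u h gu uf _; have [wu _] := gu.
  have fix3 : tv u (ch 5) = ch 5 by apply: tv_fix; rewrite dotC uf oppr0.
  split=> Ah x y.
    rewrite -(valid_tv _ _ _ _ wu) fix3 => /Ah.
    by rewrite -{1}fix3 (P_inv_good gu).
  rewrite -(tv_inv u x) -(tv_inv u y) -{1 2}fix3 => /(valid_tv _ _ _ _ wu)/Ah.
  by rewrite (P_inv_good gu).
- by move=> x y; exact: P_valid2.
Qed.

(** Last [y3], related to [ch 5] by all seven transvections; the other three vectors may move
    freely, since they are already arbitrary in [P_valid3]. *)
Lemma P_valid x1 y1 x3 y3 : valid x1 y1 x3 y3 -> P x1 y1 x3 y3.
Proof.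
move=> vx; have [d1 d2 [d3 d4 d5 d6] [w1 w2 w3 w4]] := vx.
pose A y := forall x1 y1 x, valid x1 y1 x y -> P x1 y1 x y.
suff : A y3 by apply.
have iA : invariant_mv 7 (fun v => A (vec v)).
  move=> k k7 v; rewrite -tv_mv //; have wk := w_ch k7; split=> Av x y z.
    by rewrite -(valid_tv _ _ _ _ wk) => /Av; rewrite P_ch.
  rewrite -(tv_inv (ch k) x) -(tv_inv (ch k) y) -(tv_inv (ch k) z).
  by move/(valid_tv _ _ _ _ wk)/Av; rewrite P_ch.
rewrite -(coordsK y3).
have pv : primitive 7 (coords y3).
  by apply: good_primitive; rewrite coordsK; exists (- x3); rewrite dotNr (dotC y3 x3) d2 opprK.
have qv : qform (coords y3) = 1 by rewrite -w_vec coordsK.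
apply/(orbit6 pv qv iA).
have pv1 : primitive 7 (0, 0, 0, 0, 0, 1) by exists 0, 0, 0, 0, 0, 1.
have wv1 : qform (0, 0, 0, 0, 0, 1) = 1 by exact/val_inj.
apply/(orbit6 pv1 wv1 iA); rewrite /vec !mulr0z mulr1z !addr0 !add0r => *; exact: P_valid3.
Qed.

End Transitivity.

(** * Homeomorphisms acting on splittings *)

Section Functor.
Variable R : realType.

Lemma hclass_boundary (T : topologicalType) (z w : Z1 R T) (d : chain R T 2) :
  boundary d = val z - val w -> hclass z = hclass w.
Proof.
move=> dE; apply/eqP; rewrite /hclass -Quotient.idealrBE unfold_in; apply/asboolP.
by exists d; rewrite dE raddfB.
Qed.

Lemma H1_map_hclass (S T : topologicalType) (f : continuousType S T) (z : Z1 R S) :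
  H1_map f (hclass z) = hclass (Z1_map f z).
Proof.
have [d dE] := hclass_eqP (hclassK (hclass z)).
apply: (@hclass_boundary _ _ _ (chain_map f d)).
by rewrite boundary_chain_map dE raddfB.
Qed.

Lemma chain_map_square (S T T' U : topologicalType) (f : continuousType T U)
    (g : continuousType S T) (f' : continuousType T' U) (g' : continuousType S T')
    n (c : chain R S n) : (forall p, f (g p) = f' (g' p)) ->
  chain_map f (chain_map g c) = chain_map f' (chain_map g' c).
Proof.
move=> E; rewrite -[c]freeg_sumE; elim/big_ind: _ => [|x y Hx Hy|s _].
- by rewrite !raddf0.
- by rewrite !raddfD /= Hx Hy.
rewrite /chain_map !liftU !raddf_int_scalable /= !liftU !scale1r.
by congr (_ *: << _ >>); apply/continuousEP => p /=; exact: E.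
Qed.

(** Functoriality stated for commuting squares, which suits inclusions of subspaces and needs no
    bundled composites. *)
Lemma H1_map_square (S T T' U : topologicalType) (f : continuousType T U)
    (g : continuousType S T) (f' : continuousType T' U) (g' : continuousType S T') (h : H1 R S) :
  (forall p, f (g p) = f' (g' p)) -> H1_map f (H1_map g h) = H1_map f' (H1_map g' h).
Proof.
move=> E; rewrite -(hclassK h) !H1_map_hclass; congr hclass; apply/val_inj.
exact: chain_map_square.
Qed.

Lemma H1_map_id (T : topologicalType) (f : continuousType T T) (h : H1 R T) :
  (forall p, f p = p) -> H1_map f h = h.
Proof.
move=> E; rewrite -{2}(hclassK h) /H1_map; congr hclass; apply/val_inj => /=.
rewrite -[val (repr h)]freeg_sumE; elim/big_ind: _ => [|x y Hx Hy|s _].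
- by rewrite !raddf0.
- by rewrite !raddfD /= Hx Hy.
rewrite /chain_map liftU (_ : (f \o s : simplex R T 1) = s).
  by apply/eqP; apply/freeg_eqP => t; rewrite coeffZ !coeffU mul1r.
by apply/continuousEP => p /=; rewrite E.
Qed.

Lemma H1_map_cancel (T : topologicalType) (f g : continuousType T T) (h : H1 R T) :
  cancel g f -> H1_map f (H1_map g h) = h.
Proof.
move=> E; have ci : continuous (@id T) by move=> x.
rewrite (@H1_map_square _ _ _ _ f g (mkcts ci) (mkcts ci)) //.
by rewrite !H1_map_id.
Qed.

End Functor.

Lemma continuous_within_map (S T U : topologicalType) (A : set T) (B : set S) (g : S -> T) (F : T -> U) :
  continuous g -> (forall p, B p -> A (g p)) -> {within A, continuous F} ->
  {within B, continuous (F \o g)}.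
Proof.
move=> cg gA /subspace_continuousP cF; apply/subspace_continuousP => x Bx.
move=> P nP; have h : nbhs (g x) [set y | A y -> P (F y)] := cF _ (gA _ Bx) P nP.
have h' : nbhs x [set y | A (g y) -> P (F (g y))] := cg x _ h.
by apply: (@filterS _ _ _ _ _ _ h') => y hy By; apply: hy; exact: gA.
Qed.

Lemma continuous_within_comp (S T U : topologicalType) (B : set S) (g : S -> T) (F : T -> U) :
  {within B, continuous g} -> continuous F -> {within B, continuous (F \o g)}.
Proof. by move=> cg cF; apply: within_continuous_comp => // y _; exact: cF. Qed.

Section Homeo.
Variables (R : realType) (T : topologicalType) (phi psi : continuousType T T).
Hypotheses (phiK : cancel phi psi) (psiK : cancel psi phi).
Implicit Types (A B X : set T) (c d : loop R T).

Lemma homeo_image A : phi @` A = psi @^-1` A.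
Proof.
apply/seteqP; split=> [_ [x Ax <-]|y Ay] /=; first by rewrite phiK.
by exists (psi y).
Qed.

Lemma push_subproof1 c : continuous (phi \o c).
Proof. by move=> t; apply: continuous_comp; [exact: loop_continuous|exact: cts_fun]. Qed.

Lemma push_subproof2 c t : (phi \o c) (t + 1) = (phi \o c) t.
Proof. by rewrite /= loop_periodic. Qed.

Definition push c : loop R T := Loop (@push_subproof1 c) (@push_subproof2 c).

Lemma range_push c : range (push c) = phi @` range c.
Proof. by rewrite -[LHS]/(range (phi \o c)) image_comp. Qed.

Lemma connected_image A : connected A -> connected (phi @` A).
Proof.
move=> cA; apply: connected_continuous_connected => //.
by apply: continuous_subspaceT; exact: cts_fun.
Qed.

Lemma frontier_image X : frontier (phi @` X) = phi @` frontier X.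
Proof.
rewrite !homeo_image /frontier; apply/seteqP; split=> y [cy iy]; split.
- move=> B nB; have := cy (psi @^-1` B) (@cts_fun _ _ psi _ _ nB).
  by case=> x [/= xX xB]; exists (psi x).
- move=> iX; apply: iy; exact: (@cts_fun _ _ psi).
- move=> B nB; have nB' : nbhs (psi y) (phi @^-1` B) by apply: (@cts_fun _ _ phi); rewrite psiK.
  by case: (cy _ nB') => x [/= xX xB]; exists (phi x); split=> //=; rewrite phiK.
- move=> iX; apply: iy; rewrite -[y]psiK in iX; have : nbhs (psi y) (phi @^-1` (psi @^-1` X)) := @cts_fun _ _ phi _ _ iX.
  by rewrite (_ : phi @^-1` _ = X) //; apply/funext => x /=; rewrite phiK.
Qed.

Lemma H1_incl_image X (h : H1 R X) : exists h' : H1 R (phi @` X),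
  H1_map phi (H1_incl h) = H1_incl h'.
Proof.
have sub (p : X) : phi (set_val p) \in phi @` X.
  by apply/mem_set; exists (set_val p) => //; exact: (set_mem (valP p)).
pose g (p : X) : (phi @` X : set T) := exist _ (phi (set_val p)) (sub p).
have cg : continuous g.
  apply: continuous_sub => x; apply: continuous_comp; [exact: initial_continuous|exact: cts_fun].
by exists (H1_map (mkcts cg) h); apply: H1_map_square.
Qed.

End Homeo.

Section Transport.
Variables (R : realType) (T : topologicalType) (phi psi : continuousType T T).
Hypotheses (phiK : cancel phi psi) (psiK : cancel psi phi).
Implicit Types (A B X : set T) (c d : loop R T).
Notation push := (@push R T phi).

Lemma image_phiK A : psi @` (phi @` A) = A.
Proof. by rewrite image_comp (_ : psi \o phi = id) ?image_id //; apply/funext. Qed.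

Lemma component_image A X : component A X -> component (phi @` A) (phi @` X).
Proof.
case=> p Ap ->; exists (phi p); first by exists p.
apply/seteqP; split.
  apply: connected_component_max.
  - exists p => //; exact: connected_component_refl.
  - exact: image_subset (@connected_component_sub _ _ _).
  - by apply: connected_image; exact: component_connected.
move=> y hy; exists (psi y); last exact: psiK.
have : (psi @` connected_component (phi @` A) (phi p)) (psi y) by exists y.
apply: connected_component_max.
- by exists (phi p) => //; apply: connected_component_refl; exists p.
- by move=> _ [z /connected_component_sub[x Ax <-] <-]; rewrite phiK.
- by apply: connected_image; exact: component_connected.
Qed.

Lemma null_homotopic_push c : null_homotopic (push c) -> null_homotopic c.
Proof.
case=> F [F1 F2 F3 [p F4]]; exists (psi \o F); split.
- by apply: continuous_within_comp => //; exact: cts_fun.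
- by move=> t u ht /=; rewrite F2.
- by move=> u /=; rewrite F3 /= phiK.
- by exists (psi p) => u /=; rewrite F4.
Qed.

Lemma isotopic_image A B : isotopic R (phi @` A) (phi @` B) -> isotopic R A B.
Proof.
case=> F [G [[F1 F2] F3 F4 F5]].
pose m (x : R * T) := (x.1, phi x.2).
have cm : continuous m.
  move=> x; apply: (@contat_pair _ x _ _ (fun x => x.1) (fun x => phi x.2)).
    by exact: cvg_fst.
  by apply: (@contat_comp _ x _ _ snd phi); [exact: cts_fun|exact: cvg_snd].
exists (psi \o F \o m), (psi \o G \o m); split.
- have mm (p : R * T) : (`[0, 1] `*` setT) p -> (`[0, 1] `*` setT) (m p) by [].
  have cp : continuous psi by exact: cts_fun.
  split.
    exact: (continuous_within_map cm mm (continuous_within_comp F1 cp)).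
  exact: (continuous_within_map cm mm (continuous_within_comp F2 cp)).
- by move=> t p ht; rewrite /= /m /= !psiK; have [-> ->] := F3 t (phi p) ht; rewrite phiK.
- by move=> p; rewrite /= F4 phiK.
- by rewrite -(image_phiK B) -F5 !image_comp.
Qed.

Lemma ess_sep_push c : ess_sep_scc c -> ess_sep_scc (push c).
Proof.
case=> sc ec Sc; split.
- by move=> t u ht hu /(can_inj phiK); exact: sc.
- by move/null_homotopic_push.
- move=> cn; apply: Sc; rewrite range_push in cn.
  rewrite -(image_phiK (~` range c)).
  apply: connected_image; rewrite (_ : phi @` _ = ~` (phi @` range c)) //.
  by rewrite !(homeo_image phiK psiK).
Qed.

Lemma separating_pair_push c d : separating_pair c d -> separating_pair (push c) (push d).
Proof.
case=> ec ed cd nis; split; [exact: ess_sep_push|exact: ess_sep_push| |].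
- rewrite !range_push !(homeo_image phiK psiK) -preimage_setI cd.
  by rewrite preimage_set0.
- by rewrite !range_push => /isotopic_image.
Qed.

Lemma H1_incl_image_range X : range (@H1_incl R T (phi @` X)) =
  H1_map phi @` range (@H1_incl R T X).
Proof.
apply/seteqP; split=> [_ [h _ <-]|_ [_ [h _ <-] <-]]; last first.
  by have [h' ->] := H1_incl_image phi h; exists h'.
have [h' E] := H1_incl_image psi h; exists (H1_map psi (H1_incl h)).
  rewrite E; move: h' {E}; rewrite image_phiK => h'; by exists h'.
by rewrite H1_map_cancel.
Qed.

End Transport.

Section SymmetricTransport.
Variable R : realType.
Notation Sigma := (Sigma3 R).
Notation H := (H1 R Sigma).

(** Every ingredient of a symmetric pair is topological and the homeomorphism commutes with the
    involution, so the whole pair can be pushed forward. *)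
Lemma symmetric_splitting_image (phi psi : continuousType Sigma Sigma) (V : 'I_3 -> set H) :
  cancel phi psi -> cancel psi phi ->
  (forall p, hyperelliptic (phi p) = phi (hyperelliptic p)) ->
  symmetric_splitting V -> symmetric_splitting (fun i => H1_map phi @` V i).
Proof.
move=> phiK psiK phis [c [d [sp sc sd [X [cX [f0 f1 f2] XV]]]]].
have sinv e : s_invariant e -> s_invariant (push phi e).
  move=> se; rewrite /s_invariant !range_push -[in RHS]se !image_comp.
  by apply: eq_imagel => p _ /=.
exists (push phi c), (push phi d); split; [exact: (separating_pair_push phiK psiK)| | |].
- exact: sinv.
- exact: sinv.
exists (fun i => phi @` X i); split.
- move=> i; rewrite !range_push -image_setU.
  rewrite (_ : ~` _ = phi @` ~` (range c `|` range d)); last first.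
    by rewrite !(homeo_image phiK psiK).
  exact: (component_image phiK psiK).
- by rewrite !(frontier_image phiK psiK) f0 f1 f2 !range_push image_setU.
- by move=> i; rewrite XV (H1_incl_image_range _ phiK psiK).
Qed.

Variable dot : H -> H -> int.
Hypothesis dotP : intersection_form dot.
Hypothesis rank6 : exists e : 'I_6 -> H, Zbasis setT e.

Definition span (x y : H) : set H := [set h | exists a b : int, h = x *~ a + y *~ b].

(** The middle plane is an orthogonal complement, so that four vectors encode the splitting and an
    isometry acts on it through them. *)
Definition quad_splitting (x1 y1 x3 y3 : H) (i : 'I_3) : set H :=
  match val i with
  | 0 => span x1 y1
  | 1 => [set h | [/\ dot h x1 = 0, dot h y1 = 0, dot h x3 = 0 & dot h y3 = 0]]
  | _ => span x3 y3
  end.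

Lemma tv_bij u : (forall h, tv dot u (h - u *~ dot h u) = h) /\
  forall h, tv dot u h - u *~ dot (tv dot u h) u = h.
Proof.
split=> h; first exact: tv_inv.
by rewrite /tv (dotD dotP) (dotMz dotP) (dotxx dotP rank6) mulr0 addr0 addrK.
Qed.

Lemma tw_tv k (n : int) h : (k < 7)%N -> `|n|%N = 1%N ->
  H1_map (twc R (o7 k) n) h = h + ch R k *~ (n * dot h (ch R k)).
Proof.
by move=> k7 n1; rewrite (tw_transvection rank6) // o7E // (lam_dot dotP rank6).
Qed.

Lemma quad_splitting_image (t t' : H -> H) x1 y1 x3 y3 i :
  (forall h k, t (h + k) = t h + t k) -> (forall h n, t (h *~ n) = t h *~ n) ->
  (forall h k, dot (t h) (t k) = dot h k) -> cancel t' t ->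
  t @` quad_splitting x1 y1 x3 y3 i = quad_splitting (t x1) (t y1) (t x3) (t y3) i.
Proof.
move=> tD tM tdot t'K.
have sE x y : t @` span x y = span (t x) (t y).
  apply/seteqP; split=> [_ [_ [a [b ->]] <-]|_ [a [b ->]]].
    by exists a, b; rewrite tD !tM.
  by exists (x *~ a + y *~ b); [exists a, b|rewrite tD !tM].
rewrite /quad_splitting; case: (val i) => [|[|j]] //.
apply/seteqP; split=> [_ [h [h1 h2 h3 h4] <-]|h [h1 h2 h3 h4]].
  by split; rewrite tdot.
exists (t' h); last exact: t'K.
by split; rewrite -tdot t'K.
Qed.

(** The chain twist and its inverse realize the transvection and its inverse by homeomorphisms
    commuting with the involution. *)
Lemma symmetric_quad_tw k x1 y1 x3 y3 : (k < 7)%N ->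
  symmetric_splitting (quad_splitting (tv dot (ch R k) x1) (tv dot (ch R k) y1)
    (tv dot (ch R k) x3) (tv dot (ch R k) y3)) <->
  symmetric_splitting (quad_splitting x1 y1 x3 y3).
Proof.
move=> k7; set u := ch R k.
pose ti h := h - u *~ dot h u.
have [tiK tKi] := tv_bij u.
have tiE h : H1_map (twc R (o7 k) (-1)) h = ti h.
  by rewrite tw_tv // mulN1r mulrNz.
have tE h : H1_map (twc R (o7 k) 1) h = tv dot u h by rewrite tw_tv // mul1r.
have tiD h h' : ti (h + h') = ti h + ti h'.
  by rewrite /ti (dotD dotP) mulrzDr opprD addrACA.
have tiM h n : ti (h *~ n) = ti h *~ n.
  by rewrite /ti (dotMz dotP) mulrzBl [in u *~ _]mulrC mulrzA.
have tid h h' : dot (ti h) (ti h') = dot h h'.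
  by rewrite -(tv_dot dotP rank6 u) /ti !tiK.
have twK1 : cancel (twc R (o7 k) 1) (twc R (o7 k) (-1)) := @twK R (o7 k) 1.
have twK2 : cancel (twc R (o7 k) (-1)) (twc R (o7 k) 1).
  by have := @twK R (o7 k) (-1); rewrite opprK.
split.
  move=> /(symmetric_splitting_image twK2 twK1 (@tw_hyp R (o7 k) (-1))).
  rewrite (_ : (fun i => _) = quad_splitting x1 y1 x3 y3) //; apply/funext => i.
  rewrite (_ : H1_map _ = ti); last exact/funext.
  by rewrite (@quad_splitting_image ti (tv dot u)) // /ti !tKi.
move=> /(symmetric_splitting_image twK1 twK2 (@tw_hyp R (o7 k) 1)).
rewrite (_ : (fun i => _) = quad_splitting (tv dot u x1) (tv dot u y1) (tv dot u x3) (tv dot u y3)) //.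
apply/funext => i; rewrite (_ : H1_map _ = tv dot u); last exact/funext.
apply: (@quad_splitting_image _ ti) => //.
- by move=> h h'; rewrite (tvD dotP).
- by move=> h n; rewrite (tvMz dotP).
- by move=> h h'; rewrite (tv_dot dotP rank6).
Qed.

End SymmetricTransport.

(** * Connected pieces of the surface *)

Section Joined.
Variables (R : realType) (T : topologicalType).
Implicit Types (X : set T) (p q r : T).

Definition joined X p q := exists C, [/\ connected C, C `<=` X, C p & C q].

Lemma joined_trans X p q r : joined X p q -> joined X q r -> joined X p r.
Proof.
case=> C [cC sC Cp Cq] [D [cD sD Dq Dr]]; exists (C `|` D); split; [|by move=> x []; auto|by left|by right].
by apply: connectedU => //; exists q.
Qed.

Lemma joined_sub X Y p q : X `<=` Y -> joined X p q -> joined Y p q.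
Proof. by move=> XY [C [? sC ? ?]]; exists C; split=> // x /sC/XY. Qed.

Lemma joined_path X (g : R -> T) : continuous g -> (forall t, 0 <= t <= 1 -> X (g t)) ->
  joined X (g 0) (g 1).
Proof.
move=> cg gX; exists (g @` `[0, 1]); split.
- apply: connected_continuous_connected; first exact: segment_connected.
  exact: continuous_subspaceT.
- by move=> _ [t ht <-]; apply: gX; move: ht; rewrite /= in_itv.
- by exists 0 => //=; rewrite in_itv /=; lra.
- by exists 1 => //=; rewrite in_itv /=; lra.
Qed.

Lemma connected_joined X q : (forall p, X p -> joined X p q) -> connected X.
Proof.
move=> h; have /choice[C CP] : forall p, exists C, X p -> [/\ connected C, C `<=` X, C p & C q].
  by move=> p; have [/h[C]|nX] := pselect (X p); [exists C|exists set0 => /nX].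
have -> : X = \bigcup_(p in X) C p.
  apply/seteqP; split=> [p Xp|x [p /CP[_ s _ _] /s]] //.
  by exists p => //; have [] := CP p Xp.
apply: bigcup_connected; last by move=> p /CP[].
by exists q => p /CP[].
Qed.

Lemma connected_side (f : T -> R) (C : set T) (a : R) : continuous f -> connected C ->
  (forall p, C p -> f p != a) -> (forall p, C p -> f p < a) \/ (forall p, C p -> a < f p).
Proof.
move=> cf cC fa; have [[p [Cp pa]]|none] := pselect (exists p, C p /\ f p < a); last first.
  right=> p Cp; rewrite lt_neqAle eq_sym fa //= leNgt; apply/negP => pa.
  by apply: none; exists p.
left; suff E : C `&` [set p | f p < a] = C by move=> q; rewrite -E => -[].
apply: cC; first by exists p.
- by exists [set p | f p < a] => //; exact: open_lt.
- exists [set p | f p <= a]; first last.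
    apply/seteqP; split=> q [Cq /= qa]; split => //=; first exact: ltW.
    by rewrite lt_neqAle fa.
  rewrite (_ : [set p | f p <= a] = ~` [set p | a < f p]).
    by apply: open_closedC; exact: open_gt.
  by apply/seteqP; split=> q /=; rewrite leNgt => /negP.
Qed.

End Joined.

Section SurfaceConnected.
Variable R : realType.
Notation Sigma := (Sigma3 R).
Implicit Types (p q : Sigma) (x y : R).

Definition outer_y (s : bool) x : R := (if s then 1 else -1) * Num.sqrt (25 - x ^+ 2).

Lemma outer_y_sqr s x : -5 <= x <= 5 -> outer_y s x ^+ 2 = 25 - x ^+ 2.
Proof.
move=> hx; rewrite /outer_y exprMn sqr_sqrtr; last by nra.
by case: s; rewrite ?sqrrN expr1n mul1r.
Qed.

Lemma outer_y_domain s x : -5 <= x <= 5 -> domain_eq x (outer_y s x) = 0.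
Proof. by move=> hx; rewrite domain_eqE outer_y_sqr // (_ : 25 - _ = 0) ?mul0r //; ring. Qed.

Definition outer_pt (s : bool) x : Sigma := surf x (outer_y s x) 0.

Lemma outer_ptE s x : -5 <= x <= 5 ->
  [/\ cx (outer_pt s x) = x, cy (outer_pt s x) = outer_y s x & cz (outer_pt s x) = 0].
Proof. by move=> hx; apply: surfE; rewrite outer_y_domain // expr0n. Qed.

Lemma cx_itv p : -5 <= cx p <= 5.
Proof. by have [h _ _ _] := Sigma_domain p; have := sqr_ge0 (cy p); nra. Qed.

(** At fixed [x], moving [y] away from the axis never enters a hole. The sheet is kept until the
    outer circle, where both sheets meet. *)
Lemma vertical_path p y' : (y' ^+ 2 <= 25 - cx p ^+ 2) -> cy p ^+ 2 <= y' ^+ 2 -> 0 <= cy p * y' ->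
  y' ^+ 2 = 25 - cx p ^+ 2 -> joined [set q | cx q = cx p] p (surf (cx p) y' 0).
Proof.
move=> h1 h2 h3 h4.
have [d1 d2 d3 d4] := Sigma_domain p.
pose yt t := cy p + clamp01 t * (y' - cy p).
have ytd t : cy p ^+ 2 <= yt t ^+ 2 <= y' ^+ 2.
  have := clamp01_itv t; rewrite /yt; set u := clamp01 t => hu.
  move: h2 h3 hu; move: (cy p) => y h2 h3 hu.
  have hA : y ^+ 2 <= y * y' by have := mulr_ge0 (sqr_ge0 y) (_ : 0 <= y' ^+ 2 - y ^+ 2); rewrite subr_ge0 => /(_ h2) ?; nra.
  have hB : y * y' <= y' ^+ 2 by have := mulr_ge0 (sqr_ge0 y') (_ : 0 <= y' ^+ 2 - y ^+ 2); rewrite subr_ge0 => /(_ h2) ?; nra.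
  have u0 : 0 <= u by lra.
  have u1 : 0 <= 1 - u by lra.
  rewrite -subr_ge0 -[X in _ && X]subr_ge0; apply/andP; split.
    rewrite (_ : _ - _ = 2 * (u * (y * y' - y ^+ 2)) + (u * (y' - y)) ^+ 2); last by ring.
    by rewrite addr_ge0 ?sqr_ge0 // mulr_ge0 // mulr_ge0 // subr_ge0.
  rewrite (_ : _ - _ = (1 - u) * ((1 - u) * (y * y' - y ^+ 2) + (1 + u) * (y' ^+ 2 - y * y'))); last by ring.
  by apply: mulr_ge0 => //; apply: addr_ge0; apply: mulr_ge0; rewrite ?subr_ge0 //; lra.
have D0 t : 0 <= domain_eq (cx p) (yt t).
  by apply: domain_ge0; have := ytd t; split; lra.
pose z t : R := (if 0 <= cz p then 1 else -1) * Num.sqrt (domain_eq (cx p) (yt t)).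
have zE t : z t ^+ 2 = domain_eq (cx p) (yt t).
  by rewrite exprMn sqr_sqrtr //; case: ifP => _; rewrite ?sqrrN expr1n mul1r.
pose g t := surf (cx p) (yt t) (z t).
have cg : continuous g.
  apply: surf_continuous => //; first by cont.
    by rewrite /yt; cont.
  by rewrite /z /yt; cont.
have g0 : g 0 = p.
  have y0 : yt 0 = cy p by rewrite /yt clamp01_id ?mul0r ?addr0 //; lra.
  have [gx gy gz] := surfE (zE 0).
  apply: Sigma_eq; rewrite ?gx ?gy ?gz ?y0 //.
  rewrite /z y0 -czE sqrtr_sqr; case: ifP => zp; first by rewrite ger0_norm ?mul1r.
  by rewrite ltr0_norm ?mulrNN ?mul1r // ltNge zp.
have g1 : g 1 = surf (cx p) y' 0.
  have y1 : yt 1 = y' by rewrite /yt clamp01_id; [ring|lra].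
  rewrite /g y1 /z y1; have -> : domain_eq (cx p) y' = 0.
    by rewrite domain_eqE h4 (_ : 25 - _ = 0) ?mul0r //; ring.
  by rewrite sqrtr0 mulr0.
rewrite -{2}g0 -g1; apply: joined_path => // t _ /=.
by have [-> _ _] := surfE (zE t).
Qed.

Lemma joined_outer p : exists s, joined [set q | cx q = cx p] p (outer_pt s (cx p)).
Proof.
have hx := cx_itv p; exists (0 <= cy p); have [d1 _ _ _] := Sigma_domain p.
have h := outer_y_sqr (0 <= cy p) hx.
apply: vertical_path; rewrite ?h //; first by lra.
rewrite /outer_y; case: ifP => y0; first by rewrite mul1r mulr_ge0 ?sqrtr_ge0.
by rewrite mulN1r mulrN oppr_ge0 mulr_le0_ge0 ?sqrtr_ge0 // ltW // ltNge y0.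
Qed.

Lemma joined_arc s x1 x2 : -5 <= x1 <= 5 -> -5 <= x2 <= 5 ->
  joined [set q | Num.min x1 x2 <= cx q <= Num.max x1 x2] (outer_pt s x1) (outer_pt s x2).
Proof.
move=> h1 h2.
pose xt t := x1 + clamp01 t * (x2 - x1).
have hx t : Num.min x1 x2 <= xt t <= Num.max x1 x2.
  have := clamp01_itv t; rewrite /xt; set u := clamp01 t => hu.
  by case: (leP x1 x2) => h; nra.
have hx' t : -5 <= xt t <= 5.
  by have := hx t; case: (leP x1 x2) => _ /andP[]; lra.
pose g t := outer_pt s (xt t).
have cg : continuous g.
  apply: surf_continuous; [by move=> t; rewrite outer_y_domain // expr0n| | |].
  - by rewrite /xt; cont.
  - by rewrite /outer_y /xt; cont.
  - by cont.
have g0 : g 0 = outer_pt s x1 by rewrite /g /xt clamp01_id ?mul0r ?addr0 //; lra.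
have g1 : g 1 = outer_pt s x2 by rewrite /g /xt clamp01_id; [congr outer_pt; ring|lra].
rewrite -g0 -g1; apply: joined_path => // t _ /=.
by have [-> _ _] := outer_ptE s (hx' t).
Qed.

Lemma joined_zone (I : R -> Prop) x0 : -5 <= x0 <= 5 ->
  (forall x1 x2 x, I x1 -> I x2 -> Num.min x1 x2 <= x <= Num.max x1 x2 -> I x) -> I x0 ->
  forall p, I (cx p) -> exists s, joined [set q | I (cx q)] p (outer_pt s x0).
Proof.
move=> hx0 cI I0 p Ip; have [s h] := joined_outer p; exists s.
apply: joined_trans (joined_sub _ h) _; first by move=> q /= ->.
apply: joined_sub (joined_arc s (cx_itv p) hx0) => q /= hq.
exact: cI hq.
Qed.

Lemma outer_pt_end s x : x ^+ 2 = 25 -> outer_pt s x = outer_pt true x.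
Proof. by move=> h; rewrite /outer_pt /outer_y h subrr sqrtr0 !mulr0. Qed.

Lemma connected_left a : -5 < a -> connected [set p : Sigma | cx p < a].
Proof.
move=> ha; apply: (@connected_joined _ _ (outer_pt true (-5))) => p /= pa.
have [|||s] := @joined_zone (fun x => x < a) (-5) _ _ _ p pa; [lra| |by []|].
  by move=> x1 x2 x; case: (leP x1 x2) => _; lra.
by rewrite (outer_pt_end s) //; lra.
Qed.

Lemma connected_right a : a < 5 -> connected [set p : Sigma | a < cx p].
Proof.
move=> ha; apply: (@connected_joined _ _ (outer_pt true 5)) => p /= pa.
have [|||s] := @joined_zone (fun x => a < x) 5 _ _ _ p pa; [lra| |by []|].
  by move=> x1 x2 x; case: (leP x1 x2) => _; lra.
by rewrite (outer_pt_end s) //; lra.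
Qed.

(** The vertical chord between two neighbouring holes lies in the domain. *)
Lemma joined_cross (x0 : R) : -2 < x0 < -1 ->
  joined [set q | cx q = x0] (outer_pt false x0) (outer_pt true x0).
Proof.
move=> hx0.
have hx : -5 <= x0 <= 5 by lra.
pose Y := Num.sqrt (25 - x0 ^+ 2).
have YE : Y ^+ 2 = 25 - x0 ^+ 2 by rewrite sqr_sqrtr //; nra.
pose yt t := (2 * clamp01 t - 1) * Y.
have ytd t : yt t ^+ 2 <= Y ^+ 2.
  have := clamp01_itv t; rewrite /yt; set u := clamp01 t => hu.
  by rewrite exprMn ler_piMl ?sqr_ge0 //; nra.
have D0 t : 0 <= domain_eq x0 (yt t).
  by apply: domain_ge0; have := ytd t; have := sqr_ge0 (yt t); split; nra.
have zE t : Num.sqrt (domain_eq x0 (yt t)) ^+ 2 = domain_eq x0 (yt t) by rewrite sqr_sqrtr.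
pose g t := surf x0 (yt t) (Num.sqrt (domain_eq x0 (yt t))).
have cg : continuous g.
  by apply: surf_continuous => //; rewrite /yt; cont.
have g0 : g 0 = outer_pt false x0.
  rewrite /g; have -> : yt 0 = outer_y false x0.
    by rewrite /yt clamp01_id ?mulr0 ?sub0r //; lra.
  by rewrite outer_y_domain // sqrtr0.
have g1 : g 1 = outer_pt true x0.
  rewrite /g; have -> : yt 1 = outer_y true x0.
    by rewrite /yt clamp01_id; [rewrite mulr1 /outer_y; congr (_ * _); ring|lra].
  by rewrite outer_y_domain // sqrtr0.
rewrite -g0 -g1; apply: joined_path => // t _ /=.
by have [-> _ _] := surfE (zE t).
Qed.

(** Over this zone the two outer arcs are disjoint; the chord at $-5/4$, to the left of the middle
    hole, joins them. *)
Lemma connected_middle : connected [set p : Sigma | -(3/2) < cx p < 3/2].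
Proof.
apply: (@connected_joined _ _ (outer_pt true (-(5/4)))) => p /= pa.
have [|||s] := @joined_zone (fun x => -(3/2) < x < 3/2) (-(5/4)) _ _ _ p pa; [lra| |lra|].
  by move=> x1 x2 x; case: (leP x1 x2) => _; lra.
case: s => // h; apply: joined_trans h _.
apply: joined_sub (joined_cross _); last by lra.
by move=> q /= ->; lra.
Qed.

End SurfaceConnected.

(** * A symmetric pair of ovals *)

Section Ovals.
Variable R : realType.
Notation Sigma := (Sigma3 R).
Notation hc := (hc R).
Implicit Types (p q : Sigma) (x y : R).

(* Over [1 < |x| < 2] the surface is the tube of ovals
   [(x, r cos t, r sin t sqrt (oval_G x (r cos t)))] with [r = sqrt (25 - x ^+ 2)]. *)
Definition oval_G x y : R := ((x + 3) ^+ 2 + y ^+ 2 - 1) *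
  ((x ^+ 2 + y ^+ 2 - 1) * ((x - 3) ^+ 2 + y ^+ 2 - 1)).

Lemma oval_G_gt0 x y : 1 < `|x| < 2 -> 0 < oval_G x y.
Proof.
move=> hx; have y0 := sqr_ge0 y.
have hx' : 1 < x < 2 \/ -2 < x < -1 by move: hx; case: (ger0P x) => _; lra.
by rewrite /oval_G; do !apply: mulr_gt0; case: hx' => h; nra.
Qed.

Definition oval_r x : R := Num.sqrt (25 - x ^+ 2).
Definition oval_z x t : R := oval_r x * sint t * Num.sqrt (oval_G x (oval_r x * cost t)).
Definition oval_pt x t : Sigma := surf x (oval_r x * cost t) (oval_z x t).

Lemma oval_r_sqr x : 1 < `|x| < 2 -> oval_r x ^+ 2 = 25 - x ^+ 2 /\ 0 < oval_r x.
Proof.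
move=> hx; have h : 0 < 25 - x ^+ 2 by move: hx; case: (ger0P x) => _; nra.
by rewrite /oval_r sqr_sqrtr ?ltW // sqrtr_gt0.
Qed.

Lemma oval_zE x t : 1 < `|x| < 2 -> oval_z x t ^+ 2 = domain_eq x (oval_r x * cost t).
Proof.
move=> hx; have [r2 _] := oval_r_sqr hx.
rewrite /oval_z exprMn sqr_sqrtr; last exact/ltW/oval_G_gt0.
rewrite domain_eqE -/(oval_G _ _); congr (_ * _).
by rewrite !exprMn r2 -[X in X - (_ + _)](_ : x ^+ 2 + (25 - x ^+ 2) * (cost t ^+ 2 + sint t ^+ 2) = 25);
  [ring|rewrite cost2Dsint2; ring].
Qed.

Lemma oval_ptE x t : 1 < `|x| < 2 -> [/\ cx (oval_pt x t) = x,
  cy (oval_pt x t) = oval_r x * cost t & cz (oval_pt x t) = oval_z x t].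
Proof. by move=> hx; apply: surfE; exact: oval_zE. Qed.

Lemma oval_surj p : 1 < `|cx p| < 2 -> exists t, p = oval_pt (cx p) t.
Proof.
move=> hx; have [r2 r0] := oval_r_sqr hx.
have G0 := oval_G_gt0 (cy p) hx; set g := Num.sqrt (oval_G (cx p) (cy p)).
have g0 : 0 < g by rewrite sqrtr_gt0.
have [|t [ct st]] := @turn_exists R (cy p / oval_r (cx p)) (cz p / (oval_r (cx p) * g)).
  rewrite !expr_div_n czE domain_eqE -/(oval_G _ _) exprMn (sqr_sqrtr (ltW G0)) r2.
  by field; rewrite -r2 sqrf_eq0; lra.
exists t; have [ex ey ez] := oval_ptE t hx.
have yE : oval_r (cx p) * cost t = cy p by rewrite ct mulrC divfK //; lra.
apply: Sigma_eq; rewrite ?ex ?ey ?ez ?yE //.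
rewrite /oval_z yE st -/g mulrAC mulrC divfK // mulf_neq0 //; lra.
Qed.

Lemma oval_continuous (T : topologicalType) (f g : T -> R) : (forall u, 1 < `|f u| < 2) ->
  continuous f -> continuous g -> continuous (fun u => oval_pt (f u) (g u)).
Proof.
move=> hf cf cg; apply: surf_continuous => //.
- by move=> u; exact: oval_zE.
- by rewrite /oval_r; cont.
- by rewrite /oval_z /oval_r /oval_G; cont.
Qed.

Variable x0 : R.
Hypothesis hx0 : 1 < `|x0| < 2.

Lemma oval_subproof1 : continuous (oval_pt x0).
Proof. by apply: oval_continuous => //; cont. Qed.

Lemma oval_subproof2 t : oval_pt x0 (t + 1) = oval_pt x0 t.
Proof. by rewrite /oval_pt /oval_z -[1]/(1%:~R) costDz sintDz. Qed.

Definition oval : loop R Sigma := Loop oval_subproof1 oval_subproof2.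

Lemma range_oval : range oval = [set p | cx p = x0].
Proof.
apply/seteqP; split=> [_ [t _ <-]|p /= px]; first by have [] := oval_ptE t hx0.
by have [|t pE] := @oval_surj p; [rewrite px|exists t => //; rewrite pE px].
Qed.

Lemma oval_simple : simple oval.
Proof.
move=> t u; rewrite !in_itv /= => ht hu E.
have [_ y1 z1] := oval_ptE t hx0; have [_ y2 z2] := oval_ptE u hx0.
have [_ r0] := oval_r_sqr hx0.
have rn : oval_r x0 != 0 by lra.
have cE : cost t = cost u.
  by apply: (mulfI rn); rewrite -y1 -y2; congr cy.
have G0 := oval_G_gt0 (oval_r x0 * cost t) hx0.
have sE : sint t = sint u.
  have : oval_z x0 t = oval_z x0 u by rewrite -z1 -z2; congr cz.
  rewrite /oval_z -cE => /mulIf h; apply: (mulfI rn); apply: h.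
  by rewrite sqrtr_eq0 -ltNge.
have /intrP[n tn] := turn_inj cE sE.
have n0 : n = 0.
  have : -1 < (n%:~R : R) < 1 by rewrite -tn; lra.
  by rewrite -[-1]/(-(1%:~R : R)) -mulrNz ltr_int ltrz1; lia.
by apply/eqP; rewrite -subr_eq0 tn n0.
Qed.

Lemma hyper_oval : s_invariant oval.
Proof.
rewrite /s_invariant range_oval; apply/seteqP; split=> [_ [p /= px <-]|p /= px].
  by have [-> _ _] := hypE p.
by exists (hyperelliptic p); [have [-> _ _] := hypE p|exact: hypK].
Qed.

Lemma outer_left : cx (outer_pt true (-5 : R)) = -5.
Proof. by have [|->] := @outer_ptE R true (-5); first lra. Qed.

Lemma outer_right : cx (outer_pt true (5 : R)) = 5.
Proof. by have [|->] := @outer_ptE R true 5; first lra. Qed.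

Lemma oval_separating : separating oval.
Proof.
have hx1 : -2 < x0 < 2 by move: hx0; case: (ger0P x0) => _; lra.
move=> cn; have [p Cp|h|h] := connected_side (@cx_continuous R) cn (a := x0).
- by apply/eqP => px; apply: Cp; rewrite range_oval.
- have := h (outer_pt true 5); rewrite outer_right range_oval /= outer_right => /(_ (ltac:(lra))); lra.
- have := h (outer_pt true (-5)); rewrite outer_left range_oval /= outer_left => /(_ (ltac:(lra))); lra.
Qed.

(** Sliding along the tube of ovals at a fixed angle approaches a point of the oval from either
    side; this determines the frontiers of the pieces. *)
Lemma oval_limit p (s : R) : cx p = x0 -> `|s| = 1 ->
  forall B, nbhs p B -> exists q, [/\ B q, 0 < s * (cx q - x0) & `|cx q - x0| < 1].
Proof.
move=> px s1 B nB.
have hx1 : 1 < `|cx p| < 2 by rewrite px.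
have [t pE] := oval_surj hx1; rewrite px in pE hx1.
pose e : R := Num.min (2 - `|x0|) (`|x0| - 1).
have e0 : 0 < e by rewrite /e lt_min; apply/andP; split; lra.
pose f (u : R) := x0 + s * (clamp (e / 2) u).
have hf u : 1 < `|f u| < 2.
  have := @clamp_le R (e / 2) u; rewrite ler_norml => /(_ (ltac:(lra))) hu.
  have : e <= 2 - `|x0| /\ e <= `|x0| - 1 by rewrite /e !ge_min !lexx orbT.
  have : s = 1 \/ s = -1 by move: s1; case: (ger0P s) => _ ?; [left|right]; lra.
  rewrite /f; move: hu; set c := clamp _ _ => hu [] -> [e1 e2];
    case: (ger0P x0) e1 e2 => h e1 e2; case: (ger0P (_ + _)); lra.
pose g u := oval_pt (f u) t.
have cg : continuous g by apply: oval_continuous => //; [rewrite /f; cont|cont].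
have f0 : f 0 = x0 by rewrite /f clamp_id ?normr0 ?mulr0 ?addr0 //; lra.
have g0 : g 0 = p by rewrite /g f0 -pE.
have nB' : nbhs (0 : R) (g @^-1` B) by apply: cg; rewrite g0.
have [d /= d0 dB] := nB'.
pose u : R := Num.min (d / 2) (e / 2).
have u0 : 0 < u by rewrite /u lt_min; apply/andP; split; lra.
have ud : u <= d / 2 /\ u <= e / 2 by rewrite /u !ge_min !lexx orbT.
exists (g u); split.
- by apply: dB; rewrite /ball /= sub0r normrN gtr0_norm //; lra.
- have [-> _ _] := oval_ptE t (hf u).
  rewrite /f clamp_id; last by rewrite gtr0_norm; lra.
  have s2 : s ^+ 2 = 1 by rewrite -(real_normK (num_real s)) s1 expr1n.
  by rewrite (_ : _ * _ = s ^+ 2 * u); [rewrite s2 mul1r|ring].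
- have [-> _ _] := oval_ptE t (hf u).
  rewrite /f clamp_id; last by rewrite gtr0_norm; lra.
  have : e <= 2 - `|x0| /\ e <= `|x0| - 1 by rewrite /e !ge_min !lexx orbT.
  by rewrite (_ : x0 + s * u - x0 = s * u); [rewrite normrM s1 mul1r gtr0_norm //; lra|ring].
Qed.

End Ovals.

(** * The model pair of ovals and the splitting it cuts out *)

Section BasePair.
Variable R : realType.
Notation Sigma := (Sigma3 R).
Notation hc := (hc R).
Implicit Types (p q : Sigma) (x y : R).

Definition side (i : nat) : set Sigma := match i with
  | 0 => [set p | cx p < -(3/2)]
  | 1 => [set p | -(3/2) < cx p < 3/2]
  | _ => [set p | 3/2 < cx p] end.

Lemma base_hl : 1 < `|-(3/2) : R| < 2.
Proof. by rewrite normrN ger0_norm; lra. Qed.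

Lemma base_hr : 1 < `|3/2 : R| < 2.
Proof. by rewrite ger0_norm; lra. Qed.

Definition ovl := oval base_hl.
Definition ovr := oval base_hr.

Lemma side_connected (i : nat) : connected (side i).
Proof.
case: i => [|[|i]]; [apply: connected_left|exact: connected_middle|apply: connected_right]; lra.
Qed.

Lemma side_open (i : nat) : open (side i).
Proof.
have o1 := open_lt (-(3/2)) (@cx_continuous R).
have o2 := open_lt (3/2) (@cx_continuous R).
have o3 := open_gt (-(3/2)) (@cx_continuous R).
have o4 := open_gt (3/2) (@cx_continuous R).
case: i => [|[|i]] //=.
rewrite (_ : [set p | _] = [set p : Sigma | -(3/2) < cx p] `&` [set p | cx p < 3/2]).
  exact: openI.
by apply/seteqP; split=> p /=; [move/andP|case=> -> ->].
Qed.

Definition base_compl : set Sigma := ~` (range ovl `|` range ovr).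

Lemma base_complE : base_compl = [set p | cx p != -(3/2) /\ cx p != 3/2].
Proof.
rewrite /base_compl !range_oval; apply/seteqP; split=> p /=.
  by move=> h; split; apply/eqP => h'; apply: h; [left|right].
by case=> /eqP h1 /eqP h2 [].
Qed.

Lemma side_compl (i : nat) : side i `<=` base_compl.
Proof.
rewrite base_complE; case: i => [|[|i]] p /= h; split; lra.
Qed.

Lemma side_component (i : nat) p : side i p -> side i = connected_component base_compl p.
Proof.
move=> sp; apply/seteqP; split.
  by apply: connected_component_max => //; [exact: side_compl|exact: side_connected].
have cn := @component_connected _ base_compl p.
have pC := connected_component_refl (side_compl sp).
have sub := @connected_component_sub _ base_compl p; rewrite base_complE in sub cn pC *.
have [q /sub[]//|h1|h1] := connected_side (@cx_continuous R) cn (a := -(3/2)).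
  have := h1 _ pC; case: i sp => [|[|i]] /= sp; [|lra|lra] => _ q /h1 //=.
have [q /sub[]//|h2|h2] := connected_side (@cx_continuous R) cn (a := 3/2).
  have := h2 _ pC; have := h1 _ pC; case: i sp => [|[|i]] /= sp; [lra| |lra] => _ _ q Cq /=.
  by rewrite h1 // h2.
have := h2 _ pC; case: i sp => [|[|i]] /= sp; [lra|lra|] => _ q /h2 //=.
Qed.

Lemma surf_pt x : -5 <= x <= 5 -> exists p, cx p = x.
Proof. by move=> hx; exists (outer_pt true x); have [] := outer_ptE true hx. Qed.

Lemma side_is_component (i : nat) : component base_compl (side i).
Proof.
have [p sp] : exists p, side i p.
  case: i => [|[|i]].
  - by have [|p px] := @surf_pt (-4); [lra|exists p; rewrite /= px; lra].
  - by have [|p px] := @surf_pt 0; [lra|exists p; rewrite /= px; lra].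
  - by have [|p px] := @surf_pt 4; [lra|exists p; rewrite /= px; lra].
by exists p; [exact: side_compl sp|exact: side_component].
Qed.

Lemma side_closure (i : nat) : closure (side i) `<=`
  match i with 0 => [set p | cx p <= -(3/2)] | 1 => [set p | -(3/2) <= cx p <= 3/2]
  | _ => [set p | 3/2 <= cx p] end.
Proof.
have out p (A : set Sigma) : open A -> A p -> A `&` side i = set0 -> ~ closure (side i) p.
  move=> oA Ap A0 cp; have [q [qs qA]] := cp A (open_nbhs_nbhs (conj oA Ap)).
  by have : (A `&` side i) q by []; rewrite A0.
have o1 := open_lt (-(3/2)) (@cx_continuous R).
have o2 := open_lt (3/2) (@cx_continuous R).
have o3 := open_gt (-(3/2)) (@cx_continuous R).
have o4 := open_gt (3/2) (@cx_continuous R).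
move=> p cp; case: i out cp => [|[|i]] out cp /=.
- rewrite leNgt; apply/negP => h; apply: (out p _ o3 h _ cp).
  by apply/seteqP; split=> // q [] /=; lra.
- apply/andP; split; rewrite leNgt; apply/negP => h.
    by apply: (out p _ o1 h _ cp); apply/seteqP; split=> // q [] /=; lra.
  by apply: (out p _ o4 h _ cp); apply/seteqP; split=> // q [] /=; lra.
- rewrite leNgt; apply/negP => h; apply: (out p _ o2 h _ cp).
  by apply/seteqP; split=> // q [] /=; lra.
Qed.

Lemma side_frontier : [/\ frontier (side 0) = range ovl,
  frontier (side 1) = range ovl `|` range ovr & frontier (side 2) = range ovr].
Proof.
have lim x0 (hx0 : 1 < `|x0| < 2) p (s : R) (A : set Sigma) : cx p = x0 -> `|s| = 1 ->
    (forall q, 0 < s * (cx q - x0) -> `|cx q - x0| < 1 -> A q) -> closure A p.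
  move=> px s1 h B nB; have [q [Bq q1 q2]] := oval_limit hx0 px s1 nB.
  by exists q; split=> //; exact: h.
have int i : (side i)° = side i by apply/interior_id; exact: side_open.
have n1 : `|1 : R| = 1 by rewrite normr1.
have n2 : `|-1 : R| = 1 by rewrite normrN1.
rewrite /frontier !int !range_oval; split; apply/seteqP; split=> p /=.
- by case=> /(@side_closure 0) /= h1 h2; lra.
- move=> px; split; last by lra.
  by apply: (lim _ base_hl p (-1) _ px n2) => q /= h1 h2; lra.
- by case=> /(@side_closure 1) /= h1 h2; have [|] := ltP (-(3/2)) (cx p); [right|left]; lra.
- case=> px; (split; last by lra).
    apply: (lim _ base_hl p 1 _ px n1) => q /= h1; rewrite ltr_norml; lra.
  apply: (lim _ base_hr p (-1) _ px n2) => q /= h1; rewrite ltr_norml; lra.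
- by case=> /(@side_closure 2) /= h1 h2; lra.
- move=> px; split; last by lra.
  by apply: (lim _ base_hr p 1 _ px n1) => q /= h1 h2; lra.
Qed.

Lemma disjoint_ovals : range ovl `&` range ovr = set0.
Proof. by rewrite !range_oval; apply/seteqP; split=> // p [] /= -> ?; lra. Qed.

Section Homology.
Variable dot : H1 R Sigma -> H1 R Sigma -> int.
Hypothesis dotP : intersection_form dot.
Hypothesis rank6 : exists e : 'I_6 -> H1 R Sigma, Zbasis setT e.

Lemma lam_incl_int k (X : set Sigma) (h : H1 R X) : (k < 7)%N ->
  (forall p, X p -> dual k p \is a Num.int) -> lam k (H1_incl h) = 0.
Proof.
move=> k7 hX; rewrite /lam /H1_incl deg_map; last exact: dual_circ.
by apply: (deg_cst (a := 0)) => p; rewrite subr0; apply: hX; exact: (set_mem (valP p)).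
Qed.

Lemma lam_incl_comb k (X : set Sigma) (h h' : H1 R X) (a b : int) : (k < 7)%N ->
  lam k (H1_incl (h *~ a + h' *~ b)) = lam k (H1_incl h *~ a + H1_incl h' *~ b).
Proof.
move=> k7; have cd := dual_circ R k7.
have ci : circ (dual k \o (@set_val _ X)).
  by apply: circ_comp cd; exact: initial_continuous.
by rewrite lamD // !lamMz // /lam /H1_incl !deg_map // degD // !deg_mulz.
Qed.

Lemma incl_comb (X : set Sigma) (h h' : H1 R X) (a b : int) :
  H1_incl (h *~ a + h' *~ b) = H1_incl h *~ a + H1_incl h' *~ b.
Proof.
apply: (lam_inj rank6) => k; have k7 : (k < 7)%N by exact: ltn_trans (ltn_ord k) _.
exact: lam_incl_comb.
Qed.

Lemma loop_class_incl (X : set Sigma) (c : loop R Sigma) : (forall t, X (c t)) ->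
  range (@H1_incl R Sigma X) (loop_class c).
Proof.
move=> cX; pose f t : X := exist _ (c t) (mem_set (cX t)).
have cf : continuous f by apply: continuous_sub; exact: loop_continuous.
have pf t : f (t + 1) = f t by apply/val_inj; exact: loop_periodic.
exists (loop_class (Loop cf pf)) => //.
rewrite /H1_incl /loop_class H1_map_hclass; congr hclass; apply/val_inj => /=.
rewrite /chain_map liftU scale1r; congr << _ >>.
by apply/continuousEP => p.
Qed.

Lemma range_incl_span (X : set Sigma) (x y : H1 R Sigma) : range (@H1_incl R Sigma X) x ->
  range (@H1_incl R Sigma X) y -> span x y `<=` range (@H1_incl R Sigma X).
Proof.
by move=> [h _ <-] [h' _ <-] _ [a [b ->]]; rewrite -incl_comb; eexists.
Qed.

Lemma hole_tau_far (c : R) p : [\/ c = -3, c = 0 | c = 3] -> 9 / 4 <= (cx p - c) ^+ 2 ->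
  hole_U c p -> 1 <= `|hole_tau c p|.
Proof.
move=> c3 far U; have yy := sqr_ge0 (cy p).
have rr := rad_sqr c p; have r1 := rad_ge1 c3 p.
have r2 : 3 / 2 <= rad c p by nra.
have z0 : cz p != 0.
  apply/eqP => z0; have [|_ h] := @hole_domain R c c3 (cx p) (cy p).
    by move: U; rewrite /hole_U => U; apply/andP; split; lra.
  have := h _; rewrite -czE z0 expr0n /= => /(_ erefl); lra.
rewrite /hole_tau normrM normrM normr_sg z0 mul1r !ger0_norm; lra.
Qed.

Lemma dual_side k (i : nat) p : (k < 7)%N -> side i p ->
  match i with 0 => (2 < k)%N | 1 => (k < 2)%N || (4 < k)%N | _ => (k < 4)%N end ->
  dual k p \is a Num.int.
Proof.
move=> k7 sp ki; apply: dual_int; rewrite /chU /chtau.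
case ko : (odd k) => U.
  apply: hole_tau_far U; first by apply: hc3; lia.
  by case: k k7 ki ko => [|[|[|[|[|[|[|//]]]]]]] // _; case: i sp => [|[|i]] //= sp _ _; rewrite /hc /=; nra.
exfalso; move: U; rewrite /gap_U.
by case: k k7 ki ko => [|[|[|[|[|[|[|//]]]]]]] // _; case: i sp => [|[|i]] //= sp _ _; rewrite /hc /=; lra.
Qed.

Lemma lam_side k (i : nat) (h : H1 R (side i)) : (k < 7)%N ->
  match i with 0 => (2 < k)%N | 1 => (k < 2)%N || (4 < k)%N | _ => (k < 4)%N end ->
  lam k (H1_incl h) = 0.
Proof. by move=> k7 ki; apply: lam_incl_int => // p sp; exact: dual_side ki. Qed.

Lemma alpha_loop_domain (t : R) : (2 * sint t * ((3 + 2 * cost t) ^+ 2 + 8) *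
    Num.sqrt ((8 + 2 * cost t) * (4 + 2 * cost t))) ^+ 2 = domain_eq 0 (3 + 2 * cost t).
Proof.
have := cost_itv t => ci; rewrite exprMn sqr_sqrtr; last by apply: mulr_ge0; lra.
rewrite domain_eqE.
have s2 : sint t ^+ 2 = 1 - cost t ^+ 2 by rewrite -[1](cost2Dsint2 t); ring.
by rewrite !exprMn s2; ring.
Qed.

(** For $y = 3+2\cos$ one has $(5-y)(y-1) = 4\sin^2$, so the root of [domain_eq] over $x=0$ becomes
    an explicit signed expression. The loop shows that [aa 1] is carried by the middle piece. *)
Definition alpha_fun (t : R) : Sigma := surf 0 (3 + 2 * cost t)
  (2 * sint t * ((3 + 2 * cost t) ^+ 2 + 8) * Num.sqrt ((8 + 2 * cost t) * (4 + 2 * cost t))).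

Lemma alpha_subproof1 : continuous alpha_fun.
Proof. by apply: surf_continuous; [move=> t; rewrite alpha_loop_domain|cont|cont|cont]. Qed.

Lemma alpha_subproof2 t : alpha_fun (t + 1) = alpha_fun t.
Proof. by rewrite /alpha_fun -[1]/(1%:~R) costDz sintDz. Qed.

Definition alpha_loop : loop R Sigma := Loop alpha_subproof1 alpha_subproof2.

Lemma alpha_loopE t : [/\ cx (alpha_loop t) = 0, cy (alpha_loop t) = 3 + 2 * cost t &
  Num.sg (cz (alpha_loop t)) = Num.sg (sint t)].
Proof.
have [x1 y1 z1] := surfE (alpha_loop_domain t); split=> //; rewrite z1.
have ci := cost_itv t.
rewrite !sgrM (gtr0_sg (_ : 0 < 2)) // mul1r [Num.sg (_ + 8)]gtr0_sg ?mulr1; last first.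
  by have := sqr_ge0 (3 + 2 * cost t); lra.
by rewrite [Num.sg (Num.sqrt _)]gtr0_sg ?mulr1 // sqrtr_gt0 mulr_gt0; lra.
Qed.

Lemma lam_alpha_loop : lam 3 (loop_class alpha_loop) = -1.
Proof.
have cb := @bump_coord_cont R.
apply: (deg_cross_left (a := fun t => clamp 1 (4 * bump_coord t))); first exact: dual_circ.
- by cont.
- by rewrite bump_coordE div1r sint_quarter cost_quarter normr0 gtr0_sg // clamp_out1 //; lra.
- by rewrite bump_coordE sint_3quarter cost_3quarter normr0 sgrN gtr0_sg // clamp_outN1 //; lra.
- move=> t ht; have [x1 y1 z1] := alpha_loopE t; have c0 := cost_le0 ht; have ci := cost_itv t.
  rewrite /dual /dualf /chU /chtau /= /hole_U /hole_tau /rad z1 x1 y1 /hc.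
  rewrite (_ : 0 - 3 * (1 - 1) = 0 :> R) ?expr0n ?add0r; last by ring.
  rewrite sqrtr_sqr ger0_norm; last by lra.
  have -> : 4 * bump_coord t = 2 * (Num.sg (sint t) * (3 + 2 * cost t - 1)).
    by rewrite bump_coordE ler0_norm //; ring.
  case: ifP => hU; first by rewrite subrr.
  rewrite sub0r rpredN; apply: clamp_half_int.
  have s0 : sint t != 0.
    apply/eqP => s0; have [c1|c1] := sint0_cost s0; first by lra.
    by move: hU => /negbT; rewrite c1; lra.
  rewrite normrM normrM normr_sg s0 mul1r !ger0_norm; [|lra|lra].
  by move: hU => /negbT; rewrite -leNgt; nra.
- move=> t ht; have [x1 y1 z1] := alpha_loopE t; have c0 := cost_ge0 ht.
  rewrite /dual /dualf /chU /chtau /= /hole_U x1 y1 /hc.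
  by rewrite ifF ?rpred0 //; apply/negbTE; rewrite -leNgt; nra.
Qed.

(** Dual functions of chain curves away from a piece are integral on it, so the corresponding
    coordinates of its classes vanish; explicit loops in the piece give the reverse inclusion. *)
Lemma base_corresponds : corresponds ovl ovr (quad_splitting dot (ch R 0) (ch R 1) (aa R 2) (ch R 5)).
Proof.
exists (fun i : 'I_3 => side i); split.
- by move=> i; exact: side_is_component.
- exact: side_frontier.
have spanI (i : nat) (x y : H1 R Sigma) : range (@H1_incl R Sigma (side i)) x ->
    range (@H1_incl R Sigma (side i)) y ->
    (forall h : H1 R (side i), span x y (H1_incl h)) -> span x y = range (@H1_incl R Sigma (side i)).
  move=> rx ry h; apply/seteqP; split; first exact: range_incl_span.
  by move=> _ [z _ <-].
have inr (i : nat) (k : 'I_7) : (forall t, side i (cc R k t)) ->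
    range (@H1_incl R Sigma (side i)) (loop_class (cc R k)) by exact: loop_class_incl.
have zero (i : nat) (h : H1 R (side i)) k := @lam_side k i h.
have even0 (h : H1 R Sigma) := sum_even_lam dotP rank6 h.
have neg (i : nat) (x : H1 R Sigma) : range (@H1_incl R Sigma (side i)) (x *~ -1) ->
    range (@H1_incl R Sigma (side i)) x.
  by move=> rx; apply: (range_incl_span rx rx); exists (-1), 0; rewrite mulr0z addr0 -mulrzA mulr1z.
case=> -[|[|[|//]]] i3.
- change (span (ch R 0) (ch R 1) = range (@H1_incl R Sigma (side 0))).
  apply: spanI => [| |h].
  + apply: inr => t /=; have [|-> _ _] := @cc_even R (o7 0) t; rewrite ?o7E //.
    by rewrite /hc /=; have := cost_itv t; lra.
  + apply: inr => t /=; have [|-> _ _] := @cc_odd R (o7 1) t; rewrite ?o7E //.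
    by rewrite /hc /=; have := cost_itv t; lra.
  rewrite -(coordsK rank6 (H1_incl h)) /coords /vec.
  have := even0 (H1_incl h); rewrite !(zero 0%N h 3%N, zero 0%N h 4%N, zero 0%N h 5%N, zero 0%N h 6%N) //.
  rewrite !addr0 => l02; exists (lam 1 (H1_incl h)), (- lam 0 (H1_incl h)).
  by rewrite (_ : - lam 0 (H1_incl h) - lam 2 (H1_incl h) = 0) ?mulr0z ?addr0 //; lia.
- change ([set h | [/\ dot h (ch R 0) = 0, dot h (ch R 1) = 0, dot h (aa R 2) = 0 & dot h (ch R 5) = 0]] =
    range (@H1_incl R Sigma (side 1))).
  apply/seteqP; split=> [h [h0 h1 h2 h5]|_ [h _ <-]].
    have r3 : range (@H1_incl R Sigma (side 1)) (ch R 3).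
      apply: inr => t /=; have [|-> _ _] := @cc_odd R (o7 3) t; rewrite ?o7E //.
      by rewrite /hc /=; have := cost_itv t; lra.
    have ra : range (@H1_incl R Sigma (side 1)) (aa R 1).
      apply: neg; have hx t : cx (alpha_loop t) = hc (Ordinal i3).
        by have [-> _ _] := alpha_loopE t; rewrite /hc /=; ring.
      have := alpha_class rank6 hx; rewrite lam_alpha_loop => <-.
      by apply: loop_class_incl => t /=; have [-> _ _] := alpha_loopE t; lra.
    apply: (range_incl_span ra r3).
    move: h0 h1 h2 h5; rewrite -!(lam_dot dotP rank6) //.
    rewrite /aa !(dotDr dotP) -!(lam_dot dotP rank6) // => h0 h1 h2 h5.
    rewrite -(coordsK rank6 h) /coords /vec h0 h1 h5 (_ : _ - _ - lam 4 h = 0); last by lia.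
    exists (lam 3 h), (- lam 2 h).
    by rewrite oppr0 !mulr0z !add0r addr0.
  have := even0 (H1_incl h).
  rewrite !(zero 1%N h 0%N, zero 1%N h 1%N, zero 1%N h 5%N, zero 1%N h 6%N) // => l24.
  split; try by rewrite -(lam_dot dotP rank6) // zero.
  by rewrite /aa !(dotDr dotP) -!(lam_dot dotP rank6) // (zero 1%N h 0%N) //; lia.
- change (span (aa R 2) (ch R 5) = range (@H1_incl R Sigma (side 2))).
  apply: spanI => [| |h].
  + apply: neg; rewrite mulrN1z -(ch6 rank6).
    apply: inr => t /=; have [|-> _ _] := @cc_even R (o7 6) t; rewrite ?o7E //.
    by rewrite /hc /=; have := cost_itv t; lra.
  + apply: inr => t /=; have [|-> _ _] := @cc_odd R (o7 5) t; rewrite ?o7E //.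
    by rewrite /hc /=; have := cost_itv t; lra.
  rewrite -(coordsK rank6 (H1_incl h)) /coords /vec.
  rewrite !(zero 2%N h 0%N, zero 2%N h 1%N, zero 2%N h 2%N, zero 2%N h 3%N) //.
  exists (lam 5 (H1_incl h)), (0 - 0 - lam 4 (H1_incl h)).
  by rewrite oppr0 subr0 !mulr0z !add0r.
Qed.

End Homology.
End BasePair.

(** * The ovals are essential and not isotopic *)

Section Essential.
Variable R : realType.
Notation Sigma := (Sigma3 R).
Notation hc := (hc R).
Implicit Types (p q : Sigma).

Lemma int_eq (x y : R) : x \is a Num.int -> x = y -> y \is a Num.int.
Proof. by move=> + <-. Qed.

Lemma norm_int_ge1 (n : int) : n != 0 -> 1 <= `|n%:~R : R|.
Proof. by move=> n0; rewrite -intr_norm -[1]/(1%:~R : R) ler_int; lia. Qed.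

Lemma int_const (h : R -> R) t : continuous h -> (forall t, 0 <= t <= 1 -> h t \is a Num.int) ->
  0 <= t <= 1 -> h t = h 0.
Proof.
move=> ch hi ht; have := @int_continuous_const R (fun s => h (t * s)).
rewrite mulr1 mulr0; apply; first by cont.
by move=> s hs; apply: hi; nra.
Qed.

Definition rim_U (p : Sigma) := 81 / 4 < cx p ^+ 2 + cy p ^+ 2.
(** Dual function of the outer circle, with [z] as transverse coordinate. The radius $9/2$ bounding
    [rim_U] is one at which $|z| > 1$ throughout. *)
Definition rim : Sigma -> R := dualf rim_U (@cz R).

Lemma rim_far p : cx p ^+ 2 + cy p ^+ 2 = 81 / 4 -> 1 < `|cz p|.
Proof.
move=> h; have x2 : 0 <= cx p ^+ 2 <= 81 / 4.
  by rewrite sqr_ge0 /= -h lerDl sqr_ge0.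
rewrite -(@ltr_pXn2r _ 2) ?nnegrE // expr1n real_normK ?num_real // czE domain_eqE h.
rewrite (_ : _ * _ = (25 - 81 / 4) * ((81 / 4 - 1) * ((113 / 4) ^+ 2 - 36 * cx p ^+ 2))).
  by nra.
have -> : cy p ^+ 2 = 81 / 4 - cx p ^+ 2 by rewrite -h; ring.
by field.
Qed.

Lemma rim_circ : circ rim.
Proof.
have cf : continuous (fun p : Sigma => cx p ^+ 2 + cy p ^+ 2) by cont.
have cn : continuous (fun p : Sigma => `|cz p|) by cont.
apply: band_circ.
- exact: (open_gt (81 / 4) cf).
- by move=> p _; exact: cz_continuous.
move=> p; rewrite /rim_U -leNgt le_eqVlt => /orP[/eqP/rim_far h|h].
  have := open_nbhs_nbhs (conj (open_gt 1 cn) h).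
  by apply: filterS => q /= /ltW.
have := open_nbhs_nbhs (conj (open_lt (81 / 4) cf) h).
by apply: filterS => q /= hq; rewrite ltNge (ltW hq).
Qed.

(** The annuli of the outer circle and of a middle gap are disjoint. Together the two functions thus
    map the surface to a wedge of two circles, where a commutator, trivial in homology, is still
    detectable. *)
Lemma rim_gap k p : (k < 7)%N -> ~~ odd k -> `|hc k./2 - 3 / 2| = 3 / 2 ->
  rim p \is a Num.int \/ dual k p \is a Num.int.
Proof.
move=> k7 ko hk; rewrite /rim /dualf; case: ifP => U; last by left; rewrite rpred0.
right; apply: dual_int; rewrite /chU /chtau (negbTE ko) /gap_U /gap_tau => hx.
move: U; rewrite /rim_U => U; rewrite leNgt; apply/negP; rewrite ltr_norml => hy.
have y2 : cy p ^+ 2 <= 1 / 4 by nra.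
have : hc k./2 = 3 \/ hc k./2 = 0 by move: hk; case: (ger0P (_ - _)) => _ ?; [left|right]; lra.
by case=> hE; rewrite hE in hx; nra.
Qed.

Variables (x0 : R) (k : nat).
Hypotheses (hx0 : 1 < `|x0| < 2) (x0E : `|x0| = 3 / 2).
Hypotheses (k7 : (k < 7)%N) (ko : ~~ odd k) (hk : `|hc k./2 - 3 / 2| = 3 / 2).
Hypothesis kx : hc k./2 - 3 < x0 < hc k./2.

Let Z (t : R) := cz (oval hx0 t).

Lemma oval_r2 : oval_r x0 ^+ 2 = 91 / 4 /\ 0 < oval_r x0.
Proof.
have [r2 r0] := oval_r_sqr hx0; split=> //.
by rewrite r2 -(real_normK (num_real x0)) x0E; field.
Qed.

Lemma oval_cy t : cy (oval hx0 t) = oval_r x0 * cost t.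
Proof. by have [] := oval_ptE t hx0. Qed.

Lemma oval_big t : (oval_r x0 * cost t) ^+ 2 <= 18 -> 1 <= `|Z t|.
Proof.
have [r2 r0] := oval_r2; have [ex ey ez] := oval_ptE t hx0 => h.
rewrite /Z -(@ler_pXn2r _ 2) ?nnegrE // expr1n real_normK ?num_real // czE.
rewrite -[loop_fun _ _]/(oval_pt x0 t) ex ey domain_eqE.
have xx : x0 ^+ 2 = 9 / 4 by rewrite -(real_normK (num_real x0)) x0E; field.
set Y := (oval_r x0 * cost t) ^+ 2 in h *.
have Y0 : 0 <= Y by exact: sqr_ge0.
have -> : ((x0 + 3) ^+ 2 + Y - 1) * ((x0 ^+ 2 + Y - 1) * ((x0 - 3) ^+ 2 + Y - 1)) =
    (x0 ^+ 2 + Y - 1) * ((x0 ^+ 2 + Y + 8) ^+ 2 - 36 * x0 ^+ 2) by ring.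
rewrite xx.
have e1 : 19 / 4 <= 25 - (9 / 4 + Y) by lra.
have e2 : 5 / 4 <= 9 / 4 + Y - 1 by lra.
have e3 : 20 <= (9 / 4 + Y + 8) ^+ 2 - 36 * (9 / 4) by nra.
by apply: mulr_ege1; [lra|apply: mulr_ege1; lra].
Qed.

Lemma oval_sign t : Num.sg (Z t) = Num.sg (sint t).
Proof.
have [_ r0] := oval_r2; have [_ _ ez] := oval_ptE t hx0.
rewrite /Z -[loop_fun _ _]/(oval_pt x0 t) ez /oval_z !sgrM (gtr0_sg r0) mul1r.
by rewrite [Num.sg (Num.sqrt _)]gtr0_sg ?mulr1 // sqrtr_gt0 oval_G_gt0.
Qed.

Lemma oval_top : clamp 1 (Z (1 / 4)) = 1.
Proof.
apply: clamp_out1; have := @oval_big (1 / 4); rewrite div1r cost_quarter mulr0 expr0n /=.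
move=> /(_ (ltac:(lra))); have := oval_sign 4^-1; rewrite sint_quarter sgr1.
by case: (sgrP (Z _)) => //; lra.
Qed.

Lemma oval_bottom : clamp 1 (Z (3 / 4)) = -1.
Proof.
apply: clamp_outN1; have := @oval_big (3 / 4); rewrite cost_3quarter mulr0 expr0n /=.
move=> /(_ (ltac:(lra))); have := oval_sign (3 / 4); rewrite sint_3quarter sgrN sgr1.
by case: (sgrP (Z _)) => //; lra.
Qed.

Lemma rim_oval t : rim (oval hx0 t) - (clamp 1 (Z t) - 1) / 2 \is a Num.int.
Proof.
rewrite /rim /dualf -/(Z t); case: ifP => U.
  by rewrite (_ : _ - _ = 1) ?rpred1 //; field.
rewrite sub0r rpredN (_ : (_ - 1) / 2 = (clamp 1 (Z t) + 1) / 2 - 1); last by field.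
rewrite rpredB ?rpred1 //; apply/clamp_half_int/oval_big.
move/negbT: U; rewrite /rim_U -leNgt oval_cy; have [-> _ _] := oval_ptE t hx0.
have xx : x0 ^+ 2 = 9 / 4 by rewrite -(real_normK (num_real x0)) x0E; field.
by rewrite xx; lra.
Qed.

Lemma gap_oval t : dual k (oval hx0 t) - (clamp 1 (2 * (oval_r x0 * cost t)) - 1) / 2 \is a Num.int.
Proof.
rewrite /dual /dualf /chU /chtau (negbTE ko) /gap_U /gap_tau oval_cy.
have [-> _ _] := oval_ptE t hx0; rewrite kx.
by rewrite (_ : _ - _ = 1) ?rpred1 //; field.
Qed.

Lemma oval_lift_Z : continuous Z.
Proof. by have co := @loop_continuous _ _ (oval hx0); rewrite /Z; cont. Qed.

(* In a null homotopy the functions [rim] and [dual k] lift to a map into the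
   grid of points with an integral coordinate, where the loop around the unit
   square given by the oval is not null homotopic: it crosses one edge once. *)
Lemma oval_essential : essential (oval hx0).
Proof.
case=> F [Fc Fper F0 [pt F1]].
pose cl (x : R * R) := (clamp01 x.1, clamp01 x.2).
have ccl : continuous cl by rewrite /cl; cont.
have cl01 (s t : R) : 0 <= s <= 1 -> 0 <= t <= 1 -> cl (s, t) = (s, t).
  by move=> hs ht; rewrite /cl /= !clamp01_id.
have cFcl : continuous (F \o cl).
  have : {within setT, continuous (F \o cl)}.
    apply: continuous_within_map Fc => // p _; split=> //=.
    by rewrite in_itv /=; exact: clamp01_itv.
  exact: (continuous_subspace_setT _).2.
have Fcl1 (s : R) : F (cl (s, 1)) = F (cl (s, 0)).
  rewrite /cl /= (@clamp01_id _ 1) ?(@clamp01_id _ 0); [|lra|lra].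
  by rewrite -{1}[1](add0r 1) Fper //= in_itv /=; exact: clamp01_itv.
have c1 : circ (rim \o (F \o cl)) by apply: circ_comp => //; exact: rim_circ.
have c2 : circ (dual k \o (F \o cl)) by apply: circ_comp => //; exact: dual_circ.
have [g1 cg1 g1E] := lift_rect c1; have [g2 cg2 g2E] := lift_rect c2.
have cZ := oval_lift_Z.
(* [(G1, G2)] runs once around the boundary of the square $[-1,0]^2$; the lifts [a] and [b] are
   shifted by integers so as to start on it. *)
pose G1 (t : R) := (clamp 1 (Z t) - 1) / 2.
pose G2 (t : R) := (clamp 1 (2 * (oval_r x0 * cost t)) - 1) / 2.
pose a x := g1 (cl x) - (g1 (0, 0) - G1 0).
pose b x := g2 (cl x) - (g2 (0, 0) - G2 0).
have ca : continuous a by rewrite /a; cont.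
have cb : continuous b by rewrite /b; cont.
have F0E t : 0 <= t <= 1 -> (F \o cl) (0, t) = oval hx0 t.
  by move=> ht; rewrite /= cl01 ?F0 //; lra.
have i1 : g1 (0, 0) - G1 0 \is a Num.int.
  have := g1E 0 0; rewrite /= cl01 ?F0; [|lra|lra].
  move=> /(_ (ltac:(lra)) (ltac:(lra))) h; have := rpredD h (rim_oval 0).
  by move/int_eq; apply; rewrite /G1; ring.
have i2 : g2 (0, 0) - G2 0 \is a Num.int.
  have := g2E 0 0; rewrite /= cl01 ?F0; [|lra|lra].
  move=> /(_ (ltac:(lra)) (ltac:(lra))) h; have := rpredD h (gap_oval 0).
  by move/int_eq; apply; rewrite /G2; ring.
have clK x : cl (cl x) = cl x by rewrite -[RHS]cl01 //; exact: clamp01_itv.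
have aE x : a x - rim (F (cl x)) \is a Num.int.
  have := g1E (clamp01 x.1) (clamp01 x.2) (clamp01_itv _) (clamp01_itv _).
  rewrite -/(cl x) /= clK => h; have := rpredB h i1.
  by move/int_eq; apply; rewrite /a; ring.
have bE x : b x - dual k (F (cl x)) \is a Num.int.
  have := g2E (clamp01 x.1) (clamp01 x.2) (clamp01_itv _) (clamp01_itv _).
  rewrite -/(cl x) /= clK => h; have := rpredB h i2.
  by move/int_eq; apply; rewrite /b; ring.
have grid x : a x \is a Num.int \/ b x \is a Num.int.
  have [h|h] := @rim_gap k (F (cl x)) k7 ko hk; [left|right].
    by have := rpredD (aE x) h; rewrite subrK.
  by have := rpredD (bE x) h; rewrite subrK.
have I0 : 0 <= (0 : R) <= 1 by lra.
have I1 : 0 <= (1 : R) <= 1 by lra.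
have a0 t : 0 <= t <= 1 -> a (0, t) = G1 t.
  move=> ht; apply/eqP; rewrite -subr_eq0.
  rewrite (@int_const (fun t => a (0, t) - G1 t) t) //; last first.
  - move=> u hu; have := rpredD (aE (0, u)) (rim_oval u).
    have -> : F (cl (0, u)) = oval hx0 u by exact: F0E.
    by move/int_eq; apply; rewrite /G1; ring.
  - by rewrite /G1; cont.
  by rewrite /a cl01 // /G1; apply/eqP; ring.
have b0 t : 0 <= t <= 1 -> b (0, t) = G2 t.
  move=> ht; apply/eqP; rewrite -subr_eq0.
  rewrite (@int_const (fun t => b (0, t) - G2 t) t) //; last first.
  - move=> u hu; have := rpredD (bE (0, u)) (gap_oval u).
    have -> : F (cl (0, u)) = oval hx0 u by exact: F0E.
    by move/int_eq; apply; rewrite /G2; ring.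
  - by rewrite /G2; cont.
  by rewrite /b cl01 // /G2; apply/eqP; ring.
have a1 t : 0 <= t <= 1 -> a (1, t) = a (1, 0).
  move=> ht; apply/eqP; rewrite -subr_eq0.
  rewrite (@int_const (fun t => a (1, t) - a (1, 0)) t) ?subrr //; first by cont.
  move=> u hu; have := rpredB (aE (1, u)) (aE (1, 0)).
  by rewrite !cl01 // !F1; move/int_eq; apply; ring.
have b1 t : 0 <= t <= 1 -> b (1, t) = b (1, 0).
  move=> ht; apply/eqP; rewrite -subr_eq0.
  rewrite (@int_const (fun t => b (1, t) - b (1, 0)) t) ?subrr //; first by cont.
  move=> u hu; have := rpredB (bE (1, u)) (bE (1, 0)).
  by rewrite !cl01 // !F1; move/int_eq; apply; ring.
have perE (f : R * R -> R) (r : Sigma -> R) : continuous f -> (forall x, f x - r (F (cl x)) \is a Num.int) ->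
    f (1, 1) = f (1, 0) -> forall s, 0 <= s <= 1 -> f (s, 1) = f (s, 0).
  move=> cf fE f1 s hs; have h u : 0 <= u <= 1 -> f (u, 1) - f (u, 0) = f (0, 1) - f (0, 0).
    move=> hu; rewrite (@int_const (fun u => f (u, 1) - f (u, 0)) u) //; first by cont.
    move=> v hv; have := rpredB (fE (v, 1)) (fE (v, 0)).
    by rewrite Fcl1; move/int_eq; apply; ring.
  have := h s hs; rewrite -(h 1 I1) f1 subrr => /eqP; rewrite subr_eq0 => /eqP //.
have pa := perE a rim ca aE (a1 1 I1).
have pb := perE b (dual k) cb bE (b1 1 I1).
(* [K] collapses the grid except for the edge $[-1,0]\times\{0\}$, along which [2 * a + 1] runs from
   -1 to 1. It exists on the grid, a covering of the wedge, but does not descend to the wedge. *)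
pose U (x : R * R) := `|b x| < 1 / 2.
pose K := dualf U (fun x : R * R => 2 * a x + 1).
have cK : circ K.
  have cnb : continuous (fun x => `|b x|) by cont.
  apply: band_circ.
  - exact: (open_lt (1/2) cnb).
  - by move=> x _; cont.
  move=> x; rewrite /U -leNgt => hb.
  have b0x : 0 < `|b x| by lra.
  have := open_nbhs_nbhs (conj (open_gt 0 cnb) b0x); apply: filterS => y /= hy hU.
  have [/intrP[n ->]|/intrP[n bn]] := grid y.
    have -> : 2 * n%:~R + 1 = (2 * n + 1)%:~R :> R by rewrite intrD intrM.
    by apply: norm_int_ge1; clear; lia.
  move: hy hU; rewrite bn normr_gt0 intr_eq0 => /norm_int_ge1 h1 h2.
  by have := le_lt_trans h1 h2; clear; lra.
have [g cg gE] := lift_rect cK.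
(* An explicit lift of [K] along the oval: it varies only where the cosine is positive, the crossing
   of the edge being cut in two by the base point [t = 0]. *)
pose L (t : R) := (clamp 1 (Z (Num.min t (1/4))) + 1) / 2 + (clamp 1 (Z (Num.max t (3/4))) + 1) / 2.
have cL : continuous L by rewrite /L; cont.
have KL t : 0 <= t <= 1 -> K (0, t) - L t \is a Num.int.
  move=> ht; rewrite /K /dualf /U a0 // b0 //.
  have [r2 r0] := oval_r2; have ci := cost_itv t.
  have cle (z : R) : -1 <= clamp 1 z <= 1 by have := @clamp_le R 1 z ler01; rewrite ler_norml.
  have GZ : clamp 1 (2 * G1 t + 1) = clamp 1 (Z t).
    by rewrite /G1 (_ : 2 * _ + 1 = clamp 1 (Z t)); [apply: clamp_id; rewrite ler_norml|field].
  have ZI : cost t = 0 -> (clamp 1 (Z t) + 1) / 2 \is a Num.int.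
    by move=> c0; apply: clamp_half_int; apply: oval_big; rewrite c0 mulr0 expr0n.
  have Llo : t <= 1/4 -> L t = (clamp 1 (Z t) + 1) / 2.
    by move=> h; rewrite /L min_l // max_r; [rewrite oval_bottom; field|lra].
  have Lhi : 3/4 <= t -> L t = 1 + (clamp 1 (Z t) + 1) / 2.
    by move=> h; rewrite /L min_r; [rewrite max_l // oval_top; field|lra].
  have Lmid : 1/4 <= t <= 3/4 -> L t = 1.
    by move=> h; rewrite /L min_r; [rewrite max_r; [rewrite oval_top oval_bottom; field|lra]|lra].
  have [cp|cn] := ltP 0 (cost t).
    rewrite ifT; last first.
      rewrite /G2 ler0_norm; last by have := cle (2 * (oval_r x0 * cost t)); lra.
      have : 0 < clamp 1 (2 * (oval_r x0 * cost t)).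
        by rewrite /clamp lt_max lt_min ltr01 /= !mulr_gt0 ?orbT.
      by lra.
    rewrite GZ; have [t1|t1] := leP t (1/4); first by rewrite Llo // subrr.
    have [t3|t3] := leP (3/4) t; first by rewrite Lhi // (_ : _ - _ = -1) ?rpredN ?rpred1 //; ring.
    have tm : 1/4 <= t <= 3/4 by lra.
    by have := lt_le_trans cp (cost_le0 tm); rewrite ltxx.
  rewrite ifF; last first.
    apply/negbTE; rewrite -leNgt /G2 ler0_norm; last by have := cle (2 * (oval_r x0 * cost t)); lra.
    have : clamp 1 (2 * (oval_r x0 * cost t)) <= 0.
      by rewrite /clamp ge_max ge_min; apply/andP; split; [lra|apply/orP; right; nra].
    by lra.
  rewrite sub0r rpredN.
  have [t1|t1] := leP t (1/4).
    rewrite Llo //; apply: ZI; apply/eqP; rewrite eq_le cn /=; apply: cost_ge0; lra.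
  have [t3|t3] := leP (3/4) t; last by rewrite Lmid ?rpred1 //; lra.
  rewrite Lhi // rpredD ?rpred1 //; apply: ZI; apply/eqP; rewrite eq_le cn /=.
  by have := @cost_ge0 R (t - 1); rewrite -[1]/(1%:~R) -mulrNz costDz; apply; lra.
have KE s : 0 <= s <= 1 -> K (s, 1) = K (s, 0).
  by move=> hs; rewrite /K /dualf /U pa // pb.
have k0 : g (0, 1) - g (0, 0) = 1.
  have h := @int_const (fun t => g (0, t) - L t) 1 _ _ I1.
  have : g (0, 1) - L 1 = g (0, 0) - L 0.
    apply: h; first by cont.
    by move=> t ht; have := rpredD (gE 0 t I0 ht) (KL t ht); move/int_eq; apply; ring.
  have L0 : L 0 = (clamp 1 (Z 0) + 1) / 2.
    by rewrite /L min_l; [rewrite max_r; [rewrite oval_bottom; field|lra]|lra].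
  have L1 : L 1 = 1 + (clamp 1 (Z 1) + 1) / 2.
    by rewrite /L min_r; [rewrite max_l; [rewrite oval_top; field|lra]|lra].
  have Z1 : Z 1 = Z 0 by rewrite /Z -[1](add0r 1) loop_periodic.
  by rewrite L0 L1 Z1; lra.
have k1 : g (1, 1) - g (1, 0) = 0.
  have h := @int_const (fun t => g (1, t) - g (1, 0)) 1 _ _ I1.
  rewrite h ?subrr //; first by cont.
  move=> t ht; have := rpredB (gE 1 t I1 ht) (gE 1 0 I1 I0).
  have -> : K (1, t) = K (1, 0) by rewrite /K /dualf /U a1 // b1.
  by move/int_eq; apply; ring.
(* The increment around the loop cannot depend on [s], yet it is 1 on the oval and 0 at the constant
   end. *)
have := @int_const (fun s => g (s, 1) - g (s, 0)) 1 _ _ I1; rewrite k0 k1 => h.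
suff : (0 : R) = 1 by lra.
apply: h; first by cont.
move=> s hs; have := rpredB (gE s 1 hs I1) (gE s 0 hs I0).
by rewrite KE //; move/int_eq; apply; ring.
Qed.

End Essential.

Section BaseSymmetric.
Variable R : realType.
Notation Sigma := (Sigma3 R).
Notation hc := (hc R).

Lemma ovl_essential : essential (@ovl R).
Proof.
apply: (@oval_essential R _ 2) => //; first by rewrite normrN ger0_norm; lra.
  by rewrite /hc /= -[_ - _ ]opprB normrN ger0_norm; lra.
by rewrite /hc /=; lra.
Qed.

Lemma ovr_essential : essential (@ovr R).
Proof.
apply: (@oval_essential R _ 4) => //; first by rewrite ger0_norm; lra.
  by rewrite /hc /= ger0_norm; lra.
by rewrite /hc /=; lra.
Qed.

(** An isotopy restricts to a homotopy of the loop, so its degrees can be computed at the end of the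
    isotopy. *)
Lemma isotopic_lam (F : R * Sigma -> Sigma) (c : loop R Sigma) (X : set Sigma) k :
  {within `[0, 1] `*` setT, continuous F} -> (forall p, F (0, p) = p) -> (k < 7)%N ->
  (forall t, X (F (1, c t))) -> (forall p, X p -> dual k p \is a Num.int) ->
  lam k (loop_class c) = 0.
Proof.
move=> Fc F0 k7 FX hX.
have cc : continuous (fun x : R * R => F (clamp01 x.1, c x.2)).
  apply: (continuous_subspace_setT _).2.
  have cm : continuous (fun x : R * R => (clamp01 x.1, c x.2)).
    by have cc := @loop_continuous _ _ c; cont.
  apply: (continuous_within_map cm _ Fc) => x _; split => //=.
  by rewrite in_itv /=; exact: clamp01_itv.
have c1 : continuous (fun t => F (1, c t)).
  have cm : continuous (fun t : R => (1 : R, t)) by cont.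
  have := (fun t => continuous_comp (cm t) (cc (1, t))).
  by rewrite (_ : _ \o _ = fun t => F (1, c t)) //; apply/funext => t; rewrite /= clamp01_id //; lra.
have p1 t : F (1, c (t + 1)) = F (1, c t) by rewrite loop_periodic.
rewrite /lam (@deg_homotopic _ _ _ c (Loop c1 p1) _ (dual_circ R k7) cc).
- apply/eqP; rewrite -(intr_eq0 R) (@deg_loop _ _ _ _ (fun=> 0)) ?subrr //; first exact: dual_circ.
    by cont.
  by move=> t _; rewrite sub0r rpredN; apply: hX; exact: FX.
- by move=> s _; rewrite /= -[1](add0r 1) loop_periodic.
- by move=> t ht; rewrite /= !clamp01_id ?F0 //; lra.
Qed.

(** The final homeomorphism would send each side of the left oval into one side of the right one. If
    both went to $x<3/2$ it would not be onto. A side sent to $x>3/2$ would take [ch 1] or [ch 3]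
    there, but [lam 0] and [lam 2] vanish on that piece and not on these classes. *)
Lemma ovals_nonisotopic : ~ isotopic R (range (@ovl R)) (range (@ovr R)).
Proof.
case=> F [G [[Fc Gc] FG F0 F1]].
pose phi p := F (1, p).
have cphi : continuous phi.
  apply: (continuous_subspace_setT _).2.
  have cm : continuous (fun p : Sigma => (1 : R, p)) by cont.
  by apply: (continuous_within_map cm _ Fc) => x _; split => //=; rewrite in_itv /=; lra.
have I1 : (1 : R) \in `[0, 1] by rewrite in_itv /=; lra.
have phi_off p : cx p != -(3/2) -> cx (phi p) != 3/2.
  move=> px; apply/eqP => h; have : range (@ovr R) (phi p) by rewrite range_oval.
  rewrite -F1 range_oval => -[q /= qx E].
  have [_ G1] := FG 1 p I1; have [_ G2] := FG 1 q I1.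
  by move: px; rewrite -G1 -/(phi p) -E G2 qx eqxx.
have conn (X : set Sigma) : connected X -> (forall p, X p -> cx p != -(3/2)) ->
    (forall p, X p -> cx (phi p) < 3/2) \/ (forall p, X p -> 3/2 < cx (phi p)).
  move=> cX hX; apply: (connected_side _ cX (f := fun p => cx (phi p))).
    by cont.
  by move=> p Xp; apply/phi_off/hX.
have dR k (p : Sigma) : (k < 4)%N -> 3/2 < cx p -> dual k p \is a Num.int.
  by move=> k4 px; apply: (dual_side (i := 2)) => //; lia.
have e1 : -5 < -(3/2) :> R by clear; lra.
have e2 : -(3/2) < 5 :> R by clear; lra.
have [] := conn _ (connected_left e1); first by move=> p /= px; rewrite lt_eqF.
  move=> hl.
  have [] := conn _ (connected_right e2); first by move=> p /= px; rewrite gt_eqF.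
    move=> hr; have [G1 _] := FG 1 (outer_pt true 5) I1.
    pose q := G (1, outer_pt true (5 : R)).
    have qE : cx (phi q) = 5 by rewrite /phi /q G1 outer_right.
    have [qx|qx|qx] := ltgtP (cx q) (-(3/2)).
    - by have := hl _ qx; rewrite qE; clear; lra.
    - by have := hr _ qx; rewrite qE; clear; lra.
    have : (fun p => F (1, p)) @` range (@ovl R) `<=` range (@ovr R) by rewrite F1.
    move=> /(_ (phi q)); rewrite !range_oval => h.
    by have := h (ex_intro2 _ _ q qx erefl); rewrite /= qE; clear; lra.
  move=> h.
  have : lam 2 (loop_class (cc R (o7 3))) = 0.
    apply: (@isotopic_lam F _ [set p | 3/2 < cx p]) => //; last by move=> p; exact: dR.
    move=> t; apply: h => /=; have [|-> _ _] := @cc_odd R (o7 3) t; rewrite ?o7E //.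
    by rewrite /hc /=; have := cost_itv t; clear; lra.
  by rewrite -/(ch R 3) lam_ch.
move=> h; have : lam 0 (loop_class (cc R (o7 1))) = 0.
  apply: (@isotopic_lam F _ [set p | 3/2 < cx p]) => //; last by move=> p; exact: dR.
  move=> t; apply: h => /=; have [|-> _ _] := @cc_odd R (o7 1) t; rewrite ?o7E //.
  by rewrite /hc /=; have := cost_itv t; clear; lra.
by rewrite -/(ch R 1) lam_ch.
Qed.

Lemma base_symmetric dot : intersection_form dot ->
  (exists e : 'I_6 -> H1 R Sigma, Zbasis setT e) ->
  symmetric_splitting (quad_splitting dot (ch R 0) (ch R 1) (aa R 2) (ch R 5)).
Proof.
move=> dotP rank6; exists (@ovl R), (@ovr R); split.
- split; [| |exact: disjoint_ovals|exact: ovals_nonisotopic].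
    by split; [exact: oval_simple|exact: ovl_essential|exact: oval_separating].
  by split; [exact: oval_simple|exact: ovr_essential|exact: oval_separating].
- exact: hyper_oval.
- exact: hyper_oval.
- exact: base_corresponds.
Qed.

End BaseSymmetric.

(** * Splittings and the Arf invariant *)

Section Splittings.
Variable R : realType.
Notation Sigma := (Sigma3 R).
Notation H := (H1 R Sigma).
Notation ch := (@ch R).
Notation aa := (@aa R).
Variable dot : H -> H -> int.
Hypothesis dotP : intersection_form dot.
Hypothesis rank6 : exists e : 'I_6 -> H, Zbasis setT e.
Variable w : H -> 'F_2.
Hypothesis wP : Sp_quadratic dot w.

Lemma sum_pair_bool (F : 'I_1 * bool -> H) : \sum_k F k = F (ord0, true) + F (ord0, false).
Proof.
by rewrite (eq_bigr (fun k => F (k.1, k.2))) => [|[i b] _ //]; rewrite -(pair_bigA _ (fun i b => F (i, b))) big_ord1 big_bool.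
Qed.

Lemma span_symplectic x y (V : set H) : V = span x y -> dot x y = 1 ->
  @symplectic_basis H dot 1 V [ffun=> (x, y)].
Proof.
move=> VE xy; have yx : dot y x = -1 by rewrite (dotC dotP rank6) xy.
have xx := dotxx dotP rank6; split; [split|].
- move=> f; rewrite sum_pair_bool !ffunE /= => E.
  have d1 := congr1 (dot^~ x) E; have d2 := congr1 (dot^~ y) E.
  move: d1 d2; rewrite /= (dot0 dotP) !(dotD dotP) !(dotMz dotP) !xx xy yx !(dot0 dotP) => d1 d2 [i b].
  have -> : i = ord0 by exact: ord1.
  case: b; lia.
- rewrite VE; apply/seteqP; split=> [h [a [b ->]]|h [f _ <-]].
    by exists (fun k => if k.2 then b else a) => //; rewrite sum_pair_bool !ffunE /= addrC.
  by rewrite sum_pair_bool !ffunE /=; exists (f (ord0, false)), (f (ord0, true)); rewrite addrC.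
- by move=> i j; rewrite !ffunE !ord1 eqxx /= xy yx !xx.
Qed.

(** [Arf] uses a basis picked by [xget]. The change of basis has determinant 1 modulo 2, and
    independence becomes a finite check over ['F_2]. *)
Lemma Arf_span x y (V : set H) : V = span x y -> dot x y = 1 -> Arf dot 1 w V = w x * w y.
Proof.
move=> VE xy; rewrite /Arf; set e := xget _ _.
have [[_ be] /(_ ord0 ord0)[e1 _ _ _]] : @symplectic_basis H dot 1 V e.
  rewrite /e; case: xgetP => // none.
  by have := none _ (span_symplectic VE xy).
rewrite big_ord1; move: e1; set x' := (e ord0).1; set y' := (e ord0).2 => e1.
have inV (b : bool) : span x y (if b then y' else x').
  rewrite -VE be; exists (fun k => (k.2 == b)%:R) => //.
  by rewrite sum_pair_bool /=; case: b; rewrite ?mulr1z ?mulr0z ?addr0 ?add0r.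
have [a [b xE]] := inV false; have [c [d yE]] := inV true.
have wE (m n : int) : w (x *~ m + y *~ n) = m%:~R * w x + n%:~R * w y + m%:~R * n%:~R.
  rewrite (wD wP) !(wMz dotP rank6 wP) (dotMz dotP) (dotMr dotP) xy mulr1.
  by rewrite intrM.
have det : (a%:~R * d%:~R + b%:~R * c%:~R : 'F_2) = 1.
  have := e1; rewrite eqxx xE yE !(dotD dotP) !(dotDr dotP) !(dotMz dotP) !(dotMr dotP).
  rewrite !(dotxx dotP rank6) xy (dotC dotP rank6 y x) xy => h.
  have e2 : a * d - b * c = 1 by move: h => /=; lia.
  have := congr1 (fun z : int => z%:~R : 'F_2) e2; rewrite /= intrB !intrM => e3.
  rewrite -[RHS]e3; congr (_ + _).
  by move: (_ * _ : 'F_2); apply: F2_cases; apply/val_inj.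
rewrite xE yE !wE; move: (w x) (w y) (a%:~R : 'F_2) (b%:~R : 'F_2) (c%:~R : 'F_2) (d%:~R : 'F_2) det.
by do 6 apply: F2_cases; move=> // _; apply/val_inj.
Qed.

(** Unimodularity of the form: by [lam_dot], the chain classes are dual to the classes
    [dual_class]. *)
Lemma functional_dot (f : H -> int) : (forall h k, f (h + k) = f h + f k) ->
  exists z, forall h, f h = dot h z.
Proof.
move=> fD; have f0 : f 0 = 0 by apply/(@addrI _ (f 0)); rewrite -fD !addr0.
have fN x : f (- x) = - f x by apply/eqP; rewrite -addr_eq0 -fD addNr f0.
have fM x n : f (x *~ n) = n * f x.
  have hn m : f (x *+ m) = m%:Z * f x.
    by elim: m => [|m IH]; rewrite ?mulr0n ?f0 ?mul0r // mulrS fD IH intS mulrDl mul1r.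
  by case: n => n; [exact: hn|rewrite NegzE mulrNz fN mulNr -pmulrn hn].
exists (\sum_(j < 6) ch j *~ f (dual_class R j)) => h.
have dotS (F : 'I_6 -> H) : dot h (\sum_j F j) = \sum_j dot h (F j).
  by elim/big_rec2: _ => [|i x y _ <-]; rewrite ?(dot0r dotP) ?(dotDr dotP).
rewrite dotS {1}(coordE rank6 h); transitivity (\sum_(j < 6) f (dual_class R j *~ lam j h)).
  by elim/big_rec2: _ => [|i x y _ <-]; rewrite ?f0 ?fD.
apply: eq_bigr => j _; rewrite fM (dotMr dotP) -(lam_dot dotP rank6).
  exact: mulrC.
exact: ltn_trans (ltn_ord j) _.
Qed.

Lemma Zbasis2 (V : set H) (e : 'I_2 -> H) : Zbasis V e -> V = span (e 0) (e 1) /\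
  forall a b, e 0 *~ a + e 1 *~ b = 0 -> a = 0 /\ b = 0.
Proof.
have sE (f : 'I_2 -> int) : \sum_i e i *~ f i = e 0 *~ f 0 + e 1 *~ f 1.
  by rewrite big_ord_recl big_ord1; congr (_ + e _ *~ f _); exact/val_inj.
case=> ind ->; split=> [|a b E].
  apply/seteqP; split=> [h [f _ <-]|h [a [b ->]]]; first by rewrite sE; exists (f 0), (f 1).
  by exists (fun i => if i == 0 then a else b) => //; rewrite sE.
have h := ind (fun i => if i == 0 then a else b); rewrite sE /= in h.
by split; [have := h E 0|have := h E 1].
Qed.

Variable V : 'I_3 -> set H.
Hypothesis splitV : orthogonal_splitting dot V.

(** An orthogonal summand of a unimodular form is unimodular. A coordinate functional of [V i] is
    [dot] with some [z], of which only the component in [V i] counts; hence a multiple of the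
    product of the two basis vectors equals 1. *)
Lemma splitting_span i : exists x y, V i = span x y /\ dot x y = 1.
Proof.
have [bas orth dec] := splitV.
have [e /Zbasis2[VE ind]] := bas i.
have [D DP] := choice dec.
have Duniq h (v : {ffun 'I_3 -> H}) : (forall j, V j (v j)) -> h = \sum_j v j -> D h = v.
  by move=> h1 h2; have [_ u] := DP h; exact: u.
have DV h j : V j (D h j) by have [[]] := DP h.
have DE h : h = \sum_j D h j by have [[]] := DP h.
have VD j h k : V j h -> V j k -> V j (h + k).
  have [e' /Zbasis2[-> _]] := bas j; move=> [a [b ->]] [c [d ->]].
  by exists (a + c), (b + d); rewrite !mulrzDr addrACA.
have Dadd h k : D (h + k) = [ffun j => D h j + D k j].
  apply: Duniq => [j|]; first by rewrite ffunE; exact: VD.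
  by under eq_bigr do rewrite ffunE; rewrite big_split -!DE.
have cf h : exists c : int * int, D h i = e 0 *~ c.1 + e 1 *~ c.2.
  by have := DV h i; rewrite VE => -[a [b E]]; exists (a, b).
have [c cP] := choice cf.
have cE h a b : D h i = e 0 *~ a + e 1 *~ b -> c h = (a, b).
  rewrite cP => /eqP; rewrite -subr_eq0 => /eqP E.
  have [] : (c h).1 - a = 0 /\ (c h).2 - b = 0.
    by apply: ind; rewrite -[RHS]E !mulrzBr opprD addrACA.
  by move=> /eqP + /eqP; rewrite !subr_eq0; case: (c h) => p q /= /eqP -> /eqP ->.
have [|z zP] := @functional_dot (fun h => (c h).2).
  move=> h k; rewrite (cE (h + k) ((c h).1 + (c k).1) ((c h).2 + (c k).2)) //.
  by rewrite Dadd ffunE (cP h) (cP k) !mulrzDr addrACA.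
have V0 j : V j 0.
  by have [e' /Zbasis2[-> _]] := bas j; exists 0, 0; rewrite !mulr0z addr0.
have De h : V i h -> D h i = h.
  move=> Vh; rewrite (Duniq h [ffun j => if j == i then h else 0]) ?ffunE ?eqxx //.
    by move=> j; rewrite ffunE; case: eqP => [->|].
  by rewrite (bigD1 i) //= ffunE eqxx big1 ?addr0 // => j /negPf ji; rewrite ffunE ji.
have e1z : dot (e 1) z = 1.
  rewrite -zP (cE (e 1) 0 1) // De ?mulr0z ?mulr1z ?add0r //.
  by rewrite VE; exists 0, 1; rewrite ?mulr0z ?mulr1z ?add0r.
have e1V : V i (e 1) by rewrite VE; exists 0, 1; rewrite ?mulr0z ?mulr1z ?add0r.
have dotS x (F : 'I_3 -> H) : dot x (\sum_j F j) = \sum_j dot x (F j).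
  by elim/big_rec2: _ => [|k a b _ <-]; rewrite ?(dot0r dotP) ?(dotDr dotP).
move: e1z; rewrite {1}(DE z) dotS (bigD1 i) //= big1 ?addr0; last first.
  by move=> j ji; apply: (orth i j) => //; rewrite eq_sym.
rewrite (cP z) (dotDr dotP) !(dotMr dotP) (dotxx dotP rank6) mulr0 addr0 => E.
have : dot (e 1) (e 0) = 1 \/ dot (e 1) (e 0) = -1.
  move: E; clear; move: (dot _ _) => q /(congr1 absz); rewrite abszM => /eqP.
  by rewrite muln_eq1 => /andP[_ /eqP]; lia.
case=> E1.
  exists (e 1), (e 0); split=> //; rewrite VE.
  by apply/seteqP; split=> h [a [b ->]]; exists b, a; rewrite addrC.
by exists (e 0), (e 1); split=> //; rewrite (dotC dotP rank6) E1 opprK.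
Qed.

Lemma splitting_quad x1 y1 x3 y3 : V 0 = span x1 y1 -> V 2 = span x3 y3 ->
  V = quad_splitting dot x1 y1 x3 y3.
Proof.
have [_ orth dec] := splitV; move=> V0E V2E.
have sl (x y : H) : span x y x by exists 1, 0; rewrite mulr1z mulr0z addr0.
have sr (x y : H) : span x y y by exists 0, 1; rewrite mulr1z mulr0z add0r.
have nd i h : V i h -> (forall k, V i k -> dot h k = 0) -> h = 0.
  have [x [y [VE xy]]] := splitting_span i.
  rewrite VE => -[a [b ->]] E; have := E x (sl _ _); have := E y (sr _ _).
  rewrite !(dotD dotP) !(dotMz dotP) !(dotxx dotP rank6) xy (dotC dotP rank6 y) xy => e1 e2.
  have -> : a = 0 by lia.
  by have -> : b = 0; [lia|rewrite !mulr0z addr0].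
apply/funext => i; have [->|->|->] : [\/ i = 0, i = 1 | i = 2].
  by case: i => -[|[|[|//]]] h; [constructor 1|constructor 2|constructor 3]; exact/val_inj.
- exact: V0E.
- apply/seteqP; split=> [h Vh|h [h1 h2 h3 h4]].
    have h0 k : V 0 k -> dot h k = 0 by exact: (orth 1 0).
    have h2 k : V 2 k -> dot h k = 0 by exact: (orth 1 2).
    rewrite /quad_splitting /=; split; [apply: h0|apply: h0|apply: h2|apply: h2];
      rewrite ?V0E ?V2E; by [exact: sl|exact: sr].
  have [v [[vV hE] _]] := dec h.
  have dotS (F : 'I_3 -> H) k : dot (\sum_j F j) k = \sum_j dot (F j) k.
    by elim/big_rec2: _ => [|j a b _ <-]; rewrite ?(dot0 dotP) ?(dotD dotP).
  have hv j k : V j k -> dot h k = dot (v j) k.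
    move=> Vk; rewrite hE dotS (bigD1 j) //= big1 ?addr0 // => l lj.
    exact: orth lj (vV l) Vk.
  have v0 : v 0 = 0.
    apply: (nd 0 _ (vV 0)) => k Vk; rewrite -(hv _ _ Vk).
    by move: Vk; rewrite V0E => -[a [b ->]]; rewrite (dotDr dotP) !(dotMr dotP) h1 h2 !mulr0.
  have v2 : v 2 = 0.
    apply: (nd 2 _ (vV 2)) => k Vk; rewrite -(hv _ _ Vk).
    by move: Vk; rewrite V2E => -[a [b ->]]; rewrite (dotDr dotP) !(dotMr dotP) h3 h4 !mulr0.
  have -> : h = v 1.
    rewrite hE (bigD1 1) //= big1 ?addr0 // => -[[|[|[|//]]] jh] // _.
      by rewrite (_ : Ordinal jh = 0) //; exact/val_inj.
    by rewrite (_ : Ordinal jh = 2) //; exact/val_inj.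
  exact: vV.
- exact: V2E.
Qed.

Hypothesis w_aa : forall i, (i < 3)%N -> w (aa i) = (i != 1%N)%:R.
Hypothesis w_ch : forall k, (k < 7)%N -> w (ch k) = 1.

Lemma F2_mul1 (a b : 'F_2) : a * b = 1 -> a = 1 /\ b = 1.
Proof. by move: a b; do 2 apply: F2_cases; move=> //; rewrite ?(mul0r, mulr0) => /eqP. Qed.

Lemma splitting_valid : Arf dot 1 w (V 0) = 1 -> Arf dot 1 w (V 2) = 1 ->
  exists x1 y1 x3 y3, V = quad_splitting dot x1 y1 x3 y3 /\ valid dot w x1 y1 x3 y3.
Proof.
have [x1 [y1 [V0E d1]]] := splitting_span 0.
have [x3 [y3 [V2E d3]]] := splitting_span 2.
rewrite (Arf_span V0E d1) (Arf_span V2E d3) => /F2_mul1[w1 w2] /F2_mul1[w3 w4].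
exists x1, y1, x3, y3; split; first exact: splitting_quad.
have [_ orth _] := splitV.
have sl (x y : H) : span x y x by exists 1, 0; rewrite mulr1z mulr0z addr0.
have sr (x y : H) : span x y y by exists 0, 1; rewrite mulr1z mulr0z add0r.
by split=> //; split; apply: (orth 0 2) => //; rewrite ?V0E ?V2E; do ?[exact: sl|exact: sr].
Qed.

Lemma symmetric_of_Arf : Arf dot 1 w (V 0) = 1 -> Arf dot 1 w (V 2) = 1 -> symmetric_splitting V.
Proof.
move=> A0 A2; have [x1 [y1 [x3 [y3 [-> v]]]]] := splitting_valid A0 A2.
apply: (P_valid dotP rank6 wP w_aa w_ch
  (P := fun x1 y1 x3 y3 => symmetric_splitting (quad_splitting dot x1 y1 x3 y3)) _ _ v).
  by move=> k *; exact: symmetric_quad_tw.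
exact: base_symmetric.
Qed.

(** Having a hyperbolic pair with product 0 in the middle plane is invariant under the chain
    transvections and holds for the model, through [aa 1] and [ch 3]; transitivity spreads it. *)
Lemma middle_Arf : Arf dot 1 w (V 0) = 1 -> Arf dot 1 w (V 2) = 1 -> Arf dot 1 w (V 1) = 0.
Proof.
move=> A0 A2; have [x1 [y1 [x3 [y3 [-> v]]]]] := splitting_valid A0 A2.
pose P x1 y1 x3 y3 := exists x y, [/\ quad_splitting dot x1 y1 x3 y3 1 = span x y, dot x y = 1 & w x * w y = 0].
suff [x [y [VE xy wxy]]] : P x1 y1 x3 y3 by rewrite (Arf_span VE xy).
apply: (P_valid dotP rank6 wP w_aa w_ch (P := P) _ _ v).
  clear A0 A2 v x1 y1 x3 y3; move=> k x1 y1 x3 y3 k7; set u := ch k; have wu : w u = 1 := w_ch k7.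
  pose ti h := h - u *~ dot h u.
  have [tiK tKi] := tv_bij dotP rank6 u.
  have E := @quad_splitting_image R dot (tv dot u) ti x1 y1 x3 y3 1 (tvD dotP u) (tvMz dotP u) (tv_dot dotP rank6 u) tiK.
  split=> -[x [y [VE xy wxy]]].
    exists (ti x), (ti y); split.
    - move: VE; rewrite -E => VE; apply/seteqP; split=> h.
        move=> Qh; have : span x y (tv dot u h) by rewrite -VE; exists h.
        case=> a [b hE]; exists a, b; rewrite -[h]tKi -/(ti _) hE.
        by rewrite /ti !(dotD dotP) !(dotMz dotP) !mulrzDr !mulrzBl opprD addrACA; congr (_ - _ + (_ - _)); rewrite mulrC mulrzA.
      case=> a [b hE]; have : span x y (tv dot u h).
        by exists a, b; rewrite hE (tvD dotP) !(tvMz dotP) !tiK.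
      by rewrite -VE => -[h' Qh'] /(congr1 (fun h => h - u *~ dot h u)); rewrite !tKi => <-.
    - by rewrite -(tv_dot dotP rank6 u) /ti !tiK.
    - have wt h : w (ti h) = w h by rewrite -[in RHS](tiK h) (w_tv dotP rank6 wP).
      by rewrite !wt.
  exists (tv dot u x), (tv dot u y); split.
  - rewrite -E VE; apply/seteqP; split=> [_ [h [a [b ->]] <-]|h [a [b ->]]].
      by exists a, b; rewrite (tvD dotP) !(tvMz dotP).
    by exists (x *~ a + y *~ b); [exists a, b|rewrite (tvD dotP) !(tvMz dotP)].
  - by rewrite (tv_dot dotP rank6).
  - by rewrite !(w_tv dotP rank6 wP).
have aa2E h : dot h (aa 2) = lam 0 h + lam 2 h + lam 4 h.
  by rewrite /aa !(dotDr dotP) !(lam_dot dotP rank6).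
exists (aa 1), (ch 3); split.
- apply/seteqP; split=> h.
    rewrite /quad_splitting /= -!(lam_dot dotP rank6) // aa2E => -[h0 h1 h2 h5].
    exists (lam 3 h), (- lam 2 h); rewrite -[LHS](coordsK rank6) /coords /vec h0 h1 h5.
    have -> : - (0 : int) - lam 2 h - lam 4 h = 0 by lia.
    by rewrite oppr0 !mulr0z !addr0 !add0r.
  case=> a [b ->]; change ([/\ dot (aa 1 *~ a + ch 3 *~ b) (ch 0) = 0, dot (aa 1 *~ a + ch 3 *~ b) (ch 1) = 0,
    dot (aa 1 *~ a + ch 3 *~ b) (aa 2) = 0 & dot (aa 1 *~ a + ch 3 *~ b) (ch 5) = 0]).
  rewrite aa2E -!(lam_dot dotP rank6) // !lamD // !lamMz // !lam_aa // !lam_ch //.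
  by rewrite /lamc /=; split; lia.
- by rewrite -(lam_dot dotP rank6) // lam_aa.
- by rewrite w_aa // mul0r.
Qed.

End Splittings.

(** * Local constancy of degrees *)

Section LocalConstancy.
Variable R : realType.

Lemma circB (T : topologicalType) (f g : T -> R) : circ f -> circ g -> circ (fun p => f p - g p).
Proof.
move=> [cf sf] [cg sg]; split=> p.
  rewrite (_ : _ \o _ = fun p => cost (f p) * cost (g p) + sint (f p) * sint (g p)).
    by apply: contatD; apply: contatM; [exact: cf|exact: cg|exact: sf|exact: sg].
  by apply/funext => q /=; rewrite costD costN sintN mulrN opprK.
rewrite (_ : _ \o _ = fun p => sint (f p) * cost (g p) - cost (f p) * sint (g p)).
  by apply: contatD; [|apply: contatN]; apply: contatM; [exact: sf|exact: cg|exact: cf|exact: sg].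
by apply/funext => q /=; rewrite sintD costN sintN mulrN.
Qed.

Lemma cost_gt0_res (a : R) : 0 < cost a -> `|res a| < 4^-1.
Proof.
move=> a0; rewrite ltNge; apply/negP => h.
have E : cost a = cost `|res a|.
  rewrite (cost_eqm (res_int a)).1.
  by case: (ger0P (res a)) => _; rewrite ?costN.
have /andP[h1 h2] := res_itv a.
have h3 : `|res a| <= 2^-1 by rewrite ler_norml; apply/andP; split; lra.
have [e|ne] := eqVneq `|res a| 4^-1; first by move: a0; rewrite E e cost_quarter ltxx.
have : cost `|res a| < cost 4^-1.
  by apply: cost_gt => //; rewrite lt_neqAle h eq_sym ne andbT; lra.
by rewrite cost_quarter -E ltNge (ltW a0).
Qed.

(** A positive cosine keeps the residue between $-1/4$ and $1/4$, away from its jump at half a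
    turn. *)
Lemma res_continuous (T : topologicalType) (F : T -> R) : circ F -> (forall t, 0 < cost (F t)) ->
  continuous (fun t => res (F t)).
Proof.
move=> cF F0 t; apply/cvgrPdist_lt => e e0.
have m0 : 0 < Num.min e 4^-1 by rewrite lt_min e0 invr_gt0 ltr0n.
near=> q; have : `|res (F q - F t)| < Num.min e 4^-1 by near: q; exact: circ_near.
rewrite lt_min => /andP[h1 h2].
rewrite (@res_small _ (res (F t) + res (F q - F t)) (F q)); first by rewrite opprD addrA subrr add0r normrN.
  by apply: le_lt_trans (ler_normD _ _) _; have := cost_gt0_res (F0 t); lra.
have -> : F q - (res (F t) + res (F q - F t)) =
  (F t - res (F t)) + ((F q - F t) - res (F q - F t)) by ring.
by rewrite rpredD // res_int.
Unshelve. all: by end_near. Qed.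

Variables (T Q : topologicalType) (h : H1 R T).

(** Along the support of the cycle the two angles differ modulo 1 by a continuous real residue,
    hence by a coboundary. *)
Lemma deg_close (f g : T -> R) : circ f -> circ g ->
  (forall s, s \in dom (val (repr h)) -> forall t, 0 <= t <= 1 ->
     0 < cost (f (s (edge t)) - g (s (edge t)))) -> deg f h = deg g h.
Proof.
move=> cf cg H; apply: (@intr_inj R); rewrite -(hclassK h) !degE //.
rewrite (@wind_chain_comb _ _ f g g (fun p => res (f p - g p)) 0) ?mul0r ?addr0 //.
  exact: cycle_boundary.
move=> s sc; have ce := @edge_continuous R; have cs : continuous s by exact: cts_fun.
have cse : continuous (s \o edge) by rewrite /comp; cont.
apply: (@wind_comb _ _ _ _ (fun t => res ((f \o s \o edge) t - (g \o s \o edge) t))) => [|||t t01].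
- exact: (circ_comp cse cg).
- exact: (circ_comp cse cg).
- apply: res_continuous; first exact: circB (circ_comp cse cf) (circ_comp cse cg).
  move=> t /=; have -> : edge t = edge (clamp01 t) :> @std_simplex R 1.
    apply: simplex_eq => j; rewrite !set_valE /= !mxE (clamp01_id (clamp01_itv t)) //.
  exact: H (clamp01_itv t).
- by rewrite mul0r addr0 opprD addrA /=; exact: res_int.
Qed.

(* A cycle has compact support, so closeness of two families of angles only has
   to be known near each point. *)
Lemma deg_locally (F G : Q -> T -> R) (q0 : Q) :
  (forall p : T, \forall w \near (p, q0), 0 < cost (F w.2 w.1 - G w.2 w.1)) ->
  \forall q \near q0, circ (F q) -> circ (G q) -> deg (F q) h = deg (G q) h.
Proof.
move=> H.
suff : \forall q \near q0, forall s, s \in dom (val (repr h)) -> forall t, 0 <= t <= 1 ->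
    0 < cost (F q (s (edge t)) - G q (s (edge t))).
  by apply: filterS => q Hq cF cG; exact: deg_close.
elim: (dom _) => [|s l IH]; first exact: nearW.
have : \forall q \near q0, forall t, 0 <= t <= 1 -> 0 < cost (F q (s (edge t)) - G q (s (edge t))).
  have cE : continuous (s \o edge).
    by move=> t; apply: continuous_comp; [exact: edge_continuous|exact: cts_fun].
  have /compact_near_coveringP cpt := @segment_compact R 0 1.
  have : \forall q \near q0, `[(0 : R), 1] `<=` [set t | 0 < cost (F q (s (edge t)) - G q (s (edge t)))].
    apply: (cpt Q (nbhs q0) (fun q t => 0 < cost (F q (s (edge t)) - G q (s (edge t))))) => t _.
    have [[A B] /= [nA nB] AB] := H (s (edge t)).
    exists ((s \o edge) @^-1` A, B); first by split => //; exact: (cE t).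
    by move=> [t' q] /= [At' Bq]; exact: (AB (_, _)).
  by apply: filterS => q Hq t t01; apply: Hq; rewrite /= in_itv.
move: IH; apply: filterS2 => q Hl Hs s'; rewrite inE => /orP[/eqP ->|]; [exact: Hs|exact: Hl].
Qed.

End LocalConstancy.

(** * Polar coordinates on the quotient sphere *)

Section Angle.
Variable R : realType.
Notation Sigma := (Sigma3 R).
Implicit Types p q : Sigma.

(** Splitting [d] into its positive and negative parts reduces the claim to [contat_sgroot]. *)
Lemma contat_sgM (T : topologicalType) (x : T) (s d : T -> R) :
  continuous_at x s -> continuous_at x d -> (s x = 0 -> d x = 0) ->
  continuous_at x (fun y => Num.sg (s y) * d y).
Proof.
move=> cs cd sd.
have -> : (fun y => Num.sg (s y) * d y) = fun y =>
    Num.sg (s y) * Num.sqrt (Num.max (d y) 0 ^+ 2) - Num.sg (s y) * Num.sqrt (Num.max (- d y) 0 ^+ 2).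
  apply/funext => y; rewrite !sqrtr_sqr -mulrBr; congr (_ * _).
  by rewrite !ger0_norm ?le_max ?lexx ?orbT // /Num.max; case: (ltP (d y) 0); case: (ltP (- d y) 0); lra.
apply: contatD; [|apply: contatN]; apply: contat_sgroot; [by []|by cont| |by []|by cont|].
  by move=> /sd ->; rewrite maxxx expr0n.
by move=> /sd ->; rewrite oppr0 maxxx expr0n.
Qed.

Lemma connected_locally_constant (T : topologicalType) (K : set T) (N : T -> int) :
  connected K -> (forall q0 : T, K q0 -> \forall q \near q0, K q -> N q = N q0) ->
  forall p q : T, K p -> K q -> N p = N q.
Proof.
move=> cK H p q Kp Kq.
have : K `&` [set r | N r = N p] = K.
  apply: cK; first by exists p.
  - exists [set r | K r -> N r = N p]°; first exact: open_interior.
    apply/seteqP; split=> r [Kr /= Nr]; split=> //.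
      by apply: filterS (H r Kr) => r' h Kr'; rewrite h.
    by have := nbhs_singleton Nr; apply.
  - exists (~` [set r | K r -> N r <> N p]°); first by apply: open_closedC; exact: open_interior.
    apply/seteqP; split=> r [Kr /= Nr]; split=> //.
      by move=> /nbhs_singleton/(_ Kr).
    apply: contrapT => Np; apply: Nr; apply: filterS (H r Kr) => r' h Kr'.
    by rewrite h.
by move/seteqP => [_ /(_ _ Kq)[_ ->]].
Qed.

(* On the vertical line through [x] the domain is the set [inner x <= y ^+ 2 <= 25 - x ^+ 2]
   (for [-5 < x < 5]); [height] runs from 0 on the inner to 1 on the outer boundary. *)
Definition inner (x : R) : R :=
  Num.max 0 (Num.max (1 - (x + 3) ^+ 2) (Num.max (1 - x ^+ 2) (1 - (x - 3) ^+ 2))).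
Definition height p : R := (cy p ^+ 2 - inner (cx p)) / (25 - cx p ^+ 2 - inner (cx p)).
Definition shight p : R := Num.sg (cy p) * height p.
(** The value at [z = 0] is harmless: for $-5<x<5$ the quantities it multiplies in [polar_arg] and
    [half_arg] are half-integral there, so a change of sign is invisible modulo 1. *)
Definition zsign p : R := if cz p < 0 then -1 else 1.
(* The quotient of the surface by the involution is a sphere with polar coordinates
   [(5 + x) / (5 - x)] and [polar_arg], the argument in turns. *)
Definition polar_arg p : R := zsign p * shight p / 2.
Definition near_holes p : R := \sum_(i < 3) Num.max (3 / 2 - rad (hc R i) p) 0.
(* Up to a constant and modulo 1, [2 * half_arg] is [polar_arg + dual 1 + dual 3 + dual 5]. *)
Definition half_arg p : R := zsign p * ((1 / 2 - near_holes p + shight p / 2) / 2).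

Lemma inner_le p : inner (cx p) <= cy p ^+ 2.
Proof.
have [_ h1 h2 h3] := Sigma_domain p; have := sqr_ge0 (cy p).
by rewrite /inner !ge_max => y2; apply/and4P; split; lra.
Qed.

Lemma inner_ge0 x : 0 <= inner x.
Proof. by rewrite /inner le_max lexx. Qed.

Lemma inner_lt x : -5 < x < 5 -> inner x < 25 - x ^+ 2.
Proof. by move=> hx; rewrite /inner !gt_max; apply/and4P; split; nra. Qed.

Lemma height_itv p : -5 < cx p < 5 -> 0 <= height p <= 1.
Proof.
move=> hx; have h := inner_lt hx; have [d _ _ _] := Sigma_domain p.
have h' := inner_le p; rewrite /height; apply/andP; split.
  by rewrite divr_ge0 // subr_ge0 // ltW.
by rewrite ler_pdivrMr ?subr_gt0 // mul1r; lra.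
Qed.

Lemma height_y0 p : cy p = 0 -> height p = 0.
Proof.
move=> y0; have h' := inner_le p; have h := inner_ge0 (cx p).
by rewrite /height (_ : _ - _ = 0) ?mul0r // ; move: h'; rewrite y0 expr0n /=; lra.
Qed.

Lemma end_y0 p : ~ (-5 < cx p < 5) -> cy p = 0.
Proof.
move=> hx; have h := cx_itv p; have [d _ _ _] := Sigma_domain p; have y2 := sqr_ge0 (cy p).
have : cx p = 5 \/ cx p = -5.
  have [h1|h1] := ltP (cx p) 5; last by left; lra.
  by right; have [h2|h2] := ltP (-5) (cx p); [case: hx; rewrite h2|lra].
move=> e; have {}e : cx p ^+ 2 = 25 by case: e => ->; ring.
by apply/eqP; rewrite -sqrf_eq0; apply/eqP; lra.
Qed.

Lemma hcE : [/\ hc R 0 = -3, hc R 1 = 0 & hc R 2 = 3].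
Proof. by rewrite /hc; split; ring. Qed.

Lemma near_holesE p : near_holes p = Num.max (3 / 2 - rad (-3) p) 0 +
  (Num.max (3 / 2 - rad 0 p) 0 + Num.max (3 / 2 - rad 3 p) 0).
Proof.
have [h0 h1 h2] := hcE.
by rewrite /near_holes !big_ord_recl big_ord0 addr0 /= /bump /= h0 h1 h2.
Qed.

Lemma rad_le c p : `|cx p - c| <= rad c p.
Proof.
rewrite -sqrtr_sqr /rad ler_sqrt ?lerDl ?sqr_ge0 // addr_ge0 ?sqr_ge0 //.
Qed.

(** The sheets meet on a hole circle or on the outer circle. In every case
    [1 / 2 - near_holes p + shight p / 2] is 0 or 1, so half of it may change sign modulo 1; this
    explains the constants in [half_arg]. *)
Lemma z0P p : cz p = 0 -> -5 < cx p < 5 ->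
  (shight p = 0 /\ near_holes p = 1 / 2) \/
  ((shight p = 1 \/ shight p = -1) /\ near_holes p = 0).
Proof.
move=> z0 hx; have [d d1 d2 d3] := Sigma_domain p.
have := czE p; rewrite z0 expr0n /= domain_eqE => /esym/eqP.
have r_ge (c : R) : 2 <= cx p - c \/ cx p - c <= -2 -> Num.max (3 / 2 - rad c p) 0 = 0.
  move=> h; have := rad_le c p; rewrite ler_norml => /andP[h1 h2]; apply: max_r.
  by case: h; lra.
have hole (c : R) : (cx p - c) ^+ 2 + cy p ^+ 2 = 1 -> 1 - (cx p - c) ^+ 2 <= inner (cx p) ->
    [/\ shight p = 0, Num.max (3 / 2 - rad c p) 0 = 1 / 2 & -1 <= cx p - c <= 1].
  move=> e h; have h' := inner_le p; split.
  - by rewrite /shight /height (_ : cy p ^+ 2 - _ = 0) ?mul0r ?mulr0 //; lra.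
  - by rewrite /rad e sqrtr1 max_l; lra.
  - by have := sqr_ge0 (cy p); nra.
have inn : [/\ 1 - (cx p - -3) ^+ 2 <= inner (cx p), 1 - (cx p - 0) ^+ 2 <= inner (cx p) &
    1 - (cx p - 3) ^+ 2 <= inner (cx p)].
  by rewrite opprK subr0 /inner !le_max !lexx ?orbT.
have [i1 i2 i3] := inn.
rewrite !mulf_eq0 !subr_eq0 near_holesE => /orP[/eqP e|/orP[/eqP e|/orP[/eqP e|/eqP e]]].
- right; have y2 : cy p ^+ 2 = 25 - cx p ^+ 2 by lra.
  have h := inner_lt hx; have h0 := inner_ge0 (cx p).
  have ht : height p = 1 by rewrite /height y2 divff // subr_eq0 gt_eqF.
  have yn : cy p != 0 by apply/eqP => y0; move: y2; rewrite y0 expr0n /=; lra.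
  split; first by rewrite /shight ht mulr1; case: sgrP yn => //; [left|right].
  have far (c : R) : [\/ c = -3, c = 0 | c = 3] -> Num.max (3 / 2 - rad c p) 0 = 0.
    move=> hc3; apply: max_r; suff : 2 <= rad c p by lra.
    rewrite -(@ler_pXn2r _ 2) ?nnegrE ?sqrtr_ge0 // rad_sqr y2.
    by case: hc3 => ->; lra.
  by rewrite !far ?addr0 //; [constructor 3|constructor 2|constructor 1].
- have [|-> -> n] := hole (-3) _ i1; first by rewrite opprK.
  left; rewrite (r_ge 0) ?(r_ge 3) ?addr0 //; right; lra.
- have [|-> -> n] := hole 0 _ i2; first by rewrite subr0.
  by left; rewrite (r_ge (-3)) ?(r_ge 3) ?addr0 ?add0r //; [right|left]; lra.
- have [-> -> n] := hole 3 e i3.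
  by left; rewrite !r_ge ?addr0 ?add0r //; left; lra.
Qed.

Lemma zsignM p a : (cz p = 0 -> a = 0) -> zsign p * a = Num.sg (cz p) * a.
Proof.
rewrite /zsign; have [z0|z0|z0] := ltgtP (cz p) 0.
- by rewrite ltr0_sg.
- by rewrite gtr0_sg.
- by move=> ->; rewrite ?mulr0.
Qed.

Lemma cost_zsign p a : cost (zsign p * a) = cost a.
Proof. by rewrite /zsign; case: ifP; rewrite ?mulN1r ?costN ?mul1r. Qed.

Lemma sint_zsign p a : sint (zsign p * a) = zsign p * sint a.
Proof. by rewrite /zsign; case: ifP; rewrite ?mulN1r ?sintN ?mul1r. Qed.

Lemma shight_continuous p : -5 < cx p < 5 -> continuous_at p shight.
Proof.
move=> hx; have cxc := @cx_continuous R; have cyc := @cy_continuous R.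
apply: contat_sgM; first exact: cyc.
  rewrite /height /inner.
  have n0 : 25 - cx p ^+ 2 - Num.max 0 (Num.max (1 - (cx p + 3) ^+ 2) (Num.max (1 - cx p ^+ 2) (1 - (cx p - 3) ^+ 2))) != 0.
    by rewrite gt_eqF // subr_gt0; exact: inner_lt.
  by cont.
exact: height_y0.
Qed.

Lemma near_holes_continuous : continuous near_holes.
Proof.
have cxc := @cx_continuous R; have cyc := @cy_continuous R.
rewrite (funext near_holesE) /rad; cont.
Qed.

Lemma sint_shight p : cz p = 0 -> sint (shight p / 2) = 0.
Proof.
move=> z0; have [hx|hx] := pselect (-5 < cx p < 5); last first.
  by rewrite /shight (end_y0 hx) sgr0 !mul0r sint0.
by case: (z0P z0 hx) => [[-> _]|[[->|->] _]]; rewrite ?mulN1r ?sintN ?mul1r ?mul0r ?sint0 ?sint_half ?oppr0.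
Qed.

Lemma cost_polar_arg p : cost (polar_arg p) = cost (shight p / 2).
Proof. by rewrite /polar_arg -mulrA cost_zsign. Qed.

Lemma sint_polar_arg p : sint (polar_arg p) = Num.sg (cz p) * sint (shight p / 2).
Proof. by rewrite /polar_arg -mulrA sint_zsign zsignM //; exact: sint_shight. Qed.

Lemma cost_polar_arg_continuous p : -5 < cx p < 5 -> continuous_at p (fun q => cost (polar_arg q)).
Proof. by move=> hx; rewrite (funext cost_polar_arg); have := shight_continuous hx; cont. Qed.

Lemma sint_polar_arg_continuous p : -5 < cx p < 5 -> continuous_at p (fun q => sint (polar_arg q)).
Proof.
move=> hx; rewrite (funext sint_polar_arg); have := shight_continuous hx; have czc := @cz_continuous R.
by move=> c; apply: contat_sgM; [exact: czc|cont|exact: sint_shight].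
Qed.

Lemma half_arg_continuous p : -5 < cx p < 5 ->
  continuous_at p (fun q => cost (half_arg q)) /\ continuous_at p (fun q => sint (half_arg q)).
Proof.
move=> hx; have cs := shight_continuous hx; have czc := @cz_continuous R.
have cn := near_holes_continuous; have cxc := @cx_continuous R.
pose B q : R := (1 / 2 - near_holes q + shight q / 2) / 2.
have cB : continuous_at p B by rewrite /B; cont.
have B0 q : cz q = 0 -> -5 < cx q < 5 -> sint (B q) = 0.
  move=> z0 hq; rewrite /B; case: (z0P z0 hq) => [[-> ->]|[[->|->] ->]].
  - by rewrite subrr mul0r addr0 mul0r sint0.
  - by rewrite subr0 -splitr mul1r sint_half.
  - by rewrite subr0 -mulrDl subrr !mul0r sint0.
split; first by rewrite /half_arg (funext (fun q => cost_zsign q (B q))); cont.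
have c : continuous_at p (fun q => Num.sg (cz q) * sint (B q)).
  by apply: contat_sgM; [exact: czc|cont|move=> /B0; apply].
have E q : -5 < cx q < 5 -> sint (half_arg q) = Num.sg (cz q) * sint (B q).
  by move=> hq; rewrite /half_arg sint_zsign zsignM // => /B0; apply.
have nE : \forall q \near p, Num.sg (cz q) * sint (B q) = sint (half_arg q).
  near=> q; rewrite E //; apply/andP; split; near: q.
    by apply: (cvgr_gt _ (cxc p)); lra.
  by apply: (cvgr_lt _ (cxc p)); lra.
by rewrite /continuous_at E //; exact: cvg_trans (near_eq_cvg nE) c.
Unshelve. all: by end_near. Qed.

Lemma dual_near_holes i p : (i < 3)%N ->
  dual i.*2.+1 p + zsign p * Num.max (3 / 2 - rad (hc R i) p) 0 \is a Num.int.
Proof.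
move=> i3; rewrite /dual /dualf /chU /chtau /= odd_double /= uphalf_double.
set c := hc R i; have c3 : [\/ c = -3, c = 0 | c = 3] := hc3 R i3.
have r1 := rad_ge1 c3 p; have rs := rad_sqr c p.
rewrite /hole_U -rs; case: ifP => hU; last first.
  have h : 3 / 2 <= rad c p by move: hU => /negbT; rewrite -leNgt; nra.
  by rewrite add0r max_r ?mulr0 ?rpred0 //; lra.
rewrite /hole_tau; have [h|h] := leP (3 / 2) (rad c p).
  rewrite [Num.max (3 / 2 - _) 0]max_r ?mulr0 ?addr0; last by lra.
  apply: clamp_half_int; rewrite !normrM (ger0_norm (x := 2)) // (ger0_norm (x := rad c p - 1)); last by lra.
  have z0 : cz p != 0.
    apply/eqP => z0; have hh : 1 <= (cx p - c) ^+ 2 + cy p ^+ 2 < 49 / 16 by rewrite -rs hU andbT; nra.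
    have [_ D] := hole_domain c3 hh.
    by have := D (etrans (esym (czE p)) _); rewrite z0 expr0n /=; rewrite -rs; nra.
  by rewrite normr_sg z0 mul1r; lra.
rewrite max_l; last by lra.
rewrite clamp_id; last first.
  rewrite !normrM (ger0_norm (x := 2)) // (ger0_norm (x := rad c p - 1)); last by lra.
  by rewrite normr_sg; case: (cz p != 0); rewrite ?mul1r ?mul0r; lra.
rewrite /zsign; case: sgrP => z0.
- have r11 : rad c p ^+ 2 = 1.
    have [|_ D] := @hole_domain R c c3 (cx p) (cy p); first by rewrite -rs hU andbT; nra.
    by rewrite rs; apply: D; rewrite -czE z0 expr0n.
  have -> : rad c p = 1 by nra.
  by apply: (int_eq (rpred1 _)); field.
- by apply: (int_eq (rpred1 _)); field.
- by apply: (int_eq (rpred0 _)); field.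
Qed.

Lemma double_half_arg p : 0 + 2%:~R * half_arg p + 1 / 2 -
  (polar_arg p + (dual 1 p + (dual 3 p + dual 5 p))) \is a Num.int.
Proof.
have d0 := @dual_near_holes 0 p isT; have d1 := @dual_near_holes 1 p isT; have d2 := @dual_near_holes 2 p isT.
move: d0 d1 d2; rewrite /= /half_arg /polar_arg /near_holes !big_ord_recl big_ord0 addr0 /= /bump /= !add1n.
set m0 := Num.max _ _; set m1 := Num.max _ _; set m2 := Num.max _ _ => d0 d1 d2.
have zz : zsign p / 2 + 1 / 2 \is a Num.int.
  rewrite /zsign; case: ifP => _.
    by rewrite (_ : _ + _ = 0) ?rpred0 //; field.
  by rewrite (_ : _ + _ = 1) ?rpred1 //; field.
have := rpredB zz (rpredD d0 (rpredD d1 d2)); move/int_eq; apply.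
by field.
Qed.

(** The invariant functions $x$, $y^2$ and $yz$ separate the orbits of the involution. *)
Lemma yz_cases p q : cx p = cx q -> cy p ^+ 2 = cy q ^+ 2 -> cy p * cz p = cy q * cz q ->
  q = p \/ q = hyperelliptic p.
Proof.
move=> x y yz; have z : cz p ^+ 2 = cz q ^+ 2 by rewrite !czE !domain_eqE x y.
have [h1 h2 h3] := hypE p.
have fin : (cy q = cy p /\ cz q = cz p) \/ (cy q = - cy p /\ cz q = - cz p) ->
    q = p \/ q = hyperelliptic p.
  by case=> -[e1 e2]; [left|right]; apply: Sigma_eq; rewrite ?h1 ?h2 ?h3.
apply: fin; move/eqP: y; rewrite eqf_sqr => /orP[/eqP e|/eqP e].
  have [y0|y0] := eqVneq (cy q) 0.
    move/eqP: z; rewrite eqf_sqr => /orP[/eqP e'|/eqP e']; [left|right]; rewrite ?e ?e' ?y0 ?oppr0 ?opprK //.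
  by left; split=> //; apply/esym/(mulfI y0); rewrite -yz e.
have [y0|y0] := eqVneq (cy q) 0.
  move/eqP: z; rewrite eqf_sqr => /orP[/eqP e'|/eqP e']; [left|right]; rewrite ?e ?e' ?y0 ?oppr0 ?opprK //.
right; split; first by rewrite e opprK.
by apply: (mulfI y0); rewrite -yz e mulrN mulNr.
Qed.

Lemma norm_polar_arg p : -5 < cx p < 5 -> `|polar_arg p| = height p / 2.
Proof.
move=> /height_itv/andP[h0 h1]; have hy := @height_y0 p; rewrite /polar_arg /shight.
move: (height p) h0 {h1} hy => u h0 hy; rewrite !normrM (ger0_norm (x := 2^-1)) //; congr (_ / _).
rewrite (ger0_norm h0) (_ : `|zsign p| = 1) ?mul1r.
  by rewrite normr_sg; have [/hy ->|_] := eqVneq (cy p) 0; rewrite ?mulr0 ?mul1r.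
by rewrite /zsign; case: ifP; rewrite ?normrN1 ?normr1.
Qed.

Lemma height_gt0 p : -5 < cx p < 5 -> cy p * cz p != 0 -> 0 < height p < 1.
Proof.
move=> hx; rewrite mulf_eq0 negb_or => /andP[y0 z0].
have h := inner_lt hx; have h' := inner_le p; have [d d1 d2 d3] := Sigma_domain p.
have D : domain_eq (cx p) (cy p) != 0 by rewrite -czE expf_neq0.
have y2 : 0 < cy p ^+ 2 by rewrite exprn_even_gt0.
have in_lt : inner (cx p) < cy p ^+ 2.
  rewrite /inner !gt_max y2 /=; move: D; rewrite domain_eqE !mulf_eq0 !negb_or !subr_eq0 => /and4P[_ n1 n2 n3].
  by rewrite !ltrBlDl !lt_neqAle d1 d2 d3 ![1 == _]eq_sym n1 n2 n3.
have out_lt : cx p ^+ 2 + cy p ^+ 2 < 25.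
  move: D; rewrite domain_eqE mulf_eq0 negb_or subr_eq0 => /andP[n _].
  by rewrite lt_neqAle d eq_sym n.
rewrite /height; apply/andP; split; first by rewrite divr_gt0 // subr_gt0.
by rewrite ltr_pdivrMr ?subr_gt0 // mul1r; lra.
Qed.

Lemma polar_arg_fiber p q : -5 < cx p < 5 -> cx p = cx q -> polar_arg p - polar_arg q \is a Num.int ->
  q = p \/ q = hyperelliptic p.
Proof.
move=> hx xpq /intrP[n E]; have hq : -5 < cx q < 5 by rewrite -xpq.
have tp := norm_polar_arg hx; have tq := norm_polar_arg hq.
have /andP[h0 h1] := height_itv hx; have /andP[k0 k1] := height_itv hq.
have := ler_norm (polar_arg p); have := ler_norm (- polar_arg p); have := ler_norm (polar_arg q); have := ler_norm (- polar_arg q).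
rewrite !normrN tp tq => a1 a2 a3 a4.
have n1 : n%:~R <= (1 : R) by rewrite -E; lra.
have n2 : -1 <= (n%:~R : R) by rewrite -E; lra.
have hh : height p = height q.
  have [n0|[n0|n0]] : n = 0 \/ n = 1 \/ n = -1.
    have m1 : n <= 1 by rewrite -(ler_int R).
    have m2 : -1 <= n by rewrite -(ler_int R) mulrN1z.
    by clear -m1 m2; lia.
  - by move: tp; rewrite (_ : polar_arg p = polar_arg q) ?tq; [lra|move: E; rewrite n0; lra].
  - by move: E; rewrite n0 /=; lra.
  - by move: E; rewrite n0 mulrN1z; lra.
have y2 : cy p ^+ 2 = cy q ^+ 2.
  have := inner_lt hx; move: hh; rewrite /height xpq => hh lt.
  have d0 : 25 - cx q ^+ 2 - inner (cx q) != 0 by rewrite gt_eqF // subr_gt0.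
  exact: addIr (divIf d0 hh).
have z2 : cz p ^+ 2 = cz q ^+ 2 by rewrite !czE !domain_eqE xpq y2.
apply: yz_cases => //.
have yz2 : (cy p * cz p) ^+ 2 = (cy q * cz q) ^+ 2 by rewrite !exprMn y2 z2.
have [yz0|yz0] := eqVneq (cy p * cz p) 0.
  by move: yz2; rewrite yz0 expr0n /= => /esym/eqP; rewrite sqrf_eq0 => /eqP.
have /andP[g0 g1] := height_gt0 hx yz0.
have n0 : n = 0.
  have m1 : n < 1 by rewrite -(ltr_int R) -E; lra.
  have m2 : -1 < n by rewrite -(ltr_int R) mulrN1z -E; lra.
  by clear -m1 m2; lia.
have tE : polar_arg p = polar_arg q by move: E; rewrite n0; lra.
have sg_polar_arg r : cz r != 0 -> polar_arg r = Num.sg (cy r * cz r) * (height r / 2).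
  move=> z0; rewrite /polar_arg /shight sgrM (_ : zsign r = Num.sg (cz r)); first by ring.
  by rewrite /zsign; move: z0; case: sgrP.
move: (yz0); rewrite mulf_eq0 negb_or => /andP[y0 z0].
have z0' : cz q != 0 by rewrite -sqrf_eq0 -z2 sqrf_eq0.
move: tE; rewrite !sg_polar_arg // -hh => /mulIf e.
have {}e : Num.sg (cy p * cz p) = Num.sg (cy q * cz q).
  by apply: e; rewrite mulf_neq0 // gt_eqF.
by rewrite [LHS]numEsg [RHS]numEsg e -!sqrtr_sqr yz2.
Qed.

Lemma cost_turn (u v a : R) : 0 < u * cost a + v * sint a -> 0 < cost (turn u v - a).
Proof.
move=> h; have uv : (u, v) != 0.
  by apply/eqP => -[u0 v0]; move: h; rewrite u0 v0 !mul0r addr0 ltxx.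
have [cE sE] := turnP uv; rewrite costD costN sintN mulrN opprK cE sE.
rewrite ![_ / _ * _]mulrAC -mulrDl divr_gt0 // sqrtr_gt0.
by rewrite lt_neqAle addr_ge0 ?sqr_ge0 // andbT eq_sym paddr_eq0 ?sqr_ge0 // !sqrf_eq0 negb_and; move: uv; rewrite xpair_eqE negb_and.
Qed.

Lemma circ_turn (T : topologicalType) (u v : T -> R) : continuous u -> continuous v ->
  (forall t, (u t, v t) != 0) -> circ (fun t => turn (u t) (v t)).
Proof.
move=> cu cv uv.
have n0 t : Num.sqrt (u t ^+ 2 + v t ^+ 2) != 0.
  rewrite gt_eqF // sqrtr_gt0 lt_neqAle addr_ge0 ?sqr_ge0 // andbT eq_sym paddr_eq0 ?sqr_ge0 //.
  by rewrite !sqrf_eq0 negb_and; move: (uv t); rewrite xpair_eqE negb_and.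
split=> t.
  rewrite (_ : _ \o _ = fun t => u t / Num.sqrt (u t ^+ 2 + v t ^+ 2)); first by have := n0 t; cont.
  by apply/funext => s /=; rewrite (turnP (uv s)).1.
rewrite (_ : _ \o _ = fun t => v t / Num.sqrt (u t ^+ 2 + v t ^+ 2)); first by have := n0 t; cont.
by apply/funext => s /=; rewrite (turnP (uv s)).2.
Qed.

(* [zre q] and [zim q] are the coordinates of [A p * D q - A q * D p], where [A / D] is
   the coordinate on the quotient sphere: the zeros are [q] and its image under
   the involution, and the argument is [polar_arg] for [q] at one end, constant at the other. *)
Definition wt p q : R := (5 + cx p) * (5 - cx q).
Definition zre q p : R := wt p q * cost (polar_arg p) - wt q p * cost (polar_arg q).
Definition zim q p : R := wt p q * sint (polar_arg p) - wt q p * sint (polar_arg q).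
Definition zarg q p : R := turn (zre q p) (zim q p).

Lemma contat_z (U : topologicalType) (w : U) (x y a b : U -> R) :
  continuous_at w x -> continuous_at w y -> continuous_at w a -> continuous_at w b ->
  continuous_at w (fun t => (5 + x t) * (5 - y t) * a t - (5 + y t) * (5 - x t) * b t).
Proof. by cont. Qed.

(** A common zero would give equal moduli, hence equal [x], and then equal arguments, hence the same
    orbit by [polar_arg_fiber]. *)
Lemma z_neq0 p q : -5 < cx p < 5 -> q != p -> q != hyperelliptic p -> (zre q p, zim q p) != 0.
Proof.
move=> hx qp qsp; apply/eqP => -[/eqP + /eqP]; rewrite !subr_eq0 => /eqP cE /eqP sE.
have hq := cx_itv q.
have w1 : 0 <= wt p q by rewrite /wt mulr_ge0; lra.
have w2 : 0 <= wt q p by rewrite /wt mulr_ge0; lra.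
have wE : wt p q = wt q p.
  apply/eqP; rewrite -(@eqrXn2 _ 2) //; apply/eqP.
  rewrite -[LHS]mulr1 -[RHS]mulr1 -{1}(cost2Dsint2 (polar_arg p)) -(cost2Dsint2 (polar_arg q)).
  by rewrite !mulrDr -!exprMn cE sE.
have xE : cx p = cx q by move: wE; rewrite /wt; lra.
have w0 : wt p q != 0 by rewrite /wt -xE mulf_neq0 // gt_eqF //; lra.
move: cE sE; rewrite -wE => /(mulfI w0) cE /(mulfI w0) sE.
by case: (polar_arg_fiber hx xE (turn_inj cE sE)) => E; move: qp qsp; rewrite E eqxx.
Qed.

Section Parity.
Variable X : set Sigma.
Hypothesis X5 : forall p, X p -> -5 < cx p < 5.
Variable h : H1 R X.
Let T : topologicalType := X.
Let v (p : X) : Sigma := set_val p.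
Let vX (p : X) : X (v p) := set_mem (valP p).

Lemma val_continuous_at (f : Sigma -> R) (p : X) :
  continuous_at (set_val p : Sigma) f -> continuous_at p (fun q : X => f (set_val q)).
Proof. by move=> cf; apply: (@continuous_comp _ _ _ (@set_val _ X) f); [exact: initial_continuous|]. Qed.

Lemma circ_polar_arg : circ (fun p : X => polar_arg (set_val p)).
Proof.
split=> p; apply: (@val_continuous_at (fun q => _ (polar_arg q))).
  exact: cost_polar_arg_continuous (X5 (vX p)).
exact: sint_polar_arg_continuous (X5 (vX p)).
Qed.

Lemma circ_half_arg : circ (fun p : X => half_arg (set_val p)).
Proof.
split=> p; apply: (@val_continuous_at (fun q => _ (half_arg q))); have [c1 c2] := half_arg_continuous (X5 (vX p)).
  exact: c1.
exact: c2.
Qed.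

Lemma circ_zarg q : (forall p, X p -> q != p) -> (forall p, X p -> q != hyperelliptic p) ->
  circ (fun p : X => zarg q (set_val p)).
Proof.
move=> qp qsp; have cxc := @cx_continuous R.
have cc (p : X) : continuous_at p (fun p : X => cost (polar_arg (set_val p))) := circ_polar_arg.1 p.
have cs (p : X) : continuous_at p (fun p : X => sint (polar_arg (set_val p))) := circ_polar_arg.2 p.
have cx' (p : X) : continuous_at p (fun p : X => cx (set_val p)).
  by apply: val_continuous_at; exact: cxc.
apply: circ_turn => [p|p|p]; last by apply: z_neq0; [exact: X5|exact: qp|exact: qsp].
  by apply: contat_z; [exact: cx'|exact: contat_cst|exact: cc|exact: contat_cst].
by apply: contat_z; [exact: cx'|exact: contat_cst|exact: cs|exact: contat_cst].
Qed.

Lemma near_lt (U : topologicalType) (x : U) (f g : U -> R) : continuous_at x f -> continuous_at x g ->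
  f x < g x -> \forall y \near x, f y < g y.
Proof.
move=> cf cg fg; have c : continuous_at x (fun y => g y - f y) by cont.
have : \forall y \near x, 0 < g y - f y by apply: (cvgr_gt _ c); rewrite subr_gt0.
by apply: filterS => y; rewrite subr_gt0.
Qed.

Lemma pair_continuous (f : X -> R) (g : Sigma -> R) (p : X) (q : Sigma) :
  continuous_at p f -> continuous_at q g ->
  continuous_at (p, q) (fun w : X * Sigma => f w.1) /\ continuous_at (p, q) (fun w : X * Sigma => g w.2).
Proof.
move=> cf cg; split.
  by apply: (@continuous_comp _ _ _ fst f); [exact: cvg_fst|].
by apply: (@continuous_comp _ _ _ snd g); [exact: cvg_snd|].
Qed.

Definition zdeg q := deg (fun p : X => zarg q (set_val p)) h.
Definition off q := (forall p, X p -> q != p) /\ (forall p, X p -> q != hyperelliptic p).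

(** For [q] near the left end the term carrying the argument of [p] is the larger one, so [zarg]
    stays within a quarter turn of [polar_arg]. *)
Lemma zdeg_left q0 : cx q0 = -5 -> \forall q \near q0, off q -> zdeg q = deg (fun p : X => polar_arg (set_val p)) h.
Proof.
move=> x0; have cxc := @cx_continuous R.
have H : forall p : X, \forall w \near (p, q0), 0 < cost (zarg w.2 (set_val w.1) - polar_arg (set_val w.1)).
  move=> p.
  have [c1 c2] := @pair_continuous (fun p : X => cx (set_val p)) (@cx R) p q0 (val_continuous_at (cxc _)) (cxc q0).
  have : \forall w \near (p, q0), cx w.2 < cx (set_val w.1).
    by apply: (near_lt c2 c1); rewrite /= x0; have := X5 (vX p); lra.
  apply: filterS => -[p' q] /= lt; apply: cost_turn; rewrite /zre /zim.
  set a := polar_arg (set_val p'); set b := polar_arg q.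
  have cs : cost a * cost b + sint a * sint b <= 1.
    by have := cost2Dsint2 a; have := cost2Dsint2 b; have := sqr_ge0 (cost a - cost b); have := sqr_ge0 (sint a - sint b); nra.
  have -> : (wt (set_val p') q * cost a - wt q (set_val p') * cost b) * cost a +
      (wt (set_val p') q * sint a - wt q (set_val p') * sint b) * sint a =
    wt (set_val p') q * (cost a ^+ 2 + sint a ^+ 2) - wt q (set_val p') * (cost a * cost b + sint a * sint b) by ring.
  rewrite cost2Dsint2 mulr1; have hq := cx_itv q; have hp := X5 (vX p').
  have w0 : 0 <= wt q (set_val p') by rewrite /wt mulr_ge0; lra.
  have : wt q (set_val p') < wt (set_val p') q by rewrite /wt; nra.
  have : 0 <= wt q (set_val p') * (1 - (cost a * cost b + sint a * sint b)) by rewrite mulr_ge0 //; lra.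
  lra.
apply: filterS (@deg_locally R T Sigma h (fun q (p : X) => zarg q (set_val p)) (fun q (p : X) => polar_arg (set_val p)) q0 H) => q + [n1 n2].
by apply; [exact: circ_zarg|exact: circ_polar_arg].
Qed.

(** Near the right end the other term dominates, and its argument does not depend on the point of
    the cycle. *)
Lemma zdeg_right q0 : cx q0 = 5 -> \forall q \near q0, off q -> zdeg q = 0.
Proof.
move=> x0; have cxc := @cx_continuous R.
have H : forall p : X, \forall w \near (p, q0), 0 < cost (zarg w.2 (set_val w.1) - (polar_arg w.2 + 1 / 2)).
  move=> p.
  have [c1 c2] := @pair_continuous (fun p : X => cx (set_val p)) (@cx R) p q0 (val_continuous_at (cxc _)) (cxc q0).
  have : \forall w \near (p, q0), cx (set_val w.1) < cx w.2.
    by apply: (near_lt c1 c2); rewrite /= x0; have := X5 (vX p); lra.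
  apply: filterS => -[p' q] /= lt; apply: cost_turn; rewrite /zre /zim.
  set a := polar_arg (set_val p'); set b := polar_arg q.
  rewrite costD sintD mul1r cost_half sint_half.
  have cs : cost a * cost b + sint a * sint b <= 1.
    by have := cost2Dsint2 a; have := cost2Dsint2 b; have := sqr_ge0 (cost a - cost b); have := sqr_ge0 (sint a - sint b); nra.
  have -> : (wt (set_val p') q * cost a - wt q (set_val p') * cost b) * (cost b * -1 - sint b * 0) +
      (wt (set_val p') q * sint a - wt q (set_val p') * sint b) * (sint b * -1 + cost b * 0) =
    wt q (set_val p') * (cost b ^+ 2 + sint b ^+ 2) - wt (set_val p') q * (cost a * cost b + sint a * sint b) by ring.
  rewrite cost2Dsint2 mulr1; have hq := cx_itv q; have hp := X5 (vX p').
  have w0 : 0 <= wt (set_val p') q by rewrite /wt mulr_ge0; lra.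
  have : wt (set_val p') q < wt q (set_val p') by rewrite /wt; nra.
  have : 0 <= wt (set_val p') q * (1 - (cost a * cost b + sint a * sint b)) by rewrite mulr_ge0 //; lra.
  lra.
apply: filterS (@deg_locally R T Sigma h (fun q (p : X) => zarg q (set_val p)) (fun q (p : X) => polar_arg q + 1 / 2) q0 H) => q {}H [n1 n2].
rewrite /zdeg H; [|exact: circ_zarg|exact: circ_cst].
by apply: (deg_cst (a := polar_arg q + 1 / 2)) => p; rewrite subrr rpred0.
Qed.

Lemma zdeg_middle q0 : -5 < cx q0 < 5 -> off q0 -> \forall q \near q0, off q -> zdeg q = zdeg q0.
Proof.
move=> x0 [n1 n2]; have cxc := @cx_continuous R.
have H : forall p : X, \forall w \near (p, q0), 0 < cost (zarg w.2 (set_val w.1) - zarg q0 (set_val w.1)).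
  move=> p.
  have [c1 c2] := @pair_continuous (fun p : X => cx (set_val p)) (@cx R) p q0 (val_continuous_at (cxc _)) (cxc q0).
  have [c3 c4] := @pair_continuous (fun p : X => cost (polar_arg (set_val p))) (fun q => cost (polar_arg q)) p q0 (circ_polar_arg.1 p) (cost_polar_arg_continuous x0).
  have [c5 c6] := @pair_continuous (fun p : X => sint (polar_arg (set_val p))) (fun q => sint (polar_arg q)) p q0 (circ_polar_arg.2 p) (sint_polar_arg_continuous x0).
  have cz : continuous_at (p, q0) (fun w : X * Sigma => zre w.2 (set_val w.1) * zre q0 (set_val w.1) + zim w.2 (set_val w.1) * zim q0 (set_val w.1)).
    have zq0 (f : Sigma -> R) : continuous_at (p, q0) (fun w : X * Sigma => f (set_val w.1)) ->
        continuous_at (p, q0) (fun w : X * Sigma => wt (set_val w.1) q0 * f (set_val w.1) - wt q0 (set_val w.1) * f q0).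
      by move=> cf; apply: contat_z => //; exact: contat_cst.
    apply: contatD; apply: contatM; [exact: contat_z| |exact: contat_z|].
      exact: (zq0 (fun p => cost (polar_arg p))).
    exact: (zq0 (fun p => sint (polar_arg p))).
  have n0 := z_neq0 (X5 (vX p)) (n1 _ (vX p)) (n2 _ (vX p)).
  have : \forall w \near (p, q0), 0 < zre w.2 (set_val w.1) * zre q0 (set_val w.1) + zim w.2 (set_val w.1) * zim q0 (set_val w.1).
    apply: (cvgr_gt _ cz) => /=; rewrite -!expr2 lt_neqAle addr_ge0 ?sqr_ge0 // andbT eq_sym paddr_eq0 ?sqr_ge0 //.
    by rewrite !sqrf_eq0 negb_and; move: n0; rewrite xpair_eqE negb_and.
  apply: filterS => -[p' q] /= pos; apply: cost_turn.
  have uv := z_neq0 (X5 (vX p')) (n1 _ (vX p')) (n2 _ (vX p')).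
  have [-> ->] := turnP uv; rewrite !mulrA -mulrDl divr_gt0 // sqrtr_gt0.
  rewrite lt_neqAle addr_ge0 ?sqr_ge0 // andbT eq_sym paddr_eq0 ?sqr_ge0 //.
  by rewrite !sqrf_eq0 negb_and; move: uv; rewrite xpair_eqE negb_and.
apply: filterS (@deg_locally R T Sigma h (fun q (p : X) => zarg q (set_val p)) (fun q (p : X) => zarg q0 (set_val p)) q0 H) => q + [n3 n4].
by apply; exact: circ_zarg.
Qed.

(** [zdeg] is locally constant on [K]; it is the degree of [polar_arg] at one end and 0 at the
    other. *)
Lemma deg_polar_arg_eq0 (K : set Sigma) (q1 q2 : Sigma) : connected K -> (forall q, K q -> off q) ->
  K q1 -> cx q1 = -5 -> K q2 -> cx q2 = 5 -> deg (fun p : X => polar_arg (set_val p)) h = 0.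
Proof.
move=> cK oK K1 x1 K2 x2.
rewrite -(nbhs_singleton (zdeg_left x1) (oK _ K1)) -(nbhs_singleton (zdeg_right x2) (oK _ K2)).
apply: (connected_locally_constant cK) K1 K2 => q0 K0; have o0 := oK _ K0.
have hq := cx_itv q0; have [e|n5] := eqVneq (cx q0) 5.
  have z := zdeg_right e; rewrite (nbhs_singleton z o0).
  by apply: filterS z => q H /oK.
have [e|n5'] := eqVneq (cx q0) (-5).
  have z := zdeg_left e; rewrite (nbhs_singleton z o0).
  by apply: filterS z => q H /oK.
have z : -5 < cx q0 < 5 by rewrite !lt_neqAle n5 eq_sym n5'.
by apply: filterS (zdeg_middle z o0) => q H /oK.
Qed.

(** Once the argument has degree 0, [double_half_arg] leaves the three odd dual functions equal to
    twice a single angle function, up to a constant. *)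
Lemma lam_odd_even : deg (fun p : X => polar_arg (set_val p)) h = 0 ->
  lam 1 (H1_incl h) + lam 3 (H1_incl h) + lam 5 (H1_incl h) = 2 * deg (fun p : X => half_arg (set_val p)) h.
Proof.
move=> t0; have cv : continuous (@set_val _ X) by exact: initial_continuous.
have cd k : (k < 7)%N -> circ (fun p : X => dual k (set_val p)).
  by move=> k7; exact: circ_comp cv (dual_circ R k7).
have lE k : (k < 7)%N -> lam k (H1_incl h) = deg (fun p : X => dual k (set_val p)) h.
  by move=> k7; rewrite /lam /H1_incl deg_map //; exact: dual_circ.
rewrite !lE //.
have circD (f g : X -> R) : circ f -> circ g -> circ (fun p : X => f p + g p).
  move=> cf cg; rewrite (_ : (fun p : X => _) = fun p : X => f p - (0 - g p)); last by apply/funext => p; ring.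
  by apply: circB cf _; apply: circB cg; exact: circ_cst.
have degD2 (f g : X -> R) : circ f -> circ g -> deg (fun p : X => f p + g p) h = deg f h + deg g h.
  move=> cf cg; rewrite (@deg_comb R X (fun p : X => f p + g p) f g (fun=> 0) 1) ?mul1r //.
  - exact: circD.
  - by move=> p; exact: contat_cst.
  - by move=> p; rewrite mul1r addr0 subrr rpred0.
have c1 := cd 1 isT; have c3 := cd 3 isT; have c5 := cd 5 isT; have ct := circ_polar_arg; have cg := circ_half_arg.
have c35 := circD _ _ c3 c5; have c135 := circD _ _ c1 c35.
have c0 : circ (fun _ : X => 0 : R) := circ_cst _ 0.
have ck : continuous (fun _ : X => 1 / 2 : R) by move=> p; exact: contat_cst.
have := @deg_comb R X _ (fun=> 0) (fun p : X => half_arg (set_val p)) (fun=> 1 / 2) 2 h (circD _ _ ct c135) c0 cg ck.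
rewrite (deg_cst (a := 0) (f := fun=> 0)) ?add0r; last by move=> p; rewrite oppr0 rpred0.
rewrite (degD2 _ _ ct c135) (degD2 _ _ c1 c35) (degD2 _ _ c3 c5) t0 add0r addrA; apply=> p.
by have := double_half_arg (set_val p); rewrite -rpredN opprB => /int_eq; apply; ring.
Qed.

End Parity.

End Angle.

(** * Arcs between fixed points *)

Section WeierstrassPoints.
Variable R : realType.
Notation Sigma := (Sigma3 R).
Notation H := (H1 R Sigma).

Definition wx (j : nat) : R := [:: -5; -4; -2; -1; 1; 2; 4; 5]`_j.
Definition wp (j : nat) : Sigma := surf (wx j) 0 0.

Lemma wx_domain j : (j < 8)%N -> 0 ^+ 2 = domain_eq (wx j) 0.
Proof. by rewrite domain_eqE /wx; case: j => [|[|[|[|[|[|[|[|//]]]]]]]] _ /=; ring. Qed.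

Lemma wpE j : (j < 8)%N -> [/\ cx (wp j) = wx j, cy (wp j) = 0 & cz (wp j) = 0].
Proof. by move=> j8; exact: (surfE (wx_domain j8)). Qed.

Lemma wp_hyp j : (j < 8)%N -> hyperelliptic (wp j) = wp j.
Proof.
move=> /wpE[h1 h2 h3]; have [k1 k2 k3] := hypE (wp j).
by apply: Sigma_eq; rewrite ?k1 ?k2 ?k3 ?h2 ?h3 ?oppr0.
Qed.

(** Parameters 0 and $1/2$ are the ones fixed by negation modulo 1, hence the fixed points on the
    core; the left one sits at $1/2$. *)
Lemma chE_core k (b : bool) : (k < 7)%N -> chE k (b%:R / 2, 0) = wp (k + ~~ b)%N.
Proof.
move=> k7; have [w1 w2 w3] : [/\ cx (wp (k + ~~ b)) = wx (k + ~~ b), cy (wp (k + ~~ b)) = 0 & cz (wp (k + ~~ b)) = 0].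
  by apply: wpE; case: b; rewrite ?addn0 ?addn1 // ltnW.
have cb : cost (b%:R / 2 : R) = if b then -1 else 1.
  by case: b {w1 w2 w3}; rewrite ?mul1r ?mul0r ?cost_half ?cost0.
have sb : sint (b%:R / 2 : R) = 0.
  by case: b {w1 w2 w3 cb}; rewrite ?mul1r ?mul0r ?sint_half ?sint0.
have s1 : Num.sqrt (1 - 0 ^+ 2 : R) = 1 by rewrite expr0n subr0 sqrtr1.
have s5 : Num.sqrt (25 - 0 ^+ 2 : R) = 5.
  by rewrite expr0n subr0 (_ : 25 = 5 ^+ 2) ?sqrtr_sqr ?ger0_norm //; ring.
rewrite /chE; case: ifP => ok.
  have [e1 e2 e3] := @hole_EE R (hc R k./2) (hc3 R (ltac:(lia) : (k./2 < 3)%N)) (b%:R / 2) 0.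
  apply: Sigma_eq; rewrite ?e1 ?e2 ?e3 ?w1 ?w2 ?w3 /hole_r /hole_z clamp0 ?sgr0 ?mul0r //.
    rewrite cb normr0 mul0r addr0 mul1r /hc /wx.
    by case: k k7 ok {e1 e2 e3 w1 w2 w3} => [|[|[|[|[|[|[|//]]]]]]] //= _ _; case: b {cb sb} => /=; ring.
  by rewrite sb mulr0.
have [e1 e2 e3] := @gap_EE R k./2 (ltac:(lia) : (k./2 < 4)%N) (b%:R / 2) 0.
apply: Sigma_eq; rewrite ?e1 ?e2 ?e3 ?w1 ?w2 ?w3 /gap_z /gap_x /gap_y clamp0 ?sb ?sgr0 ?mul0r //.
rewrite cb /gap_l /gap_r s1 s5 /hc /wx.
by case: k k7 ok {e1 e2 e3 w1 w2 w3} => [|[|[|[|[|[|[|//]]]]]]] //= _ _; case: b {cb sb} => /=; field.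
Qed.

(** The shear at [y = 0] is $1/2$, so the twist turns its core by half a turn and exchanges the two
    fixed points on it; the others lie off the annulus. *)
Lemma tw_wp k j : (k < 7)%N -> (j < 8)%N ->
  tw (o7 k) 1 (wp j) = wp (if j == k then k.+1 else if j == k.+1 then k else j).
Proof.
move=> k7 j8; have C := @chainP R k k7; have e1 : o7 k = k :> nat := inordK k7.
have e0 : `|0 : R| <= 1 by rewrite normr0.
have twE x : tw (o7 k) 1 (chE k (x, 0)) = chE k (x + 1 / 2, 0) :> Sigma.
  rewrite /tw e1 twistE //.
  - by rewrite mulr1z mul1r add0r.
  - exact: (chart_per C).
  - exact: chart_inj2 C.
case: eqP => [->|jk].
  have := @chE_core k true k7; have := @chE_core k false k7; rewrite addn0 addn1 [false%:R]/(0 : R) [true%:R]/(1 : R) mul0r => <- <-.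
  by rewrite twE -splitr -[X in chE k (X, _)]add0r (chart_per C).
case: eqP => [->|jk1].
  have := @chE_core k true k7; have := @chE_core k false k7; rewrite addn0 addn1 [false%:R]/(0 : R) [true%:R]/(1 : R) mul0r => <- <-.
  by rewrite twE add0r.
rewrite /tw e1; apply: twist_out; first exact: (chart_per C).
move=> x y y1 E; have [U _] := chart_E C x (ltW y1); move: U; rewrite -E.
have [h1 h2 h3] := wpE j8.
rewrite /chU; case: ifP => ok; rewrite /hole_U /gap_U h1 ?h2 /hc /wx.
  case: k k7 ok jk jk1 {C e1 twE E} => [|[|[|[|[|[|[|//]]]]]]] //= _ _;
  case: j j8 {h1 h2 h3} => [|[|[|[|[|[|[|[|//]]]]]]]] //= _ _ _; lra.
case: k k7 ok jk jk1 {C e1 twE E} => [|[|[|[|[|[|[|//]]]]]]] //= _ _;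
case: j j8 {h1 h2 h3} => [|[|[|[|[|[|[|[|//]]]]]]]] //= _ _ _; lra.
Qed.

Lemma wp_end q : ~ (-5 < cx q < 5) -> q = wp 0 \/ q = wp 7.
Proof.
move=> hx; have y0 := end_y0 hx; have h := cx_itv q.
have [w1 w2 w3] := @wpE 0 isT; have [v1 v2 v3] := @wpE 7 isT.
have xE : cx q = 5 \/ cx q = -5.
  have [h1|h1] := ltP (cx q) 5; last by left; lra.
  by right; have [h2|h2] := ltP (-5) (cx q); [case: hx; rewrite h2|lra].
have z0 : cz q = 0.
  by apply/eqP; rewrite -sqrf_eq0 czE y0 domain_eqE; case: xE => ->; apply/eqP; ring.
by case: xE => e; [right|left]; apply: Sigma_eq; rewrite ?e ?y0 ?z0 ?w1 ?w2 ?w3 ?v1 ?v2 ?v3.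
Qed.

(* [\sum_(i <= k < j) lam k] is the intersection number modulo 2 with the lift of an
   arc of the quotient sphere joining the images of [wp i] and [wp j]. *)
Definition even_between i j := forall (X K : set Sigma) (h : H1 R X), connected K ->
  (forall q, K q -> ~ X q /\ ~ X (hyperelliptic q)) -> K (wp i) -> K (wp j) ->
  exists n, \sum_(i <= k < j) lam k (H1_incl h) = 2 * n.

Variable dot : H -> H -> int.
Hypothesis dotP : intersection_form dot.
Hypothesis rank6 : exists e : 'I_6 -> H, Zbasis setT e.

(** By [lam_odd_even] the odd degrees add up to an even number, while the even ones add up to 0. *)
Lemma even_between_ends : even_between 0 7.
Proof.
move=> X K h cK KX K0 K7.
have X5 p : X p -> -5 < cx p < 5.
  move=> Xp; apply: contrapT => /wp_end[E|E]; move: Xp; rewrite E; [exact: (KX _ K0).1|exact: (KX _ K7).1].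
have oK q : K q -> off X q.
  move=> Kq; have [n1 n2] := KX q Kq; split=> p Xp; apply/eqP => E; first by apply: n1; rewrite E.
  by apply: n2; rewrite E hypK.
have [w1 _ _] := @wpE 0 isT; have [v1 _ _] := @wpE 7 isT.
have t0 := deg_polar_arg_eq0 X5 h cK oK K0 w1 K7 v1.
have := lam_odd_even X5 t0; have := sum_even_lam dotP rank6 (H1_incl h).
set n := deg _ _ => e1 e2; exists n.
rewrite -[index_iota 0 7]/[:: 0; 1; 2; 3; 4; 5; 6]%N !big_cons big_nil addr0; move: e1 e2; clearbody n.
move: (lam 0 _) (lam 1 _) (lam 2 _) (lam 3 _) (lam 4 _) (lam 5 _) (lam 6 _); clear; lia.
Qed.

(* The twist along the [k]th chain curve exchanges [wp k] and [wp k.+1]. *)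
Lemma even_between_tw k i j i' j' : (k < 7)%N -> (i < 8)%N -> (j < 8)%N ->
  i' = (if i == k then k.+1 else if i == k.+1 then k else i) ->
  j' = (if j == k then k.+1 else if j == k.+1 then k else j) -> even_between i' j' ->
  forall (X K : set Sigma) (h : H1 R X), connected K ->
  (forall q, K q -> ~ X q /\ ~ X (hyperelliptic q)) -> K (wp i) -> K (wp j) ->
  exists n, \sum_(i' <= m < j') lam m (H1_incl h + ch R k *~ lam k (H1_incl h)) = 2 * n.
Proof.
move=> k7 i8 j8 -> -> E X K h cK KX Ki Kj.
have K1 : cancel (twc R (o7 k) 1) (twc R (o7 k) (-1)) := @twK R (o7 k) 1.
have K2 : cancel (twc R (o7 k) (-1)) (twc R (o7 k) 1).
  by have := @twK R (o7 k) (-1); rewrite opprK.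
have [h' hE] := H1_incl_image (twc R (o7 k) 1) h.
have := @tw_transvection R rank6 (o7 k) 1 (H1_incl h) erefl.
rewrite hE mul1r (inordK k7 : o7 k = k :> nat) => <-; apply: (E _ (twc R (o7 k) 1 @` K)).
- exact: connected_image.
- move=> _ [q Kq <-]; have [n1 n2] := KX q Kq; rewrite !(homeo_image K1 K2) /= K1; split=> //.
  by rewrite (tw_hyp (o7 k) 1 q) -[tw _ _ _]/(twc R (o7 k) 1 _) K1.
- by exists (wp i) => //; exact: tw_wp.
- by exists (wp j) => //; exact: tw_wp.
Qed.

(** The twist along curve [j] takes [wp j] to [wp j.+1] and fixes [wp i]. For the twisted class,
    degree [j - 1] changes by minus [lam j], which cancels the extra last term. *)
Lemma even_between_down i j : (i < j)%N -> (j < 7)%N -> even_between i j.+1 -> even_between i j.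
Proof.
move=> ij j7 E X K h cK KX Ki Kj.
have iE : i = (if i == j then j.+1 else if i == j.+1 then j else i).
  by rewrite ltn_eqF // ltn_eqF // ltnW.
have jE : j.+1 = (if j == j then j.+1 else if j == j.+1 then j else j) by rewrite eqxx.
have i8 : (i < 8)%N by clear -ij j7; lia.
have [n nE] := even_between_tw j7 i8 (leqW j7) iE jE E h cK KX Ki Kj.
exists n; move: nE; rewrite big_nat_recr /=; last exact: ltnW.
have lE m : (m < 7)%N -> lam m (H1_incl h + ch R j *~ lam j (H1_incl h)) =
    lam m (H1_incl h) + lam j (H1_incl h) * lamc m j.
  by move=> m7; rewrite lamD // lamMz // lam_ch.
case: j ij j7 {E Kj jE iE} lE => // j ij j7 lE.
rewrite !big_nat_recr //= !lE //; last by apply: ltnW.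
have -> : \sum_(i <= m < j) lam m (H1_incl h + ch R j.+1 *~ lam j.+1 (H1_incl h)) =
    \sum_(i <= m < j) lam m (H1_incl h).
  apply: eq_big_nat => m /andP[_ mj]; rewrite lE; last by clear -mj j7; lia.
  have n1 : (m == j.+2) = false by clear -mj; lia.
  have n2 : (j.+1 == m.+1) = false by clear -mj; lia.
  by rewrite /lamc n1 n2 mulr0 addr0.
have n1 : (j == j.+2) = false by clear; lia.
have n2 : (j.+1 == j.+2) = false by clear; lia.
by rewrite /lamc n1 n2 eqxx => <-; ring.
Qed.

(** The twist along curve [i] takes [wp i.+1] to [wp i]; the extra first term and the change in
    degree [i.+1] add up to twice [lam i]. *)
Lemma even_between_up i j : (i.+1 < j)%N -> (j < 8)%N -> even_between i j -> even_between i.+1 j.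
Proof.
move=> ij j8 E X K h cK KX Ki Kj; have i7 : (i < 7)%N by lia.
have iE : i = (if i.+1 == i then i.+1 else if i.+1 == i.+1 then i else i.+1).
  by rewrite gtn_eqF // eqxx.
have jE : j = (if j == i then i.+1 else if j == i.+1 then i else j).
  by rewrite gtn_eqF ?(ltnW ij) // gtn_eqF.
have i8 : (i.+1 < 8)%N by clear -ij j8; lia.
have [n nE] := even_between_tw i7 i8 j8 iE jE E h cK KX Ki Kj.
exists (n - lam i (H1_incl h)); move: nE.
have lE m : (m < 7)%N -> lam m (H1_incl h + ch R i *~ lam i (H1_incl h)) =
    lam m (H1_incl h) + lam i (H1_incl h) * lamc m i.
  by move=> m7; rewrite lamD // lamMz // lam_ch.
move=> e1; rewrite mulrBr -e1 (big_ltn (ltnW ij)) !(big_ltn ij) !lE //; last by clear -ij j8; lia.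
have -> : \sum_(i.+2 <= m < j) lam m (H1_incl h + ch R i *~ lam i (H1_incl h)) =
    \sum_(i.+2 <= m < j) lam m (H1_incl h).
  apply: eq_big_nat => m /andP[im mj]; rewrite lE; last by clear -mj j8; lia.
  have n1 : (m == i.+1) = false by clear -im; lia.
  have n2 : (i == m.+1) = false by clear -im; lia.
  by rewrite /lamc n1 n2 mulr0 addr0.
have n1 : (i == i.+1) = false by clear; lia.
by rewrite /lamc n1 eqxx; ring.
Qed.

Lemma even_betweenP i j : (i < j)%N -> (j < 8)%N -> even_between i j.
Proof.
have down j' : (0 < j')%N -> (j' < 8)%N -> even_between 0 j'.
  move=> j0 j8; rewrite -(subKn (j8 : (j' <= 7)%N)).
  have : (7 - j' < 7)%N by clear -j0 j8; lia.
  elim: (7 - j')%N => [|d IH] d7; first exact: even_between_ends.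
  apply: even_between_down; [lia|lia|].
  by rewrite (_ : (7 - d.+1).+1 = 7 - d)%N; [apply: IH; lia|lia].
move=> ij j8; elim: i ij => [|i IH] ij; first exact: down.
by apply: even_between_up => //; apply: IH; exact: ltnW.
Qed.

End WeierstrassPoints.

(** * Pieces of a symmetric pair *)

Section Components.
Variable T : topologicalType.
Implicit Types (U X Y F : set T).

Lemma component_eq U X Y p : component U X -> component U Y -> X p -> Y p -> X = Y.
Proof.
case=> x Ux -> [y Uy ->] xp yp.
by rewrite (same_connected_component xp) (same_connected_component yp).
Qed.

Lemma component_sub U X : component U X -> X `<=` U.
Proof. by case=> x Ux ->; exact: connected_component_sub. Qed.

Lemma component_is_connected U X : component U X -> connected X.
Proof. by case=> x Ux ->; exact: component_connected. Qed.

Lemma closure_frontier X : closure X `<=` X `|` frontier X.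
Proof.
move=> p cp; have [/interior_subset|np] := pselect (X° p); first by left.
by right; split.
Qed.

Lemma open_frontier X : X `&` frontier X = set0 -> open X.
Proof.
rewrite openE => XF p Xp; apply: contrapT => np.
have : (X `&` frontier X) p by split=> //; split=> //; exact: subset_closure.
by rewrite XF.
Qed.

(** A relatively clopen part of the complement that misses [D] also stays off the closures of [X]
    and [X'], so it is clopen in the whole space and therefore empty. *)
Lemma connected_complement (X X' D F : set T) : connected [set: T] -> open X -> open X' ->
  closure X `<=` X `|` F -> closure X' `<=` X' `|` F -> F `<=` D -> connected D ->
  D !=set0 -> D `<=` ~` (X `|` X') -> connected (~` (X `|` X')).
Proof.
move=> cT oX oX' cX cX' FD cD D0 DK; set K := ~` _.
have empty E (O C : set T) : open O -> closed C -> E = K `&` O -> E = K `&` C -> E `&` D = set0 -> E = set0.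
  move=> oO cC EO EC ED.
  have cE : closed E.
    by rewrite EC; apply: closedI => //; apply: open_closedC; exact: openU.
  have oE : open E.
    have -> : E = O `&` ~` (closure X `|` closure X').
      apply/seteqP; split=> p.
        move=> Ep; have := Ep; rewrite EO => -[Kp Op]; split=> // -[/cX|/cX'] [h|/FD h].
        - by apply: Kp; left.
        - by have : (E `&` D) p by []; rewrite ED.
        - by apply: Kp; right.
        - by have : (E `&` D) p by []; rewrite ED.
      by case=> Op np; rewrite EO; split=> // -[h|h]; apply: np; [left|right]; exact: subset_closure.
    by apply: openI => //; apply: closed_openC; apply: closedU; exact: closed_closure.
  apply: contrapT => /eqP/set0P En.
  have ET : E = [set: T].
    by apply: cT => //; [exists E => //; rewrite setTI|exists E => //; rewrite setTI].
  case: D0 => d Dd; have : (E `&` D) d by split=> //; rewrite ET.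
  by rewrite ED.
move=> B B0 [W oW BW] [C cC BC].
have DB : D `&` B = set0 \/ D `&` B = D.
  have [DB|/eqP/set0P DB] := pselect (D `&` B = set0); [by left|right].
  apply: cD => //.
    exists W => //; rewrite BW setIA; congr (_ `&` _).
    by apply/setIidPl.
  exists C => //; rewrite BC setIA; congr (_ `&` _).
  by apply/setIidPl.
case: DB => DB.
  have : B = set0 by apply: (empty B W C) => //; rewrite setIC.
  by case: B0 => b Bb; move=> B0; move: Bb; rewrite B0.
have KB : K `\` B = set0.
  apply: (empty _ (~` C) (~` W)).
  - exact: closed_openC.
  - exact: open_closedC.
  - by rewrite BC setDE setCI setIUr setICr set0U.
  - by rewrite BW setDE setCI setIUr setICr set0U.
  - by rewrite -DB setDE [D `&` B]setIC !setIA -(setIA K) setICl setI0 set0I.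
apply/seteqP; split; first by rewrite BW => p [].
by move=> p Kp; apply: contrapT => nB; have : (K `\` B) p by []; rewrite KB.
Qed.

End Components.

Section Geometry.
Variable R : realType.
Notation Sigma := (Sigma3 R).
Notation H := (H1 R Sigma).
Let s : continuousType Sigma Sigma := mkcts (@hyp_continuous R).
Let sK : cancel s s := @hypK R.

Lemma connected_Sigma : connected [set: Sigma].
Proof.
rewrite (_ : [set: Sigma] = [set p : Sigma | cx p < 6]); first by apply: connected_left; lra.
by apply/seteqP; split=> // p _ /=; have := cx_itv p; lra.
Qed.

Variables (c d : loop R Sigma) (X : 'I_3 -> set Sigma).
Hypothesis sc : s_invariant c.
Hypothesis sd : s_invariant d.
Hypothesis cd0 : range c `&` range d = set0.
Let U : set Sigma := ~` (range c `|` range d).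
Hypothesis compX : forall i, component U (X i).
Hypothesis front0 : frontier (X 0) = range c.
Hypothesis front1 : frontier (X 1) = range c `|` range d.
Hypothesis front2 : frontier (X 2) = range d.

Lemma s_U : s @` U = U.
Proof.
rewrite (homeo_image sK sK) /U -[in RHS]sc -[in RHS]sd -[@hyperelliptic R]/(s : Sigma -> Sigma).
by rewrite -image_setU (homeo_image sK sK).
Qed.

Lemma component_s Y : component U Y -> component U (s @` Y).
Proof. by move=> cY; rewrite -s_U; exact: component_image. Qed.

Lemma component_frontier_disjoint Y Z p : component U Y -> component U Z -> frontier Y <> frontier Z -> Y p -> ~ Z p.
Proof. by move=> cY cZ FYZ Yp Zp; apply: FYZ; rewrite (component_eq cY cZ Yp Zp). Qed.

Lemma range_neq : range c <> range d.
Proof. by move=> E; move: cd0; rewrite E setIid => /seteqP[/(_ (d 0))]; case=> //; exists 0. Qed.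

Lemma range_neqU1 : range c <> range c `|` range d.
Proof.
move=> E; move: cd0 => /seteqP[/(_ (d 0))]; case=> //; split; last by exists 0.
by rewrite E; right; exists 0.
Qed.

Lemma range_neqU2 : range d <> range c `|` range d.
Proof.
move=> E; move: cd0 => /seteqP[/(_ (c 0))]; case=> //; split; first by exists 0.
by rewrite E; left; exists 0.
Qed.

Lemma frontier_s Y : frontier (s @` Y) = s @` frontier Y.
Proof. exact: frontier_image. Qed.

Lemma component_open Y : component U Y -> frontier Y `<=` range c `|` range d -> open Y.
Proof.
move=> cY FY; apply: open_frontier; apply/seteqP; split=> // p [Yp /FY Fp].
exact: (component_sub cY Yp).
Qed.

Lemma s_notin Y q : ~ (Y `|` s @` Y) q -> ~ Y q /\ ~ Y (hyperelliptic q).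
Proof.
move=> n; split=> h; apply: n; [by left|right].
by exists (hyperelliptic q) => //; exact: hypK.
Qed.

(** [connected_complement] with [D] the closure of the middle piece, which contains the common
    frontier of [Y] and of its image. *)
Lemma connected_outside Y (e : loop R Sigma) : component U Y -> frontier Y = range e ->
  s_invariant e -> range e `<=` range c `|` range d -> range e <> range c `|` range d ->
  connected (~` (Y `|` s @` Y)).
Proof.
move=> cY FY se eU neU.
have cY' := component_s cY; have FY' : frontier (s @` Y) = range e by rewrite frontier_s FY.
apply: (@connected_complement _ _ _ (closure (X 1)) (range e)).
- exact: connected_Sigma.
- by apply: component_open => //; rewrite FY.
- by apply: component_open => //; rewrite FY'.
- by rewrite -FY; exact: closure_frontier.
- by rewrite -[in X in _ `|` X]FY'; exact: closure_frontier.
- by move=> p /eU; rewrite -front1 => -[].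
- exact: connected_closure (component_is_connected (compX 1)).
- by case: (compX 1) => p Up ->; exists p; apply: subset_closure; exact: connected_component_refl.
- move=> p /closure_frontier[Xp [Yp|Yp]|].
  + by apply: (component_frontier_disjoint (compX 1) cY) Yp => //; rewrite front1 FY; exact/nesym.
  + by apply: (component_frontier_disjoint (compX 1) cY') Yp => //; rewrite front1 FY'; exact/nesym.
  + by rewrite front1 => Up [/(component_sub cY)|/(component_sub cY')].
Qed.

Variable dot : H -> H -> int.
Hypothesis dotP : intersection_form dot.
Hypothesis rank6 : exists e : 'I_6 -> H, Zbasis setT e.

(** The complement of [Y] and its image is a connected set joining the two fixed points, which the
    involution fixes and which thus avoid the image too. *)
Lemma even_outside (Y : set Sigma) (e : loop R Sigma) (h : H1 R Y) i j : component U Y -> frontier Y = range e ->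
  s_invariant e -> range e `<=` range c `|` range d -> range e <> range c `|` range d ->
  (i < j)%N -> (j < 8)%N -> ~ Y (wp R i) -> ~ Y (wp R j) ->
  exists n : int, \sum_(i <= k < j) lam k (H1_incl h) = 2 * n.
Proof.
move=> cY FY se eU neU ij j8 Yi Yj; have i8 := ltn_trans ij j8.
apply: (even_betweenP dotP rank6 ij j8 h (connected_outside cY FY se eU neU)).
- by move=> q nq; exact: s_notin nq.
- by move=> [//|[q Yq E]]; apply: Yi; rewrite -(wp_hyp R i8) -E -[hyperelliptic _]/(s _) sK.
- by move=> [//|[q Yq E]]; apply: Yj; rewrite -(wp_hyp R j8) -E -[hyperelliptic _]/(s _) sK.
Qed.

(** Here the joining set is the piece [Y] itself, while the class is carried by the middle piece. *)
Lemma even_inside (Y : set Sigma) (h : H1 R (X 1)) i j : component U Y -> frontier Y <> range c `|` range d ->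
  (i < j)%N -> (j < 8)%N -> Y (wp R i) -> Y (wp R j) ->
  exists n : int, \sum_(i <= k < j) lam k (H1_incl h) = 2 * n.
Proof.
move=> cY FY ij j8 Yi Yj.
apply: (even_betweenP dotP rank6 ij j8 h (component_is_connected cY) _ Yi Yj) => q Yq; split.
  by apply: (component_frontier_disjoint cY (compX 1)) Yq; rewrite front1.
move=> h1; have : (s @` X 1) q by exists (hyperelliptic q) => //; exact: hypK.
apply: (component_frontier_disjoint cY (component_s (compX 1))) Yq.
by rewrite frontier_s front1 image_setU -[s : Sigma -> Sigma]/(@hyperelliptic R) sc sd.
Qed.

End Geometry.

(** * Finite combinatorics of even subsets of the eight fixed points *)

Section Counting.

(** Exhaustive test over all bit sequences of a given length, meant for evaluation. *)
Fixpoint all_bits n (f : bitseq -> bool) : bool :=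
  if n is n'.+1 then all_bits n' (fun s => f (true :: s)) && all_bits n' (fun s => f (false :: s)) else f [::].

Lemma all_bitsP n f : all_bits n f -> forall s, size s = n -> f s.
Proof.
elim: n f => [|n IH] f /=; first by move=> h [].
move=> /andP[h1 h2] [//|[] s] /= [sn]; first exact: (IH _ h1).
exact: (IH _ h2).
Qed.

(* The mod 2 class with dual coordinates [s] is represented by the even subset
   [points s] of the eight fixed points; the complement represents the same class. *)
Definition points (s : bitseq) : bitseq := false :: scanl addb false s.
Definition bit (s : bitseq) i := nth false s i.
(** Appends the seventh degree, which the relation among the even chain curves determines modulo
    2. *)
Definition closing (s : bitseq) : bitseq := rcons s (bit s 0 (+) bit s 2 (+) bit s 4).
Definition dotb (s t : bitseq) : bool :=
  (bit s 0 && bit t 1) (+) (bit s 1 && bit t 0) (+)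
  (((bit s 0 (+) bit s 2) && bit t 3) (+) (bit s 3 && (bit t 0 (+) bit t 2))) (+)
  (((bit s 0 (+) bit s 2 (+) bit s 4) && bit t 5) (+) (bit s 5 && (bit t 0 (+) bit t 2 (+) bit t 4))).
(** The value of the quadratic form at a single class; on the even subset it is half the cardinality
    modulo 2. *)
Definition arfb (s : bitseq) : bool :=
  let x1 := bit s 1 in let y1 := bit s 0 in let x2 := bit s 3 in let y2 := bit s 0 (+) bit s 2 in
  let x3 := bit s 5 in let y3 := bit s 0 (+) bit s 2 (+) bit s 4 in
  x1 (+) y1 (+) (x1 && y1) (+) (y2 (+) (x2 && y2)) (+) (x3 (+) y3 (+) (x3 && y3)).
Definition constant_on (Q p : bitseq) : bool :=
  if all (fun i => if bit Q i then bit p i else true) (iota 0 8) then true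
  else all (fun i => if bit Q i then ~~ bit p i else true) (iota 0 8).
Definition cpoints s := points (closing s).

(* The conditionals below are nested [if]s because [vm_compute] evaluates both
   arguments of [==>] and [&&]. *)
Lemma one_piece_check : all_bits 8 (fun P => all_bits 6 (fun s =>
  if constant_on (map negb P) (cpoints s) then all_bits 6 (fun t =>
    if dotb s t then if constant_on (map negb P) (cpoints t) then
      (3 <= count id P)%N && ((count id P <= 4)%N ==> arfb s && arfb t)
    else true else true) else true)).
Proof. by vm_compute. Qed.

(** A class constant on [P] and off [P] is represented, up to complement, by the empty set or by
    [P], the latter then of even cardinality; two such classes meet evenly. *)
Lemma two_pieces_check : all_bits 8 (fun P => all_bits 6 (fun s =>
  if constant_on P (cpoints s) then if constant_on (map negb P) (cpoints s) then all_bits 6 (fun t =>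
    if constant_on P (cpoints t) then if constant_on (map negb P) (cpoints t) then ~~ dotb s t
    else true else true) else true else true)).
Proof. by vm_compute. Qed.

(** If one of the sets has at least five points, the other has exactly three and they are
    complementary. *)
Lemma disjoint_check : all_bits 8 (fun P => if (3 <= count id P)%N then all_bits 8 (fun Q =>
  if all (fun i => ~~ (bit P i && bit Q i)) (iota 0 8) then
    if (3 <= count id Q)%N then (count id P <= 4)%N && (count id Q <= 4)%N || (Q == map negb P) else true
  else true) else true).
Proof. by vm_compute. Qed.

Lemma constant_onP (Q p : bitseq) : (forall i j, (i < j)%N -> (j < 8)%N -> bit Q i -> bit Q j -> bit p i = bit p j) ->
  constant_on Q p.
Proof.
move=> H; have {}H i j : (i < 8)%N -> (j < 8)%N -> bit Q i -> bit Q j -> bit p i = bit p j.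
  by move=> i8 j8 Qi Qj; have [ij|ij|->//] := ltngtP i j; [exact: H|apply/esym; exact: H].
rewrite /constant_on; case: ifPn => // /allPn[i]; rewrite mem_iota => /andP[_ i8].
case: ifP => // Qi pi; apply/allP => j; rewrite mem_iota => /andP[_ j8].
by case: ifP => // Qj; rewrite -(H i j).
Qed.

(** Classes constant off [P] are the even subsets of [P], up to complement. An odd pairing requires
    at least three points; with three or four, both subsets are pairs, on which the form is 1,
    because a full set of four points meets every even subset evenly. *)
Lemma one_piece P s t : size P = 8 -> size s = 6 -> size t = 6 ->
  constant_on (map negb P) (cpoints s) -> constant_on (map negb P) (cpoints t) -> dotb s t ->
  (3 <= count id P)%N && ((count id P <= 4)%N ==> arfb s && arfb t).
Proof.
move=> P8 s6 t6 cs ct d; have := all_bitsP one_piece_check P8.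
by move=> /all_bitsP/(_ s s6); rewrite cs => /all_bitsP/(_ t t6); rewrite d ct.
Qed.

Lemma two_pieces P s t : size P = 8 -> size s = 6 -> size t = 6 ->
  constant_on P (cpoints s) -> constant_on (map negb P) (cpoints s) ->
  constant_on P (cpoints t) -> constant_on (map negb P) (cpoints t) -> ~~ dotb s t.
Proof.
move=> P8 s6 t6 cs cs' ct ct'; have := all_bitsP two_pieces_check P8.
by move=> /all_bitsP/(_ s s6); rewrite cs cs' => /all_bitsP/(_ t t6); rewrite ct ct'.
Qed.

Lemma disjoint_pieces P Q : size P = 8 -> size Q = 8 -> (forall i, (i < 8)%N -> ~~ (bit P i && bit Q i)) ->
  (3 <= count id P)%N -> (3 <= count id Q)%N ->
  (count id P <= 4)%N && (count id Q <= 4)%N \/ Q = map negb P.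
Proof.
move=> P8 Q8 dis p3 q3; have := all_bitsP disjoint_check P8; rewrite p3 => /all_bitsP/(_ Q Q8).
have -> : all (fun i => ~~ (bit P i && bit Q i)) (iota 0 8).
  by apply/allP => i; rewrite mem_iota; exact: dis.
by rewrite q3 => /orP[|/eqP]; auto.
Qed.

End Counting.

(** * The end planes of a symmetric splitting have Arf invariant 1 *)

Section Forward.
Variable R : realType.
Notation Sigma := (Sigma3 R).
Notation H := (H1 R Sigma).
Notation ch := (@ch R).
Notation aa := (@aa R).
Variable dot : H -> H -> int.
Hypothesis dotP : intersection_form dot.
Hypothesis rank6 : exists e : 'I_6 -> H, Zbasis setT e.
Variable w : H -> 'F_2.
Hypothesis wP : Sp_quadratic dot w.
Hypothesis w_aa : forall i, (i < 3)%N -> w (aa i) = (i != 1%N)%:R.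
Hypothesis w_ch : forall k, (k < 7)%N -> w (ch k) = 1.

Definition odd_int (a : int) : bool := (a%:~R : 'F_2) != 0.

Lemma F2D (a b : 'F_2) : (a + b != 0) = (a != 0) (+) (b != 0).
Proof. by move: a b; do 2 apply: F2_cases. Qed.

Lemma F2M (a b : 'F_2) : (a * b != 0) = (a != 0) && (b != 0).
Proof. by rewrite mulf_eq0 negb_or. Qed.

Lemma F2N (a : 'F_2) : (- a != 0) = (a != 0).
Proof. by rewrite oppr_eq0. Qed.

Lemma odd_int0 : odd_int 0 = false.
Proof. by []. Qed.

Lemma odd_intD a b : odd_int (a + b) = odd_int a (+) odd_int b.
Proof. by rewrite /odd_int intrD F2D. Qed.

Lemma odd_intM a b : odd_int (a * b) = odd_int a && odd_int b.
Proof. by rewrite /odd_int intrM F2M. Qed.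

Lemma odd_intN a : odd_int (- a) = odd_int a.
Proof. by rewrite /odd_int intrN F2N. Qed.

Definition bits (h : H) : bitseq := mkseq (fun k => odd_int (lam k h)) 6.

Lemma arf_bits h : (w h != 0) = arfb (bits h).
Proof.
rewrite -{1}(coordsK rank6 h) (w_vec dotP rank6 wP w_aa w_ch) /qform /coords.
by rewrite !(F2D, F2M, F2N, intrD, intrN).
Qed.

Lemma dot_lam h k : dot h k =
  lam 0 h * lam 1 k + lam 1 h * - lam 0 k +
  ((lam 0 h + lam 2 h) * lam 3 k + lam 3 h * - (lam 0 k + lam 2 k)) +
  ((lam 0 h + lam 2 h + lam 4 h) * lam 5 k + lam 5 h * - (lam 0 k + lam 2 k + lam 4 k)).
Proof.
have aaE : dot h (aa 1) = lam 0 h + lam 2 h /\ dot h (aa 2) = lam 0 h + lam 2 h + lam 4 h.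
  by split; rewrite /aa !(dotDr dotP) -!(lam_dot dotP rank6).
rewrite -{1}(coordsK rank6 k) /coords /vec; case: aaE.
move: (aa 1) (aa 2) => a1 a2 e1 e2.
rewrite !(dotDr dotP) !(dotMr dotP) e1 e2 -!(lam_dot dotP rank6) //.
move: (lam 0 h) (lam 1 h) (lam 2 h) (lam 3 h) (lam 4 h) (lam 5 h).
move: (lam 0 k) (lam 1 k) (lam 2 k) (lam 3 k) (lam 4 k) (lam 5 k).
by clear; intros; ring.
Qed.

Lemma dot_bits h k : odd_int (dot h k) = dotb (bits h) (bits k).
Proof.
rewrite dot_lam /dotb /bits /bit; cbn [mkseq map iota nth].
move: (lam 0 h) (lam 1 h) (lam 2 h) (lam 3 h) (lam 4 h) (lam 5 h).
move: (lam 0 k) (lam 1 k) (lam 2 k) (lam 3 k) (lam 4 k) (lam 5 k).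
by clear; intros; rewrite !(odd_intD, odd_intM, odd_intN).
Qed.

Lemma points_sum (l : nat -> int) j : odd_int (l 6) = odd_int (l 0) (+) odd_int (l 2) (+) odd_int (l 4) ->
  (j < 8)%N -> bit (cpoints (mkseq (fun k => odd_int (l k)) 6)) j = odd_int (\sum_(0 <= k < j) l k).
Proof.
move=> l6; have s0 : \sum_(0 <= k < 0) l k = 0 by rewrite big_geq.
have sS n : \sum_(0 <= k < n.+1) l k = \sum_(0 <= k < n) l k + l n by rewrite big_nat_recr.
case: j => [|[|[|[|[|[|[|[|//]]]]]]]] _; rewrite ?sS s0 ?odd_intD ?l6 odd_int0 /cpoints /closing /points /bit;
  cbn [mkseq map iota nth rcons scanl];
  by move: (odd_int (l 0)) (odd_int (l 1)) (odd_int (l 2)) (odd_int (l 3)) (odd_int (l 4)) (odd_int (l 5));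
  clear; do 6 case.
Qed.

Lemma points_bits h j : (j < 8)%N ->
  bit (cpoints (bits h)) j = odd_int (\sum_(0 <= k < j) lam k h).
Proof.
move=> j8; apply: (@points_sum (fun k => lam k h)) => //.
rewrite -!odd_intD -odd_intN; congr odd_int; have := sum_even_lam dotP rank6 h.
by move: (lam 0 h) (lam 2 h) (lam 4 h) (lam 6 h); clear; lia.
Qed.

Lemma even_points h i j : (i < j)%N -> (j < 8)%N ->
  (exists n : int, \sum_(i <= k < j) lam k h = 2 * n) ->
  bit (cpoints (bits h)) i = bit (cpoints (bits h)) j.
Proof.
move=> ij j8 [n nE]; rewrite !points_bits ?(ltn_trans ij j8) //.
rewrite [in RHS](@big_cat_nat _ _ _ i) //=; last exact: ltnW.
by rewrite nE odd_intD odd_intM addbF.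
Qed.

Lemma symmetric_Arf (V : 'I_3 -> set H) : orthogonal_splitting dot V -> symmetric_splitting V ->
  Arf dot 1 w (V 0) = 1 /\ Arf dot 1 w (V 2) = 1.
Proof.
move=> splitV [c [d [[_ _ cd0 _] sc sd [X [compX [f0 f1 f2] VX]]]]].
pose P i := mkseq (fun j => `[< X i (wp R j) >]) 8.
have P8 i : size (P i) = 8%N by rewrite size_mkseq.
have PE i j : (j < 8)%N -> bit (P i) j = `[< X i (wp R j) >] by move=> j8; rewrite /bit nth_mkseq.
have nPE i j : (j < 8)%N -> bit (map negb (P i)) j = ~~ `[< X i (wp R j) >].
  by move=> j8; rewrite /bit (nth_map false) ?P8 // nth_mkseq.
have bits6 h : size (bits h) = 6%N by rewrite size_mkseq.
have odd1 : odd_int 1 by [].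
have outer i (e : loop R Sigma) h : frontier (X i) = range e -> s_invariant e ->
    range e `<=` range c `|` range d -> range e <> range c `|` range d -> V i h ->
    constant_on (map negb (P i)) (cpoints (bits h)).
  move=> fe se eU neU; rewrite VX => -[h' _ <-]; apply: constant_onP => j k jk k8.
  rewrite !nPE ?(ltn_trans jk k8) // => /asboolPn nj /asboolPn nk; apply: even_points => //.
  exact: (even_outside sc sd compX f1 dotP rank6 h' (compX i) fe se eU neU).
have cU : range c `<=` range c `|` range d by move=> p; left.
have dU : range d `<=` range c `|` range d by move=> p; right.
have nc := range_neqU1 cd0; have nd := range_neqU2 cd0.
have out0 h : V 0 h -> constant_on (map negb (P 0)) (cpoints (bits h)) by exact: outer f0 sc cU nc.
have out2 h : V 2 h -> constant_on (map negb (P 2)) (cpoints (bits h)) by exact: outer f2 sd dU nd.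
have in1 i h : frontier (X i) <> range c `|` range d -> V 1 h -> constant_on (P i) (cpoints (bits h)).
  move=> fi; rewrite VX => -[h' _ <-]; apply: constant_onP => j k jk k8.
  rewrite !PE ?(ltn_trans jk k8) // => /asboolP Xj /asboolP Xk; apply: even_points => //.
  exact: (even_inside sc sd compX f1 dotP rank6 h' (compX i) fi).
have sl (x y : H) : span x y x by exists 1, 0; rewrite mulr1z mulr0z addr0.
have sr (x y : H) : span x y y by exists 0, 1; rewrite mulr1z mulr0z add0r.
have dotb1 x y : dot x y = 1 -> dotb (bits x) (bits y) by rewrite -dot_bits => ->.
have [x0 [y0 [V0 d0]]] := splitting_span dotP rank6 splitV 0.
have [x1 [y1 [V1 d1]]] := splitting_span dotP rank6 splitV 1.
have [x2 [y2 [V2 d2]]] := splitting_span dotP rank6 splitV 2.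
have piece i x y : (forall h, V i h -> constant_on (map negb (P i)) (cpoints (bits h))) ->
    V i = span x y -> dot x y = 1 -> (3 <= count id (P i))%N && ((count id (P i) <= 4)%N ==> arfb (bits x) && arfb (bits y)).
  by move=> out VE xy; apply: one_piece => //; [apply: out|apply: out|exact: dotb1]; rewrite VE.
have /andP[n0 /implyP a0] := piece 0 _ _ out0 V0 d0.
have /andP[n2 /implyP a2] := piece 2 _ _ out2 V2 d2.
have dis j : (j < 8)%N -> ~~ (bit (P 0) j && bit (P 2) j).
  move=> j8; rewrite !PE //; apply/andP => -[/asboolP h0 /asboolP h2].
  apply: (component_frontier_disjoint (compX 0) (compX 2) _ h0 h2).
  by rewrite f0 f2; exact: range_neq.
have arf1 h : arfb (bits h) -> w h = 1 by rewrite -arf_bits; move: (w h); apply: F2_cases.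
(* Either both end pieces have three or four fixed points, and their forms are known, or their fixed
   points are complementary, a case to be excluded through the middle plane. *)
case: (disjoint_pieces (P8 0) (P8 2) dis n0 n2) => [/andP[m0 m2]|P2].
  have /andP[/arf1 w1 /arf1 w2] := a0 m0; have /andP[/arf1 w3 /arf1 w4] := a2 m2.
  rewrite (Arf_span dotP rank6 wP V0 d0) (Arf_span dotP rank6 wP V2 d2).
  by rewrite w1 w2 w3 w4 mulr1.
(* If the end pieces held all eight fixed points, every class of the middle plane would be constant
   on both sets; such classes pair evenly, against [d1]. *)
have X1 h : V 1 h -> constant_on (P 0) (cpoints (bits h)) /\ constant_on (map negb (P 0)) (cpoints (bits h)).
  by move=> Vh; split; [|rewrite -P2]; apply: in1 Vh; rewrite ?f0 ?f2.
have [c1 c2] : _ := X1 x1 (eq_ind_r (fun A : set H => A x1) (sl x1 y1) V1).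
have [c3 c4] : _ := X1 y1 (eq_ind_r (fun A : set H => A y1) (sr x1 y1) V1).
by have := two_pieces (P8 0) (bits6 x1) (bits6 y1) c1 c2 c3 c4; rewrite dotb1.
Qed.

End Forward.

Theorem proposition1p2 (R : realType)
    (dot : H1 R (Sigma3 R) -> H1 R (Sigma3 R) -> int) (alpha beta : 'I_3 -> loop R (Sigma3 R))
    (omega0 : H1 R (Sigma3 R) -> 'F_2) (V : 'I_3 -> set (H1 R (Sigma3 R)))
    (dotP : intersection_form dot)
    (alphaP : forall i, is_alpha i (alpha i))
    (betaP : forall i, is_beta i (beta i))
    (orientP : forall i, dot (loop_class (alpha i)) (loop_class (beta i)) = 1)
    (omega0P : Sp_quadratic dot omega0)
    (omega0_alpha : forall i, omega0 (loop_class (alpha i)) = (i != 1)%:R)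
    (omega0_beta : forall i, omega0 (loop_class (beta i)) = 1)
    (splitV : orthogonal_splitting dot V) :
  symmetric_splitting V <->
  [/\ Arf dot 1 omega0 (V 0) = 1, Arf dot 1 omega0 (V 2) = 1
    & Arf dot 1 omega0 (V 1) = 0].
Proof.
have rank6 := splitting_rank6 splitV.
(* The given loops represent [aa i] and [bb i] up to a common sign, which a quadratic form does not
   see. *)
have w_ab (i : 'I_3) : omega0 (aa R i) = (i != 1)%:R /\ omega0 (bb R i) = 1.
  have [n [n1 [aE bE]]] := alpha_beta_unit dotP rank6 (alphaP i) (betaP i) (orientP i).
  by rewrite -(omega0_alpha i) -(omega0_beta i) aE bE !(omega_unit dotP omega0P).
have w_aa i : (i < 3)%N -> omega0 (aa R i) = (i != 1%N)%:R.
  by move=> i3; have [-> _] := w_ab (Ordinal i3).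
have w_bb i : (i < 3)%N -> omega0 (bb R i) = 1.
  by move=> i3; have [_ ->] := w_ab (Ordinal i3).
have w_ch k : (k < 7)%N -> omega0 (ch R k) = 1.
  by move=> k7; exact: (omega_ch dotP rank6 omega0P w_aa w_bb k7).
split=> [symV|[A0 A2 _]].
  have [A0 A2] := symmetric_Arf dotP rank6 omega0P w_aa w_ch splitV symV.
  by split=> //; exact: (middle_Arf dotP rank6 omega0P splitV w_aa w_ch A0 A2).
exact: (symmetric_of_Arf dotP rank6 omega0P splitV w_aa w_ch A0 A2).
Qed.
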